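(* Let $\Omega\subset\mathbb{R}^n$ be a special Lipschitz domain. Let $s_0,s_1\in\mathbb{R}$, $p_0,p_1\in(1,+\infty)$. The space $\mathrm{C}_c^\infty(\Omega)$ is a dense subspace of (i) $\dot{\mathrm{H}}^{s_0,p_0}_0(\Omega)\cap\dot{\mathrm{H}}^{s_1,p_1}_0(\Omega)$, if $s_j>-1+1/p_j$ for $j\in\{0,1\}$; (ii) $\dot{\mathrm{H}}^{s_0,p_0}_0(\Omega)$, if $-n/p_0'<s_0<0$; (iii) $\dot{\mathrm{W}}^{k_0,1}_0(\Omega)\cap\dot{\mathrm{W}}^{k_1,1}_0(\Omega)$, for all $k_0,k_1\in\mathbb{N}$.
   Context: $n\geqslant2$, $\mathbb{N}$ is the set of non-negative integers, $p'$ is the Hölder conjugate of $p$. A special Lipschitz domain is $\Omega=\{(x',x_n)\in\mathbb{R}^{n-1}\times\mathbb{R}: x_n>\phi(x')\}$ with $\phi:\mathbb{R}^{n-1}\to\mathbb{R}$ globally Lipschitz. Littlewood–Paley family: fix $\varphi\in\mathrm{C}_c^\infty(\mathbb{R}^n)$ radial, real, non-negative, $\operatorname{supp}\varphi\subset B(0,4/3)$, $\varphi=1$ on $B(0,3/4)$; $\varphi_j(\xi)=\varphi(2^{-j}\xi)$, $\psi_j(\xi)=\varphi_j(\xi/2)-\varphi_j(\xi)$, $\dot{\Delta}_j=\mathcal{F}^{-1}\psi_j\mathcal{F}$, $j\in\mathbb{Z}$. $\mathcal{S}'_h(\mathbb{R}^n)$ is the set of $u\in\mathcal{S}'(\mathbb{R}^n)$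 such that for all $\Theta\in\mathrm{C}_c^\infty(\mathbb{R}^n)$, $\lVert\mathcal{F}^{-1}\Theta(\lambda\cdot)\mathcal{F}u\rVert_{\mathrm{L}^\infty}\to0$ as $\lambda\to+\infty$. $\dot{\mathrm{H}}^{s,p}(\mathbb{R}^n)$ (resp. $\dot{\mathrm{W}}^{k,1}(\mathbb{R}^n)$) is the normed space of $u\in\mathcal{S}'_h(\mathbb{R}^n)$ with $\lVert u\rVert_{\dot{\mathrm{H}}^{s,p}}=\lVert\sum_{j}(-\Delta)^{s/2}\dot{\Delta}_ju\rVert_{\mathrm{L}^p}<\infty$ (resp. $\lVert\nabla^ku\rVert_{\mathrm{L}^1}<\infty$). For a function space $\mathrm{X}(\mathbb{R}^n)$, $\mathrm{X}_0(\Omega):=\{u\in\mathrm{X}(\mathbb{R}^n):\operatorname{supp}u\subset\overline{\Omega}\}$ with the norm of $\mathrm{X}(\mathbb{R}^n)$. Intersections carry the sum of the norms. Elements of $\mathrm{C}^\infty_c(\Omega)$ are extended by $0$ to $\mathbb{R}^n$. *)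

(* Defs.v *)
From HB Require Import structures.
From mathcomp Require Import all_boot all_order all_algebra.
From mathcomp Require Import complex.
From mathcomp Require Import all_classical all_reals all_analysis.

Set Implicit Arguments.
Unset Strict Implicit.
Unset Printing Implicit Defensive.

Import Order.TTheory GRing.Theory Num.Theory.
Import numFieldNormedType.Exports.
Import Normc.

Local Open Scope classical_set_scope.
Local Open Scope ring_scope.
Local Open Scope complex_scope.

(* [R^n] is ['rV[R]_n], with the sigma-algebra generated by the coordinates;
   Lebesgue measure on it is built by adding one last coordinate at a time. *)


Section measurable_rV.
Context {R : realType}.
Variable n : nat.

Definition coord_rV (i : 'I_n) (x : 'rV[R]_n) : measurableTypeR R := x ord0 i.

Let rV_set0 : g_sigma_preimage coord_rV set0.
Proof. exact: sigma_algebra0. Qed.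

Let rV_setC A : g_sigma_preimage coord_rV A -> g_sigma_preimage coord_rV (~` A).
Proof. exact: sigma_algebraC. Qed.

Let rV_bigcup (F : (set 'rV[R]_n)^nat) :
  (forall i, g_sigma_preimage coord_rV (F i)) ->
  g_sigma_preimage coord_rV (\bigcup_i (F i)).
Proof. exact: sigma_algebra_bigcup. Qed.

HB.instance Definition _ := @isMeasurable.Build default_measure_display
  'rV[R]_n (g_sigma_preimage coord_rV) rV_set0 rV_setC rV_bigcup.

Lemma measurable_coord_rV (i : 'I_n) : measurable_fun setT (coord_rV i).
Proof.
move=> _ Y mY; rewrite setTI; apply: sub_sigma_algebra => /=.
rewrite -bigcup_seq/=; exists i => /=; first by rewrite mem_index_enum.
by exists Y => //; rewrite setTI.
Qed.

Lemma measurable_fun_rV d (T : measurableType d) (f : T -> 'rV[R]_n) :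
  (forall i, measurable_fun setT (coord_rV i \o f)) -> measurable_fun setT f.
Proof.
move=> mf _ A mA; rewrite setTI.
have : preimage_set_system setT f (g_sigma_preimage coord_rV) (f @^-1` A).
  by exists A => //; rewrite setTI.
rewrite -g_sigma_preimage_comp.
apply: smallest_sub; first exact: sigma_algebra_measurable.
rewrite -bigcup_seq => B [i _] [C mC <-]; exact: mf.
Qed.

End measurable_rV.

Section lebesgue_rV.
Context {R : realType}.

Definition rcons_rV n (p : 'rV[R]_n * measurableTypeR R) : 'rV[R]_n.+1 :=
  \row_i oapp (p.1 ord0) p.2 (unlift ord_max i).

Lemma measurable_rcons_rV n : measurable_fun setT (@rcons_rV n).
Proof.
apply: measurable_fun_rV => i.
case: (unliftP ord_max i) => [j ->|->].
  rewrite (_ : _ \o _ = coord_rV j \o fst); last first.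
    by apply/funext => p; rewrite /coord_rV /= mxE liftK.
  exact: measurableT_comp (measurable_coord_rV j) measurable_fst.
rewrite (_ : _ \o _ = snd); first exact: measurable_snd.
by apply/funext => p; rewrite /coord_rV /= mxE unlift_none.
Qed.

Section step.
Local Open Scope ereal_scope.
Variables (n : nat) (mu : {measure set 'rV[R]_n -> \bar R}).

Definition lebesgue_rV_step : set 'rV[R]_n.+1 -> \bar R :=
  pushforward (mu \x @lebesgue_measure R) (@rcons_rV n).

Let step0 : lebesgue_rV_step set0 = 0.
Proof. by rewrite /lebesgue_rV_step /pushforward preimage_set0 measure0. Qed.

Let step_ge0 A : 0 <= lebesgue_rV_step A.
Proof. exact: (measure_ge0 (mu \x @lebesgue_measure R)). Qed.

Let step_sigma_additive : semi_sigma_additive lebesgue_rV_step.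
Proof.
have m (A : set 'rV[R]_n.+1) : measurable A -> measurable (@rcons_rV n @^-1` A).
  by move=> mA; rewrite -[X in measurable X]setTI; exact: measurable_rcons_rV.
move=> F mF tF mUF; rewrite /lebesgue_rV_step /pushforward preimage_bigcup.
apply: measure_semi_sigma_additive.
- by move=> i; exact: m.
- apply/trivIsetP => /= i j _ _ ij; rewrite -preimage_setI.
  by move/trivIsetP : tF => /(_ _ _ _ _ ij) ->//; rewrite preimage_set0.
- by rewrite -preimage_bigcup; exact: m.
Qed.

HB.instance Definition _ := isMeasure.Build _ _ _
  lebesgue_rV_step step0 step_ge0 step_sigma_additive.

End step.

Fixpoint lebesgue_rV n : {measure set 'rV[R]_n -> \bar R} :=
  if n is k.+1 return {measure set 'rV[R]_n -> \bar R} then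
    lebesgue_rV_step (lebesgue_rV k)
  else \d_(0 : 'rV[R]_0).

End lebesgue_rV.

Section functions.
Context {R : realType} {n : nat}.
Implicit Types (x xi : 'rV[R]_n) (f g : 'rV[R]_n -> R[i]).

Definition dotv x xi : R := \sum_(i < n) x ord0 i * xi ord0 i.

(* The library norm on ['rV[R]_n] is the sup norm, hence this one. *)
Definition enorm x : R := Num.sqrt (dotv x x).

Definition pderiv (i : 'I_n) f : 'rV[R]_n -> R[i] := fun x =>
  'D_(delta_mx ord0 i) (@complex.Re R \o f) x +i*
  'D_(delta_mx ord0 i) (@complex.Im R \o f) x.

Definition pderivs (s : seq 'I_n) f : 'rV[R]_n -> R[i] := foldr pderiv f s.

Definition smooth f := forall (s : seq 'I_n) x,
  differentiable (@complex.Re R \o pderivs s f) x /\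
  differentiable (@complex.Im R \o pderivs s f) x.

Definition supp f : set 'rV[R]_n := closure [set x | f x != 0].

(* [C_c^oo(U)], as functions on [R^n] that vanish outside of [U]. *)
Definition Cc_infty (U : set 'rV[R]_n) : set ('rV[R]_n -> R[i]) :=
  [set f | smooth f /\ compact (supp f) /\ supp f `<=` U].

Definition schwartz_norm (N : nat) f : \bar R :=
  ereal_sup [set y | exists (s : seq 'I_n) x, (size s <= N)%N /\
    y = ((1 + enorm x) ^+ N * normc (pderivs s f x))%:E].

Definition schwartz : set ('rV[R]_n -> R[i]) :=
  [set f | smooth f /\ forall N, (schwartz_norm N f < +oo)%E].

Definition cintegral f : R[i] :=
  (\int[lebesgue_rV n]_x complex.Re (f x)) +i*
  (\int[lebesgue_rV n]_x complex.Im (f x)).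

Definition expi (t : R) : R[i] := cos t +i* sin t.

(* Convention: [F f (xi) = \int f(x) exp(-i x.xi) dx]. *)
Definition fourier f : 'rV[R]_n -> R[i] := fun xi =>
  cintegral (fun x => f x * expi (- dotv x xi)).

Definition fourier_inv f : 'rV[R]_n -> R[i] := fun x =>
  ((2 * pi) ^- n)%:C * cintegral (fun xi => f xi * expi (dotv x xi)).

End functions.

(* A tempered distribution is a functional on [schwartz]; it is encoded as a
   total functional that vanishes at functions that are not in [schwartz], so
   that equality of functionals is equality of distributions. *)

Section distributions.
Context {R : realType} {n : nat}.
Local Notation E := 'rV[R]_n.
Local Notation functional := ((E -> R[i]) -> R[i]).
Implicit Types (u v : functional) (f g m : E -> R[i]) (p : \bar R).

Definition on_schwartz (u : functional) : functional :=
  patch (fun=> 0) schwartz u.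

Definition tempered : set functional := [set u |
  [/\ forall f, ~ schwartz f -> u f = 0,
      forall (a : R[i]) f g, schwartz f -> schwartz g ->
        u (fun x => a * f x + g x) = a * u f + u g &
      exists (C : R) (N : nat), forall f, schwartz f ->
        ((normc (u f))%:E <= C%:E * schwartz_norm N f)%E]].

Definition distr_of g : functional :=
  on_schwartz (fun f => cintegral (fun x => g x * f x)).

(* [F^-1 m F u], by transposition: [<F v, f> = <v, F f>]. *)
Definition multiplier m u : functional :=
  on_schwartz (fun f => u (fourier (fun xi => m xi * fourier_inv f xi))).

Definition dpderivs (s : seq 'I_n) u : functional :=
  on_schwartz (fun f => (-1) ^+ size s * u (pderivs s f)).

Definition dsupp u : set E := [set x | forall V, open_nbhs x V ->
  exists2 f, Cc_infty V f & u f != 0].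

(* [L^p] norm, with the Euclidean norm in the target, of a finite family of
   distributions; it is [+oo] unless all of them are given by functions. *)
Definition Lp_norms (I : finType) p (U : I -> functional) : \bar R :=
  ereal_inf [set Lnorm (lebesgue_rV n) p
      (fun x => (Num.sqrt (\sum_(i : I) normc (g i x) ^+ 2))%:E) |
    g in [set g : I -> E -> R[i] | forall i,
      [/\ measurable_fun setT (@complex.Re R \o g i),
          measurable_fun setT (@complex.Im R \o g i),
          (Lnorm (lebesgue_rV n) p (fun x => (normc (g i x))%:E) < +oo)%E &
          U i = distr_of (g i)]]].

Definition Lp_norm p u : \bar R := Lp_norms p (fun _ : unit => u).

Definition Sh' : set functional := [set u | tempered u /\
  forall Theta, Cc_infty setT Theta ->
    Lp_norm +oo%E (multiplier (fun xi => Theta (lambda *: xi)) u)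
      @[lambda --> +oo%R] --> 0%E].

(* Both ends of the two-sided series converge independently, in [S']. *)
Definition distr_sum (w : int -> functional) v := forall f, schwartz f ->
  forall eps : R, 0 < eps -> \forall M & N \near \oo,
    normc (\sum_(0 <= k < (M + N).+1) w (k%:Z - M%:Z) f - v f) < eps.

Definition LP_cutoff (phi : E -> R) : Prop :=
  [/\ Cc_infty [set x | enorm x < 4 / 3] (fun x => (phi x)%:C),
      forall x y, enorm x = enorm y -> phi x = phi y,
      forall x, 0 <= phi x &
      forall x, enorm x < 3 / 4 -> phi x = 1].

Definition LP_phi (phi : E -> R) (j : int) : E -> R :=
  fun xi => phi ((2 : R) ^ (- j) *: xi).

Definition LP_psi (phi : E -> R) (j : int) : E -> R :=
  fun xi => LP_phi phi j (2^-1 *: xi) - LP_phi phi j xi.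

(* [(-Laplacian)^(s/2) Delta_j u]; its symbol vanishes near the origin. *)
Definition LP_block (phi : E -> R) (s : R) u (j : int) : functional :=
  multiplier (fun xi => (enorm xi `^ s * LP_psi phi j xi)%:C) u.

Definition Hdot_norm (phi : E -> R) (s p : R) u : \bar R :=
  ereal_inf [set Lp_norm p%:E v | v in
    [set v | tempered v /\ distr_sum (LP_block phi s u) v]].

Definition Wdot_norm (k : nat) u : \bar R :=
  Lp_norms 1%E (fun t : k.-tuple 'I_n => dpderivs t u).

(* [X_0(U)], for the space [X] of the elements of [Sh'] with finite norm. *)
Definition space0 (nrm : functional -> \bar R) (U : set E) : set functional :=
  [set u | [/\ Sh' u, (nrm u < +oo)%E & dsupp u `<=` closure U]].

Definition dense_subspace (D X : set functional) (nrm : functional -> \bar R) :=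
  [/\ D `<=` X,
      D 0 /\ forall (a : R[i]) u v, D u -> D v -> D (fun f => a * u f + v f) &
      forall u, X u -> forall eps : R, 0 < eps ->
        exists2 v, D v & (nrm (u \- v)%R < eps%:E)%E].

Definition Cc_infty_distr (U : set E) : set functional := distr_of @` Cc_infty U.

End distributions.

Definition special_lipschitz {R : realType} {m : nat} (Omega : set 'rV[R]_m.+1) :=
  exists2 phi : 'rV[R]_m -> R,
    (exists L : R, forall x y, `|phi x - phi y| <= L * enorm (x - y)) &
    Omega = [set x | phi (\row_i x ord0 (lift ord_max i)) < x ord0 ord_max].

(* Main.v *)
(* An element [u] of the space is approximated by [S^N (theta_k w)], where
   [S] is convolution with [zeta = rho_d - rho_T]: [rho] has integral 1 and is
   supported in an upward cone, [rho_t] is its L^1-normalised dilate, d is small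
   and T large. The cone makes [S] push supports inside Omega. As [zeta] has mean
   zero, [S^N] gains N powers at both ends of the frequency axis, so [S^N u]
   is an honest L^p function [w], even though [u] need not be one, and
   [w] can be truncated by [theta_k] without divisions by small frequencies;
   the error is [u - S^(2N) u] plus [S^N] applied to a small L^p function. The first
   term tends to 0 since [rho_d * v -> v], and [rho_T * v -> 0] in L^p when
   1 < p, or in L^1 when [v] has integral 0. The derivatives of order k >= 1
   in (iii) have integral 0 because n >= 2; if k0 or k1 is 0, then [u] is already
   integrable and [zeta = rho_d] suffices. *)
From HB Require Import structures.
Require Import Defs.
From mathcomp Require Import all_boot all_order all_algebra.
From mathcomp Require Import complex.
From mathcomp Require Import all_classical all_reals all_analysis.
From mathcomp Require Import measurable_realfun ess_sup_inf.
From mathcomp Require Import ring lra.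

Set Implicit Arguments.
Unset Strict Implicit.
Unset Printing Implicit Defensive.

Import Order.TTheory GRing.Theory Num.Theory.
Import numFieldNormedType.Exports.
Import Normc.

Local Open Scope classical_set_scope.
Local Open Scope ring_scope.
Local Open Scope complex_scope.

(** Single Littlewood-Paley blocks are bounded on L^p, but summing them usually takes a multiplier
    theorem, and none holds at p = 1. The powers of S remove this obstacle: near frequency 2^j the
    kernel of S has L^1 norm O(2^-|j|), so N + 1 factors absorb a symbol of order d with |d| <= N
    and leave a geometric series, summed by Young's inequality alone for every p >= 1. The estimate
    works in both directions: it turns (-Delta)^(s/2) u in L^p into [w], and it bounds the
    homogeneous norm of S^N r by the L^p norm of r. A distribution is seen only through test
    functions, so each operator acts by its transpose on them, and even the support of the
    approximant is computed there. With two norms at once, each space yields its own [w], but S^N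
    (theta_k w) paired with h is [u] evaluated at a function built from h alone, so both give the
    same approximant. Fourier inversion is proved up to a factor [cF], of which only the
    nonvanishing is used. *)

Section affine_line.
Context {R : realType}.
Local Open Scope ereal_scope.

Lemma measurable_affine_line (c a : R) :
  measurable_fun [set: measurableTypeR R] (fun t : measurableTypeR R => (c * t + a)%R : measurableTypeR R).
Proof.
by apply: measurable_funD => //; apply: measurable_funM.
Qed.

(** Uniqueness of Lebesgue measure: the pushforward under the affine map, scaled by |c|, gives
    half-open intervals their length. For negative c the preimage is closed on the other side, hence
    the two cases. *)
Lemma ge0_integral_affine_line (c a : R) (f : measurableTypeR R -> \bar R) : (c != 0)%R ->
  measurable_fun setT f -> (forall t, 0 <= f t) ->
  \int[@lebesgue_measure R]_t f t =
  (`|c|)%:E * \int[@lebesgue_measure R]_t f (c * t + a)%R.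
Proof.
move=> c0 mf f0.
have nc0 : (0 <= `|c|)%R by [].
pose g (t : measurableTypeR R) : measurableTypeR R := (c * t + a)%R.
have mg : measurable_fun setT g := measurable_affine_line c a.
pose nu' := mscale (NngNum nc0) (pushforward (@lebesgue_measure R) g).
pose nu := nu' mg.
have E (A : set (measurableTypeR R)) : measurable A -> lebesgue_measure A = nu A.
  apply: lebesgue_measure_unique => _ [[u v] uv <-] /=.
  rewrite /nu /mscale /= /pushforward lebesgue_measure_itv/=.
  have /orP[cp|cn] : ((0 < c) || (c < 0))%R by rewrite -neq_lt eq_sym.
  - have -> : g @^-1` `]u, v]%classic = `]((u - a) / c)%R, ((v - a) / c)%R]%classic.
      apply/seteqP; split => t /=; rewrite !in_itv/= /g => /andP[H1 H2];
        apply/andP; split.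
      + by rewrite ltr_pdivrMr// mulrC; lra.
      + by rewrite ler_pdivlMr// mulrC; lra.
      + by move: H1; rewrite ltr_pdivrMr// mulrC; lra.
      + by move: H2; rewrite ler_pdivlMr// mulrC; lra.
    rewrite lebesgue_measure_itv/= !lte_fin ltr_pM2r ?invr_gt0// ltrD2r.
    case: ifPn => // _; last by rewrite mule0.
    by rewrite -!EFinB -EFinM gtr0_norm//; congr EFin; field.
  - have -> : g @^-1` `]u, v]%classic = `[((v - a) / c)%R, ((u - a) / c)%R[%classic.
      apply/seteqP; split => t /=; rewrite !in_itv/= /g => /andP[H1 H2];
        apply/andP; split.
      + by rewrite ler_ndivrMr// mulrC; lra.
      + by rewrite ltr_ndivlMr// mulrC; lra.
      + by move: H2; rewrite ltr_ndivlMr// mulrC; lra.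
      + by move: H1; rewrite ler_ndivrMr// mulrC; lra.
    rewrite lebesgue_measure_itv/= !lte_fin ltr_nM2r ?invr_lt0// ltrD2r.
    case: ifPn => // _; last by rewrite mule0.
    by rewrite -!EFinB -EFinM ltr0_norm//; congr EFin; field.
rewrite (eq_measure_integral nu); last by move=> A mA _; exact: E.
rewrite ge0_integral_mscale//; last first.
rewrite ge0_integral_pushforward// => y _; exact: f0.
Qed.

End affine_line.

(** * Lebesgue measure on R^n: sigma-finiteness, Tonelli, affine changes of variables *)

Section lebesgue_rV_theory.
Context {R : realType}.

Definition cube n (k : nat) : set 'rV[R]_n := [set x | forall i, `|x ord0 i| <= k%:R].

Lemma measurable_cube n k : measurable (@cube n k).
Proof.
rewrite (_ : @cube n k = \bigcap_(i in [set: 'I_n]) (coord_rV i @^-1` `[- k%:R, k%:R]%classic)).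
  apply: fin_bigcap_measurable => // i _.
  rewrite -[X in measurable X]setTI; apply: measurable_coord_rV => //.
apply/seteqP; split => x /=.
  by move=> h i _ /=; rewrite in_itv/= -ler_norml; exact: h.
by move=> h i; have := h i I; rewrite /= in_itv/= -ler_norml.
Qed.

Lemma cube_lty n k : (lebesgue_rV n (@cube n k) < +oo)%E.
Proof.
elim: n => [|n IH] /=.
  by rewrite diracE; case: (_ \in _); rewrite ltry.
rewrite /lebesgue_rV_step /pushforward.
have -> : @rcons_rV R n @^-1` cube k = cube k `*` `[- k%:R, k%:R]%classic.
  apply/seteqP; split => -[x t] /= h.
    split=> [i|].
      by have := h (lift ord_max i); rewrite mxE liftK.
    by rewrite in_itv/= -ler_norml; have := h ord_max; rewrite mxE unlift_none.
  case: h => h1; rewrite in_itv/= -ler_norml => h2 i.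
  rewrite mxE /=; case: (unliftP ord_max i) => [j _|_] //=; exact: h1.
have m2 : measurable (`[- k%:R, k%:R]%classic : set (measurableTypeR R)) by [].
rewrite product_measure1E//; last exact: measurable_cube.
have H : (@lebesgue_measure R `[(- k%:R : R)%R, (k%:R : R)%R]%classic < +oo)%E.
  by rewrite lebesgue_measure_itv/=; case: ifPn => _; rewrite -?EFinB ltry.
by apply: lte_mul_pinfty => //; rewrite ge0_fin_numE.
Qed.

Lemma sigma_finite_lebesgue_rV n : sigma_finite setT (@lebesgue_rV R n).
Proof.
exists (@cube n).
  apply/seteqP; split => // x _.
  pose b := \sum_(i < n) `|x ord0 i|.
  have b0 : 0 <= b by apply: sumr_ge0.
  exists (Num.truncn b).+1 => //= i.
  apply: (@le_trans _ _ b); last exact/ltW/truncnS_gt.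
  by rewrite /b (bigD1 i)//= lerDl sumr_ge0.
by move=> i; split; [exact: measurable_cube|exact: cube_lty].
Qed.

(** The same set function under a head constant of its own, to which sigma-finiteness, required by
    Tonelli's theorem, can be attached. [integral_lebE] passes from one to the other. *)
Definition leb n : set 'rV[R]_n -> \bar R := lebesgue_rV n.
Arguments leb : clear implicits.
HB.instance Definition _ n := isMeasure.Build _ _ _ (leb n)
  (measure0 (lebesgue_rV n)) (measure_ge0 (lebesgue_rV n))
  (@measure_semi_sigma_additive _ _ _ (lebesgue_rV n)).
HB.instance Definition _ n :=
  Measure_isSigmaFinite.Build _ _ _ (leb n) (sigma_finite_lebesgue_rV n).

Lemma lebE n (A : set 'rV[R]_n) : leb n A = lebesgue_rV n A.
Proof. by []. Qed.

Local Open Scope ereal_scope.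

Lemma integral_lebE n D (f : 'rV[R]_n -> \bar R) : measurable D ->
  \int[lebesgue_rV n]_(x in D) f x = \int[leb n]_(x in D) f x.
Proof. by move=> mD; apply: eq_measure_integral => A mA _. Qed.

Lemma ge0_integral_rV_step n (f : 'rV[R]_n.+1 -> \bar R) :
  measurable_fun setT f -> (forall x, 0 <= f x) ->
  \int[leb n.+1]_x f x =
  \int[leb n]_x \int[@lebesgue_measure R]_t f (rcons_rV (x, t)).
Proof.
move=> mf f0.
transitivity (\int[measure_function_pushforward__canonical__measure_function_Measure (lebesgue_rV n \x @lebesgue_measure R) (@measurable_rcons_rV R n)]_x f x).
  by apply: eq_measure_integral => A mA _.
rewrite ge0_integral_pushforward//; last exact: measurable_rcons_rV.
rewrite preimage_setT.
transitivity (\int[leb n \x @lebesgue_measure R]_x (f \o @rcons_rV R n) x).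
  apply: eq_measure_integral => A mA _; exact: integral_lebE.
have mfr : measurable_fun setT (f \o @rcons_rV R n).
  by apply: measurableT_comp => //; exact: measurable_rcons_rV.
exact: (fubini_tonelli1 (m1 := leb n) (m2 := @lebesgue_measure R) (f \o @rcons_rV R n) mfr (fun x => f0 _)).
Qed.

Lemma measurable_affine n (c : R) (a : 'rV[R]_n) :
  measurable_fun setT (fun x : 'rV[R]_n => (c *: x + a)%R).
Proof.
apply: measurable_fun_rV => i.
rewrite (_ : _ \o _ = fun x : 'rV[R]_n => (c * x ord0 i + a ord0 i)%R).
  by apply: (@measurableT_comp _ _ _ _ _ _ (fun t : measurableTypeR R => (c * t + (a ord0 i))%R)
    _ (coord_rV i)); [exact: measurable_affine_line|exact: measurable_coord_rV].
by apply/funext => x; rewrite /= /coord_rV !mxE.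
Qed.

(** Induction on the dimension: the last coordinate is handled by the one-dimensional formula, the
    others by the induction hypothesis applied to the partial integral [F]. *)
Lemma ge0_integral_affine n (c : R) (a : 'rV[R]_n) (f : 'rV[R]_n -> \bar R) : (c != 0)%R ->
  measurable_fun setT f -> (forall t, 0 <= f t) ->
  \int[leb n]_x f x =
  (`|c| ^+ n)%:E * \int[leb n]_x f (c *: x + a)%R.
Proof.
move=> c0; elim: n a f => [|n IH] a f mf f0.
  rewrite expr0 mul1e; apply: eq_integral => x _; congr f.
  by apply/rowP => -[].
have mf' : measurable_fun setT (fun x : 'rV[R]_n.+1 => f (c *: x + a)%R).
  by apply: measurableT_comp => //; exact: measurable_affine.
rewrite !ge0_integral_rV_step//.
pose a' : 'rV[R]_n := (\row_i a ord0 (lift ord_max i))%R.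
pose F x := \int[@lebesgue_measure R]_t f (rcons_rV (x, t)).
have mF : measurable_fun setT F.
  apply: (measurable_fun_fubini_tonelli_F (m2 := @lebesgue_measure R) (f \o @rcons_rV R n)).
    by apply: measurableT_comp => //; exact: measurable_rcons_rV.
  by move=> x; exact: f0.
have F0 x : 0 <= F x by apply: integral_ge0.
rewrite (IH a' F mF F0) exprS mulrC EFinM -muleA; congr (_ * _).
have K x t : (c *: rcons_rV (x, t) + a)%R = rcons_rV ((c *: x + a')%R, (c * t + a ord0 ord_max)%R).
  apply/rowP => i; rewrite !mxE.
  by case: unliftP => [j ->|->]/=; rewrite ?mxE.
rewrite -ge0_integralZl//; last 2 first.
- rewrite [X in measurable_fun _ X](_ : _ = fun x => \int[@lebesgue_measure R]_t
    (fun x : 'rV[R]_n.+1 => f (c *: x + a)%R) (rcons_rV (x, t))) //.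
  apply: (measurable_fun_fubini_tonelli_F (m2 := @lebesgue_measure R)
     ((fun x : 'rV[R]_n.+1 => f (c *: x + a)%R) \o @rcons_rV R n)).
    by apply: measurableT_comp => //; exact: measurable_rcons_rV.
  by move=> x; exact: f0.
- by move=> x _; apply: integral_ge0.
apply: eq_integral => x _.
rewrite /F (ge0_integral_affine_line (a ord0 ord_max) c0)//.
  by congr (_ * _); apply: eq_integral => t _; rewrite K.
apply: (measurableT_comp mf).
have mp : measurable_fun setT (fun t : measurableTypeR R => (((c *: x + a')%R : 'rV[R]_n), t)).
  by apply: measurable_fun_pair => //; exact: measurable_cst.
exact: (measurableT_comp (@measurable_rcons_rV R n) mp).
Qed.

(** The sigma-algebra is generated by coordinates, not by open sets; an open set is the union of the
    countably many boxes with rational centre and radius 1/(k+1) that it contains. *)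
Lemma measurable_open_rV n (U : set 'rV[R]_n) : open U -> measurable U.
Proof.
move=> oU.
pose box (q : 'rV[rat]_n * nat) : set 'rV[R]_n :=
  [set x | forall i, (`|ratr (q.1 ord0 i) - x ord0 i| < (q.2.+1%:R)^-1)%R].
have mbox q : measurable (box q).
  rewrite (_ : box q = \bigcap_(i in [set: 'I_n])
     (coord_rV i @^-1` ball (ratr (q.1 ord0 i) : R) (q.2.+1%:R)^-1)).
    apply: fin_bigcap_measurable => // i _.
    rewrite -[X in measurable X]setTI; apply: measurable_coord_rV => //.
    exact: measurable_ball.
  apply/seteqP; split => x /= h i; [move=> _|]; by have := h i; exact.
rewrite (_ : U = \bigcup_(q in [set q | box q `<=` U]) box q).
  rewrite bigcup_mkcond; apply: countable_bigcupT_measurable => // q.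
  by case: ifPn.
apply/seteqP; split => [x Ux|x [q /= qU qx]]; last exact: qU.
have /nbhs_ballP[e /= e0 eU] : nbhs x U by exact: open_nbhs_nbhs.
(* Two points of a box of radius 1/(k+1) differ by less than 2/(k+1) in each coordinate, which must
   stay below [e]. *)
pose k := Num.truncn (2 / e).
have ke : (2 * (k.+1%:R)^-1 < e)%R.
  by rewrite ltr_pdivrMr// mulrC -ltr_pdivrMr// truncnS_gt.
have qq i : exists q : rat, (`|ratr q - x ord0 i| < (k.+1%:R)^-1)%R.
  have [|q] := @rat_in_itvoo R (x ord0 i - (k.+1%:R)^-1)%R (x ord0 i + (k.+1%:R)^-1)%R.
    by rewrite ltrD2l gt0_cp// invr_gt0.
  by rewrite in_itv/= => h; exists q; rewrite ltr_distl.
have [q Hq] := choice qq.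
exists ((\row_i q i)%R, k) => [y /= hy|i /=]; last by rewrite mxE.
apply: eU; split => // a i; rewrite ord1 /ball /=.
have := hy i; have := Hq i; rewrite /= mxE => h1 h2.
have -> : (x ord0 i - y ord0 i = (ratr (q i) - y ord0 i) - (ratr (q i) - x ord0 i))%R by ring.
apply: le_lt_trans (ler_normB _ _) _; apply: lt_trans ke; rewrite mulr_natl mulr2n.
exact: ltrD.
Qed.

End lebesgue_rV_theory.
Arguments leb {R} n.
Global Opaque leb.

(** * Complex-valued functions: modulus, measurability, integrals, Fubini *)

Section complex_aux.
Context {R : realType}.
Implicit Types (z w : R[i]) (x y : R).

Lemma Re_mulc z w : complex.Re (z * w) = complex.Re z * complex.Re w - complex.Im z * complex.Im w.
Proof. by case: z w => [a b] [c d]. Qed.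

Lemma Im_mulc z w : complex.Im (z * w) = complex.Re z * complex.Im w + complex.Im z * complex.Re w.
Proof. by case: z w => [a b] [c d]. Qed.

Lemma Re_addc z w : complex.Re (z + w) = complex.Re z + complex.Re w.
Proof. by case: z w => [a b] [c d]. Qed.

Lemma Im_addc z w : complex.Im (z + w) = complex.Im z + complex.Im w.
Proof. by case: z w => [a b] [c d]. Qed.

Lemma Re_oppc z : complex.Re (- z) = - complex.Re z. Proof. by case: z. Qed.
Lemma Im_oppc z : complex.Im (- z) = - complex.Im z. Proof. by case: z. Qed.

Lemma complex_eq z w : complex.Re z = complex.Re w -> complex.Im z = complex.Im w -> z = w.
Proof. by case: z w => [a b] [c d] /= -> ->. Qed.

Lemma normc_ge0 z : 0 <= normc z.
Proof. by case: z => a b; exact: sqrtr_ge0. Qed.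

Lemma normc_geRe z : `|complex.Re z| <= normc z.
Proof.
case: z => a b /=; rewrite -sqrtr_sqr ler_sqrt ?lerDl ?sqr_ge0//.
by rewrite addr_ge0 ?sqr_ge0.
Qed.

Lemma normc_geIm z : `|complex.Im z| <= normc z.
Proof.
case: z => a b /=; rewrite -sqrtr_sqr ler_sqrt ?lerDr ?sqr_ge0//.
by rewrite addr_ge0 ?sqr_ge0.
Qed.

Lemma normc_real x : normc (x%:C) = `|x|.
Proof. by rewrite /= expr0n/= addr0 sqrtr_sqr. Qed.

Lemma normc_leD z : normc z <= `|complex.Re z| + `|complex.Im z|.
Proof.
case: z => a b /=; rewrite -[leRHS]ger0_norm ?addr_ge0// -sqrtr_sqr ler_sqrt ?sqr_ge0//.
rewrite sqrrD -!normrX (ger0_norm (sqr_ge0 a)) (ger0_norm (sqr_ge0 b)).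
by rewrite -addrA lerD2l lerDr mulrn_wge0// mulr_ge0.
Qed.

Lemma normc_expi x : normc (expi x) = 1.
Proof. by rewrite /= cos2Dsin2 sqrtr1. Qed.

Lemma normc_sum (I : Type) (r : seq I) (P : pred I) (F : I -> R[i]) :
  normc (\sum_(i <- r | P i) F i) <= \sum_(i <- r | P i) normc (F i).
Proof.
elim/big_rec2 : _ => [|i x z _ h]; first by rewrite normc0.
by apply: le_trans (le_normcD _ _) _; rewrite lerD2l.
Qed.

Lemma normcX z k : normc (z ^+ k) = normc z ^+ k.
Proof. by elim: k => [|k IH]; rewrite ?expr0 ?normc1// !exprS normcM IH. Qed.

Lemma normc_eq0 z : (normc z == 0) = (z == 0).
Proof.
by apply/eqP/eqP => [|->]; [exact: eq0_normc|exact: normc0].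
Qed.

Lemma normc_gt0 z : (0 < normc z) = (z != 0).
Proof. by rewrite lt_neqAle normc_ge0 andbT eq_sym normc_eq0. Qed.

Lemma normc_distC z w : normc (z - w) = normc (w - z).
Proof. by rewrite -normcN opprB. Qed.

End complex_aux.

Section cmeas.
Context {R : realType} d (T : measurableType d).
Implicit Types (f g : T -> R[i]) (h : T -> R).

(** Componentwise, as in the conditions that [Lp_norms] puts on representing functions. *)
Definition cmeas f := measurable_fun setT (@complex.Re R \o f) /\
  measurable_fun setT (@complex.Im R \o f).

Lemma cmeas_cst (c : R[i]) : cmeas (fun=> c).
Proof. by split; exact: measurable_cst. Qed.

Lemma cmeasD f g : cmeas f -> cmeas g -> cmeas (fun x => f x + g x).
Proof.
move=> [f1 f2] [g1 g2]; split.
- rewrite (_ : _ \o _ = (@complex.Re R \o f) \+ (@complex.Re R \o g)).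
    exact: measurable_funD.
  by apply/funext => x /=; rewrite Re_addc.
- rewrite (_ : _ \o _ = (@complex.Im R \o f) \+ (@complex.Im R \o g)).
    exact: measurable_funD.
  by apply/funext => x /=; rewrite Im_addc.
Qed.

Lemma cmeasM f g : cmeas f -> cmeas g -> cmeas (fun x => f x * g x).
Proof.
move=> [f1 f2] [g1 g2]; split.
- rewrite (_ : _ \o _ = (@complex.Re R \o f) \* (@complex.Re R \o g) \-
    (@complex.Im R \o f) \* (@complex.Im R \o g)).
    by apply: measurable_funB; exact: measurable_funM.
  by apply/funext => x /=; rewrite Re_mulc.
- rewrite (_ : _ \o _ = (@complex.Re R \o f) \* (@complex.Im R \o g) \+
    (@complex.Im R \o f) \* (@complex.Re R \o g)).
    by apply: measurable_funD; exact: measurable_funM.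
  by apply/funext => x /=; rewrite Im_mulc.
Qed.

Lemma cmeasZ (c : R[i]) f : cmeas f -> cmeas (fun x => c * f x).
Proof. by move=> mf; apply: cmeasM => //; exact: cmeas_cst. Qed.

Lemma cmeasN f : cmeas f -> cmeas (fun x => - f x).
Proof.
move=> /(cmeasZ (-1)); rewrite (_ : (fun x => -1 * f x) = (fun x => - f x))//.
by apply/funext => x; rewrite mulN1r.
Qed.

Lemma cmeasB f g : cmeas f -> cmeas g -> cmeas (fun x => f x - g x).
Proof. by move=> mf mg; apply: cmeasD => //; exact: cmeasN. Qed.

Lemma cmeas_sum I (r : seq I) (F : I -> T -> R[i]) : (forall i, cmeas (F i)) ->
  cmeas (fun x => \sum_(i <- r) F i x).
Proof.
move=> mF; elim: r => [|i r IH].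
  rewrite (_ : (fun x => _) = fun=> 0); first exact: cmeas_cst.
  by apply/funext => x; rewrite big_nil.
rewrite (_ : (fun x => _) = fun x => F i x + \sum_(j <- r) F j x); first exact: cmeasD.
by apply/funext => x; rewrite big_cons.
Qed.

Lemma cmeas_normc f : cmeas f -> measurable_fun setT (fun x => normc (f x)).
Proof.
move=> [f1 f2].
rewrite (_ : (fun x => _) = fun x => Num.sqrt ((complex.Re (f x)) ^+ 2 + (complex.Im (f x)) ^+ 2)).
  apply: (measurableT_comp (f := @Num.sqrt R)); first exact: (continuous_measurable_fun (@sqrt_continuous R)).
  by apply: measurable_funD; exact: measurable_funX.
by apply/funext => x; case: (f x).
Qed.

Lemma cmeas_EFin_normc f : cmeas f -> measurable_fun setT (fun x => (normc (f x))%:E).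
Proof. by move=> mf; apply/measurable_EFinP; exact: cmeas_normc. Qed.

Lemma cmeas_real h : measurable_fun setT h -> cmeas (fun x => (h x)%:C).
Proof. by move=> mh; split => //; exact: measurable_cst. Qed.

End cmeas.

Lemma cmeas_comp {R : realType} d1 d2 (T1 : measurableType d1) (T2 : measurableType d2)
  (f : T2 -> R[i]) (h : T1 -> T2) :
  cmeas f -> measurable_fun setT h -> cmeas (f \o h).
Proof. by move=> [f1 f2] mh; split; [exact: (measurableT_comp f1 mh)|exact: (measurableT_comp f2 mh)]. Qed.

Section cintegral_theory.
Context {R : realType} {n : nat}.
Local Notation E := 'rV[R]_n.
Local Notation mu := (@leb R n).
Implicit Types (f g : E -> R[i]) (c : R[i]).

Definition inorm f : \bar R := (\int[mu]_x (normc (f x))%:E)%E.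

Definition L1 f := cmeas f /\ (inorm f < +oo)%E.

Lemma inorm_ge0 f : (0 <= inorm f)%E.
Proof. by apply: integral_ge0 => x _; rewrite lee_fin normc_ge0. Qed.

Lemma cintegralE f : cintegral f =
  (\int[mu]_x complex.Re (f x)) +i* (\int[mu]_x complex.Im (f x)).
Proof. by rewrite /cintegral /Rintegral; congr (fine _ +i* fine _); exact: integral_lebE. Qed.

Lemma L1_Re f : L1 f -> mu.-integrable setT (fun x => (complex.Re (f x))%:E).
Proof.
move=> [mf fi]; have [f1 f2] := mf.
apply: (@le_integrable _ _ _ _ _ measurableT _ (fun x => (normc (f x))%:E)) => //.
- exact/measurable_EFinP.
- by move=> x _; rewrite !abse_EFin lee_fin (ger0_norm (normc_ge0 _)) normc_geRe.
- apply/integrableP; split; first exact: cmeas_EFin_normc.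
  by under eq_integral do rewrite abse_EFin ger0_norm ?normc_ge0//.
Qed.

Lemma L1_Im f : L1 f -> mu.-integrable setT (fun x => (complex.Im (f x))%:E).
Proof.
move=> [mf fi]; have [f1 f2] := mf.
apply: (@le_integrable _ _ _ _ _ measurableT _ (fun x => (normc (f x))%:E)) => //.
- exact/measurable_EFinP.
- by move=> x _; rewrite !abse_EFin lee_fin (ger0_norm (normc_ge0 _)) normc_geIm.
- apply/integrableP; split; first exact: cmeas_EFin_normc.
  by under eq_integral do rewrite abse_EFin ger0_norm ?normc_ge0//.
Qed.

Lemma le_inorm f g : cmeas f -> cmeas g -> (forall x, normc (f x) <= normc (g x)) ->
  (inorm f <= inorm g)%E.
Proof.
move=> mf mg fg; apply: ge0_le_integral => //.
- by move=> x _; rewrite lee_fin normc_ge0.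
- exact: cmeas_EFin_normc.
- exact: cmeas_EFin_normc.
- by move=> x _; rewrite lee_fin.
Qed.

Lemma le_L1 f g : cmeas f -> L1 g -> (forall x, normc (f x) <= normc (g x)) -> L1 f.
Proof.
by move=> mf [mg gi] fg; split => //; apply: le_lt_trans gi; exact: le_inorm.
Qed.

Lemma inormD f g : cmeas f -> cmeas g ->
  (inorm (fun x => f x + g x)%R <= inorm f + inorm g)%E.
Proof.
move=> mf mg; rewrite /inorm -ge0_integralD//; last 4 first.
- by move=> x _; rewrite lee_fin normc_ge0.
- exact: cmeas_EFin_normc.
- by move=> x _; rewrite lee_fin normc_ge0.
- exact: cmeas_EFin_normc.
apply: ge0_le_integral => //.
- by move=> x _; rewrite lee_fin normc_ge0.
- by apply: cmeas_EFin_normc; exact: cmeasD.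
- by apply: emeasurable_funD; exact: cmeas_EFin_normc.
- by move=> x _; rewrite -EFinD lee_fin le_normcD.
Qed.

Lemma inormZ c f : cmeas f -> inorm (fun x => c * f x) = ((normc c)%:E * inorm f)%E.
Proof.
move=> mf; rewrite /inorm -ge0_integralZl//.
- by apply: eq_integral => x _; rewrite normcM EFinM.
- exact: cmeas_EFin_normc.
- by move=> x _; rewrite lee_fin normc_ge0.
- by rewrite lee_fin normc_ge0.
Qed.

Lemma L1D f g : L1 f -> L1 g -> L1 (fun x => f x + g x).
Proof.
move=> [mf fi] [mg gi]; split; first exact: cmeasD.
by apply: le_lt_trans (inormD mf mg) _; exact: lte_add_pinfty.
Qed.

Lemma L1Z c f : L1 f -> L1 (fun x => c * f x).
Proof.
move=> [mf fi]; split; first exact: cmeasZ.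
rewrite inormZ//; apply: lte_mul_pinfty => //.
by rewrite lee_fin normc_ge0.
Qed.

Lemma L10 : L1 (fun=> 0).
Proof.
split; first exact: cmeas_cst.
by rewrite /inorm integral0_eq ?ltry// => x _; rewrite normc0.
Qed.

Lemma L1N f : L1 f -> L1 (fun x => - f x).
Proof.
by move=> /(L1Z (-1)); under [X in L1 X -> _]eq_fun do rewrite mulN1r.
Qed.

Lemma L1B f g : L1 f -> L1 g -> L1 (fun x => f x - g x).
Proof. by move=> hf hg; apply: L1D => //; exact: L1N. Qed.

Lemma L1_sum I (r : seq I) (F : I -> E -> R[i]) : (forall i, L1 (F i)) ->
  L1 (fun x => \sum_(i <- r) F i x).
Proof.
move=> LF; elim: r => [|i r IH].
  by under eq_fun do rewrite big_nil; exact: L10.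
by under eq_fun do rewrite big_cons; exact: L1D.
Qed.

Lemma cintegralD f g : L1 f -> L1 g ->
  cintegral (fun x => f x + g x) = cintegral f + cintegral g.
Proof.
move=> hf hg; rewrite !cintegralE; apply: complex_eq; rewrite /= -RintegralD//.
all: try exact: L1_Re. all: try exact: L1_Im.
- by apply: eq_Rintegral => x _; rewrite Re_addc.
- by apply: eq_Rintegral => x _; rewrite Im_addc.
Qed.

Lemma cintegralZ c f : L1 f -> cintegral (fun x => c * f x) = c * cintegral f.
Proof.
move=> hf; rewrite !cintegralE; apply: complex_eq; rewrite ?Re_mulc ?Im_mulc /=.
- rewrite -!RintegralZl//; [|exact: L1_Im|exact: L1_Re].
  rewrite -RintegralB//.
  + by apply: eq_Rintegral => x _; rewrite Re_mulc.
  + by apply: (@integrableZl _ _ _ mu setT measurableT (complex.Re c) (fun x => (complex.Re (f x))%:E)); exact: L1_Re.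
  + by apply: (@integrableZl _ _ _ mu setT measurableT (complex.Im c) (fun x => (complex.Im (f x))%:E)); exact: L1_Im.
- rewrite -!RintegralZl//; [|exact: L1_Re|exact: L1_Im].
  rewrite -RintegralD//.
  + by apply: eq_Rintegral => x _; rewrite Im_mulc.
  + by apply: (@integrableZl _ _ _ mu setT measurableT (complex.Re c) (fun x => (complex.Im (f x))%:E)); exact: L1_Im.
  + by apply: (@integrableZl _ _ _ mu setT measurableT (complex.Im c) (fun x => (complex.Re (f x))%:E)); exact: L1_Re.
Qed.

Lemma cintegral0 : cintegral (fun _ : E => 0) = 0.
Proof.
by rewrite cintegralE /= /Rintegral integral0_eq.
Qed.

Lemma cintegralN f : L1 f -> cintegral (fun x => - f x) = - cintegral f.
Proof.
move=> hf; rewrite -mulN1r -cintegralZ//; congr cintegral.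
by apply/funext => x; rewrite mulN1r.
Qed.

Lemma cintegralB f g : L1 f -> L1 g ->
  cintegral (fun x => f x - g x) = cintegral f - cintegral g.
Proof. by move=> hf hg; rewrite cintegralD ?cintegralN//; exact: L1N. Qed.

Lemma cintegral_sum I (r : seq I) (F : I -> E -> R[i]) : (forall i, L1 (F i)) ->
  cintegral (fun x => \sum_(i <- r) F i x) = \sum_(i <- r) cintegral (F i).
Proof.
move=> LF; elim: r => [|i r IH].
  by under eq_fun do rewrite big_nil; rewrite cintegral0 big_nil.
under eq_fun do rewrite big_cons.
by rewrite cintegralD// ?IH ?big_cons//; exact: L1_sum.
Qed.

(** Real and imaginary parts are bounded separately, which costs the factor 2. It reappears in
    Young's inequality and in all later constants, where it is harmless. *)
Lemma normc_cintegral f : L1 f -> ((normc (cintegral f))%:E <= 2%:E * inorm f)%E.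
Proof.
move=> hf; have [mf fi] := hf; have [f1 f2] := mf.
have H (h : R[i] -> R) : measurable_fun setT (h \o f) -> (forall z, `|h z| <= normc z) ->
    (`|\int[mu]_x h (f x)|%:E <= inorm f)%E.
  move=> mh hz.
  have ih : mu.-integrable setT (fun x => (h (f x))%:E).
    apply: (@le_integrable _ _ _ _ _ measurableT _ (fun x => (normc (f x))%:E)) => //.
    - exact/measurable_EFinP.
    - by move=> x _; rewrite !abse_EFin lee_fin (ger0_norm (normc_ge0 _)).
    - apply/integrableP; split; first exact: cmeas_EFin_normc.
      by under eq_integral do rewrite abse_EFin ger0_norm ?normc_ge0//.
  apply: (@le_trans _ _ (\int[mu]_x `|h (f x)|%:E)%E).
    rewrite EFin_normr_Rintegral//.
    by apply: le_abse_integral => //; exact/measurable_EFinP.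
  apply: ge0_le_integral => //.
  - by apply/measurable_EFinP; exact: measurableT_comp.
  - exact: cmeas_EFin_normc.
  - by move=> x _; rewrite lee_fin.
rewrite cintegralE.
apply: (@le_trans _ _ (`|\int[mu]_x complex.Re (f x)|%:E + `|\int[mu]_x complex.Im (f x)|%:E)%E).
  by rewrite -EFinD lee_fin; apply: le_trans (normc_leD _) _.
rewrite [X in (_ <= X)%E](_ : _ = (inorm f + inorm f)%E); last first.
  by rewrite mule_natl mule2n.
by apply: leeD; [apply: H => // z; exact: normc_geRe|apply: H => // z; exact: normc_geIm].
Qed.

Lemma ge0_integral_leb_affine (k : R) (a : E) (h : E -> \bar R) : k != 0 ->
  measurable_fun setT h -> (forall t, 0 <= h t)%E ->
  (\int[mu]_x h (k *: x + a)%R = ((`|k| ^- n)%:E * \int[mu]_x h x))%E.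
Proof.
move=> k0 mh h0; rewrite (ge0_integral_affine a k0 mh h0) muleA -EFinM mulVf ?mul1e//.
by rewrite expf_neq0// normr_eq0.
Qed.

Lemma cmeas_affine (k : R) (a : E) f : cmeas f -> cmeas (fun x : E => f (k *: x + a)).
Proof. by move=> mf; apply: (cmeas_comp mf); exact: measurable_affine. Qed.

Lemma inorm_affine (k : R) (a : E) f : k != 0 -> cmeas f ->
  (inorm (fun x : E => f (k *: x + a)%R) = ((`|k| ^- n)%:E * inorm f))%E.
Proof.
move=> k0 mf; rewrite /inorm -(ge0_integral_leb_affine a k0)//.
  exact: cmeas_EFin_normc.
by move=> x; rewrite lee_fin normc_ge0.
Qed.

Lemma L1_affine (k : R) (a : E) f : k != 0 -> L1 f -> L1 (fun x : E => f (k *: x + a)).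
Proof.
move=> k0 [mf fi]; split; first exact: cmeas_affine.
by rewrite inorm_affine//; apply: lte_mul_pinfty => //; rewrite lee_fin invr_ge0 exprn_ge0.
Qed.

Lemma Rintegral_affine (k : R) (a : E) (h : E -> R) : k != 0 ->
  mu.-integrable setT (EFin \o h) ->
  \int[mu]_x h (k *: x + a) = `|k| ^- n * \int[mu]_x h x.
Proof.
move=> k0 ih; have [mh hi] := integrableP _ _ _ ih.
have mh' : measurable_fun setT h by exact/measurable_EFinP.
rewrite /Rintegral integralE [in RHS]integralE.
have P (g : E -> \bar R) : mu.-integrable setT g -> (forall x, 0 <= g x)%E ->
   (\int[mu]_x g (k *: x + a)%R = (`|k| ^- n)%:E * \int[mu]_x g x)%E.
  by move=> /integrableP[mg _] g0; exact: ge0_integral_leb_affine.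
have ip := integrable_funepos measurableT ih.
have iN := integrable_funeneg measurableT ih.
have := P _ ip (fun x => funepos_ge0 _ _); have := P _ iN (fun x => funeneg_ge0 _ _).
have -> : (fun x0 : E => (h (k *: x0 + a))%:E)^\+%E = fun x => ((EFin \o h)^\+%E (k *: x + a)).
  by apply/funext => x; rewrite !funeposE.
have -> : (fun x0 : E => (h (k *: x0 + a))%:E)^\-%E = fun x => ((EFin \o h)^\-%E (k *: x + a)).
  by apply/funext => x; rewrite !funenegE.
rewrite /= => -> ->.
have /= f1 := integrable_fin_num measurableT ip.
have /= f2 := integrable_fin_num measurableT iN.
rewrite -muleBr//; last by rewrite fin_num_adde_defl// fin_numN.
by rewrite fineM// fin_numB f1.
Qed.

Lemma cintegral_affine (k : R) (a : E) f : k != 0 -> L1 f ->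
  cintegral (fun x : E => f (k *: x + a)) = (`|k| ^- n)%:C * cintegral f.
Proof.
move=> k0 hf; rewrite !cintegralE.
rewrite (Rintegral_affine (h := fun x => complex.Re (f x)) a k0 (L1_Re hf)).
rewrite (Rintegral_affine (h := fun x => complex.Im (f x)) a k0 (L1_Im hf)).
by apply: complex_eq; rewrite ?Re_mulc ?Im_mulc /= !mul0r ?subr0 ?addr0.
Qed.

Lemma cintegral_shift (a : E) f : L1 f -> cintegral (fun x : E => f (x + a)) = cintegral f.
Proof.
move=> hf; have := cintegral_affine a (oner_neq0 R) hf.
rewrite normr1 expr1n invr1 mul1r => <-.
by congr cintegral; apply/funext => x; rewrite scale1r.
Qed.

Lemma cintegral_opp f : L1 f -> cintegral (fun x : E => f (- x)) = cintegral f.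
Proof.
move=> hf; have := @cintegral_affine (-1) 0 f _ hf.
rewrite oppr_eq0 oner_eq0 normrN normr1 expr1n invr1 mul1r => <-//.
by congr cintegral; apply/funext => x; rewrite scaleN1r addr0.
Qed.

Lemma ge0_fubini (F : E * E -> \bar R) : measurable_fun setT F -> (forall x, 0 <= F x)%E ->
  (\int[mu]_x \int[mu]_y F (x, y) = \int[mu]_y \int[mu]_x F (x, y))%E.
Proof. by move=> mF F0; exact: (fubini_tonelli (m1 := mu) (m2 := mu)). Qed.

(** The map [h] stands for the real or the imaginary part, so that one proof serves both. *)
Lemma prod_integrable (F : E * E -> R[i]) (h : R[i] -> R) : cmeas F ->
  (\int[mu]_x \int[mu]_y (normc (F (x, y)))%:E < +oo)%E ->
  measurable_fun setT (h \o F) -> (forall z, `|h z| <= normc z) ->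
  (mu \x mu)%E.-integrable setT (fun x => (h (F x))%:E).
Proof.
move=> mF Fi mh hz.
apply/integrable12ltyP; first exact/measurable_EFinP.
apply: le_lt_trans Fi; apply: ge0_le_integral => //.
- by move=> x _; apply: integral_ge0.
- apply: (measurable_fun_fubini_tonelli_F (m2 := mu) (fun x => `|(h (F x))%:E|%E)) => //.
  by apply/measurable_EFinP; exact: measurableT_comp.
- apply: (measurable_fun_fubini_tonelli_F (m2 := mu) (fun x => (normc (F x))%:E)).
    exact: cmeas_EFin_normc.
  by move=> x; rewrite lee_fin normc_ge0.
move=> x _; apply: ge0_le_integral => //.
- apply: measurableT_comp => //; apply/measurable_EFinP.
  exact: (measurableT_comp mh (measurable_pair1 x)).
- apply/measurable_EFinP.
  exact: (measurableT_comp (cmeas_normc mF) (measurable_pair1 x)).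
- by move=> y _; rewrite abse_EFin lee_fin.
Qed.

Lemma cfubini (F : E * E -> R[i]) : cmeas F ->
  (\int[mu]_x \int[mu]_y (normc (F (x, y)))%:E < +oo)%E ->
  (forall x, L1 (fun y => F (x, y))) -> (forall y, L1 (fun x => F (x, y))) ->
  cintegral (fun x => cintegral (fun y => F (x, y))) =
  cintegral (fun y => cintegral (fun x => F (x, y))).
Proof.
move=> mF Fi Fx Fy; have [F1 F2] := mF.
have Q (h : R[i] -> R) : measurable_fun setT (h \o F) -> (forall z, `|h z| <= normc z) ->
   (forall f, L1 f -> mu.-integrable setT (fun x => (h (f x))%:E)) ->
   \int[mu]_x \int[mu]_y h (F (x, y)) = \int[mu]_y \int[mu]_x h (F (x, y)).
  move=> mh hz ih.
  have iF := prod_integrable mF Fi mh hz.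
  have := Fubini iF; rewrite /Rintegral => H; congr fine.
  transitivity (\int[mu]_x \int[mu]_y (h (F (x, y)))%:E)%E; [|rewrite H].
    by apply: eq_integral => x _; rewrite fineK// integrable_fin_num//; exact: (ih _ (Fx x)).
  by apply: eq_integral => x _; rewrite fineK// integrable_fin_num//; exact: (ih _ (Fy x)).
rewrite [LHS]cintegralE [RHS]cintegralE; congr (_ +i* _).
- under eq_Rintegral do rewrite cintegralE /=.
  under [RHS]eq_Rintegral do rewrite cintegralE /=.
  by apply: Q => // [z|f]; [exact: normc_geRe|exact: L1_Re].
- under eq_Rintegral do rewrite cintegralE /=.
  under [RHS]eq_Rintegral do rewrite cintegralE /=.
  by apply: Q => // [z|f]; [exact: normc_geIm|exact: L1_Im].
Qed.

End cintegral_theory.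

Lemma normcr0 {R : realType} : normc (0 : R[i]) = 0.
Proof. exact: normc0. Qed.

Lemma normcr1 {R : realType} : normc (1 : R[i]) = 1.
Proof. exact: normc1. Qed.

(** * Norms and polynomial weights on R^n *)

Section weights.
Context {R : realType} {n : nat}.
Implicit Types (x y h : 'rV[R]_n).

(** The l^1 norm: it is the sum that bounds first-order Taylor terms coordinate by coordinate, and
    it lies between the Euclidean norm and n times it. The weight [wt] is built on it. *)
Definition onorm x : R := \sum_(i < n) `|x ord0 i|.
Definition wt x : R := 1 + onorm x.

Lemma sum_ord_cst (c : R) : \sum_(i < n) c = n%:R * c.
Proof. by rewrite sumr_const card_ord mulr_natl. Qed.

Lemma onorm_ge0 x : 0 <= onorm x. Proof. exact: sumr_ge0. Qed.
Lemma wt_ge1 x : 1 <= wt x. Proof. by rewrite lerDl onorm_ge0. Qed.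
Lemma wt_gt0 x : 0 < wt x. Proof. exact: lt_le_trans (wt_ge1 x). Qed.
Lemma wt_ge0 x : 0 <= wt x. Proof. exact: ltW (wt_gt0 x). Qed.
Lemma onorm_le_wt x : onorm x <= wt x. Proof. by rewrite lerDr. Qed.
Lemma wtX_gt0 x k : 0 < wt x ^+ k. Proof. by rewrite exprn_gt0 ?wt_gt0. Qed.
Lemma wtX_ge1 x k : 1 <= wt x ^+ k. Proof. by rewrite exprn_ege1 ?wt_ge1. Qed.

Lemma coord_le_onorm x i : `|x ord0 i| <= onorm x.
Proof. by rewrite /onorm (bigD1 i)//= lerDl sumr_ge0. Qed.

Lemma coord_le_norm x i : `|x ord0 i| <= `|x|.
Proof.
have [->//|xi0] := eqVneq (x ord0 i) 0; first by rewrite normr0.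
rewrite [leRHS]/Num.norm /= mx_normrE; apply/bigmax_geP; right => /=.
by exists (ord0, i).
Qed.

Lemma onorm_le_norm x : onorm x <= n%:R * `|x|.
Proof.
rewrite -sum_ord_cst.
by apply: ler_sum => i _; exact: coord_le_norm.
Qed.

Lemma norm_le_onorm x : `|x| <= onorm x.
Proof.
rewrite [leLHS]/Num.norm /= mx_normrE; apply/bigmax_leP; split; first exact: onorm_ge0.
by move=> [a i] _ /=; rewrite ord1; exact: coord_le_onorm.
Qed.

Lemma onormN x : onorm (- x) = onorm x.
Proof. by apply: eq_bigr => i _; rewrite mxE normrN. Qed.

Lemma onormD x y : onorm (x + y) <= onorm x + onorm y.
Proof.
rewrite -big_split /=; apply: ler_sum => i _; rewrite mxE; exact: ler_normD.
Qed.

Lemma onormZ k x : onorm (k *: x) = `|k| * onorm x.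
Proof. by rewrite /onorm mulr_sumr; apply: eq_bigr => i _; rewrite mxE normrM. Qed.

Lemma onorm0 : onorm 0 = 0.
Proof. by apply: big1 => i _; rewrite mxE normr0. Qed.

Lemma wtN x : wt (- x) = wt x. Proof. by rewrite /wt onormN. Qed.

(** Peetre's inequality in multiplicative form. Through [wt_shift] it moves decay from a point to a
    translate of it, at the cost of a power of the weight of the shift. *)
Lemma wtD x y : wt (x + y) <= wt x * wt y.
Proof.
rewrite /wt mulrDr mulr1 mulrDl mul1r -!addrA lerD2l.
apply: le_trans (onormD x y) _.
by rewrite lerD2l lerDl mulr_ge0 ?onorm_ge0.
Qed.

Lemma wt_shift x h : wt x <= wt (x + h) * wt h.
Proof. by rewrite -[in leLHS](addrK h x) -(wtN h); exact: wtD. Qed.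

Lemma wt_shiftX x h k : wt x ^+ k <= wt (x + h) ^+ k * wt h ^+ k.
Proof.
by rewrite -exprMn lerXn2r ?nnegrE ?mulr_ge0 ?wt_ge0// wt_shift.
Qed.

Lemma wt_segment t h : 0 <= t <= 1 -> wt (t *: h) <= wt h.
Proof.
by move=> /andP[t0 t1]; rewrite /wt lerD2l onormZ ger0_norm// ler_piMl// onorm_ge0.
Qed.

Lemma wtX_mono x k l : (k <= l)%N -> wt x ^+ k <= wt x ^+ l.
Proof. by move=> kl; rewrite ler_weXn2l ?wt_ge1. Qed.

Lemma dotv_ge0 x : 0 <= dotv x x.
Proof. by apply: sumr_ge0 => i _; rewrite -expr2 sqr_ge0. Qed.

Lemma enorm_ge0 x : 0 <= enorm x. Proof. exact: sqrtr_ge0. Qed.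

Lemma sqr_enorm x : enorm x ^+ 2 = dotv x x.
Proof. by rewrite sqr_sqrtr ?dotv_ge0. Qed.

Lemma coord_le_enorm x i : `|x ord0 i| <= enorm x.
Proof.
rewrite -sqrtr_sqr ler_sqrt ?dotv_ge0// /dotv (bigD1 i)//= -expr2 lerDl.
by apply: sumr_ge0 => j _; rewrite -expr2 sqr_ge0.
Qed.

Lemma onorm_le_enorm x : onorm x <= n%:R * enorm x.
Proof.
rewrite -sum_ord_cst.
by apply: ler_sum => i _; exact: coord_le_enorm.
Qed.

Lemma enorm_le_onorm x : enorm x <= onorm x.
Proof.
rewrite -(ger0_norm (onorm_ge0 x)) -sqrtr_sqr ler_sqrt ?sqr_ge0//.
rewrite expr2 {1}/onorm mulr_suml /dotv; apply: ler_sum => i _.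
by rewrite -[leLHS]ger0_norm -?expr2 ?sqr_ge0// normrX expr2 ler_wpM2l// coord_le_onorm.
Qed.

Lemma enorm_eq0 x : (enorm x == 0) = (x == 0).
Proof.
apply/eqP/eqP => [x0|->]; last first.
  by rewrite /enorm /dotv big1 ?sqrtr0// => i _; rewrite mxE mul0r.
by apply/rowP => i; apply/eqP; rewrite mxE -normr_le0 -x0 coord_le_enorm.
Qed.

Lemma enormZ k x : enorm (k *: x) = `|k| * enorm x.
Proof.
rewrite /enorm (_ : dotv _ _ = k ^+ 2 * dotv x x).
  by rewrite sqrtrM ?sqr_ge0// sqrtr_sqr.
by rewrite /dotv mulr_sumr; apply: eq_bigr => i _; rewrite !mxE; ring.
Qed.

Lemma dotvC x y : dotv x y = dotv y x.
Proof. by apply: eq_bigr => i _; rewrite mulrC. Qed.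

Lemma dotvDl x y h : dotv (x + y) h = dotv x h + dotv y h.
Proof. by rewrite /dotv -big_split; apply: eq_bigr => i _; rewrite mxE mulrDl. Qed.

Lemma dotvDr x y h : dotv h (x + y) = dotv h x + dotv h y.
Proof. by rewrite dotvC dotvDl ![dotv _ h]dotvC. Qed.

Lemma dotvZl k x y : dotv (k *: x) y = k * dotv x y.
Proof. by rewrite /dotv mulr_sumr; apply: eq_bigr => i _; rewrite mxE mulrA. Qed.

Lemma dotvZr k x y : dotv x (k *: y) = k * dotv x y.
Proof. by rewrite dotvC dotvZl dotvC. Qed.

Lemma dotvNl x y : dotv (- x) y = - dotv x y.
Proof. by rewrite -scaleN1r dotvZl mulN1r. Qed.

Lemma dotvNr x y : dotv x (- y) = - dotv x y.
Proof. by rewrite dotvC dotvNl dotvC. Qed.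

Lemma dotv_le x y : `|dotv x y| <= onorm x * onorm y.
Proof.
apply: le_trans (ler_norm_sum _ _ _) _.
rewrite {1}/onorm mulr_suml; apply: ler_sum => i _.
by rewrite normrM ler_wpM2l// coord_le_onorm.
Qed.

End weights.

(** * Differentiation: smoothness, Leibniz rule, mean value and Taylor estimates with decay *)

Section differentiation.
Context {R : realType} {n : nat}.
Local Notation E := 'rV[R]_n.
Implicit Types (f g : E -> R[i]) (u v : E -> R) (x h : E).
Local Notation e_ i := (delta_mx (ord0 : 'I_1) (i : 'I_n) : 'rV[R]_n).

Lemma rV_sum_delta h : h = \sum_i h ord0 i *: e_ i.
Proof. by rewrite {1}(row_sum_delta h). Qed.

Lemma derive_sum_delta u x h : differentiable u x ->
  'D_h u x = \sum_i h ord0 i * 'D_(e_ i) u x.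
Proof.
move=> du; rewrite deriveE// {1}(rV_sum_delta h) linear_sum.
by apply: eq_bigr => i _; rewrite linearZ deriveE.
Qed.

(** A quadratic remainder on a fixed ball is stronger than a little-o, and unlike a little-o it
    survives integration over a parameter. All derivatives of integrals below are found in this
    way. *)
Lemma quad_differentiable u x (d : 'I_n -> R) (C : R) :
  (forall h, `|h| <= 1 -> `|u (x + h) - u x - \sum_i h ord0 i * d i| <= C * `|h| ^+ 2) ->
  differentiable u x /\ forall i, 'D_(e_ i) u x = d i.
Proof.
move=> H.
pose L (h : E) : R := \sum_i h ord0 i * d i.
have Llin : linear L.
  move=> a h k; rewrite /L scaler_sumr -big_split; apply: eq_bigr => i _.
  by rewrite !mxE /= mulrDl /GRing.scale /= mulrA.
pose Lm := GRing.isLinear.Build R E R _ L Llin.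
pose LL : {linear E -> R} := HB.pack L Lm.
have Lc : continuous LL.
  move=> y; apply: differentiable_continuous.
  rewrite (_ : (LL : E -> R) = \sum_(i < n) (fun h : E => d i *: (h ord0 i : R))).
    apply: differentiable_sum => i; apply: differentiableZ; exact: differentiable_coord.
  by apply/funext => h; rewrite fct_sumE; apply: eq_bigr => i _; rewrite mulrC.
have nb (e : R) : 0 < e -> \forall h \near (0 : E), `|h| <= e.
  by move=> e0; apply: (@nbhs0_le R E).
have D : u \o shift x = cst (u x) + LL +o_ (0 : E) id.
  apply/eqaddoP => _/posnumP[eps]; near=> h.
  have -> : (u \o shift x - (cst (u x) + LL)) h = u (x + h) - u x - L h.
    by rewrite -[LHS]/(u (h + x) - (u x + L h)) (addrC h) opprD addrA.
  have h1 : `|h| <= 1 by near: h; exact: nb.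
  have C1 : 0 < `|C| + 1 by rewrite ltr_wpDl.
  have h2 : `|h| <= (`|C| + 1)^-1 * eps%:num by near: h; apply: nb; rewrite mulr_gt0 ?invr_gt0.
  apply: le_trans (H h h1) _.
  rewrite expr2 mulrA; apply: ler_wpM2r => //.
  apply: (@le_trans _ _ ((`|C| + 1) * `|h|)).
    by apply: ler_wpM2r => //; apply: le_trans (ler_norm _) _; rewrite lerDl.
  by rewrite -ler_pdivlMl.
have dE := diff_unique Lc D.
have du : differentiable u x.
  by apply/diff_locallyP; rewrite dE.
split => // i; rewrite deriveE// dE /= /L (bigD1 i)//= mxE !eqxx mul1r big1 ?addr0//.
by move=> j ji; rewrite mxE (negbTE ji) andbF mul0r.
Unshelve. all: by end_near. Qed.

Lemma mvt_rV u x h : (forall y, differentiable u y) ->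
  exists2 t : R, 0 <= t <= 1 & u (x + h) - u x = \sum_i h ord0 i * 'D_(e_ i) u (x + t *: h).
Proof.
move=> du.
pose w (t : R) := u (x + t *: h).
have dw (t : R) : is_derive t (1 : R) w ('D_h u (x + t *: h)).
  have dl : is_diff t (fun t : R => x + t *: h) (fun k => k *: h).
    have := @is_diffD _ _ _ (cst x) (fun t : R => t *: h) _ _ t (is_diff_cst x t) (is_diff_scalel t h).
    by rewrite (_ : (0 : R -> E) + _ = ( *:%R ^~ h))// add0r.
  have : is_diff t w ('d u (x + t *: h) \o (fun k => k *: h)).
    exact: (@is_diff_comp _ _ _ _ _ _ _ _ _ dl (differentiableP (du _))).
  move=> dw; apply: DeriveDef; first exact/diff_derivable.
  by rewrite deriveE// diff_val /= scale1r deriveE.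
have [|c] := @MVT_segment R w (fun t => 'D_h u (x + t *: h)) 0 1 ler01.
  apply: continuous_subspaceT => t; apply: differentiable_continuous.
  by apply/derivable1_diffP; have [] := dw t.
rewrite in_itv /= => c01; rewrite /w scale1r scale0r addr0 subr0 mulr1 => H.
by exists c => //; rewrite H derive_sum_delta.
Qed.

Definition cdiff f x := differentiable (@complex.Re R \o f) x /\
  differentiable (@complex.Im R \o f) x.

Lemma smooth_cdiff f x : smooth f -> cdiff f x.
Proof. by move=> /(_ [::] x). Qed.

Lemma smooth_pderiv f i : smooth f -> smooth (pderiv i f).
Proof. by move=> sf s x; have := sf (rcons s i) x; rewrite /pderivs foldr_rcons. Qed.

Lemma smooth_pderivs f s : smooth f -> smooth (pderivs s f).
Proof. by move=> sf; elim: s => //= i s; exact: smooth_pderiv. Qed.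

Lemma pderivs_rcons f s i : pderivs (rcons s i) f = pderivs s (pderiv i f).
Proof. by rewrite /pderivs foldr_rcons. Qed.

Lemma pderivs_cat f s t : pderivs (s ++ t) f = pderivs s (pderivs t f).
Proof. by rewrite /pderivs foldr_cat. Qed.

(** A coinduction principle: [smooth] is the largest class of componentwise differentiable functions
    that is stable under partial derivatives. *)
Lemma closed_smooth (S : set (E -> R[i])) : (forall f, S f -> forall x, cdiff f x) ->
  (forall f i, S f -> S (pderiv i f)) -> S `<=` smooth.
Proof.
move=> Sd Sp f Sf s x; apply: (Sd (pderivs s f)).
by elim: s => //= i s; exact: Sp.
Qed.

Lemma cdiff_cst (c : R[i]) x : cdiff (fun=> c) x.
Proof. by split; exact: differentiable_cst. Qed.

Lemma cdiffD f g x : cdiff f x -> cdiff g x -> cdiff (fun y => f y + g y) x.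
Proof.
move=> [f1 f2] [g1 g2]; split.
- rewrite (_ : _ \o _ = (@complex.Re R \o f) + (@complex.Re R \o g)).
    exact: differentiableD.
  by apply/funext => y; rewrite /= Re_addc.
- rewrite (_ : _ \o _ = (@complex.Im R \o f) + (@complex.Im R \o g)).
    exact: differentiableD.
  by apply/funext => y; rewrite /= Im_addc.
Qed.

Lemma cdiffM f g x : cdiff f x -> cdiff g x -> cdiff (fun y => f y * g y) x.
Proof.
move=> [f1 f2] [g1 g2]; split.
- rewrite (_ : _ \o _ = (@complex.Re R \o f) * (@complex.Re R \o g) -
     (@complex.Im R \o f) * (@complex.Im R \o g)).
    by apply: differentiableB; exact: differentiableM.
  by apply/funext => y; rewrite /= Re_mulc.
- rewrite (_ : _ \o _ = (@complex.Re R \o f) * (@complex.Im R \o g) +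
     (@complex.Im R \o f) * (@complex.Re R \o g)).
    by apply: differentiableD; exact: differentiableM.
  by apply/funext => y; rewrite /= Im_mulc.
Qed.

Lemma pderiv_cst (c : R[i]) i : pderiv i (fun _ : E => c) = fun=> 0.
Proof.
by apply/funext => x; rewrite /pderiv; apply: complex_eq => /=; exact: derive_cst.
Qed.

Lemma pderivD f g i x : cdiff f x -> cdiff g x ->
  pderiv i (fun y => f y + g y) x = pderiv i f x + pderiv i g x.
Proof.
move=> [f1 f2] [g1 g2]; rewrite /pderiv; apply: complex_eq => /=.
- rewrite (_ : _ \o _ = (@complex.Re R \o f) + (@complex.Re R \o g)).
    by rewrite deriveD//; exact: diff_derivable.
  by apply/funext => y; rewrite /= Re_addc.
- rewrite (_ : _ \o _ = (@complex.Im R \o f) + (@complex.Im R \o g)).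
    by rewrite deriveD//; exact: diff_derivable.
  by apply/funext => y; rewrite /= Im_addc.
Qed.

Lemma pderivM f g i x : cdiff f x -> cdiff g x ->
  pderiv i (fun y => f y * g y) x = pderiv i f x * g x + f x * pderiv i g x.
Proof.
move=> [/(@diff_derivable _ _ _ _ _ (e_ i)) f1 /(@diff_derivable _ _ _ _ _ (e_ i)) f2]
  [/(@diff_derivable _ _ _ _ _ (e_ i)) g1 /(@diff_derivable _ _ _ _ _ (e_ i)) g2].
have rule1 (a b c d A B C D : R) : a *: C + c *: A - (b *: D + d *: B) =
  A * c - B * d + (a * C - b * D) by rewrite /GRing.scale /=; ring.
have rule2 (a b c d A B C D : R) : a *: D + d *: A + (b *: C + c *: B) =
  A * d + B * c + (a * D + b * C) by rewrite /GRing.scale /=; ring.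
rewrite /pderiv; apply: complex_eq => /=.
- rewrite (_ : _ \o _ = (@complex.Re R \o f) * (@complex.Re R \o g) -
     (@complex.Im R \o f) * (@complex.Im R \o g)); last first.
    by apply/funext => y; rewrite /= Re_mulc.
  rewrite (deriveB (derivableM f1 g1) (derivableM f2 g2)).
  rewrite (deriveM f1 g1) (deriveM f2 g2) Re_addc !Re_mulc.
  exact: rule1.
- rewrite (_ : _ \o _ = (@complex.Re R \o f) * (@complex.Im R \o g) +
     (@complex.Im R \o f) * (@complex.Re R \o g)); last first.
    by apply/funext => y; rewrite /= Im_mulc.
  rewrite (deriveD (derivableM f1 g2) (derivableM f2 g1)).
  rewrite (deriveM f1 g2) (deriveM f2 g1) Im_addc !Im_mulc.
  exact: rule2.
Qed.

Lemma smoothP f : smooth f <-> (forall x, cdiff f x) /\ forall i, smooth (pderiv i f).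
Proof.
split=> [sf|[df sf] s x]; first by split=> *; [exact: smooth_cdiff|exact: smooth_pderiv].
by case/lastP: s => [|s i]; [exact: df|rewrite pderivs_rcons; exact: sf].
Qed.

Lemma smooth_cst (c : R[i]) : smooth (fun _ : E => c).
Proof.
apply: (closed_smooth (S := [set f | exists c, f = fun=> c])); last by exists c.
  by move=> _ [d ->] x; exact: cdiff_cst.
by move=> _ i [d ->]; exists 0; exact: pderiv_cst.
Qed.

(** Sums of products of smooth functions are stable under partial derivatives by the first-order
    Leibniz rule, so [closed_smooth] applies and no Leibniz formula of higher order is needed. *)
Inductive sprod : (E -> R[i]) -> Prop :=
| sprodM f g : smooth f -> smooth g -> sprod (fun x => f x * g x)
| sprodD f g : sprod f -> sprod g -> sprod (fun x => f x + g x).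

Lemma sprod_cdiff f x : sprod f -> cdiff f x.
Proof.
elim=> [{}f g sf sg|{}f g _ df _ dg]; first by apply: cdiffM; exact: smooth_cdiff.
exact: cdiffD.
Qed.

Lemma sprod_smooth f : sprod f -> smooth f.
Proof.
apply: (closed_smooth (S := sprod)) => [{}f sf x|{}f i]; first exact: sprod_cdiff.
elim=> [{}f g sf sg|{}f g sf IHf sg IHg].
- rewrite (_ : pderiv i _ = fun x => pderiv i f x * g x + f x * pderiv i g x).
    by apply: sprodD; apply: sprodM => //; exact: smooth_pderiv.
  by apply/funext => x; rewrite pderivM//; exact: smooth_cdiff.
- rewrite (_ : pderiv i _ = fun x => pderiv i f x + pderiv i g x); first exact: sprodD.
  by apply/funext => x; rewrite pderivD//; exact: sprod_cdiff.
Qed.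

Lemma smoothM f g : smooth f -> smooth g -> smooth (fun x => f x * g x).
Proof. by move=> sf sg; apply: sprod_smooth; exact: sprodM. Qed.

Lemma smoothZ c f : smooth f -> smooth (fun x => c * f x).
Proof. by move=> sf; apply: smoothM => //; exact: smooth_cst. Qed.

Lemma smoothD f g : smooth f -> smooth g -> smooth (fun x => f x + g x).
Proof.
move=> sf sg; apply: sprod_smooth.
rewrite (_ : (fun x => _) = fun x => 1 * f x + 1 * g x).
  by apply: sprodD; apply: sprodM => //; exact: smooth_cst.
by apply/funext => x; rewrite !mul1r.
Qed.

Lemma pderivZ c f i : smooth f -> pderiv i (fun y => c * f y) = fun x => c * pderiv i f x.
Proof.
move=> sf; apply/funext => x.
rewrite pderivM; [|exact: cdiff_cst|exact: smooth_cdiff].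
by rewrite pderiv_cst mul0r add0r.
Qed.

Lemma pderivsZ c f s : smooth f -> pderivs s (fun y => c * f y) = fun x => c * pderivs s f x.
Proof.
move=> sf; elim: s => //= i s ->; rewrite pderivZ//; exact: smooth_pderivs.
Qed.

Lemma pderivsD f g s : smooth f -> smooth g ->
  pderivs s (fun y => f y + g y) = fun x => pderivs s f x + pderivs s g x.
Proof.
move=> sf sg; elim: s => //= i s ->; apply/funext => x.
by rewrite pderivD//; apply: smooth_cdiff; exact: smooth_pderivs.
Qed.

Lemma affine_diff f (k : R) (a : E) x : cdiff f (k *: x + a) ->
  cdiff (fun y => f (k *: y + a)) x /\ forall i,
  pderiv i (fun y => f (k *: y + a)) x = k%:C * pderiv i f (k *: x + a).
Proof.
move=> [f1 f2].
have dl : is_diff x (fun y : E => k *: y + a) (fun y => k *: y).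
  have := @is_diffD _ _ _ (fun y : E => k *: y) (cst a) _ _ x (is_diff_scaler k x) (is_diff_cst a x).
  by rewrite (_ : _ + (0 : E -> E) = ( *:%R k))// addr0.
have P u : differentiable u (k *: x + a) ->
    is_diff x (u \o (fun y => k *: y + a)) ('d u (k *: x + a) \o (fun y => k *: y)).
  by move=> du; exact: (@is_diff_comp _ _ _ _ _ _ _ _ _ dl (differentiableP du)).
have [d1 v1] := P _ f1; have [d2 v2] := P _ f2.
split=> [|i]; first by [].
rewrite /pderiv; apply: complex_eq; rewrite ?Re_mulc ?Im_mulc /= !mul0r ?subr0 ?addr0.
- rewrite -[_ \o _]/((@complex.Re R \o f) \o (fun y => k *: y + a)).
  by rewrite deriveE// v1 /= linearZ deriveE.
- rewrite -[_ \o _]/((@complex.Im R \o f) \o (fun y => k *: y + a)).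
  by rewrite deriveE// v2 /= linearZ deriveE.
Qed.

Lemma pderivs_affine f (k : R) (a : E) s : smooth f ->
  pderivs s (fun y => f (k *: y + a)) = fun x => (k ^+ size s)%:C * pderivs s f (k *: x + a).
Proof.
move=> sf; elim: s => [|i s IH] /=.
  by apply/funext => x; rewrite expr0 mul1r.
rewrite IH; apply/funext => x.
have cd := smooth_cdiff (k *: x + a) (smooth_pderivs s sf).
have [c1 c2] := affine_diff cd.
rewrite pderivM//; last exact: cdiff_cst.
rewrite pderiv_cst mul0r add0r c2 mulrA -/(pderivs s f); congr (_ * _).
by rewrite exprSr rmorphM.
Qed.

Lemma smooth_affine f (k : R) (a : E) : smooth f -> smooth (fun y => f (k *: y + a)).
Proof.
move=> sf s x; rewrite pderivs_affine//; apply: cdiffM; first exact: cdiff_cst.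
by have [] := affine_diff (smooth_cdiff (k *: x + a) (smooth_pderivs s sf)).
Qed.

(** The region [onorm h <= n%:R] contains the unit ball of the sup norm, where [quad_differentiable]
    asks for the estimate. *)
Lemma quad_cdiff f x (d : 'I_n -> R[i]) (C : R) :
  (forall h, onorm h <= n%:R -> normc (f (x + h) - f x - \sum_i (h ord0 i)%:C * d i) <= C * onorm h ^+ 2) ->
  cdiff f x /\ forall i, pderiv i f x = d i.
Proof.
move=> H.
have H' h : `|h| <= 1 -> normc (f (x + h) - f x - \sum_i (h ord0 i)%:C * d i) <= `|C| * n%:R ^+ 2 * `|h| ^+ 2.
  move=> h1; apply: le_trans (H h _) _.
    by apply: le_trans (onorm_le_norm _) _; rewrite ler_piMr.
  rewrite -mulrA -exprMn; apply: le_trans (ler_norm _) _.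
  rewrite normrM (ger0_norm (sqr_ge0 _)) ler_wpM2l// lerXn2r ?nnegrE ?onorm_ge0 ?mulr_ge0//.
  exact: onorm_le_norm.
have [|d1 e1] := @quad_differentiable (@complex.Re R \o f) x (fun i => complex.Re (d i)) (`|C| * n%:R ^+ 2).
  move=> h /H'; apply: le_trans; apply: le_trans (normc_geRe _).
  rewrite !Re_addc !Re_oppc /= (_ : complex.Re (\sum_i _) = \sum_i h ord0 i * complex.Re (d i))//.
  elim/big_rec2 : _ => // i a b _ <-.
  by rewrite Re_addc Re_mulc /= mul0r subr0.
have [|d2 e2] := @quad_differentiable (@complex.Im R \o f) x (fun i => complex.Im (d i)) (`|C| * n%:R ^+ 2).
  move=> h /H'; apply: le_trans; apply: le_trans (normc_geIm _).
  rewrite !Im_addc !Im_oppc /= (_ : complex.Im (\sum_i _) = \sum_i h ord0 i * complex.Im (d i))//.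
  elim/big_rec2 : _ => // i a b _ <-.
  by rewrite Im_addc Im_mulc /= mul0r addr0.
by split=> // i; apply: complex_eq; rewrite /= ?e1 ?e2.
Qed.

Lemma coord_diff (i : 'I_n) x : cdiff (fun x : E => (x ord0 i)%:C) x /\
  forall j, pderiv j (fun x : E => (x ord0 i)%:C) x = (i == j)%:R.
Proof.
apply: (@quad_cdiff _ _ _ 0) => h _; rewrite (bigD1 i)//= eqxx mulr1 big1 => [|j ji].
  rewrite mul0r (_ : _ - _ = 0) ?normcr0//.
  by apply: complex_eq; rewrite /= ?mxE; ring.
by rewrite eq_sym (negbTE ji) mulr0.
Qed.

Lemma smooth_coord (i : 'I_n) : smooth (fun x : E => (x ord0 i)%:C).
Proof.
apply/smoothP; split=> [x|j]; first by have [] := coord_diff i x.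
rewrite (_ : pderiv j _ = fun=> (i == j)%:R); first exact: smooth_cst.
by apply/funext => x; have [] := coord_diff i x.
Qed.

(** The intermediate points for the real and the imaginary part differ, so each part is bounded on
    its own; hence the factor 2. *)
Lemma cmvt f x h (C : 'I_n -> R) : (forall y, cdiff f y) ->
  (forall i t, 0 <= t <= 1 -> normc (pderiv i f (x + t *: h)) <= C i) ->
  normc (f (x + h) - f x) <= 2 * \sum_i `|h ord0 i| * C i.
Proof.
move=> df dC.
have P (u : E -> R) : (forall y, differentiable u y) ->
    (forall i t, 0 <= t <= 1 -> `|'D_(e_ i) u (x + t *: h)| <= C i) ->
    `|u (x + h) - u x| <= \sum_i `|h ord0 i| * C i.
  move=> du uC; have [t t01 ->] := mvt_rV x h du.
  apply: le_trans (ler_norm_sum _ _ _) _; apply: ler_sum => i _.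
  by rewrite normrM ler_wpM2l// uC.
apply: le_trans (normc_leD _) _; rewrite mulr_natl mulr2n.
rewrite Re_addc Im_addc Re_oppc Im_oppc; apply: lerD.
- apply: (P (@complex.Re R \o f)) => [y|i t t01]; first by have [] := df y.
  by apply: le_trans (dC i t t01); exact: (normc_geRe (pderiv i f _)).
- apply: (P (@complex.Im R \o f)) => [y|i t t01]; first by have [] := df y.
  by apply: le_trans (dC i t t01); exact: (normc_geIm (pderiv i f _)).
Qed.

(** The gradient is bounded at points of the segment, not at [x]; Peetre's inequality moves the
    weight there and [wt h ^+ N] pays for it. *)
Lemma mvt_decay f N C : (forall y, cdiff f y) ->
  (forall i y, wt y ^+ N * normc (pderiv i f y) <= C) ->
  forall x h, wt x ^+ N * normc (f (x + h) - f x) <= 2 * C * onorm h * wt h ^+ N.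
Proof.
move=> df dC x h.
have C0 (i : 'I_n) : 0 <= C by apply: le_trans (dC i 0); rewrite mulr_ge0 ?normc_ge0// exprn_ge0 ?wt_ge0.
rewrite mulrC -ler_pdivlMr ?wtX_gt0//.
have := @cmvt f x h (fun i => C * wt h ^+ N / wt x ^+ N) df; rewrite -mulr_suml -/(onorm h).
have -> : 2 * (onorm h * (C * wt h ^+ N / wt x ^+ N)) =
   2 * C * onorm h * wt h ^+ N / wt x ^+ N by ring.
apply => i t t01.
rewrite ler_pdivlMr ?wtX_gt0// mulrC.
apply: (@le_trans _ _ (wt (x + t *: h) ^+ N * wt h ^+ N * normc (pderiv i f (x + t *: h)))).
  rewrite ler_wpM2r ?normc_ge0//; apply: le_trans (wt_shiftX x (t *: h) N) _.
  rewrite ler_wpM2l ?exprn_ge0 ?wt_ge0// lerXn2r ?nnegrE ?wt_ge0//.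
  exact: wt_segment.
by rewrite mulrAC ler_wpM2r ?exprn_ge0 ?wt_ge0.
Qed.

Lemma taylor_decay f N C : smooth f ->
  (forall i j y, wt y ^+ N * normc (pderiv j (pderiv i f) y) <= C) ->
  forall x h, wt x ^+ N * normc (f (x + h) - f x - \sum_i (h ord0 i)%:C * pderiv i f x) <=
    4 * C * onorm h ^+ 2 * wt h ^+ N.
Proof.
move=> sf dC x h.
(* Subtracting the linear part at [x] makes the gradient of [g] a difference of gradients of [f],
   which [mvt_decay] already bounds by a multiple of [onorm h]. A second mean value estimate gives
   the square, and 4 = 2 * 2. *)
pose g y := f y + \sum_i (- pderiv i f x) * (y ord0 i)%:C.
have sg : smooth (fun y => \sum_i (- pderiv i f x) * (y ord0 i)%:C).
  elim: index_enum => [|i r IH]; first by under eq_fun do rewrite big_nil; exact: smooth_cst.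
  under eq_fun do rewrite big_cons.
  by apply: smoothD => //; apply: smoothZ; exact: smooth_coord.
have gE i y : pderiv i g y = pderiv i f y - pderiv i f x.
  rewrite /g pderivD; [|exact: smooth_cdiff|exact: smooth_cdiff]; congr (_ + _).
  have S (r : seq 'I_n) : pderiv i (fun y => \sum_(j <- r) (- pderiv j f x) * (y ord0 j)%:C) y =
      \sum_(j <- r) (- pderiv j f x) * (j == i)%:R /\ smooth (fun y => \sum_(j <- r) (- pderiv j f x) * (y ord0 j)%:C).
    elim: r => [|j r [IH IHs]].
      under eq_fun do rewrite big_nil.
      by rewrite pderiv_cst big_nil; split => //; exact: smooth_cst.
    under eq_fun do rewrite big_cons.
    have sj : smooth (fun y : E => (- pderiv j f x) * (y ord0 j)%:C) by apply: smoothZ; exact: smooth_coord.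
    rewrite big_cons -IH pderivD; [|exact: smooth_cdiff|exact: smooth_cdiff].
    rewrite pderivZ; last exact: smooth_coord.
    by have [_ ->] := coord_diff j y; split=> //; exact: smoothD.
  have [-> _] := S (index_enum _); rewrite (bigD1 i)//= eqxx mulr1 big1 ?addr0// => j ji.
  by rewrite (negbTE ji) mulr0.
have sgg : smooth g by apply: smoothD.
have -> : f (x + h) - f x - \sum_i (h ord0 i)%:C * pderiv i f x = g (x + h) - g x.
  rewrite /g opprD addrACA; congr (_ + _).
  rewrite -sumrB -sumrN; by apply: eq_bigr => i _; rewrite mxE rmorphD /=; ring.
have C0 (i : 'I_n) : 0 <= C by apply: le_trans (dC i i 0); rewrite mulr_ge0 ?normc_ge0// exprn_ge0 ?wt_ge0.
rewrite mulrC -ler_pdivlMr ?wtX_gt0//.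
have := @cmvt g x h (fun i => 2 * C * onorm h * wt h ^+ N / wt x ^+ N) (fun y => smooth_cdiff y sgg).
have -> : 2 * (\sum_(i < n) `|h ord0 i| * (2 * C * onorm h * wt h ^+ N / wt x ^+ N)) =
   4 * C * onorm h ^+ 2 * wt h ^+ N / wt x ^+ N.
  by rewrite -mulr_suml -/(onorm h); ring.
apply => i t t01; rewrite gE.
rewrite ler_pdivlMr ?wtX_gt0// mulrC.
apply: le_trans (mvt_decay (fun y => smooth_cdiff y (smooth_pderiv i sf)) (dC i) x (t *: h)) _.
have CC := C0 i.
rewrite -!mulrA !ler_wpM2l//; apply: ler_pM => //; rewrite ?onorm_ge0 ?exprn_ge0 ?wt_ge0//.
  by have := wt_segment h t01; rewrite /wt lerD2l.
by rewrite lerXn2r ?nnegrE ?wt_ge0//; exact: wt_segment.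
Qed.

Lemma cdiff_continuous f x : cdiff f x ->
  {for x, continuous (@complex.Re R \o f)} /\ {for x, continuous (@complex.Im R \o f)}.
Proof. by move=> [f1 f2]; split; exact: differentiable_continuous. Qed.

Lemma measurable_continuous_rV (u : E -> R) : continuous u -> measurable_fun setT u.
Proof.
move=> cu; apply: (measurability _ (RGenOpens.measurableE R)) => //.
move=> _ [_ [a [b ->] <-]]; rewrite setTI; apply: measurable_open_rV.
by apply: open_comp => // x _; exact: cu.
Qed.

Lemma smooth_cmeas f : smooth f -> cmeas f.
Proof.
move=> sf; split; apply: measurable_continuous_rV => x.
  by have [] := cdiff_continuous (smooth_cdiff x sf).
by have [] := cdiff_continuous (smooth_cdiff x sf).
Qed.

End differentiation.

(** * An integrable weight, and Schwartz functions *)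

Section weight_integral.
Context {R : realType}.

(** The product form makes integrability an iteration of the one-dimensional integral of 1/(1+t^2),
    while by [wtV_le_bell] decay of order 2n in [wt] suffices to be dominated by it. *)
Definition bell n (x : 'rV[R]_n) : R := \prod_(i < n) (1 + x ord0 i ^+ 2)^-1.

Lemma bell_gt0 n (x : 'rV[R]_n) : 0 < bell x.
Proof. by apply: prodr_gt0 => i _; rewrite invr_gt0 ltr_wpDr// sqr_ge0. Qed.

Lemma bell_ge0 n (x : 'rV[R]_n) : 0 <= bell x. Proof. exact: ltW (bell_gt0 x). Qed.

Lemma measurable_bell n : measurable_fun setT (@bell n).
Proof.
rewrite /bell; elim: (index_enum _) => [|i r IH].
  by under eq_fun do rewrite big_nil; exact: measurable_cst.
under eq_fun do rewrite big_cons; apply: measurable_funM => //.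
rewrite [X in measurable_fun _ X](_ : _ =
  (fun t : measurableTypeR R => (1 + t ^+ 2)^-1) \o @coord_rV R n i)//.
apply: measurableT_comp (measurable_coord_rV i).
apply: continuous_measurable_fun; exact: continuous_oneDsqrV.
Qed.

Lemma wtV_le_bell n (x : 'rV[R]_n) : (wt x ^+ (2 * n))^-1 <= bell x.
Proof.
rewrite /bell prodfV lef_pV2 ?posrE ?wtX_gt0//; last first.
  by apply: prodr_gt0 => i _; rewrite ltr_wpDr// sqr_ge0.
rewrite exprM -[n in _ ^+ n]card_ord -prodr_const; apply: ler_prod => i _.
rewrite addr_ge0 ?sqr_ge0//= /wt sqrrD expr1n mul1r.
rewrite -addrA lerD2l -[leLHS]ger0_norm ?sqr_ge0// normrX.
apply: le_trans (_ : onorm x ^+ 2 <= _).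
  by rewrite lerXn2r ?nnegrE ?onorm_ge0// coord_le_onorm.
by rewrite lerDr mulrn_wge0// onorm_ge0.
Qed.

Local Open Scope ereal_scope.

Lemma integral_bell_lty n : \int[leb n]_x (bell x)%:E < +oo.
Proof.
elim: n => [|n IH].
  under eq_integral do rewrite /bell big_ord0.
  rewrite integral_cst// mul1e -[X in X < _]/(@leb R 0 setT) lebE/=.
  by rewrite diracE; case: (_ \in _); rewrite ltry.
rewrite ge0_integral_rV_step; last 2 first.
- by apply/measurable_EFinP; exact: measurable_bell.
- by move=> x; rewrite lee_fin bell_ge0.
pose c := \int[@lebesgue_measure R]_t ((1 + t ^+ 2)^-1)%:E.
have m1 : measurable_fun setT (fun t : measurableTypeR R => ((1 + t ^+ 2)^-1)%:E).
  by apply/measurable_EFinP; apply: continuous_measurable_fun; exact: continuous_oneDsqrV.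
have p1 (t : R) : (0 <= (1 + t ^+ 2)^-1)%R by rewrite invr_ge0 addr_ge0 ?sqr_ge0.
have cfin : c < +oo.
  rewrite /c ge0_symfun_integralT//; last 2 first.
  - exact: continuous_oneDsqrV.
  - by move=> t /=; rewrite sqrrN.
  rewrite (_ : [set x | _] = `[0%R, +oo[%classic); last first.
    by apply/seteqP; split => x/=; rewrite in_itv/= andbT.
  by rewrite integral0y_oneDsqr -EFinM ltry.
rewrite (eq_integral (fun x => (bell x)%:E * c)); last first.
  move=> x _; rewrite /c -ge0_integralZl//.
  - apply: eq_integral => t _; rewrite -EFinM; congr EFin.
    rewrite /bell big_ord_recr /= mxE unlift_none /=; congr (_ * _)%R.
    apply: eq_bigr => i _; rewrite mxE.
    have -> : widen_ord (leqnSn n) i = lift ord_max i by apply: val_inj; rewrite /= /bump leqNgt ltn_ord.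
    by rewrite liftK.
  - by move=> t _; rewrite lee_fin.
  - by rewrite lee_fin bell_ge0.
have c0 : 0 <= c by apply: integral_ge0 => t _; rewrite lee_fin.
rewrite ge0_integralZr//; last 2 first.
- by apply/measurable_EFinP; exact: measurable_bell.
- by move=> x _; rewrite lee_fin bell_ge0.
have B0 : 0 <= \int[leb n]_x (bell x)%:E by apply: integral_ge0 => x _; rewrite lee_fin bell_ge0.
by apply: lte_mul_pinfty => //; rewrite ge0_fin_numE.
Qed.

End weight_integral.

Section schwartz_theory.
Context {R : realType} {n : nat}.
Local Notation E := 'rV[R]_n.
Implicit Types (f g : E -> R[i]).

(** The Schwartz class with one constant per seminorm and the weight [wt], free of suprema;
    [schwartzP] identifies it with [schwartz]. *)
Definition schw f := smooth f /\ forall s N, exists C : R, forall x,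
  wt x ^+ N * normc (pderivs s f x) <= C.

Lemma schw_smooth f : schw f -> smooth f. Proof. by case. Qed.

Lemma schw_pderivs f s : schw f -> schw (pderivs s f).
Proof.
move=> [sf df]; split; first exact: smooth_pderivs.
by move=> t N; have [C hC] := df (t ++ s) N; exists C => x; rewrite -pderivs_cat.
Qed.

Lemma schw_pderiv f i : schw f -> schw (pderiv i f).
Proof. exact: (@schw_pderivs f [:: i]). Qed.

Lemma schw_bound f N : schw f -> exists2 C : R, 0 <= C & forall x, wt x ^+ N * normc (f x) <= C.
Proof.
move=> [_ /(_ [::] N)[C hC]]; exists C => //.
by apply: le_trans (hC 0); rewrite mulr_ge0 ?normc_ge0// exprn_ge0 ?wt_ge0.
Qed.

Lemma fin_bound (I : finType) (P : I -> R -> Prop) :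
  (forall i C D, C <= D -> P i C -> P i D) -> (forall i, exists C, P i C) ->
  exists2 C, 0 <= C & forall i, P i C.
Proof.
move=> Pm /choice[C hC]; exists (\sum_i `|C i|); first exact: sumr_ge0.
move=> i; apply: Pm (hC i); apply: le_trans (ler_norm _) _.
by rewrite (bigD1 i)//= lerDl sumr_ge0.
Qed.

Lemma schw_bound_all f k N : schw f -> exists2 C : R, 0 <= C & forall s x, (size s <= k)%N ->
  wt x ^+ N * normc (pderivs s f x) <= C.
Proof.
elim: k f => [|k IH] f sf.
  have [C C0 hC] := schw_bound N sf; exists C => // s x.
  by rewrite leqn0 => /nilP ->; exact: hC.
have [C0 C0p h0] := schw_bound N sf.
have [|i|C Cp hC] := @fin_bound 'I_n (fun i C => forall s x, (size s <= k)%N ->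
    wt x ^+ N * normc (pderivs s (pderiv i f) x) <= C).
- by move=> i C D CD h s x sk; apply: le_trans CD; exact: h.
- by have [C _ hC] := IH _ (schw_pderiv i sf); exists C.
exists (C0 + C); first exact: addr_ge0.
move=> s x; case/lastP: s => [_|s i].
  by apply: le_trans (h0 x) _; rewrite lerDl.
rewrite size_rcons ltnS => sk; rewrite pderivs_rcons.
by apply: le_trans (hC i s x sk) _; rewrite lerDr.
Qed.

Lemma schwartz_norm_le N f (B : R) : (forall s x, (size s <= N)%N ->
  wt x ^+ N * normc (pderivs s f x) <= B) -> (schwartz_norm N f <= B%:E)%E.
Proof.
move=> h; apply: ge_ereal_sup => _ [s [x [sN ->]]]; rewrite lee_fin.
apply: le_trans (h s x sN); rewrite ler_wpM2r ?normc_ge0//.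
by rewrite lerXn2r ?nnegrE ?addr_ge0 ?enorm_ge0 ?onorm_ge0// lerD2l enorm_le_onorm.
Qed.

(** The factor comes from [wt x <= n.+1%:R * (1 + enorm x)], the l^1 norm being at most n times the
    Euclidean one. *)
Lemma schwartz_norm_ge N f s x : (size s <= N)%N ->
  ((wt x ^+ N * normc (pderivs s f x))%:E <= ((n.+1%:R ^+ N)%:E * schwartz_norm N f))%E.
Proof.
move=> sN.
apply: (@le_trans _ _ ((n.+1%:R ^+ N)%:E * ((1 + enorm x) ^+ N * normc (pderivs s f x))%:E)%E).
  rewrite -EFinM lee_fin mulrA ler_wpM2r ?normc_ge0// -exprMn.
  rewrite lerXn2r ?nnegrE ?wt_ge0 ?mulr_ge0 ?addr_ge0 ?enorm_ge0//.
  rewrite /wt -natr1.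
  have := onorm_le_enorm x; have := enorm_ge0 x; have := ler0n R n; nra.
apply: lee_wpmul2l; first by rewrite lee_fin exprn_ge0.
by apply: ereal_sup_ubound; exists s, x.
Qed.

Lemma schwartzP f : schwartz f <-> schw f.
Proof.
split=> -[sf df]; split=> //.
- move=> s N; pose M := maxn (size s) N.
  have Mfin : (schwartz_norm M f) \is a fin_num.
    rewrite ge0_fin_numE//.
    apply: le_trans (_ : ((1 + enorm (0 : E)) ^+ M * normc (pderivs [::] f 0))%:E <= _)%E.
      by rewrite lee_fin mulr_ge0 ?normc_ge0 ?exprn_ge0// addr_ge0 ?enorm_ge0.
    by apply: ereal_sup_ubound; exists [::], 0.
  exists (n.+1%:R ^+ M * fine (schwartz_norm M f)) => x.
  apply: le_trans (_ : wt x ^+ M * normc (pderivs s f x) <= _).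
    by rewrite ler_wpM2r ?normc_ge0// wtX_mono// leq_maxr.
  by rewrite -lee_fin [leRHS]EFinM fineK//; apply: schwartz_norm_ge; rewrite leq_maxl.
- move=> N; have [C _ hC] := schw_bound_all N N (conj sf df).
  by apply: le_lt_trans (schwartz_norm_le hC) _; rewrite ltry.
Qed.

Lemma schwD f g : schw f -> schw g -> schw (fun x => f x + g x).
Proof.
move=> [sf df] [sg dg]; split; first exact: smoothD.
move=> s N; have [C hC] := df s N; have [D hD] := dg s N; exists (C + D) => x.
rewrite pderivsD//; apply: le_trans (_ : wt x ^+ N * (normc (pderivs s f x) + normc (pderivs s g x)) <= _).
  by rewrite ler_wpM2l ?exprn_ge0 ?wt_ge0// le_normcD.
by rewrite mulrDr lerD.
Qed.

(** The multipliers of the Schwartz space: smooth functions all of whose derivatives grow at most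
    polynomially. Constants, coordinates and characters are the instances used. *)
Definition slow f := smooth f /\ forall s, exists N (C : R), forall x,
  normc (pderivs s f x) <= C * wt x ^+ N.

Lemma slow_pderiv f i : slow f -> slow (pderiv i f).
Proof.
move=> [sf df]; split; first exact: smooth_pderiv.
by move=> s; have [N [C h]] := df (rcons s i); exists N, C => x; rewrite -pderivs_rcons.
Qed.

Lemma schw_slow f : schw f -> slow f.
Proof.
move=> [sf df]; split=> // s; have [C hC] := df s 0%N; exists 0%N, C => x.
by have := hC x; rewrite !expr0 mul1r mulr1.
Qed.

(** Induction on the derivatives from the innermost one: it splits the product into two products of
    the same kind. *)
Lemma slow_schwM f g : slow f -> schw g -> schw (fun x => f x * g x).
Proof.
move=> lf lg; have [sf _] := lf; have [sg _] := lg; split; first exact: smoothM.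
move=> s; elim/last_ind: s f g lf lg sf sg => [|s i IH] f g lf lg sf sg N.
  have [_ /(_ [::])[M [C hC]]] := lf.
  have [D D0 hD] := schw_bound (N + M) lg; exists (`|C| * D) => x /=.
  rewrite normcM mulrCA mulrA; apply: le_trans (_ : (`|C| * wt x ^+ M) * wt x ^+ N * normc (g x) <= _).
    rewrite ler_wpM2r ?normc_ge0// ler_wpM2r ?exprn_ge0 ?wt_ge0//.
    apply: le_trans (hC x) _; rewrite ler_wpM2r ?exprn_ge0 ?wt_ge0//; exact: ler_norm.
  by rewrite -!mulrA ler_wpM2l// mulrA -exprD addnC.
have [C hC] := IH _ _ (slow_pderiv i lf) lg (smooth_pderiv i sf) sg N.
have [D hD] := IH _ _ lf (schw_pderiv i lg) sf (smooth_pderiv i sg) N.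
exists (C + D) => x; rewrite pderivs_rcons.
have -> : pderiv i (fun y => f y * g y) = fun y => pderiv i f y * g y + f y * pderiv i g y.
  by apply/funext => y; rewrite pderivM//; exact: smooth_cdiff.
rewrite pderivsD; [|by apply: smoothM => //; exact: smooth_pderiv..].
apply: le_trans (lerD (hC x) (hD x)); rewrite -mulrDr.
by rewrite ler_wpM2l ?exprn_ge0 ?wt_ge0// le_normcD.
Qed.

Lemma schwM f g : schw f -> schw g -> schw (fun x => f x * g x).
Proof. by move=> /schw_slow; exact: slow_schwM. Qed.

Lemma pderivs_cst (c : R[i]) s : s != [::] -> pderivs s (fun _ : E => c) = fun=> 0.
Proof.
case/lastP: s => // s i _; rewrite pderivs_rcons pderiv_cst.
by elim: s => //= j s ->; exact: pderiv_cst.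
Qed.

Lemma slow_cst (c : R[i]) : slow (fun=> c).
Proof.
split; first exact: smooth_cst.
move=> s; exists 0%N, (normc c) => x; rewrite expr0 mulr1.
case: s => // i s; rewrite pderivs_cst// normcr0; exact: normc_ge0.
Qed.

Lemma slow_coord i : slow (fun x : E => (x ord0 i)%:C).
Proof.
split; first exact: smooth_coord.
move=> s; exists 1%N, 1 => x; rewrite mul1r expr1.
case/lastP: s => [|s j] /=.
  rewrite -[leLHS]/(normc (x ord0 i)%:C) normc_real.
  exact: le_trans (coord_le_onorm x i) (onorm_le_wt x).
rewrite pderivs_rcons.
have -> : pderiv j (fun x : E => (x ord0 i)%:C) = fun=> (i == j)%:R.
  by apply/funext => y; have [_ ->] := coord_diff i y.
case: s => [|k s].
  by rewrite -[pderivs _ _ x]/((i == j)%:R); case: (i == j); rewrite ?normcr1 ?normcr0 ?wt_ge1 ?wt_ge0.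
by rewrite pderivs_cst// normcr0 wt_ge0.
Qed.

Lemma schwZ c f : schw f -> schw (fun x => c * f x).
Proof. exact: slow_schwM (slow_cst c). Qed.

Lemma schw_coordM i f : schw f -> schw (fun x => (x ord0 i)%:C * f x).
Proof. exact: slow_schwM (slow_coord i). Qed.

Lemma schwN f : schw f -> schw (fun x => - f x).
Proof. by move=> /(schwZ (-1)); under [X in schw X -> _]eq_fun do rewrite mulN1r. Qed.

Lemma schwB f g : schw f -> schw g -> schw (fun x => f x - g x).
Proof. by move=> sf sg; apply: schwD => //; exact: schwN. Qed.

Lemma schw0 : schw (fun=> 0).
Proof.
split; first exact: smooth_cst.
move=> s N; exists 0 => x.
by case: s => [|i s]; [rewrite -[pderivs _ _ x]/(0 : R[i])|rewrite pderivs_cst//]; rewrite normcr0 mulr0.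
Qed.

Lemma schw_sum I (r : seq I) (F : I -> E -> R[i]) : (forall i, schw (F i)) ->
  schw (fun x => \sum_(i <- r) F i x).
Proof.
move=> LF; elim: r => [|i r IH].
  by under eq_fun do rewrite big_nil; exact: schw0.
by under eq_fun do rewrite big_cons; exact: schwD.
Qed.

Lemma schw_affine (k : R) (a : E) f : k != 0 -> schw f -> schw (fun x => f (k *: x + a)).
Proof.
move=> k0 [sf df]; split; first exact: smooth_affine.
move=> s N; have [C hC] := df s N.
(* Writing x = k^-1 (k x + a) - k^-1 a bounds [wt x] by [K] times the weight at the image point. *)
pose K := (1 + `|k^-1|) * wt (k^-1 *: a).
have K0 : 0 <= K by rewrite mulr_ge0 ?wt_ge0// addr_ge0.
have Kx x : wt x <= K * wt (k *: x + a).
  have xE : x = k^-1 *: (k *: x + a) + - (k^-1 *: a).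
    by rewrite scalerDr scalerA mulVf// scale1r addrK.
  rewrite [in leLHS]xE.
  apply: le_trans (wtD _ _) _; rewrite wtN /K mulrAC ler_wpM2r ?wt_ge0//.
  rewrite /wt onormZ mulrDl mul1r mulrDr mulr1.
  by rewrite -addrA lerD2l addrA lerDr addr_ge0 ?onorm_ge0.
exists (`|k| ^+ size s * K ^+ N * `|C|) => x.
rewrite pderivs_affine// normcM normc_real normrX.
apply: le_trans (_ : (K * wt (k *: x + a)) ^+ N * (`|k| ^+ size s * normc (pderivs s f (k *: x + a))) <= _).
  rewrite ler_wpM2r ?mulr_ge0 ?normc_ge0 ?exprn_ge0//.
  by rewrite lerXn2r ?nnegrE ?wt_ge0 ?mulr_ge0 ?wt_ge0.
have H := le_trans (hC (k *: x + a)) (ler_norm C).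
rewrite exprMn [leLHS](_ : _ = `|k| ^+ size s * K ^+ N *
  (wt (k *: x + a) ^+ N * normc (pderivs s f (k *: x + a)))); last by ring.
by rewrite ler_wpM2l// mulr_ge0 ?exprn_ge0.
Qed.

Lemma schw_shift (a : E) f : schw f -> schw (fun x => f (x + a)).
Proof. by move=> /(schw_affine a (oner_neq0 R)); under [X in schw X -> _]eq_fun do rewrite scale1r. Qed.

Lemma schw_opp f : schw f -> schw (fun x => f (- x)).
Proof.
have h : (-1 : R) != 0 by rewrite oppr_eq0 oner_eq0.
by move=> /(schw_affine 0 h); under [X in schw X -> _]eq_fun do rewrite scaleN1r addr0.
Qed.

Lemma schw_scale (k : R) f : k != 0 -> schw f -> schw (fun x => f (k *: x)).
Proof. by move=> k0 /(schw_affine 0 k0); under [X in schw X -> _]eq_fun do rewrite addr0. Qed.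

Lemma decay_L1 f (C : R) : cmeas f -> (forall x, normc (f x) <= C * bell x) -> L1 f.
Proof.
move=> mf fC; split => //.
have C0 : 0 <= C.
  by rewrite -(pmulr_lge0 _ (bell_gt0 (0 : E))); apply: le_trans (fC 0); exact: normc_ge0.
apply: le_lt_trans (_ : (\int[leb n]_x (C%:E * (bell x)%:E) < +oo)%E).
  apply: ge0_le_integral => //.
  - by move=> x _; rewrite lee_fin normc_ge0.
  - exact: cmeas_EFin_normc.
  - by apply/measurable_EFinP; apply: measurable_funM => //; exact: measurable_bell.
  - by move=> x _; rewrite -EFinM lee_fin.
rewrite ge0_integralZl//.
- apply: lte_mul_pinfty => //; exact: integral_bell_lty.
- by apply/measurable_EFinP; exact: measurable_bell.
- by move=> x _; rewrite lee_fin bell_ge0.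
Qed.

Lemma wt_bell f (C : R) x : wt x ^+ (2 * n) * normc (f x) <= C -> normc (f x) <= C * bell x.
Proof.
move=> h; apply: le_trans (_ : C / wt x ^+ (2 * n) <= _).
  by rewrite ler_pdivlMr ?wtX_gt0// mulrC.
have C0 : 0 <= C by apply: le_trans h; rewrite mulr_ge0 ?normc_ge0// exprn_ge0 ?wt_ge0.
by rewrite ler_wpM2l// wtV_le_bell.
Qed.

Lemma schw_cmeas f : schw f -> cmeas f.
Proof. by move=> [sf _]; exact: smooth_cmeas. Qed.

Lemma schw_L1 f : schw f -> L1 f.
Proof.
move=> sf; have [C C0 hC] := schw_bound (2 * n) sf.
by apply: (@decay_L1 _ C) => [|x]; [exact: schw_cmeas|exact: wt_bell].
Qed.

Lemma schw_mvt f N : schw f -> exists2 C : R, 0 <= C & forall x h,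
  wt x ^+ N * normc (f (x + h) - f x) <= C * onorm h * wt h ^+ N.
Proof.
move=> sf; have [C C0 hC] := schw_bound_all 1 N sf.
exists (2 * C); first by rewrite mulr_ge0.
apply: mvt_decay => [y|i y]; first exact: smooth_cdiff (schw_smooth sf).
exact: (hC [:: i]).
Qed.

Lemma schw_taylor f N : schw f -> exists2 C : R, 0 <= C & forall x h,
  wt x ^+ N * normc (f (x + h) - f x - \sum_i (h ord0 i)%:C * pderiv i f x) <=
    C * onorm h ^+ 2 * wt h ^+ N.
Proof.
move=> sf; have [C C0 hC] := schw_bound_all 2 N sf.
exists (4 * C); first by rewrite mulr_ge0.
apply: taylor_decay => [|i j y]; first exact: schw_smooth sf.
exact: (hC [:: j; i]).
Qed.

(* The integral is translation invariant, so its difference quotients vanish. *)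
Lemma cintegral_pderiv f i : schw f -> cintegral (pderiv i f) = 0.
Proof.
move=> sf; have [C C0 hC] := schw_taylor (2 * n) sf.
have [B Bfin hB] : exists2 B : R, 0 <= B & (\int[@leb R n]_x (bell x)%:E = B%:E)%E.
  have f1 : (\int[@leb R n]_x (bell x)%:E)%E \is a fin_num.
    by rewrite ge0_fin_numE ?integral_bell_lty// integral_ge0// => x _; rewrite lee_fin bell_ge0.
  exists (fine (\int[@leb R n]_x (bell x)%:E)%E); last by rewrite fineK.
  by apply: fine_ge0; apply: integral_ge0 => x _; rewrite lee_fin bell_ge0.
pose e : E := delta_mx ord0 i.
have key (t : R) : 0 < t <= 1 -> normc (cintegral (pderiv i f)) <= 2 * (C * 2 ^+ (2 * n) * B) * t.
  move=> /andP[t0 t1].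
  have onte : onorm (t *: e) = t.
    rewrite onormZ gtr0_norm// (_ : onorm e = 1) ?mulr1// /onorm (bigD1 i)//= big1 ?addr0.
      by rewrite /e mxE !eqxx normr1.
    by move=> j ji; rewrite /e mxE (negbTE ji) andbF normr0.
  have r_ x : normc (f (x + t *: e) - f x - t%:C * pderiv i f x) <= (C * 2 ^+ (2 * n) * t ^+ 2) * bell x.
    have -> : t%:C * pderiv i f x = \sum_j ((t *: e) ord0 j)%:C * pderiv j f x.
      rewrite (bigD1 i)//= big1 ?addr0; first by rewrite !mxE !eqxx mulr1.
      by move=> j ji; rewrite !mxE (negbTE ji) andbF mulr0 mul0r.
    apply: (@wt_bell (fun x => _)); apply: le_trans (hC x (t *: e)) _.
    rewrite onte mulrAC ler_wpM2r ?sqr_ge0// ler_wpM2l// lerXn2r ?nnegrE ?wt_ge0//.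
    by rewrite /wt onte -[leRHS]/(1 + 1) lerD2l.
  have Lf := schw_L1 sf; have Ls := schw_L1 (schw_shift (t *: e) sf).
  have Lp := L1Z t%:C (schw_L1 (schw_pderiv i sf)).
  have := cintegralB (L1B Ls Lf) Lp.
  rewrite (cintegralB Ls Lf) (cintegral_shift (t *: e) Lf) subrr sub0r cintegralZ; last exact: schw_L1 (schw_pderiv i sf).
  move=> H; have : normc (t%:C * cintegral (pderiv i f)) <= 2 * (C * 2 ^+ (2 * n) * t ^+ 2 * B).
    rewrite -normcN -H -lee_fin; apply: le_trans (normc_cintegral (L1B (L1B Ls Lf) Lp)) _.
    rewrite EFinM lee_pmul2l//.
    apply: le_trans (_ : (\int[leb n]_x ((C * 2 ^+ (2 * n) * t ^+ 2)%:E * (bell x)%:E) <= _)%E).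
      apply: ge0_le_integral => //.
      - by move=> x _; rewrite lee_fin normc_ge0.
      - by apply: cmeas_EFin_normc; have [] := L1B (L1B Ls Lf) Lp.
      - by apply/measurable_EFinP; apply: measurable_funM => //; exact: measurable_bell.
      - by move=> x _; rewrite -EFinM lee_fin.
    rewrite ge0_integralZl//.
    - by rewrite hB.
    - by apply/measurable_EFinP; exact: measurable_bell.
    - by move=> x _; rewrite lee_fin bell_ge0.
    - by rewrite lee_fin !mulr_ge0 ?exprn_ge0// ltW.
  rewrite normcM normc_real gtr0_norm// mulrC -ler_pdivlMr//.
  by move=> h; apply: le_trans h _; rewrite ler_pdivrMr//; rewrite le_eqVlt; apply/orP; left; apply/eqP; ring.
apply/eqP; rewrite -normc_eq0 eq_le normc_ge0 andbT leNgt; apply/negP => p0.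
set a := normc _ in p0 key *; set K := 2 * (C * 2 ^+ (2 * n) * B) in key.
have K0 : 0 <= K by rewrite !mulr_ge0// exprn_ge0.
have := key (Num.min 1 (a / (2 * (K + 1)))).
rewrite lt_min ltr01 ge_min lexx /= divr_gt0 ?mulr_gt0 ?ltr_wpDl// => /(_ isT).
apply/negP; rewrite -ltNge.
apply: le_lt_trans (_ : K * (a / (2 * (K + 1))) < _); first by rewrite ler_wpM2l// ge_min lexx orbT.
rewrite mulrCA gtr_pMr// ltr_pdivrMr ?mulr_gt0 ?ltr_wpDl// mul1r.
by lra.
Qed.

Lemma cintegral_byparts f g i : schw f -> schw g ->
  cintegral (fun x => pderiv i f x * g x) = - cintegral (fun x => f x * pderiv i g x).
Proof.
move=> sf sg; apply/eqP; rewrite -addr_eq0 -cintegralD; last 2 first.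
- by apply: schw_L1; apply: schwM => //; exact: schw_pderiv.
- by apply: schw_L1; apply: schwM => //; exact: schw_pderiv.
rewrite -(cintegral_pderiv i (schwM sf sg)); apply/eqP; congr cintegral.
by apply/funext => x; rewrite pderivM//; apply: smooth_cdiff; exact: schw_smooth.
Qed.

End schwartz_theory.

(** * Differentiation under the integral sign; trigonometric bounds *)

Section param.
Context {R : realType} {n : nat}.
Local Notation E := 'rV[R]_n.
Implicit Types (f g : E -> R[i]).

Definition rnorm f : R := fine (inorm f).

Lemma inormE f : L1 f -> inorm f = (rnorm f)%:E.
Proof. by move=> [_ fi]; rewrite fineK// ge0_fin_numE// inorm_ge0. Qed.

Lemma rnorm_ge0 f : 0 <= rnorm f.
Proof. by apply: fine_ge0; exact: inorm_ge0. Qed.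

Lemma inorm_real (B : E -> R) : (forall y, 0 <= B y) ->
  inorm (fun y => (B y)%:C) = (\int[leb n]_y (B y)%:E)%E.
Proof.
by move=> B0; apply: eq_integral => y _; rewrite normc_real ger0_norm.
Qed.

Lemma normc_cintegral_le f (B : E -> R) (k : R) : 0 <= k -> L1 f -> L1 (fun y => (B y)%:C) ->
  (forall y, normc (f y) <= k * B y) ->
  normc (cintegral f) <= 2 * (k * rnorm (fun y => (B y)%:C)).
Proof.
move=> k0 Lf LB fB; rewrite -lee_fin; apply: le_trans (normc_cintegral Lf) _.
rewrite EFinM lee_pmul2l// EFinM -inormE//.
have -> : k%:E = (normc k%:C)%:E by rewrite normc_real ger0_norm.
rewrite -inormZ; last by case: LB.
apply: le_inorm; [by case: Lf|by apply: cmeasZ; case: LB|move=> y].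
rewrite normcM !normc_real ger0_norm//; apply: le_trans (fB y) _.
by rewrite ler_wpM2l// ler_norm.
Qed.

(** Integrating a quadratic remainder with an integrable factor [B] leaves a quadratic remainder,
    which [quad_cdiff] turns into derivatives. *)
Lemma param_diff (K : E -> E -> R[i]) (K' : 'I_n -> E -> R[i]) (B : E -> R) x :
  (forall x, L1 (K x)) -> (forall i, L1 (K' i)) -> L1 (fun y => (B y)%:C) ->
  (forall h y, onorm h <= n%:R ->
    normc (K (x + h) y - K x y - \sum_i (h ord0 i)%:C * K' i y) <= onorm h ^+ 2 * B y) ->
  cdiff (fun x => cintegral (K x)) x /\
  forall i, pderiv i (fun x => cintegral (K x)) x = cintegral (K' i).
Proof.
move=> LK LK' LB KB.
apply: (@quad_cdiff _ _ _ _ _ (2 * rnorm (fun y => (B y)%:C))) => h hn.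
have LS : L1 (fun y => \sum_i (h ord0 i)%:C * K' i y) by apply: L1_sum => i; exact: L1Z.
have -> : cintegral (K (x + h)) - cintegral (K x) - \sum_i (h ord0 i)%:C * cintegral (K' i) =
   cintegral (fun y => K (x + h) y - K x y - \sum_i (h ord0 i)%:C * K' i y).
  rewrite cintegralB//; last exact: L1B.
  rewrite cintegralB// cintegral_sum => [|i]; last exact: L1Z.
  by congr (_ - _); apply: eq_bigr => i _; rewrite cintegralZ.
rewrite -mulrA [_ * onorm h ^+ 2]mulrC; apply: normc_cintegral_le => //; first exact: sqr_ge0.
  by apply: L1B => //; exact: L1B.
by move=> y; exact: KB.
Qed.

Lemma schw_weight_L1 f k : schw f -> L1 (fun y => (wt y ^+ k * normc (f y))%:C).
Proof.
move=> sf; have [C C0 hC] := schw_bound (2 * n + k) sf.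
apply: (@decay_L1 _ _ _ C).
  apply: cmeas_real; apply: measurable_funM; last exact: cmeas_normc (schw_cmeas sf).
  apply: measurable_funX; apply: measurable_funD => //.
  rewrite /onorm; elim: (index_enum _) => [|i r IH].
    by under eq_fun do rewrite big_nil; exact: measurable_cst.
  under eq_fun do rewrite big_cons; apply: measurable_funD => //.
  by apply: measurableT_comp => //; exact: measurable_coord_rV.
move=> y; apply: (@wt_bell _ _ (fun y => (wt y ^+ k * normc (f y))%:C)).
rewrite normc_real ger0_norm ?mulr_ge0 ?exprn_ge0 ?wt_ge0 ?normc_ge0//.
by rewrite mulrA -exprD; exact: hC.
Qed.

End param.

Section trig_bounds.
Context {R : realType}.

Lemma mvt_from0 (u du : R -> R) (k : R -> R) (t : R) :
  (forall x : R, is_derive x (1 : R) u (du x)) -> u 0 = 0 ->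
  (forall x : R, `|x| <= `|t| -> `|du x| <= k t) -> `|u t| <= k t * `|t|.
Proof.
move=> dx u0 hk.
have cu a b : {within `[a, b], continuous u}.
  apply: continuous_subspaceT => x; apply: differentiable_continuous.
  by apply/derivable1_diffP; have [] := dx x.
have [t0|t0] := leP 0 t.
  have [c] := @MVT_segment R u du 0 t t0 (fun x _ => dx x) (cu _ _).
  rewrite in_itv /= => /andP[c0 ct]; rewrite u0 !subr0 => ->.
  by rewrite normrM ler_wpM2r// hk// !ger0_norm.
have [c] := @MVT_segment R u du t 0 (ltW t0) (fun x _ => dx x) (cu _ _).
rewrite in_itv /= => /andP[c0 ct]; rewrite u0 !sub0r => /eqP.
rewrite eqr_oppLR => /eqP ->.
by rewrite normrN normrM normrN ler_wpM2r// hk// !ler0_norm// ?lerN2// ltW.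
Qed.

Lemma sin_le (t : R) : `|sin t| <= `|t|.
Proof.
rewrite -[leRHS]mul1r; apply: (@mvt_from0 sin cos (fun=> 1)) => [|x _].
- by rewrite sin0.
- by rewrite ler_norml cos_geN1 cos_le1.
Qed.

Lemma cosB1_le (t : R) : `|cos t - 1| <= `|t| * `|t|.
Proof.
apply: (@mvt_from0 (fun t => cos t - 1) (fun t => - sin t) (fun t => `|t|)) => [x||x xt].
- by rewrite -[- sin x]subr0; apply: is_deriveB.
- by rewrite cos0 subrr.
- by rewrite normrN; apply: le_trans (sin_le x) xt.
Qed.

Lemma sinB_le (t : R) : `|sin t - t| <= `|t| * `|t| * (1 + `|t|).
Proof.
apply: le_trans (_ : (`|t| * `|t|) * `|t| <= _); last first.
  by rewrite ler_wpM2l ?mulr_ge0// lerDr.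
apply: (@mvt_from0 (fun t => sin t - t) (fun t => cos t - 1) (fun t => `|t| * `|t|)) => [|x xt].
- by rewrite sin0 subrr.
- by apply: le_trans (cosB1_le x) _; rewrite ler_pM.
Qed.

(** A remainder quadratic for all t is wanted, since phases are unbounded: the cubic bound is used
    for |t| <= 1, the trivial one beyond. *)
Lemma sinB_le2 (t : R) : `|sin t - t| <= 4 * (`|t| * `|t|).
Proof.
have [t1|t1] := leP `|t| 1.
  apply: le_trans (sinB_le t) _; rewrite mulrC ler_wpM2r ?mulr_ge0//; lra.
apply: le_trans (ler_normB _ _) _; have := sin_le t; nra.
Qed.

Lemma expiD (s t : R) : expi (s + t) = expi s * expi t.
Proof. by apply: complex_eq; rewrite ?Re_mulc ?Im_mulc /= ?cosD ?sinD//; ring. Qed.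

Lemma expi0 : expi (0 : R) = 1.
Proof. by rewrite /expi cos0 sin0. Qed.

Lemma normci : normc ('i%C : R[i]) = 1.
Proof. by rewrite /normc /= expr0n expr1n add0r sqrtr1. Qed.

(** 5 = 1 + 4, from the cosine and the sine. *)
Lemma expi_taylor (t : R) : normc (expi t - 1 - 'i%C * t%:C) <= 5 * (`|t| * `|t|).
Proof.
apply: le_trans (normc_leD _) _.
rewrite !Re_addc !Im_addc !Re_oppc !Im_oppc Re_mulc Im_mulc /=.
rewrite (_ : cos t - 1 - _ = cos t - 1); last by ring.
rewrite (_ : sin t - 0 - _ = sin t - t); last by ring.
by have := cosB1_le t; have := sinB_le2 t; lra.
Qed.

End trig_bounds.

(** * The Fourier transform on Schwartz functions *)

Section fourier_theory.
Context {R : realType} {n : nat}.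
Local Notation E := 'rV[R]_n.
Implicit Types (f g : E -> R[i]).

Lemma measurable_dotv d (T : measurableType d) (u v : T -> E) :
  measurable_fun setT u -> measurable_fun setT v -> measurable_fun setT (fun p => dotv (u p) (v p)).
Proof.
move=> mu mv; rewrite /dotv; elim: (index_enum _) => [|i r IH].
  by under eq_fun do rewrite big_nil; exact: measurable_cst.
under eq_fun do rewrite big_cons; apply: measurable_funD => //; apply: measurable_funM.
- exact: (measurableT_comp (measurable_coord_rV i) mu).
- exact: (measurableT_comp (measurable_coord_rV i) mv).
Qed.

Lemma cmeas_expi d (T : measurableType d) (u : T -> R) :
  measurable_fun setT u -> cmeas (fun x => expi (u x)).
Proof.
move=> mu; split.
- by apply: (measurableT_comp (f := @cos R)) => //; apply: continuous_measurable_fun; exact: continuous_cos.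
- by apply: (measurableT_comp (f := @sin R)) => //; apply: continuous_measurable_fun; exact: continuous_sin.
Qed.

Lemma L1_expi f (u : E -> R) : measurable_fun setT u -> L1 f -> L1 (fun x => f x * expi (u x)).
Proof.
move=> mu Lf; apply: (le_L1 (g := f)) => //.
  by apply: cmeasM; [case: Lf|exact: cmeas_expi].
by move=> x; rewrite normcM normc_expi mulr1.
Qed.

Lemma measurable_dotvl (xi : E) : measurable_fun setT (fun x : E => dotv x xi).
Proof. by apply: measurable_dotv => //; exact: measurable_cst. Qed.

Lemma measurable_Ndotvl (xi : E) : measurable_fun setT (fun x : E => - dotv x xi).
Proof. by apply: measurableT_comp => //; exact: measurable_dotvl. Qed.

Lemma L1_fourier f xi : L1 f -> L1 (fun x => f x * expi (- dotv x xi)).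
Proof. by move=> Lf; apply: L1_expi => //; exact: measurable_Ndotvl. Qed.

Lemma fourierD f g : L1 f -> L1 g -> fourier (fun x => f x + g x) = fun xi => fourier f xi + fourier g xi.
Proof.
move=> Lf Lg; apply/funext => xi; rewrite /fourier -cintegralD; [|exact: L1_fourier..].
by congr cintegral; apply/funext => x; rewrite mulrDl.
Qed.

Lemma fourierZ c f : L1 f -> fourier (fun x => c * f x) = fun xi => c * fourier f xi.
Proof.
move=> Lf; apply/funext => xi; rewrite /fourier -cintegralZ; last exact: L1_fourier.
by congr cintegral; apply/funext => x; rewrite mulrA.
Qed.

Lemma expi_dotv_taylor (x h xi : E) :
  normc (expi (- dotv x (xi + h)) - expi (- dotv x xi) -
    \sum_i (h ord0 i)%:C * ((- 'i%C) * (x ord0 i)%:C * expi (- dotv x xi))) <=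
  onorm h ^+ 2 * (5 * wt x ^+ 2).
Proof.
have -> : \sum_i (h ord0 i)%:C * ((- 'i%C) * (x ord0 i)%:C * expi (- dotv x xi)) =
    expi (- dotv x xi) * ('i%C * (- dotv x h)%:C).
  have -> : (- dotv x h)%:C = \sum_i - ((x ord0 i)%:C * (h ord0 i)%:C) :> R[i].
    by rewrite rmorphN rmorph_sum -sumrN; apply: eq_bigr => i _; rewrite rmorphM.
  by rewrite !mulr_sumr; apply: eq_bigr => i _; ring.
rewrite dotvDr opprD expiD -[X in _ * _ - X - _]mulr1 -!mulrBr normcM normc_expi mul1r.
apply: le_trans (expi_taylor _) _.
rewrite normrN -expr2 [leRHS]mulrCA ler_wpM2l// -exprMn lerXn2r ?nnegrE ?mulr_ge0 ?onorm_ge0 ?wt_ge0//.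
apply: le_trans (dotv_le x h) _; rewrite mulrC ler_wpM2l ?onorm_ge0//; exact: onorm_le_wt.
Qed.

Lemma fourier_diff f : schw f -> (forall xi, cdiff (fourier f) xi) /\
  forall i, pderiv i (fourier f) = fourier (fun x => (- 'i%C) * ((x ord0 i)%:C * f x)).
Proof.
move=> sf; have P xi := @param_diff R n (fun xi x => f x * expi (- dotv x xi))
  (fun i x => (- 'i%C) * ((x ord0 i)%:C * f x) * expi (- dotv x xi))
  (fun x => 5 * (wt x ^+ 2 * normc (f x))) xi.
have Q xi : cdiff (fourier f) xi /\ forall i, pderiv i (fourier f) xi =
   fourier (fun x => (- 'i%C) * ((x ord0 i)%:C * f x)) xi.
  apply: P => [x|i||h y _].
  - by apply: L1_fourier; exact: schw_L1.
  - by apply: L1_fourier; apply: schw_L1; apply: schwZ; exact: schw_coordM.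
  - have := L1Z (5%:C) (schw_weight_L1 2 sf); congr (L1 _).
    by apply/funext => x; rewrite -rmorphM.
  have -> : f y * expi (- dotv y (xi + h)) - f y * expi (- dotv y xi) -
      \sum_i (h ord0 i)%:C * (- 'i%C * ((y ord0 i)%:C * f y) * expi (- dotv y xi)) =
    f y * (expi (- dotv y (xi + h)) - expi (- dotv y xi) -
      \sum_i (h ord0 i)%:C * ((- 'i%C) * (y ord0 i)%:C * expi (- dotv y xi))).
    rewrite !mulrBr mulr_sumr; congr (_ - _); apply: eq_bigr => i _; ring.
  rewrite normcM mulrC; apply: le_trans (ler_wpM2r (normc_ge0 _) (expi_dotv_taylor y h xi)) _.
  by rewrite !mulrA.
split=> [xi|i]; first by have [] := Q xi.
by apply/funext => xi; have [_] := Q xi.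
Qed.

Lemma expi_diff (xi : E) x : cdiff (fun x => expi (- dotv x xi)) x /\
  forall i, pderiv i (fun x => expi (- dotv x xi)) x = (- 'i%C) * (xi ord0 i)%:C * expi (- dotv x xi).
Proof.
apply: (@quad_cdiff _ _ _ _ _ (5 * wt xi ^+ 2)) => h _.
rewrite mulrC; have := expi_dotv_taylor xi h x.
rewrite (dotvC xi (x + h)) (dotvC xi x); apply: le_trans.
by rewrite le_eqVlt eqxx.
Qed.

Lemma slow_expi (xi : E) : slow (fun x => expi (- dotv x xi)).
Proof.
have H s : exists c : R[i], pderivs s (fun x => expi (- dotv x xi)) = fun x => c * expi (- dotv x xi).
  elim: s => [|i s [c IH]]; first by exists 1; apply/funext => x; rewrite mul1r.
  exists (c * ((- 'i%C) * (xi ord0 i)%:C)).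
  rewrite /= -/(pderivs s _) IH; apply/funext => x; have [d1 d2] := expi_diff xi x.
  by rewrite pderivM//; [rewrite pderiv_cst mul0r add0r d2 mulrA|exact: cdiff_cst].
split.
  move=> s x; have [c ->] := H s; apply: cdiffM; first exact: cdiff_cst.
  by have [] := expi_diff xi x.
move=> s; have [c ->] := H s; exists 0%N, (normc c) => x.
by rewrite normcM normc_expi expr0.
Qed.

(** The integral of the derivative of [f] times a character vanishes; the Leibniz rule gives the two
    terms. *)
Lemma fourier_pderiv f i xi : schw f -> fourier (pderiv i f) xi = 'i%C * (xi ord0 i)%:C * fourier f xi.
Proof.
move=> sf; have se := slow_expi xi.
have := cintegral_pderiv i (slow_schwM se sf).
have -> : pderiv i (fun x => expi (- dotv x xi) * f x) = fun x =>
   pderiv i f x * expi (- dotv x xi) + (- 'i%C * (xi ord0 i)%:C) * (f x * expi (- dotv x xi)).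
  apply/funext => x; have [d1 d2] := expi_diff xi x.
  by rewrite pderivM//; [rewrite d2; ring|apply: smooth_cdiff; exact: schw_smooth].
rewrite cintegralD; last 2 first.
- by apply: L1_fourier; apply: schw_L1; exact: schw_pderiv.
- by apply: L1Z; apply: L1_fourier; exact: schw_L1.
rewrite cintegralZ; last by apply: L1_fourier; exact: schw_L1.
rewrite /fourier => /eqP; rewrite addr_eq0 => /eqP ->; ring.
Qed.

Lemma fourier_bounded f : L1 f -> forall xi, normc (fourier f xi) <= 2 * rnorm f.
Proof.
move=> Lf xi; rewrite -lee_fin; apply: le_trans (normc_cintegral (L1_fourier xi Lf)) _.
rewrite EFinM lee_pmul2l// -inormE//; apply: le_inorm.
- by have [] := L1_fourier xi Lf.
- by case: Lf.
- by move=> x; rewrite normcM normc_expi mulr1.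
Qed.

(** Derivatives of a transform are again transforms of Schwartz functions, so only decay of
    transforms remains. Each power of the weight 1 + sum |x_i| is gained by induction, a coordinate
    factor being absorbed by a derivative of the input. *)
Lemma schw_fourier f : schw f -> schw (fourier f).
Proof.
have F g s : schw g -> exists2 h, schw h & pderivs s (fourier g) = fourier h.
  move=> sg; elim: s => [|i s [h sh IH]]; first by exists g.
  exists (fun x : E => (- 'i%C) * ((x ord0 i)%:C * h x)); first by apply: schwZ; exact: schw_coordM.
  by rewrite /= -/(pderivs s _) IH; have [_ ->] := fourier_diff sh.
move=> sf; split.
  by move=> s x; have [h sh ->] := F f s sf; have [H _] := fourier_diff sh; exact: H.
move=> s; have [h sh ->] := F f s sf; move=> N {F}.
elim: N h sh => [|N IH] h sh.
  by exists (2 * rnorm h) => x; rewrite expr0 mul1r; apply: fourier_bounded; exact: schw_L1.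
have [C hC] := IH h sh.
have [|i|D D0 hD] := @fin_bound R 'I_n (fun i D => forall x : E, `|x ord0 i| * (wt x ^+ N * normc (fourier h x)) <= D).
- by move=> i A B AB hA x; apply: le_trans AB.
- have [D hD] := IH (pderiv i h) (schw_pderiv i sh); exists D => x.
  have := hD x; rewrite fourier_pderiv// !normcM normc_real.
  by rewrite normci mul1r [X in X <= _ -> _]mulrCA.
exists (C + n%:R * D) => x.
rewrite exprS {1}/wt -mulrA mulrDl mul1r; apply: lerD => //.
rewrite /onorm mulr_suml -sum_ord_cst; apply: ler_sum => i _; exact: hD.
Qed.

Lemma fourier_invE f x : fourier_inv f x = ((2 * pi) ^- n)%:C * fourier f (- x).
Proof.
rewrite /fourier_inv /fourier; congr (_ * cintegral _); apply/funext => xi.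
by rewrite dotvNr opprK dotvC.
Qed.

Lemma schw_fourier_inv f : schw f -> schw (fourier_inv f).
Proof.
move=> sf; rewrite (_ : fourier_inv f = fun x => ((2 * pi) ^- n)%:C * fourier f (- x)).
  by apply: schwZ; apply: schw_opp; exact: schw_fourier.
by apply/funext => x; exact: fourier_invE.
Qed.

Lemma measurable_fst_rV : measurable_fun setT (fst : E * E -> E).
Proof. exact: measurable_fst. Qed.

Lemma measurable_snd_rV : measurable_fun setT (snd : E * E -> E).
Proof. exact: measurable_snd. Qed.

Lemma int2_lty f g : L1 f -> L1 g ->
  (\int[leb n]_x \int[leb n]_y (normc (f x) * normc (g y))%:E < +oo)%E.
Proof.
move=> Lf Lg; under eq_integral.
  move=> x _; under eq_integral do rewrite EFinM.
  rewrite ge0_integralZl//; last 3 first.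
  - by apply: cmeas_EFin_normc; case: Lg.
  - by move=> y _; rewrite lee_fin normc_ge0.
  - by rewrite lee_fin normc_ge0.
  over.
rewrite ge0_integralZr//; last 3 first.
- by apply: cmeas_EFin_normc; case: Lf.
- by move=> y _; rewrite lee_fin normc_ge0.
- exact: inorm_ge0.
rewrite -/(inorm f) -/(inorm g) !inormE// -EFinM ltry//.
Qed.

(** The multiplication formula, by Fubini and the symmetry of the kernel. It replaces inversion
    wherever possible. *)
Lemma fourier_dual f g : L1 f -> L1 g ->
  cintegral (fun xi => fourier f xi * g xi) = cintegral (fun x => f x * fourier g x).
Proof.
move=> Lf Lg; have [mf _] := Lf; have [mg _] := Lg.
pose F (p : E * E) := g p.1 * (f p.2 * expi (- dotv p.2 p.1)).
have mF : cmeas F.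
  apply: cmeasM; first exact: (cmeas_comp mg measurable_fst_rV).
  apply: cmeasM; first exact: (cmeas_comp mf measurable_snd_rV).
  apply: cmeas_expi; apply: measurableT_comp => //.
  by apply: measurable_dotv; [exact: measurable_snd_rV|exact: measurable_fst_rV].
transitivity (cintegral (fun xi => cintegral (fun x => F (xi, x)))).
  congr cintegral; apply/funext => xi; rewrite mulrC -cintegralZ//; exact: L1_fourier.
rewrite cfubini//.
- congr cintegral; apply/funext => x; rewrite -cintegralZ; last exact: L1_fourier.
  by congr cintegral; apply/funext => xi; rewrite /F/= (dotvC x xi); ring.
- under eq_integral do under eq_integral do rewrite /F/= !normcM normc_expi mulr1.
  exact: int2_lty.
- by move=> xi; exact: (L1Z (g xi) (L1_fourier xi Lf)).
- move=> x; have := L1Z (f x) (L1_fourier x Lg); congr (L1 _).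
  by apply/funext => xi; rewrite /F/= (dotvC x xi); ring.
Qed.

End fourier_theory.

Section test_functions.
Context {R : realType} {n : nat}.
Local Notation E := 'rV[R]_n.
Implicit Types (f g : E -> R[i]).

Lemma supp_out f x : ~ supp f x -> f x = 0.
Proof.
move=> h; apply: contrapT => /eqP fx; apply: h; exact: subset_closure.
Qed.

Lemma open_suppC f : open (~` supp f).
Proof. by rewrite openC; exact: closed_closure. Qed.

(** Derivatives are local; this keeps the derivatives of a test function inside its support. *)
Lemma pderivs_zero_on f (V : set E) s : open V -> (forall x, V x -> f x = 0) ->
  forall x, V x -> pderivs s f x = 0.
Proof.
move=> oV fV; elim: s => //= i s IH x Vx.
have nV : \forall y \near x, V y by exact: open_nbhs_nbhs.
rewrite /pderiv; apply: complex_eq => /=.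
- rewrite (@near_eq_derive _ _ _ _ (cst 0)) ?derive_cst//.
  by near=> y; rewrite /= IH//; near: y.
- rewrite (@near_eq_derive _ _ _ _ (cst 0)) ?derive_cst//.
  by near=> y; rewrite /= IH//; near: y.
Unshelve. all: by end_near. Qed.

Lemma compact_fun_bound (A : set E) (u : E -> R) : compact A -> continuous u ->
  exists2 C : R, 0 <= C & forall x, A x -> `|u x| <= C.
Proof.
move=> cA cu.
have : compact (u @` A).
  by apply: continuous_compact => //; exact: continuous_subspaceT.
move=> /compact_bounded[M [_ hM]]; exists (`|M| + 1); first by rewrite addr_ge0.
move=> x Ax; apply: (hM (`|M| + 1)); last by exists x.
by apply: le_lt_trans (ler_norm M) _; rewrite ltrDl.
Qed.

Lemma compact_onorm_bound (A : set E) : compact A -> exists2 C : R, 0 <= C & forall x, A x -> onorm x <= C.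
Proof.
move=> cA; have [M [_ hM]] := compact_bounded cA.
exists (n%:R * (`|M| + 1)); first by rewrite mulr_ge0// addr_ge0.
move=> x Ax; apply: le_trans (onorm_le_norm x) _; rewrite ler_wpM2l//.
by apply: (hM (`|M| + 1)) => //; apply: le_lt_trans (ler_norm M) _; rewrite ltrDl.
Qed.

Lemma Cc_schw (U : set E) f : Cc_infty U f -> schw f.
Proof.
move=> [sf [cf _]]; split=> // s N.
have [M M0 hM] := compact_onorm_bound cf.
have cs x := smooth_cdiff x (smooth_pderivs s sf).
have [C1 C10 h1] := compact_fun_bound cf (fun x => (cdiff_continuous (cs x)).1).
have [C2 C20 h2] := compact_fun_bound cf (fun x => (cdiff_continuous (cs x)).2).
exists ((1 + M) ^+ N * (C1 + C2)) => x.
have [fx|nfx] := pselect (supp f x).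
  apply: ler_pM; rewrite ?exprn_ge0 ?wt_ge0 ?normc_ge0//.
    by rewrite lerXn2r ?nnegrE ?wt_ge0 ?addr_ge0// lerD2l hM.
  by apply: le_trans (normc_leD _) _; apply: lerD; [exact: h1|exact: h2].
have oS : open (~` supp f) by exact: open_suppC.
have oZ y : (~` supp f) y -> f y = 0 by exact: supp_out.
rewrite (pderivs_zero_on s oS oZ)// normcr0 mulr0.
by rewrite mulr_ge0 ?exprn_ge0 ?addr_ge0.
Qed.

(** The closed set [K] between the nonzero set and [U] is what keeps the closure of the nonzero set
    inside [U]. *)
Lemma Cc_inftyI f (U K : set E) (M : R) : smooth f -> closed K -> K `<=` U ->
  (forall x, f x != 0 -> K x) -> (forall x, f x != 0 -> onorm x <= M) -> Cc_infty U f.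
Proof.
move=> sf cK KU fK fM.
have sK : supp f `<=` K.
  by rewrite /supp closureE => x; apply; split => // y /= /fK.
split=> //; split; last exact: subset_trans KU.
apply: bounded_closed_compact; last exact: closed_closure.
exists M; split; first exact: num_real.
move=> A MA x sx /=; apply: le_trans (ltW MA).
have : closure [set x | f x != 0] `<=` [set x : E | `|x| <= M].
  rewrite closureE => y; apply; split.
    apply: (@closed_comp _ _ (fun x : E => `|x|) [set t : R | t <= M]).
      by move=> z _; exact: norm_continuous.
    exact: closed_le.
  by move=> z /= /fM; apply: le_trans; exact: norm_le_onorm.
by apply; exact: sx.
Qed.

Lemma Cc_inftyT f (M : R) : smooth f -> (forall x, f x != 0 -> onorm x <= M) -> Cc_infty setT f.
Proof. by move=> sf h; apply: (@Cc_inftyI f setT setT M) => //; exact: closedT. Qed.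

Lemma Cc_bounded U f : Cc_infty U f -> exists M, forall x, f x != 0 -> onorm x <= M.
Proof.
move=> [_ [cf _]]; have [M _ hM] := compact_onorm_bound cf; exists M => x fx.
by apply: hM; exact: subset_closure.
Qed.

Lemma Cc_inftyD (U : set E) f g (c : R[i]) : Cc_infty U f -> Cc_infty U g ->
  Cc_infty U (fun x => c * f x + g x).
Proof.
move=> hf hg; have [M hM] := Cc_bounded hf; have [N hN] := Cc_bounded hg.
have [sf [cf fU]] := hf; have [sg [cg gU]] := hg.
have H x : c * f x + g x != 0 -> f x != 0 \/ g x != 0.
  have [->|? _] := eqVneq (f x) 0; last by left.
  by rewrite mulr0 add0r; right.
apply: (@Cc_inftyI _ U (supp f `|` supp g) (Num.max M N)).
- by apply: smoothD => //; exact: smoothZ.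
- by apply: closedU; exact: closed_closure.
- by move=> x [/fU|/gU].
- by move=> x /H [h|h]; [left|right]; exact: subset_closure.
- by move=> x /H [/hM|/hN] h; rewrite le_max h ?orbT.
Qed.

End test_functions.

(** * Fourier inversion up to a constant, and the nonvanishing of that constant *)

Section inversion.
Context {R : realType} {n : nat}.
Local Notation E := 'rV[R]_n.
Implicit Types (f g h : E -> R[i]).

Lemma cintegral_dilate (h : E -> R[i]) (f : E -> R[i]) (e : R) : 0 < e -> schw h -> schw f ->
  cintegral (fun xi => fourier f xi * h (e *: xi)) = cintegral (fun y => f (e *: y) * fourier h y).
Proof.
move=> e0 sh sf; have e0' : e != 0 by rewrite gt_eqF.
have she : schw (fun xi => h (e *: xi)) by exact: schw_scale.
rewrite fourier_dual; [|exact: schw_L1|exact: schw_L1].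
have K x : fourier (fun xi => h (e *: xi)) (e *: x) = (`|e| ^- n)%:C * fourier h x.
  rewrite /fourier -(cintegral_affine 0 e0'); last by apply: L1_fourier; exact: schw_L1.
  congr cintegral; apply/funext => y; rewrite addr0; congr (_ * expi (- _)).
  by rewrite dotvZl dotvZr.
have LF : L1 (fun x => f x * fourier (fun xi => h (e *: xi)) x).
  by apply: schw_L1; apply: schwM => //; exact: schw_fourier.
have E1 := cintegral_affine 0 e0' LF.
pose c : R[i] := (`|e| ^- n)%:C.
have c0 : c != 0.
  by rewrite -normc_eq0 normc_real normr_eq0 invr_eq0 expf_neq0// normr_eq0.
have E2 : (fun x : E => f (e *: x + 0) * fourier (fun xi => h (e *: xi)) (e *: x + 0)) =
    (fun x => c * (f (e *: x) * fourier h x)).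
  by apply/funext => x; rewrite addr0 K mulrCA.
rewrite E2 cintegralZ in E1; last first.
  by apply: schw_L1; apply: schwM; [exact: schw_scale|exact: schw_fourier].
by rewrite -(mulfI c0 E1).
Qed.

(** The mean value estimate for [f] gives convergence at a linear rate as e tends to 0, in the form
    that [le_eps_eq] consumes. *)
Lemma dilate_limit f g : schw f -> schw g -> exists2 C : R, 0 <= C & forall e : R, 0 < e ->
  normc (cintegral (fun x => f (e *: x) * g x) - f 0 * cintegral g) <= C * e.
Proof.
move=> sf sg; have [C C0 hC] := schw_mvt 0 sf.
pose B := fun y => wt y ^+ 1 * normc (g y).
exists (2 * (C * rnorm (fun y => (B y)%:C))); first by rewrite !mulr_ge0// rnorm_ge0.
move=> e e0.
have sfe : schw (fun x => f (e *: x)) by apply: schw_scale => //; rewrite gt_eqF.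
have L2 := schw_L1 sg.
have L3 := schw_L1 (schwM sfe sg).
rewrite -cintegralZ// -cintegralB//; last exact: L1Z.
rewrite [leRHS](_ : _ = 2 * ((C * e) * rnorm (fun y => (B y)%:C))); last by ring.
apply: normc_cintegral_le; first by rewrite mulr_ge0// ltW.
- by apply: L1B => //; exact: L1Z.
- exact: schw_weight_L1.
move=> x; rewrite -mulrBl normcM /B !mulrA ler_wpM2r ?normc_ge0//.
have := hC 0 (e *: x); rewrite !expr0 mul1r add0r mulr1 => H; apply: le_trans H _.
by rewrite onormZ gtr0_norm// expr1 mulrA ler_wpM2l ?onorm_le_wt// mulr_ge0// ltW.
Qed.

Lemma le_eps_eq (a b : R[i]) (C : R) : (forall e : R, 0 < e -> normc (a - b) <= C * e) -> a = b.
Proof.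
move=> H; apply/eqP; rewrite -subr_eq0 -normc_eq0 eq_le normc_ge0 andbT.
have [C0|C0] := leP C 0.
  apply: le_trans (H 1 ltr01) _; by rewrite mulr1.
apply/ler_addgt0Pl => e e0; rewrite addr0.
have := H (e / C); rewrite divr_gt0// => /(_ isT).
by rewrite mulrC divfK ?gt_eqF.
Qed.

Variable w0 : E -> R[i].
Hypothesis sw0 : schw w0.
Hypothesis w01 : w0 0 = 1.

Definition kappa : R[i] := cintegral (fourier w0).

(** The integral of F f (xi) w0 (e xi) equals that of f (e y) F w0 (y). As e tends to 0 the left
    side tends to the integral of F f, because [w0 0 = 1], and the right side to f (0) times the
    integral of F w0. *)
Lemma cintegral_fourier f : schw f -> cintegral (fourier f) = f 0 * kappa.
Proof.
move=> sf; have [C C0 hC] := dilate_limit sw0 (schw_fourier sf).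
have [D D0 hD] := dilate_limit sf (schw_fourier sw0).
apply: (@le_eps_eq _ _ (C + D)) => e e0.
have := hC e e0; have := hD e e0; rewrite -(cintegral_dilate e0 sw0 sf) w01 mul1r.
rewrite (_ : (fun xi => _ * w0 _) = (fun x => w0 (e *: x) * fourier f x)); last first.
  by apply/funext => xi; rewrite mulrC.
rewrite -/kappa; set I := cintegral _ => h1 h2.
have -> : cintegral (fourier f) - f 0 * kappa = (I - f 0 * kappa) - (I - cintegral (fourier f)) by ring.
apply: le_trans (le_normcD _ _) _; rewrite normcN mulrDl addrC.
exact: lerD.
Qed.

(** The value is 1 with this normalisation, but computing it would take a Gaussian integral;
    nonvanishing, proved in [cF_neq0], is enough. *)
Definition cF : R[i] := ((2 * pi) ^- n)%:C * kappa.

Lemma fourier_shift f (a xi : E) : L1 f ->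
  fourier (fun x => f (x + a)) xi = fourier f xi * expi (dotv a xi).
Proof.
move=> Lf; rewrite mulrC /fourier -cintegralZ; last exact: L1_fourier.
rewrite -(@cintegral_shift _ _ a (fun x => expi (dotv a xi) * (f x * expi (- dotv x xi)))); last first.
  by apply: L1Z; exact: L1_fourier.
congr cintegral; apply/funext => x; rewrite mulrCA -expiD; congr (_ * expi _).
by rewrite dotvDl; ring.
Qed.

Lemma fourierK f x : schw f -> fourier_inv (fourier f) x = cF * f x.
Proof.
move=> sf; rewrite /fourier_inv /cF -mulrA; congr (_ * _).
have := cintegral_fourier (schw_shift x sf); rewrite add0r mulrC => <-.
congr cintegral; apply/funext => xi; rewrite fourier_shift//; last exact: schw_L1.
Qed.

Lemma fourier_opp f xi : L1 f -> fourier (fun x => f (- x)) xi = fourier f (- xi).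
Proof.
move=> Lf; rewrite /fourier -[RHS]cintegral_opp; last exact: L1_fourier.
by congr cintegral; apply/funext => x; rewrite dotvNl dotvNr opprK.
Qed.

Lemma fourier_invK f x : schw f -> fourier (fourier_inv f) x = cF * f x.
Proof.
move=> sf; rewrite -fourierK// fourier_invE.
have sF := schw_fourier sf.
rewrite (_ : fourier_inv f = fun y => ((2 * pi) ^- n)%:C * fourier f (- y)); last first.
  by apply/funext => y; exact: fourier_invE.
rewrite fourierZ; last by apply: schw_L1; exact: schw_opp.
by rewrite fourier_opp//; exact: schw_L1.
Qed.

End inversion.

Section positivity.
Context {R : realType} {n : nat}.
Local Notation E := 'rV[R]_n.

Lemma cube1_gt0 k : (0 < @leb R k (@cube R k 1))%E.
Proof.
elim: k => [|k IH].
  rewrite lebE /= diracE (_ : (_ \in _) = true) ?lte01//.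
  by apply/mem_set => -[].
rewrite lebE /= /lebesgue_rV_step /pushforward.
have -> : @rcons_rV R k @^-1` cube 1 = cube 1 `*` `[- 1%:R, 1%:R]%classic.
  apply/seteqP; split => -[x t] /= h.
    split=> [i|].
      by have := h (lift ord_max i); rewrite mxE liftK.
    by rewrite in_itv/= -ler_norml; have := h ord_max; rewrite mxE unlift_none.
  case: h => h1; rewrite in_itv/= -ler_norml => h2 i.
  by rewrite mxE /=; case: (unliftP ord_max i) => [j _|_] //=; exact: h1.
rewrite product_measure1E//; last exact: measurable_cube.
rewrite mule_gt0//.
have H : (0 < @lebesgue_measure R `[(-1)%R, 1%R]%classic)%E.
  rewrite lebesgue_measure_itv/= lte_fin (_ : (-1 < 1 :> R)%R); last by lra.
  by rewrite -EFinB lte_fin; lra.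
exact: H.
Qed.

(** By continuity [h] exceeds half of [h x0] near [x0]; an affine change of variables turns a box
    inside that neighbourhood into the unit cube, of positive measure by [cube1_gt0]. *)
Lemma pos_integral (h : E -> R) x0 : continuous h -> (forall x, 0 <= h x) -> 0 < h x0 ->
  (0 < \int[leb n]_x (h x)%:E)%E.
Proof.
move=> ch h0 hx0.
have /nbhs_ballP[e /= e0 he] : \forall x \near x0, h x0 / 2 < h x.
  have := ch x0 => /cvgr_gt; apply.
  by rewrite ltr_pdivrMr// ltr_pMr//; lra.
pose r := e / 2.
have r0 : 0 < r by rewrite divr_gt0.
have mh : measurable_fun setT (EFin \o h) by apply/measurable_EFinP; exact: measurable_continuous_rV.
have rn0 : r != 0 by rewrite gt_eqF.
rewrite (ge0_integral_affine x0 rn0 mh)//.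
rewrite mule_gt0 ?lte_fin ?exprn_gt0 ?normr_gt0//.
apply: lt_le_trans (_ : \int[leb n]_x ((h x0 / 2)%:E * (\1_(@cube R n 1) x)%:E) <= _)%E.
  rewrite ge0_integralZl//.
  - rewrite integral_indic// ?setIT; last exact: measurable_cube.
    by rewrite mule_gt0 ?cube1_gt0// lte_fin divr_gt0.
  - by apply/measurable_EFinP; apply: measurable_indic; exact: measurable_cube.
  - by rewrite lee_fin divr_ge0// ltW.
apply: ge0_le_integral => //.
- by move=> x _; rewrite -EFinM lee_fin mulr_ge0// divr_ge0// ltW.
- by apply/measurable_EFinP; apply: measurable_funM => //; apply: measurable_indic; exact: measurable_cube.
- by apply: (measurableT_comp mh); exact: measurable_affine.
move=> x _; rewrite -EFinM lee_fin indicE.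
case: (boolP (x \in _)) => [|_]; last by rewrite mulr0.
rewrite inE => xc; rewrite mulr1; apply/ltW/he.
split => // a i; rewrite ord1 /ball /= !mxE.
rewrite opprD addrCA subrr addr0 normrN normrM gtr0_norm//.
have H : `|x 0 i| <= 1 by rewrite (_ : 0 = ord0) ?xc//; exact: val_inj.
apply: le_lt_trans (_ : r * 1 < _); first by apply: ler_wpM2l => //; exact: ltW.
by rewrite mulr1 /r; lra.
Qed.

End positivity.

Section cutoff.
Context {R : realType} {n : nat}.
Local Notation E := 'rV[R]_n.
Variable phi : E -> R.
Hypothesis hphi : LP_cutoff phi.

Definition cphi : E -> R[i] := fun x => (phi x)%:C.

Lemma schw_cphi : schw cphi.
Proof. by have [+ _ _ _] := hphi; exact: Cc_schw. Qed.

Lemma phi_ge0 x : 0 <= phi x. Proof. by have [_ _ + _] := hphi. Qed.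

Lemma phi_even x : phi (- x) = phi x.
Proof. by have [_ + _ _] := hphi; apply; rewrite -scaleN1r enormZ normrN normr1 mul1r. Qed.

Lemma phi_eq1 x : enorm x < 3 / 4 -> phi x = 1.
Proof. by have [_ _ _ +] := hphi; apply. Qed.

Lemma phi0 : phi 0 = 1.
Proof. by apply: phi_eq1; rewrite (_ : enorm 0 = 0)//; apply/eqP; rewrite enorm_eq0. Qed.

Lemma phi_supp x : 4 / 3 <= enorm x -> phi x = 0.
Proof.
move=> h; have [[_ [_ H]] _ _ _] := hphi.
apply: contrapT => p0; have := H x; rewrite /= ltNge h /= => K.
suff : false by []. apply: K; apply: subset_closure => /=.
by apply/eqP => -[].
Qed.

Lemma cphi0 : cphi 0 = 1. Proof. by rewrite /cphi phi0. Qed.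

Lemma phi_continuous : continuous phi.
Proof.
move=> x; exact: (cdiff_continuous (smooth_cdiff x (schw_smooth schw_cphi))).1.
Qed.

(** If the constant were 0, inversion would make the double transform of the cutoff vanish, and the
    multiplication formula would give F phi * F phi integral zero. But F phi is real, as phi is
    even, and at 0 it is the integral of phi, which is positive. *)
Lemma cF_neq0 : cF cphi != 0.
Proof.
have sp := schw_cphi; have Lp := schw_L1 sp.
have p0 : (2 * pi : R) ^- n != 0 by rewrite invr_eq0 expf_neq0// mulf_neq0// gt_eqF// pi_gt0.
have c0 : ((2 * pi : R) ^- n)%:C != 0 :> R[i] by rewrite -normc_eq0 normc_real normr_eq0.
apply/negP => /eqP cF0.
pose r (xi : E) := complex.Re (fourier cphi xi).
have ev xi : fourier cphi (- xi) = fourier cphi xi.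
  by rewrite -fourier_opp//; congr fourier; apply/funext => x; rewrite /cphi phi_even.
have im0 xi : complex.Im (fourier cphi xi) = 0.
  have H y : complex.Im (fourier cphi y) = \int[leb n]_x (phi x * sin (- dotv x y)).
    rewrite /fourier cintegralE /=; apply: eq_Rintegral => x _.
    by rewrite mul0r addr0.
  have : complex.Im (fourier cphi (- xi)) = - complex.Im (fourier cphi xi).
    rewrite !H -mulN1r -RintegralZl//.
      by apply: eq_Rintegral => x _; rewrite dotvNr sinN; ring.
    have := L1_Im (L1_fourier xi Lp); congr (integrable _ _ _); apply/funext => x.
    by rewrite Im_mulc /= mul0r addr0.
  by rewrite ev; lra.
have rE xi : fourier cphi xi = (r xi)%:C by apply: complex_eq.
have sF := schw_fourier sp.
have Z : cintegral (fun xi => fourier cphi xi * fourier cphi xi) = 0.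
  rewrite fourier_dual//; last exact: schw_L1.
  rewrite (_ : (fun x => _) = fun _ => 0) ?cintegral0//.
  apply/funext => x; apply/eqP; rewrite mulf_eq0; apply/orP; right.
  have := fourierK sp cphi0 (- x) sp; rewrite cF0 mul0r fourier_invE opprK => /eqP.
  by rewrite mulf_eq0 (negbTE c0).
have cr : continuous r.
  by move=> x; exact: (cdiff_continuous (smooth_cdiff x (schw_smooth sF))).1.
have r0 : r 0 != 0.
  rewrite /r /fourier cintegralE /=.
  rewrite (@eq_Rintegral _ _ _ _ _ phi); last first.
    move=> x _; rewrite mul0r subr0.
    have -> : dotv x 0 = 0 by rewrite -(scale0r (0 : E)) dotvZr mul0r.
    by rewrite oppr0 cos0 mulr1.
  have ip := L1_Re Lp; have pp := pos_integral phi_continuous phi_ge0 (x0 := 0).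
  rewrite gt_eqF// /Rintegral fine_gt0// pp ?phi0 ?ltr01//=.
  by have := integrable_fin_num measurableT ip; rewrite fin_numElt => /andP[].
have : (0 < \int[leb n]_x (r x ^+ 2)%:E)%E.
  apply: (@pos_integral R n (fun x => r x ^+ 2) 0).
  - by move=> x; apply: continuousM; exact: cr.
  - by move=> x; exact: sqr_ge0.
  - by rewrite lt_neqAle sqr_ge0 andbT eq_sym expf_neq0.
have /(f_equal (@complex.Re R)) := Z; rewrite cintegralE /= /Rintegral.
have LZ := schw_L1 (schwM sF sF).
have iZ := integrable_fin_num measurableT (L1_Re LZ).
have E1 : (\int[leb n]_x (complex.Re (fourier cphi x * fourier cphi x))%:E = \int[leb n]_x (r x ^+ 2)%:E)%E.
  by apply: eq_integral => x _; rewrite !rE -rmorphM.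
rewrite E1 in iZ *; move=> H.
by rewrite -(fineK iZ) H ltxx.
Qed.

End cutoff.

(** * Convolution and Fourier multipliers, related by transposition *)

Section convolution.
Context {R : realType} {n : nat}.
Local Notation E := 'rV[R]_n.
Implicit Types (f g h k m v : E -> R[i]).

Definition refl f : E -> R[i] := fun x => f (- x).

Definition conv k v : E -> R[i] := fun x => cintegral (fun y => k (x - y) * v y).

(** The transposed multiplier: on Schwartz functions [multiplier m u f] is [u (Mlt m f)]. *)
Definition Mlt m f : E -> R[i] := fourier (fun xi => m xi * fourier_inv f xi).

(** A common home for Schwartz functions and every L^p with p >= 1 ([isLp_Lw]), large enough for
    pairings and for convolution with Schwartz kernels. *)
Definition Lw v := L1 (fun y => (bell y)%:C * v y).

Lemma schw_refl f : schw f -> schw (refl f). Proof. exact: schw_opp. Qed.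

Lemma schw_conv_arg k x : schw k -> schw (fun y => k (x - y)).
Proof.
move=> sk; have h : (-1 : R) != 0 by rewrite oppr_eq0 oner_eq0.
have := schw_affine x h sk.
by under [X in schw X -> _]eq_fun do rewrite scaleN1r addrC.
Qed.

Lemma conv_schwC k v x : schw k -> schw v -> conv k v x = conv v k x.
Proof.
move=> sk sv; rewrite /conv.
have L : L1 (fun y => k (x - y) * v y) by apply: schw_L1; apply: schwM => //; exact: schw_conv_arg.
have h : (-1 : R) != 0 by rewrite oppr_eq0 oner_eq0.
have := cintegral_affine x h L; rewrite normrN normr1 expr1n invr1 mul1r => <-.
congr cintegral; apply/funext => y; rewrite scaleN1r opprD opprK addrCA subrr addr0 mulrC.
by rewrite addrC.
Qed.

Lemma bounded_L1 (b g : E -> R[i]) (C : R) : cmeas b -> (forall x, normc (b x) <= C) -> L1 g ->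
  L1 (fun x => b x * g x).
Proof.
move=> mb bC Lg; apply: (@le_L1 _ _ _ (fun y => C%:C * g y)).
- by apply: cmeasM => //; case: Lg.
- exact: L1Z.
- move=> x; rewrite !normcM ler_wpM2r ?normc_ge0// normc_real.
  by apply: le_trans (bC x) (ler_norm C).
Qed.

Lemma schw_L1M (b g : E -> R[i]) : schw b -> L1 g -> L1 (fun x => b x * g x).
Proof.
move=> sb; have [C _ hC] := schw_bound 0 sb; apply: (@bounded_L1 _ _ C); first exact: schw_cmeas.
by move=> x; have := hC x; rewrite expr0 mul1r.
Qed.

Lemma schw_expiM m x : schw m -> schw (fun xi => m xi * expi (dotv x xi)).
Proof.
move=> sm; have := slow_schwM (slow_expi (- x)) sm; congr schw.
by apply/funext => xi; rewrite mulrC dotvNr opprK dotvC.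
Qed.

(** The convolution theorem in the order that needs no inversion: only the multiplication formula is
    applied, to [g] and the modulated symbol. *)
Lemma fourier_inv_conv m g x : schw m -> L1 g ->
  fourier_inv (fun xi => m xi * fourier g xi) x = conv (fourier_inv m) g x.
Proof.
move=> sm Lg; rewrite /conv.
pose q := fun xi => m xi * expi (dotv x xi).
have sq : schw q by exact: schw_expiM.
rewrite /fourier_inv; set c0 := _%:C.
transitivity (c0 * cintegral (fun xi => fourier g xi * q xi)).
  by congr (_ * cintegral _); apply/funext => xi; rewrite /q; ring.
rewrite fourier_dual//; last exact: schw_L1.
rewrite -cintegralZ; last first.
  by under eq_fun do rewrite mulrC; apply: schw_L1M => //; exact: schw_fourier.
congr cintegral; apply/funext => y; rewrite mulrCA mulrC; congr (_ * _ * _).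
rewrite /fourier; congr cintegral; apply/funext => xi.
by rewrite /q -mulrA -expiD; congr (_ * expi _); rewrite dotvDl dotvNl (dotvC xi y).
Qed.

Lemma fourier_invZ c f x : L1 f -> fourier_inv (fun y => c * f y) x = c * fourier_inv f x.
Proof. by move=> Lf; rewrite !fourier_invE fourierZ// mulrCA. Qed.

(** The multiplier acts on test functions by the reflected kernel, as the order of [fourier] and
    [fourier_inv] is opposite to the usual one. *)
Lemma MltE m f : schw m -> schw f -> Mlt m f = conv (refl (fourier_inv m)) f.
Proof.
move=> sm sf; apply/funext => x.
have Lf := schw_L1 sf; have Lr := schw_L1 (schw_refl sf).
pose c0 : R[i] := ((2 * pi) ^- n)%:C.
have c00 : c0 != 0.
  by rewrite -normc_eq0 normc_real normr_eq0 invr_eq0 expf_neq0// mulf_neq0// gt_eqF// pi_gt0.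
have sG : schw (fun xi => m xi * fourier (refl f) xi).
  by apply: schwM => //; apply: schw_fourier; exact: schw_refl.
have E1 : (fun xi => m xi * fourier_inv f xi) = fun xi => c0 * (m xi * fourier (refl f) xi).
  by apply/funext => xi; rewrite fourier_invE /refl fourier_opp// mulrCA.
rewrite /Mlt E1 fourierZ; last exact: schw_L1.
have := fourier_inv_conv (- x) sm Lr; rewrite fourier_invE opprK -/c0 => ->.
have L : L1 (fun y => fourier_inv m (- x - y) * refl f y).
  apply: schw_L1; apply: schwM; last exact: schw_refl.
  by apply: schw_conv_arg; exact: schw_fourier_inv.
rewrite /conv -(cintegral_opp L); congr cintegral; apply/funext => y.
by rewrite /refl !opprK opprB [- x + y]addrC.
Qed.

Lemma schw_Mlt m f : schw m -> schw f -> schw (Mlt m f).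
Proof.
move=> sm sf; apply: schw_fourier; apply: schwM => //; exact: schw_fourier_inv.
Qed.

Lemma wt_bell2 f (C : R) x (N : nat) : wt x ^+ (2 * n + N) * normc (f x) <= C ->
  normc (f x) * wt x ^+ N <= C * bell x.
Proof.
move=> h; have := @wt_bell _ _ (fun x => (normc (f x) * wt x ^+ N)%:C) C x.
rewrite normc_real ger0_norm ?mulr_ge0 ?normc_ge0 ?exprn_ge0 ?wt_ge0//; apply.
by rewrite [X in X <= _](_ : _ = wt x ^+ (2 * n + N) * normc (f x))// exprD; ring.
Qed.

Lemma measurable_bellV : measurable_fun setT (fun y : E => (bell y)^-1).
Proof.
rewrite (_ : (fun y => _) = fun y : E => \prod_(i < n) (1 + y ord0 i ^+ 2)).
  elim: (index_enum _) => [|i r IH].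
    by under eq_fun do rewrite big_nil; exact: measurable_cst.
  under eq_fun do rewrite big_cons; apply: measurable_funM => //.
  apply: measurable_funD => //; apply: measurable_funX; exact: measurable_coord_rV.
by apply/funext => y; rewrite /bell prodfV invrK.
Qed.

Lemma Lw_cmeas v : Lw v -> cmeas v.
Proof.
move=> [mv _]; rewrite (_ : v = fun y => ((bell y)^-1)%:C * ((bell y)%:C * v y)).
  apply: cmeasM => //; apply: cmeas_real.
  exact: measurable_bellV.
apply/funext => y; rewrite mulrA -rmorphM mulVf ?mul1r//.
by rewrite gt_eqF// bell_gt0.
Qed.

Lemma Lw_dom (b v : E -> R[i]) (C : R) : cmeas b -> Lw v -> (forall y, normc (b y) <= C * bell y) ->
  L1 (fun y => b y * v y).
Proof.
move=> mb Lv bC; have mv := Lw_cmeas Lv.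
apply: (@le_L1 _ _ _ (fun y => C%:C * ((bell y)%:C * v y))).
- exact: cmeasM.
- exact: L1Z.
- move=> y; rewrite !normcM !normc_real mulrA ler_wpM2r ?normc_ge0//.
  apply: le_trans (bC y) _; rewrite (ger0_norm (bell_ge0 _)) ler_wpM2r ?bell_ge0//.
  exact: ler_norm.
Qed.

Lemma schw_LwM f v : schw f -> Lw v -> L1 (fun y => f y * v y).
Proof.
move=> sf Lv; have [C C0 hC] := schw_bound (2 * n) sf.
by apply: (@Lw_dom _ _ C) => // [|y]; [exact: schw_cmeas|exact: wt_bell].
Qed.

Lemma conv_L1 k v x : schw k -> Lw v -> L1 (fun y => k (x - y) * v y).
Proof. by move=> sk; apply: schw_LwM; exact: schw_conv_arg. Qed.

Lemma bell_le1 (y : E) : bell y <= 1.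
Proof.
rewrite /bell; apply: prodr_ile1 => i _.
by rewrite invr_ge0 addr_ge0 ?sqr_ge0//= invf_le1 ?lerDl ?sqr_ge0// ltr_wpDr// sqr_ge0.
Qed.

Lemma L1_Lw v : L1 v -> Lw v.
Proof.
apply: (@bounded_L1 _ _ 1); first by apply: cmeas_real; exact: measurable_bell.
by move=> x; rewrite normc_real ger0_norm ?bell_ge0// bell_le1.
Qed.

Lemma schw_Lw f : schw f -> Lw f.
Proof. by move=> sf; apply: L1_Lw; exact: schw_L1. Qed.

Lemma measurable_sub_rV : measurable_fun setT (fun p : E * E => p.1 - p.2).
Proof.
apply: measurable_fun_rV => i.
rewrite (_ : _ \o _ = fun p : E * E => coord_rV i p.1 - coord_rV i p.2).
  by apply: measurable_funB; [exact: (measurableT_comp (measurable_coord_rV i) measurable_fst_rV)|exact: (measurableT_comp (measurable_coord_rV i) measurable_snd_rV)].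
by apply/funext => p; rewrite /= /coord_rV !mxE.
Qed.

Lemma cmeas_conv_prod k v : cmeas k -> cmeas v -> cmeas (fun p : E * E => k (p.1 - p.2) * v p.2).
Proof.
move=> mk mv; apply: cmeasM; first exact: (cmeas_comp mk measurable_sub_rV).
exact: (cmeas_comp mv measurable_snd_rV).
Qed.

(** Peetre's inequality separates the variables: half of the decay of [f] pays for replacing the
    decay of k in x - y by decay in y. This is the domination that Fubini needs in [conv_dual]. *)
Lemma conv_dual_bound k f : schw k -> schw f -> exists2 C : R, 0 <= C & forall x y,
  normc (k (x - y)) * normc (f x) <= C * (bell x * bell y).
Proof.
move=> sk sf; have [C C0 hC] := schw_bound (2 * n) sk; have [D D0 hD] := schw_bound (2 * n + 2 * n) sf.
exists (C * D); first exact: mulr_ge0.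
move=> x y.
have h1 : normc (k (x - y)) <= C / wt (x - y) ^+ (2 * n) by rewrite ler_pdivlMr ?wtX_gt0// mulrC.
have h2 := wt_bell2 (hD x).
have h3 : wt y ^+ (2 * n) <= wt x ^+ (2 * n) * wt (x - y) ^+ (2 * n).
  have := wt_shiftX y (x - y) (2 * n); by rewrite addrC subrK.
apply: le_trans (_ : C / wt (x - y) ^+ (2 * n) * (D * bell x / wt x ^+ (2 * n)) <= _).
  apply: ler_pM; rewrite ?normc_ge0// ler_pdivlMr ?wtX_gt0//.
rewrite (_ : _ * _ = C * D * (bell x * (wt x ^+ (2 * n) * wt (x - y) ^+ (2 * n))^-1)); last first.
  by field; rewrite !gt_eqF ?wtX_gt0.
rewrite ler_wpM2l ?mulr_ge0// ler_wpM2l ?bell_ge0//.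
apply: le_trans (wtV_le_bell y); rewrite lef_pV2 ?posrE ?wtX_gt0//.
by rewrite mulr_gt0 ?wtX_gt0.
Qed.

Lemma conv_dual_fin k v f : schw k -> Lw v -> schw f ->
  (\int[leb n]_x \int[leb n]_y (normc (k (x - y) * v y * f x))%:E < +oo)%E.
Proof.
move=> sk Lv sf; have [C C0 hC] := conv_dual_bound sk sf.
have mv := Lw_cmeas Lv.
have Lb : L1 (fun x : E => (C * bell x)%:C).
  apply: (@decay_L1 _ _ _ C) => [|x]; last by rewrite normc_real ger0_norm// mulr_ge0 ?bell_ge0.
  by apply: cmeas_real; apply: measurable_funM => //; exact: measurable_bell.
apply: le_lt_trans (int2_lty Lb Lv).
have mP : cmeas (fun p : E * E => k (p.1 - p.2) * v p.2 * f p.1).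
  apply: cmeasM; last by apply: (cmeas_comp (f := f)); [exact: schw_cmeas|exact: measurable_fst_rV].
  by apply: cmeas_conv_prod => //; exact: schw_cmeas.
have mQ : measurable_fun setT (fun p : E * E => (normc (C * bell p.1)%:C * normc ((bell p.2)%:C * v p.2))%:E).
  apply/measurable_EFinP; apply: measurable_funM.
    by apply: cmeas_normc; apply: (cmeas_comp (f := fun x : E => (C * bell x)%:C)); [case: Lb|exact: measurable_fst_rV].
  by apply: cmeas_normc; apply: (cmeas_comp (f := fun y : E => (bell y)%:C * v y)); [case: Lv|exact: measurable_snd_rV].
apply: ge0_le_integral => //.
- by move=> x _; apply: integral_ge0 => y _; rewrite lee_fin normc_ge0.
- apply: (measurable_fun_fubini_tonelli_F (m2 := leb n) (fun p : E * E => (normc (k (p.1 - p.2) * v p.2 * f p.1))%:E)).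
    exact: cmeas_EFin_normc.
  by move=> p; rewrite lee_fin normc_ge0.
- apply: (measurable_fun_fubini_tonelli_F (m2 := leb n) (fun p : E * E => (normc (C * bell p.1)%:C * normc ((bell p.2)%:C * v p.2))%:E)) => //.
  by move=> p; rewrite lee_fin mulr_ge0 ?normc_ge0.
move=> x _; apply: ge0_le_integral => //.
- by move=> y _; rewrite lee_fin normc_ge0.
- exact: (measurableT_comp (cmeas_EFin_normc mP) (measurable_pair1 x)).
- exact: (measurableT_comp mQ (measurable_pair1 x)).
move=> y _; rewrite lee_fin !normcM !normc_real mulrA mulrAC ler_wpM2r ?normc_ge0//.
rewrite !ger0_norm ?bell_ge0 ?mulr_ge0 ?bell_ge0//.
by apply: le_trans (hC x y) _; rewrite mulrA.
Qed.

(** The Taylor remainder of the kernel decays in x - y, hence in y for fixed x, so [param_diff]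
    applies with a multiple of the weighted [v]. *)
Lemma conv_diff k v : schw k -> Lw v -> (forall x, cdiff (conv k v) x) /\
  forall i, pderiv i (conv k v) = conv (pderiv i k) v.
Proof.
move=> sk Lv; have [C C0 hC] := schw_taylor (2 * n) sk.
have Q x : cdiff (conv k v) x /\ forall i, pderiv i (conv k v) x = conv (pderiv i k) v x.
  pose D := C * (1 + n%:R) ^+ (2 * n) * wt x ^+ (2 * n).
  apply: (@param_diff R n (fun x y => k (x - y) * v y) (fun i y => pderiv i k (x - y) * v y)
    (fun y => D * normc ((bell y)%:C * v y))) => [z|i||h y hn].
  - exact: conv_L1.
  - by apply: conv_L1 => //; exact: schw_pderiv.
  - have LN : L1 (fun y => (normc ((bell y)%:C * v y))%:C).
      have [m1 m2] := Lv; split; first by apply: cmeas_real; exact: cmeas_normc.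
      by rewrite inorm_real// => y; exact: normc_ge0.
    have := L1Z D%:C LN; congr L1; apply/funext => y; by rewrite -rmorphM.
  have -> : k (x + h - y) * v y - k (x - y) * v y - \sum_i (h ord0 i)%:C * (pderiv i k (x - y) * v y) =
     (k (x - y + h) - k (x - y) - \sum_i (h ord0 i)%:C * pderiv i k (x - y)) * v y.
    rewrite [x + h - y]addrAC !mulrBl mulr_suml; congr (_ - _); apply: eq_bigr => i _; by rewrite mulrA.
  rewrite !normcM normc_real (ger0_norm (bell_ge0 _)) !mulrA ler_wpM2r ?normc_ge0//.
  have H := hC (x - y) h.
  apply: le_trans (_ : C * onorm h ^+ 2 * wt h ^+ (2 * n) / wt (x - y) ^+ (2 * n) <= _).
    by rewrite ler_pdivlMr ?wtX_gt0// mulrC.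
  rewrite [leLHS](_ : _ = onorm h ^+ 2 * C * (wt h ^+ (2 * n) / wt (x - y) ^+ (2 * n))); last by ring.
  rewrite [leRHS](_ : _ = onorm h ^+ 2 * C * ((1 + n%:R) ^+ (2 * n) * (wt x ^+ (2 * n) * bell y))); last by rewrite /D; ring.
  apply: ler_wpM2l; first by rewrite mulr_ge0 ?sqr_ge0.
  apply: ler_pM; rewrite ?exprn_ge0 ?wt_ge0 ?invr_ge0 ?exprn_ge0 ?wt_ge0//.
    by rewrite lerXn2r ?nnegrE ?wt_ge0 ?addr_ge0// lerD2l.
  apply: le_trans (_ : wt x ^+ (2 * n) * (wt y ^+ (2 * n))^-1 <= _); last first.
    by rewrite ler_wpM2l ?exprn_ge0 ?wt_ge0// wtV_le_bell.
  rewrite ler_pdivlMr ?wtX_gt0// mulrC ler_pdivrMr ?wtX_gt0//.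
  have := wt_shiftX y (x - y) (2 * n); by rewrite addrC subrK.
split=> [x|i]; first by have [] := Q x.
by apply/funext => x; have [_] := Q x.
Qed.

Lemma conv_smooth k v : schw k -> Lw v -> smooth (conv k v).
Proof.
move=> sk Lv; apply: (closed_smooth (S := [set f | exists2 k, schw k & f = conv k v])); last by exists k.
  by move=> _ [l sl ->] x; have [] := conv_diff sl Lv.
move=> _ i [l sl ->]; exists (pderiv i l); first exact: schw_pderiv.
by have [_ ->] := conv_diff sl Lv.
Qed.

Lemma cmeas_conv k v : schw k -> Lw v -> cmeas (conv k v).
Proof. by move=> sk Lv; apply: smooth_cmeas; exact: conv_smooth. Qed.

Lemma conv_dual k v f : schw k -> Lw v -> schw f ->
  cintegral (fun x => conv k v x * f x) = cintegral (fun y => v y * conv (refl k) f y).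
Proof.
move=> sk Lv sf; pose F (p : E * E) := k (p.1 - p.2) * v p.2 * f p.1.
have mv := Lw_cmeas Lv.
transitivity (cintegral (fun x => cintegral (fun y => F (x, y)))).
  congr cintegral; apply/funext => x; rewrite mulrC -cintegralZ; last exact: conv_L1.
  by congr cintegral; apply/funext => y; rewrite mulrC.
have sy y : schw (fun x => k (x - y) * f x).
  by apply: schwM => //; exact: schw_shift.
rewrite cfubini.
- congr cintegral; apply/funext => y; rewrite -cintegralZ.
    by congr cintegral; apply/funext => x; rewrite /F/= /refl opprB; ring.
  have := schw_L1 (sy y); congr L1; apply/funext => x; by rewrite /refl opprB.
- apply: cmeasM; last by apply: (cmeas_comp (f := f)); [exact: schw_cmeas|exact: measurable_fst_rV].
  by apply: cmeas_conv_prod => //; exact: schw_cmeas.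
- rewrite /F /=; exact: (conv_dual_fin sk Lv sf).
- move=> x; have := L1Z (f x) (conv_L1 x sk Lv); congr L1; apply/funext => y; by rewrite mulrC.
- move=> y; have := L1Z (v y) (schw_L1 (sy y)); congr L1; apply/funext => x; by rewrite /F/=; ring.
Qed.

(** The bridge between the two languages: convolving a function by the kernel of [m] is applying
    [Mlt m] to its test functions. *)
Lemma conv_Mlt m v f : schw m -> Lw v -> schw f ->
  cintegral (fun x => conv (fourier_inv m) v x * f x) = cintegral (fun y => v y * Mlt m f y).
Proof.
move=> sm Lv sf; rewrite (conv_dual (schw_fourier_inv sm) Lv sf).
by rewrite (MltE sm sf).
Qed.

Variable phi : E -> R.
Hypothesis hphi : LP_cutoff phi.
Local Notation c0 := (cF (cphi phi)).

(** Between the two multipliers stands [fourier_inv] of a [fourier], which contributes one factor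
    [c0] per composition. *)
Lemma Mlt_comp m1 m2 f : schw m1 -> schw m2 -> schw f ->
  Mlt m1 (Mlt m2 f) = Mlt (fun xi => c0 * (m1 xi * m2 xi)) f.
Proof.
move=> s1 s2 sf; rewrite /Mlt; congr fourier; apply/funext => xi.
rewrite (fourierK (schw_cphi hphi) (cphi0 hphi)); first by ring.
by apply: schwM => //; exact: schw_fourier_inv.
Qed.

Lemma MltZ c m f : schw m -> schw f -> Mlt (fun xi => c * m xi) f = fun x => c * Mlt m f x.
Proof.
move=> sm sf; rewrite /Mlt -fourierZ; last by apply: schw_L1; apply: schwM => //; exact: schw_fourier_inv.
by congr fourier; apply/funext => xi; rewrite mulrA.
Qed.

Lemma MltC m1 m2 f : schw m1 -> schw m2 -> schw f -> Mlt m1 (Mlt m2 f) = Mlt m2 (Mlt m1 f).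
Proof.
move=> s1 s2 sf; rewrite !Mlt_comp//; congr Mlt; apply/funext => xi; by rewrite (mulrC (m1 xi)).
Qed.

Lemma MltD m1 m2 f : schw m1 -> schw m2 -> schw f ->
  Mlt (fun xi => m1 xi + m2 xi) f = fun x => Mlt m1 f x + Mlt m2 f x.
Proof.
move=> s1 s2 sf; have si := schw_fourier_inv sf.
rewrite /Mlt -fourierD; [|by apply: schw_L1; exact: schwM..].
by congr fourier; apply/funext => xi; rewrite mulrDl.
Qed.

(* [sym zeta] is the symbol whose multiplier is the correlation with [zeta]. *)
Definition sym zeta : E -> R[i] := fun xi => c0^-1 * fourier zeta xi.

Lemma schw_sym zeta : schw zeta -> schw (sym zeta).
Proof. by move=> sz; apply: schwZ; exact: schw_fourier. Qed.

Lemma fourier_inv_sym zeta : schw zeta -> fourier_inv (sym zeta) = zeta.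
Proof.
move=> sz; apply/funext => x; rewrite /sym fourier_invZ; last by apply: schw_L1; exact: schw_fourier.
rewrite (fourierK (schw_cphi hphi) (cphi0 hphi))// mulrA mulVf ?mul1r//.
exact: cF_neq0.
Qed.

End convolution.

(** * L^p spaces and Young's inequality *)

Section Lp_theory.
Context {R : realType} {n : nat}.
Local Notation E := 'rV[R]_n.
Implicit Types (f g h k v : E -> R[i]) (p : R).

Definition Np p v : \bar R := (\int[leb n]_x (normc (v x) `^ p)%:E)%E.

Definition Lp p v : \bar R := Lnorm (leb n) p%:E (fun x => (normc (v x))%:E).

Definition isLp p v := cmeas v /\ (Np p v < +oo)%E.

Lemma LpE p v : Lp p v = (Np p v `^ p^-1)%E.
Proof.
rewrite /Lp unlock; congr (_ `^ _)%E; apply: eq_integral => x _.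
by rewrite abse_EFin ger0_norm ?normc_ge0// poweR_EFin.
Qed.

Lemma Lp_ge0 p v : (0 <= Lp p v)%E.
Proof. by rewrite LpE poweR_ge0. Qed.

Lemma Np_ge0 p v : (0 <= Np p v)%E.
Proof. by apply: integral_ge0 => x _; rewrite lee_fin powR_ge0. Qed.

Lemma Np_Lp p v : p != 0 -> Np p v = (Lp p v `^ p)%E.
Proof. by move=> p0; rewrite LpE -poweRrM mulVf// poweRe1// Np_ge0. Qed.

Lemma isLp_fin p v : isLp p v -> (Lp p v < +oo)%E.
Proof. by move=> [_ h]; rewrite LpE; exact: poweR_lty. Qed.

Lemma Lp_isLp p v : p != 0 -> cmeas v -> (Lp p v < +oo)%E -> isLp p v.
Proof. by move=> p0 mv h; split => //; rewrite Np_Lp//; exact: poweR_lty. Qed.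

Lemma measurable_normc_powR p v : cmeas v -> measurable_fun setT (fun x => (normc (v x) `^ p)%:E).
Proof.
move=> mv; apply/measurable_EFinP.
by apply: (measurableT_comp (measurable_powR p)); exact: cmeas_normc.
Qed.

Lemma le_Np p f g : 0 <= p -> cmeas f -> cmeas g -> (forall x, normc (f x) <= normc (g x)) ->
  (Np p f <= Np p g)%E.
Proof.
move=> p0 mf mg fg; apply: ge0_le_integral => //.
- by move=> x _; rewrite lee_fin powR_ge0.
- exact: measurable_normc_powR.
- exact: measurable_normc_powR.
- by move=> x _; rewrite lee_fin ge0_ler_powR// nnegrE normc_ge0.
Qed.

Lemma Lp_of_Np p (f v : E -> R[i]) (C : R) : 0 < p -> 0 <= C ->
  (Np p f <= (C `^ p)%:E * Np p v)%E -> (Lp p f <= C%:E * Lp p v)%E.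
Proof.
move=> p0 C0 h; rewrite !LpE.
apply: le_trans (_ : ((C `^ p)%:E * Np p v) `^ p^-1 <= _)%E.
  apply: gt0_ler_poweR => //.
  - by rewrite invr_ge0 ltW.
  - by rewrite in_itv/= leey andbT; exact: Np_ge0.
  - by rewrite in_itv/= leey andbT mule_ge0 ?Np_ge0// lee_fin powR_ge0.
rewrite poweRM ?Np_ge0 ?lee_fin ?powR_ge0//.
by rewrite poweR_EFin -powRrM mulfV ?gt_eqF// powRr1.
Qed.

Lemma le_Lp p f g : 0 < p -> cmeas f -> cmeas g -> (forall x, normc (f x) <= normc (g x)) ->
  (Lp p f <= Lp p g)%E.
Proof.
move=> p0 mf mg fg; rewrite -[leRHS]mul1e; apply: Lp_of_Np => //.
by rewrite powR1 mul1e; apply: le_Np => //; exact: ltW.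
Qed.

Lemma LpD p f g : 1 <= p -> cmeas f -> cmeas g ->
  (Lp p (fun x => f x + g x)%R <= Lp p f + Lp p g)%E.
Proof.
move=> p1 mf mg.
have p0 : 0 < p by exact: lt_le_trans p1.
have := @minkowski_EFin _ _ R (leb n) (fun x => normc (f x)) (fun x => normc (g x)) p (cmeas_normc mf) (cmeas_normc mg) p1.
apply: le_trans.
have mN : cmeas (fun x => (normc (f x) + normc (g x))%:C).
  by apply: cmeas_real; apply: measurable_funD; exact: cmeas_normc.
apply: le_trans (_ : Lp p (fun x => (normc (f x) + normc (g x))%:C) <= _)%E.
  apply: le_Lp => //; first exact: cmeasD.
  by move=> x; rewrite normc_real ger0_norm ?addr_ge0 ?normc_ge0// le_normcD.
rewrite /Lp le_eqVlt; apply/orP; left; apply/eqP; congr Lnorm; apply/funext => x.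
by rewrite normc_real ger0_norm ?addr_ge0 ?normc_ge0.
Qed.

Lemma LpZ p c f : 0 < p -> cmeas f -> Lp p (fun x => c * f x) = ((normc c)%:E * Lp p f)%E.
Proof.
move=> p0 mf; rewrite !LpE (_ : Np p _ = ((normc c `^ p)%:E * Np p f)%E).
  rewrite poweRM ?Np_ge0 ?lee_fin ?powR_ge0// poweR_EFin -powRrM mulfV ?gt_eqF//.
  by rewrite powRr1// normc_ge0.
rewrite /Np -ge0_integralZl//.
- by apply: eq_integral => x _; rewrite normcM powRM ?normc_ge0// EFinM.
- exact: measurable_normc_powR.
- by move=> x _; rewrite lee_fin powR_ge0.
- by rewrite lee_fin powR_ge0.
Qed.

Lemma LpN p f : 0 < p -> cmeas f -> Lp p (fun x => - f x) = Lp p f.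
Proof.
move=> p0 mf; rewrite /Lp; congr Lnorm; apply/funext => x; by rewrite normcN.
Qed.

Lemma isLpD p f g : 1 <= p -> isLp p f -> isLp p g -> isLp p (fun x => f x + g x).
Proof.
move=> p1 Lf Lg; have [mf _] := Lf; have [mg _] := Lg.
have p0 : 0 < p by exact: lt_le_trans p1.
apply: Lp_isLp; [by rewrite gt_eqF|exact: cmeasD|].
by apply: le_lt_trans (LpD p1 mf mg) _; apply: lte_add_pinfty; exact: isLp_fin.
Qed.

Lemma isLpZ p c f : 1 <= p -> isLp p f -> isLp p (fun x => c * f x).
Proof.
move=> p1 Lf; have [mf _] := Lf.
have p0 : 0 < p by exact: lt_le_trans p1.
apply: Lp_isLp; [by rewrite gt_eqF|exact: cmeasZ|].
rewrite LpZ//; apply: lte_mul_pinfty; [by rewrite lee_fin normc_ge0|by []|exact: isLp_fin].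
Qed.

Lemma isLpN p f : 1 <= p -> isLp p f -> isLp p (fun x => - f x).
Proof.
by move=> p1 /(isLpZ (-1) p1); under [X in isLp _ X -> _]eq_fun do rewrite mulN1r.
Qed.

Lemma isLpB p f g : 1 <= p -> isLp p f -> isLp p g -> isLp p (fun x => f x - g x).
Proof. by move=> p1 Lf Lg; exact: (isLpD p1 Lf (isLpN p1 Lg)). Qed.

Lemma isLp0 p : 0 < p -> isLp p (fun=> 0).
Proof.
move=> p0; split; first exact: cmeas_cst.
rewrite /Np integral0_eq ?ltry// => x _.
by rewrite normcr0 powR0// gt_eqF.
Qed.

Lemma Np1 v : Np 1 v = inorm v.
Proof. by apply: eq_integral => x _; rewrite powRr1// normc_ge0. Qed.

Lemma Lp1 v : Lp 1 v = inorm v.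
Proof. by rewrite LpE Np1 invr1 poweRe1// inorm_ge0. Qed.

Lemma isLp1 v : isLp 1 v <-> L1 v.
Proof. by rewrite /isLp /L1 Np1. Qed.

Lemma le_1powR p (t : R) : 1 <= p -> 0 <= t -> t <= 1 + t `^ p.
Proof.
move=> p1 t0; have [t1|t1] := leP t 1.
  by apply: le_trans t1 _; rewrite lerDl powR_ge0.
by apply: le_trans (le1r_powR (ltW t1) p1) _; rewrite lerDr.
Qed.

(** From t <= 1 + t^p, with the integrable weight for the first term and the weight at most 1 for
    the second. *)
Lemma isLp_Lw p v : 1 <= p -> isLp p v -> Lw v.
Proof.
move=> p1 [mv vi]; split.
  by apply: cmeasM => //; apply: cmeas_real; exact: measurable_bell.
apply: le_lt_trans (_ : (\int[leb n]_x ((bell x)%:E + (normc (v x) `^ p)%:E) < +oo)%E).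
  apply: ge0_le_integral => //.
  - by move=> x _; rewrite lee_fin normc_ge0.
  - apply: cmeas_EFin_normc; apply: cmeasM => //; apply: cmeas_real; exact: measurable_bell.
  - apply: emeasurable_funD; last exact: measurable_normc_powR.
    by apply/measurable_EFinP; exact: measurable_bell.
  move=> x _; rewrite -EFinD lee_fin normcM normc_real ger0_norm ?bell_ge0//.
  apply: le_trans (_ : bell x * (1 + normc (v x) `^ p) <= _).
    by rewrite ler_wpM2l ?bell_ge0// le_1powR// normc_ge0.
  by rewrite mulrDr mulr1 lerD2l ler_piMl ?powR_ge0 ?bell_le1.
rewrite ge0_integralD//.
- by apply: lte_add_pinfty => //; exact: integral_bell_lty.
- by move=> x _; rewrite lee_fin bell_ge0.
- by apply/measurable_EFinP; exact: measurable_bell.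
- by move=> x _; rewrite lee_fin powR_ge0.
- exact: measurable_normc_powR.
Qed.

Lemma decay_isLp p f (C : R) : 1 <= p -> cmeas f -> (forall x, normc (f x) <= C * bell x) -> isLp p f.
Proof.
move=> p1 mf fC; split => //.
have C0 : 0 <= C.
  by rewrite -(pmulr_lge0 _ (bell_gt0 (0 : E))); apply: le_trans (fC 0); exact: normc_ge0.
apply: le_lt_trans (_ : (\int[leb n]_x ((C `^ p)%:E * (bell x)%:E) < +oo)%E).
  apply: ge0_le_integral => //.
  - by move=> x _; rewrite lee_fin powR_ge0.
  - exact: measurable_normc_powR.
  - by apply/measurable_EFinP; apply: measurable_funM => //; exact: measurable_bell.
  move=> x _; rewrite -EFinM lee_fin.
  apply: le_trans (_ : (C * bell x) `^ p <= _).
    rewrite ge0_ler_powR ?nnegrE ?normc_ge0 ?mulr_ge0 ?bell_ge0//.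
    exact: le_trans p1.
  rewrite powRM ?bell_ge0// ler_wpM2l ?powR_ge0// ge1r_powR// bell_gt0/=; exact: bell_le1.
rewrite ge0_integralZl//.
- by apply: lte_mul_pinfty => //; [rewrite lee_fin powR_ge0|exact: integral_bell_lty].
- by apply/measurable_EFinP; exact: measurable_bell.
- by move=> x _; rewrite lee_fin bell_ge0.
- by rewrite lee_fin powR_ge0.
Qed.

Lemma schw_isLp p f : 1 <= p -> schw f -> isLp p f.
Proof.
move=> p1 sf; have [C C0 hC] := schw_bound (2 * n) sf.
by apply: (@decay_isLp _ _ C) => [//||x]; [exact: schw_cmeas|exact: wt_bell].
Qed.

(** Hölder's inequality for the splitting |k| |v| = (|k|^(1/p) |v|) |k|^(1/q), q the conjugate
    exponent. The factor 2^p is the price of [normc_cintegral]. *)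
Lemma young_pt p k v x : 1 <= p -> schw k -> isLp p v ->
  ((normc (conv k v x) `^ p)%:E <= (2 `^ p * rnorm k `^ (p - 1))%:E *
    \int[leb n]_y (normc (k (x - y)) * normc (v y) `^ p)%:E)%E.
Proof.
move=> p1 sk Lv; have [mv _] := Lv; have Lk := schw_L1 sk.
have Lwv := isLp_Lw p1 Lv; have p0 : 0 < p by exact: lt_le_trans p1.
have h := normc_cintegral (conv_L1 x sk Lwv).
have mk : cmeas (fun y : E => k (x - y)) by apply: schw_cmeas; exact: schw_conv_arg.
have rkE : inorm (fun y : E => k (x - y)) = (rnorm k)%:E.
  have nz : (-1 : R) != 0 by rewrite oppr_eq0 oner_eq0.
  rewrite -inormE//; have [mk0 _] := Lk.
  have := inorm_affine x nz mk0; rewrite normrN normr1 expr1n invr1 mul1e => <-.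
  by congr inorm; apply/funext => y; rewrite scaleN1r addrC.
have key : (inorm (fun y : E => k (x - y) * v y)%R `^ p <=
    (rnorm k `^ (p - 1))%:E * \int[leb n]_y (normc (k (x - y)) * normc (v y) `^ p)%:E)%E.
  (* At p = 1 the conjugate exponent is infinite, and the bound is an equality. *)
  move: p1; rewrite le_eqVlt => /predU1P[<-|p1].
    rewrite subrr powRr0 mul1e poweRe1 ?inorm_ge0// le_eqVlt; apply/orP; left; apply/eqP.
    by apply: eq_integral => y _; rewrite normcM powRr1// normc_ge0.
  pose q := p / (p - 1).
  have q0 : 0 < q by rewrite divr_gt0// subr_gt0.
  have pq : p^-1 + q^-1 = 1 by rewrite /q; field; rewrite !gt_eqF// ?subr_gt0.
  pose a (y : E) := normc (k (x - y)) `^ p^-1 * normc (v y).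
  pose b (y : E) := normc (k (x - y)) `^ q^-1.
  have ma : measurable_fun setT a.
    apply: measurable_funM; last exact: cmeas_normc.
    by apply: (measurableT_comp (measurable_powR p^-1)); exact: cmeas_normc.
  have mb : measurable_fun setT b.
    by apply: (measurableT_comp (measurable_powR q^-1)); exact: cmeas_normc.
  have := hoelder (leb n) ma mb p0 q0 pq; rewrite Lnorm1 => H.
  have -> : inorm (fun y : E => k (x - y) * v y)%R = (\int[leb n]_y `|((a \* b) y)%:E|)%E.
    apply: eq_integral => y _; rewrite abse_EFin ger0_norm ?mulr_ge0 ?powR_ge0 ?normc_ge0//.
    rewrite normcM /= /a /b mulrAC; congr (_ * _)%:E.
    rewrite -powRD; last by rewrite pq oner_eq0.
    by rewrite pq powRr1// normc_ge0.
  apply: le_trans (_ : ((Lnorm (leb n) p%:E (EFin \o a)) * (Lnorm (leb n) q%:E (EFin \o b))) `^ p <= _)%E.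
    apply: gt0_ler_poweR => //; first exact: ltW.
    - by rewrite in_itv/= leey andbT integral_ge0.
    - by rewrite in_itv/= leey andbT mule_ge0 ?Lnorm_ge0.
  rewrite poweRM ?Lnorm_ge0// powR_Lnorm ?gt_eqF// muleC.
  have -> : (Lnorm (leb n) q%:E (EFin \o b) `^ p = (rnorm k `^ (p - 1))%:E)%E.
    rewrite unlock /Lnorm.
    have -> : (\int[leb n]_y (`|(EFin \o b) y| `^ q) = (rnorm k)%:E)%E.
      rewrite -rkE; apply: eq_integral => y _; rewrite abse_EFin ger0_norm ?powR_ge0//.
      by rewrite poweR_EFin -powRrM mulVf ?gt_eqF// powRr1// normc_ge0.
    rewrite !poweR_EFin -powRrM; congr (_ `^ _)%:E; rewrite /q; field.
    by rewrite !gt_eqF// subr_gt0.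
  rewrite lee_wpmul2l ?lee_fin ?powR_ge0// le_eqVlt; apply/orP; left; apply/eqP.
  apply: eq_integral => y _; rewrite abse_EFin ger0_norm ?mulr_ge0 ?powR_ge0 ?normc_ge0//.
  rewrite poweR_EFin /a powRM ?powR_ge0 ?normc_ge0// -powRrM mulVf ?gt_eqF//.
  by rewrite powRr1// normc_ge0.
rewrite EFinM -muleA; apply: le_trans (_ : (2%:E * inorm (fun y : E => (k (x - y) * v y)%R)) `^ p <= _)%E.
  rewrite -poweR_EFin; apply: gt0_ler_poweR => //; first exact: ltW.
  - apply/andP; split; [exact: normc_ge0|exact: leey].
  - apply/andP; split; [exact: mule_ge0 (inorm_ge0 _)|exact: leey].
rewrite poweRM ?inorm_ge0// poweR_EFin lee_wpmul2l// lee_fin powR_ge0//.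
Qed.

(** The pointwise bound is integrated; Tonelli and translation invariance turn the double integral
    into the product of the norms. *)
Lemma young_Np p k v : 1 <= p -> schw k -> isLp p v ->
  (Np p (conv k v) <= ((2 * rnorm k) `^ p)%:E * Np p v)%E.
Proof.
move=> p1 sk Lv; have [mv _] := Lv; have p0 : 0 < p by exact: lt_le_trans p1.
have Lwv := isLp_Lw p1 Lv; have [mk _] := schw_L1 sk.
pose F (z : E * E) := (normc (k (z.1 - z.2)) * normc (v z.2) `^ p)%:E.
have mF : measurable_fun setT F.
  apply/measurable_EFinP; apply: measurable_funM.
    by apply: (measurableT_comp (cmeas_normc mk)); exact: measurable_sub_rV.
  apply: (measurableT_comp (measurable_powR p)).
  exact: (measurableT_comp (cmeas_normc mv) measurable_snd_rV).
have F0 z : (0 <= F z)%E by rewrite lee_fin mulr_ge0 ?normc_ge0 ?powR_ge0.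
apply: le_trans (_ : (\int[leb n]_x ((2 `^ p * rnorm k `^ (p - 1))%:E * \int[leb n]_y F (x, y)) <= _)%E).
  apply: ge0_le_integral => //.
  - by move=> x _; rewrite lee_fin powR_ge0.
  - by apply: measurable_normc_powR; exact: cmeas_conv.
  - apply: emeasurable_funM => //.
    exact: (measurable_fun_fubini_tonelli_F (m2 := leb n) F mF F0).
  - by move=> x _; apply: young_pt.
rewrite ge0_integralZl//; last 3 first.
- exact: (measurable_fun_fubini_tonelli_F (m2 := leb n) F mF F0).
- by move=> x _; apply: integral_ge0.
- by rewrite lee_fin mulr_ge0 ?powR_ge0.
rewrite (ge0_fubini mF F0).
have -> : (\int[leb n]_y \int[leb n]_x F (x, y) = (rnorm k)%:E * Np p v)%E.
  rewrite /Np -ge0_integralZl//; last 3 first.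
  - exact: measurable_normc_powR.
  - by move=> x _; rewrite lee_fin powR_ge0.
  - by rewrite lee_fin rnorm_ge0.
  apply: eq_integral => y _.
  rewrite -inormE; last exact: schw_L1.
  have := inorm_affine (- y) (oner_neq0 R) mk; rewrite normr1 expr1n invr1 mul1e => <-.
  rewrite muleC /inorm -ge0_integralZl//.
  - by apply: eq_integral => x _; rewrite /F /= scale1r EFinM muleC.
  - by apply: cmeas_EFin_normc; apply: cmeas_affine.
  - by move=> x _; rewrite lee_fin normc_ge0.
  - by rewrite lee_fin powR_ge0.
rewrite muleA -EFinM lee_wpmul2r ?Np_ge0// lee_fin.
rewrite -mulrA [_ `^ (p - 1) * _]mulrC mulr_powRB1 ?rnorm_ge0//.
by rewrite -powRM ?rnorm_ge0.
Qed.

Lemma young p k v : 1 <= p -> schw k -> isLp p v ->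
  (Lp p (conv k v) <= (2 * rnorm k)%:E * Lp p v)%E.
Proof.
move=> p1 sk Lv; apply: Lp_of_Np; [exact: lt_le_trans p1| |exact: young_Np].
by rewrite mulr_ge0// rnorm_ge0.
Qed.

Lemma isLp_conv p k v : 1 <= p -> schw k -> isLp p v -> isLp p (conv k v).
Proof.
move=> p1 sk Lv; apply: Lp_isLp.
- by rewrite gt_eqF//; exact: lt_le_trans p1.
- by apply: cmeas_conv => //; exact: isLp_Lw Lv.
apply: le_lt_trans (young p1 sk Lv) _; apply: lte_mul_pinfty => //; last exact: isLp_fin.
by rewrite lee_fin mulr_ge0// rnorm_ge0.
Qed.

End Lp_theory.

Import HBSimple HBNNSimple.

(** * Limits in L^p and an induction principle for L^p functions *)

Section Lp_limits.
Context {R : realType} {n : nat}.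
Local Notation E := 'rV[R]_n.
Implicit Types (f g v : E -> R[i]) (p : R).

Lemma le_normcB (z w : R[i]) : normc (z - w) <= normc z + normc w.
Proof. by rewrite -(normcN w); exact: le_normcD. Qed.

Lemma Np_Lp_le p f (e : R) : 0 < p -> 0 <= e -> (Np p f <= (e `^ p)%:E)%E -> (Lp p f <= e%:E)%E.
Proof.
move=> p0 e0 h; rewrite LpE; apply: le_trans (_ : (e `^ p)%:E `^ p^-1 <= _)%E.
  apply: gt0_ler_poweR => //.
  - by rewrite invr_ge0 ltW.
  - by rewrite in_itv/= leey andbT; exact: Np_ge0.
  - by rewrite in_itv/= leey andbT lee_fin powR_ge0.
by rewrite poweR_EFin -powRrM mulfV ?gt_eqF// powRr1.
Qed.

(** Dominated convergence for the p-th powers |f - F_k|^p, with majorant |2 G|^p. *)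
Lemma Lp_dct p (F : nat -> E -> R[i]) f (G : E -> R[i]) : 1 <= p ->
  (forall k, cmeas (F k)) -> cmeas f -> isLp p G ->
  (forall k x, normc (F k x) <= normc (G x)) -> (forall x, normc (f x) <= normc (G x)) ->
  (forall x e, 0 < e -> exists K, forall k, (K <= k)%N -> normc (f x - F k x) <= e) ->
  forall e, 0 < e -> exists K, forall k, (K <= k)%N -> (Lp p (fun x => (f x - F k x)%R) <= e%:E)%E.
Proof.
move=> p1 mF mf LG FG fG FF e e0; have p0 : 0 < p by exact: lt_le_trans p1.
have [mG NG] := LG.
pose T (k : nat) (x : E) : \bar R := (normc (f x - F k x) `^ p)%:E.
pose g (x : E) : \bar R := (normc (2%:C * G x) `^ p)%:E.
have m2G : cmeas (fun x => 2%:C * G x) by exact: cmeasZ.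
have ig : (leb n).-integrable setT g.
  apply/integrableP; split; first exact: measurable_normc_powR.
  have [_ h] := isLpZ 2%:C p1 LG; apply: le_lt_trans h; rewrite le_eqVlt; apply/orP; left; apply/eqP.
  by apply: eq_integral => x _; rewrite abse_EFin ger0_norm ?powR_ge0.
have cT (x : E) : T k x @[k --> \oo] --> 0%E.
  apply/fine_cvgP; split; first by near=> k.
  apply/cvgrPdist_le => /= d d0.
  have [K hK] := FF x (Num.min d 1) ltac:(by rewrite lt_min d0 ltr01).
  near=> k; rewrite sub0r normrN /T /= ger0_norm ?powR_ge0//.
  have /hK : (K <= k)%N by near: k; exact: nbhs_infty_ge.
  rewrite le_min => /andP[h1 h2]; apply: le_trans h1.
  have [->|nz] := eqVneq (normc (f x - F k x)) 0; first by rewrite powR0// gt_eqF.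
  by rewrite ge1r_powR// h2 andbT lt_def nz normc_ge0.
have Tg (k : nat) (x : E) : setT x -> (`|T k x| <= g x)%E.
  move=> _; rewrite abse_EFin ger0_norm ?powR_ge0// lee_fin ge0_ler_powR ?nnegrE ?normc_ge0//; first exact: ltW.
  apply: le_trans (le_normcB _ _) _; rewrite normcM.
  rewrite normc_real ger0_norm//.
  by rewrite mulr_natl mulr2n lerD// ?fG ?FG.
have mT (k : nat) : measurable_fun setT (T k).
  by apply: measurable_normc_powR; apply: cmeasB.
have gfin (x : E) : setT x -> g x \is a fin_num by [].
have := dominated_cvg measurableT mT (fun x _ => cT x) gfin ig Tg.
rewrite integral0 => /fine_cvgP[finN /cvgrPdist_le].
move=> /(_ (e `^ p) (powR_gt0 _ e0))/= hN.
have [K _ hK] : \forall k \near \oo, (Lp p (fun x => (f x - F k x)%R) <= e%:E)%E.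
  near=> k; apply: Np_Lp_le => //; first exact: ltW.
  have fk : Np p (fun x => f x - F k x) \is a fin_num by near: k.
  rewrite -(fineK fk) lee_fin.
  have : `|0 - fine (Np p (fun x => f x - F k x))| <= e `^ p by near: k.
  by rewrite sub0r normrN ger0_norm// fine_ge0// Np_ge0.
by exists K => k; exact: hK.
Unshelve. all: by end_near. Qed.

Section principle.
Variable phi : E -> R.
Hypothesis hphi : LP_cutoff phi.

Definition theta (k : nat) : E -> R := fun x => phi (k.+1%:R^-1 *: x).

Lemma schw_theta k : schw (fun x => (theta k x)%:C).
Proof. by apply: (@schw_scale _ _ _ (cphi phi)) (schw_cphi hphi); rewrite invr_neq0. Qed.

Lemma theta_bound : exists2 C : R, 1 <= C & forall k x, 0 <= theta k x <= C.
Proof.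
have [C C0 hC] := schw_bound 0 (schw_cphi hphi); exists C.
  by have := hC 0; rewrite expr0 mul1r cphi0// normcr1.
move=> k x; rewrite (phi_ge0 hphi (_ *: x))/=; have := hC (k.+1%:R^-1 *: x).
by rewrite expr0 mul1r normc_real ger0_norm// (phi_ge0 hphi).
Qed.

Lemma theta_eq1 x : exists K, forall k, (K <= k)%N -> theta k x = 1.
Proof.
exists (Num.truncn (2 * enorm x)) => k hk; apply: (phi_eq1 hphi).
rewrite enormZ ger0_norm ?invr_ge0// mulrC ltr_pdivrMr//.
have : 2 * enorm x < k.+1%:R by apply: lt_le_trans (truncnS_gt _) _; rewrite ler_nat.
by have := enorm_ge0 x; lra.
Qed.

Lemma theta_Lp p v : 1 <= p -> isLp p v -> forall e, 0 < e -> exists K, forall k, (K <= k)%N ->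
  (Lp p (fun x => (v x - (theta k x)%:C * v x)%R) <= e%:E)%E.
Proof.
move=> p1 Lv; have [C C1 hC] := theta_bound; have [mv _] := Lv.
have C0 : 0 <= C by exact: le_trans C1.
apply: (Lp_dct (G := fun x => C%:C * v x)) => //.
- by move=> k; apply: cmeasM => //; apply: schw_cmeas; exact: schw_theta.
- exact: isLpZ.
- move=> k x; rewrite !normcM !normc_real ler_wpM2r ?normc_ge0//.
  by have /andP[h1 h2] := hC k x; rewrite !ger0_norm.
- by move=> x; rewrite normcM normc_real ger0_norm// ler_peMl ?normc_ge0.
move=> x e e0; have [K hK] := theta_eq1 x; exists K => k /hK ->.
by rewrite mul1r subrr normcr0 ltW.
Qed.

(** Lipschitz functions with values in [0,1]: stable under products, hence fit for a pi-system, and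
    regular enough for an explicit mollification rate once multiplied by a cutoff. *)
Definition lipc (h : E -> R) := [/\ measurable_fun setT h, forall x, 0 <= h x <= 1 &
  exists2 L, 0 <= L & forall x y, `|h x - h y| <= L * onorm (x - y)].

Lemma lipcM (h1 h2 : E -> R) : lipc h1 -> lipc h2 -> lipc (fun x => h1 x * h2 x).
Proof.
move=> [m1 b1 [L1 L10 H1]] [m2 b2 [L2 L20 H2]]; split; first exact: measurable_funM.
  move=> x; have /andP[? ?] := b1 x; have /andP[? ?] := b2 x.
  by rewrite mulr_ge0//= mulr_ile1.
exists (L1 + L2); [exact: addr_ge0|move=> x y].
rewrite (_ : h1 x * h2 x - h1 y * h2 y = (h1 x - h1 y) * h2 x + h1 y * (h2 x - h2 y)); last by ring.
apply: le_trans (ler_normD _ _) _; rewrite [leRHS]mulrDl !normrM lerD//.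
  rewrite -[leRHS]mulr1; apply: ler_pM => //.
  by have /andP[? ?] := b2 x; rewrite ger0_norm.
rewrite -[leRHS]mul1r; apply: ler_pM => //.
by have /andP[? ?] := b1 y; rewrite ger0_norm.
Qed.

Lemma lipc1 : lipc (fun=> 1).
Proof.
split=> [|x|]; [exact: measurable_cst|by rewrite ler01 lexx|exists 0 => // x y].
by rewrite subrr normr0 mul0r.
Qed.

Lemma lipc_ray (i : 'I_n) (a : R) (k : nat) :
  lipc (fun x => Num.min 1 (Num.max 0 (k%:R * (x ord0 i - a)))).
Proof.
split=> [|x|].
- apply: measurable_minr; first exact: measurable_cst.
  apply: measurable_maxr; first exact: measurable_cst.
  apply: measurable_funM; first exact: measurable_cst.
  by apply: measurable_funB; [exact: measurable_coord_rV|exact: measurable_cst].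
- by rewrite le_min ler01 le_max lexx/= ge_min lexx.
exists k%:R => // x y.
have : `|k%:R * (x ord0 i - a) - k%:R * (y ord0 i - a)| <= k%:R * onorm (x - y).
  rewrite -mulrBr normrM ger0_norm// ler_wpM2l//.
  rewrite (_ : _ - _ = (x - y) ord0 i); first exact: coord_le_onorm.
  by rewrite !mxE; ring.
apply: le_trans; move: (k%:R * _) (k%:R * _) => s t.
rewrite /Num.min /Num.max.
case: (ltP 0 t) => ht; case: (ltP 0 s) => hs; case: (ltP 1 t) => h1; case: (ltP 1 s) => h2; rewrite ?ltr10;
  by rewrite ler_norml; case: (ger0P (t - s)) => ?; lra.
Qed.

(** Sets whose indicator is, at each point, eventually equal to the terms of a sequence of [lipc]
    functions. They form a pi-system, and coordinate rays belong to it, so it generates the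
    sigma-algebra. *)
Definition lip_sets : set (set E) := [set A | measurable A /\ exists h : nat -> E -> R,
  (forall k, lipc (h k)) /\ forall x, exists K, forall k, (K <= k)%N -> h k x = \1_A x].

Lemma lip_sets_setI : setI_closed lip_sets.
Proof.
move=> A B [mA [h [lh hA]]] [mB [g [lg gB]]]; split; first exact: measurableI.
exists (fun k x => h k x * g k x); split=> [k|x]; first exact: lipcM.
have [K1 H1] := hA x; have [K2 H2] := gB x; exists (maxn K1 K2) => k.
by rewrite geq_max => /andP[/H1-> /H2->]; rewrite indicI.
Qed.

Lemma lip_sets_ray (i : 'I_n) (a : R) : lip_sets (coord_rV i @^-1` `]a, +oo[).
Proof.
split.
  by rewrite -[X in measurable X]setTI; apply: measurable_coord_rV.
exists (fun k x => Num.min 1 (Num.max 0 (k%:R * (x ord0 i - a)))).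
split=> [k|x]; first exact: lipc_ray.
have [xa|xa] := ltP a (x ord0 i).
  exists (Num.truncn (x ord0 i - a)^-1).+1 => k hk.
  rewrite indicE mem_set; last by rewrite /coord_rV /= in_itv/= xa.
  have h : 1 <= k%:R * (x ord0 i - a).
    rewrite -ler_pdivrMr ?subr_gt0// div1r; apply: le_trans (ltW (truncnS_gt _)) _.
    by rewrite ler_nat.
  by rewrite (max_idPr _) ?(le_trans ler01)//; apply/min_idPl.
exists 0%N => k _; rewrite indicE memNset; last first.
  by rewrite /coord_rV /= in_itv/= andbT; apply/negP; rewrite -leNgt.
rewrite (max_idPl _) ?(min_idPr _)//.
by rewrite mulr_ge0_le0// subr_le0.
Qed.

Lemma measurable_lip_sets : (@measurable _ E) = <<s lip_sets >>.
Proof.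
apply/seteqP; split=> A.
  apply: smallest_sub; first exact: smallest_sigma_algebra.
  rewrite -bigcup_seq => _ [i _] [B mB <-]; rewrite setTI.
  have : <<s @RGenOInfty.G R >> B by move: mB; rewrite (RGenOInfty.measurableE R).
  apply: (@smallest_sub _ (sigma_algebra setT) _ [set C | <<s lip_sets >> (coord_rV i @^-1` C)]); last first.
    by move=> _ [a ->]; apply: sub_sigma_algebra; exact: lip_sets_ray.
  split.
  - by rewrite /= preimage_set0; exact: sigma_algebra0.
  - by move=> C hC; rewrite /= setTD preimage_setC; exact: sigma_algebraC.
  - by move=> F hF; rewrite /= preimage_bigcup; apply: sigma_algebra_bigcup.
apply: smallest_sub; first exact: sigma_algebra_measurable.
by move=> B [].
Qed.

Section induction.
Variables (p : R) (P : (E -> R[i]) -> Prop).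
Hypothesis p1 : 1 <= p.
Hypothesis Plin : forall c f g, isLp p f -> isLp p g -> P f -> P g -> P (fun x => c * f x + g x).
Hypothesis Plim : forall f, isLp p f ->
  (forall e, 0 < e -> exists g, [/\ isLp p g, P g & (Lp p (fun x => (f x - g x)%R) <= e%:E)%E]) -> P f.
Hypothesis Plip : forall h k, lipc h -> P (fun x => (h x)%:C * (theta k x)%:C).

Lemma isLp_theta k : isLp p (fun x => (theta k x)%:C).
Proof. by apply: schw_isLp => //; exact: schw_theta. Qed.

Lemma isLp_bounded_theta (b : E -> R) k : measurable_fun setT b -> (forall x, 0 <= b x <= 1) ->
  isLp p (fun x => (b x)%:C * (theta k x)%:C).
Proof.
move=> mb hb; have [mt nt] := isLp_theta k.
have mbt : cmeas (fun x => (b x)%:C * (theta k x)%:C) by apply: cmeasM => //; exact: cmeas_real.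
split; first exact: mbt.
apply: le_lt_trans nt; apply: (le_Np (le_trans ler01 p1) mbt mt).
move=> x; rewrite normcM normc_real; have /andP[h0 h1] := hb x.
by rewrite ger0_norm// ler_piMl ?normc_ge0.
Qed.

Lemma Plim_dct (F : nat -> E -> R) (f : E -> R) k :
  (forall j, measurable_fun setT (F j)) -> measurable_fun setT f ->
  (forall j x, 0 <= F j x <= 1) -> (forall x, 0 <= f x <= 1) ->
  (forall x, exists J, forall j, (J <= j)%N -> F j x = f x) ->
  (forall j, P (fun x => (F j x)%:C * (theta k x)%:C)) -> P (fun x => (f x)%:C * (theta k x)%:C).
Proof.
move=> mF mf F1 f1 Ff PF.
have le1 (b : E -> R) (x : E) : 0 <= b x <= 1 -> normc ((b x)%:C * (theta k x)%:C) <= normc (theta k x)%:C.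
  by move=> /andP[h0 h1]; rewrite normcM normc_real ger0_norm// ler_piMl ?normc_ge0.
apply: Plim; first exact: isLp_bounded_theta.
move=> e e0; have [||||x d d0|J hJ] := Lp_dct (F := fun j x => (F j x)%:C * (theta k x)%:C)
  (f := fun x => (f x)%:C * (theta k x)%:C) p1 _ _ (isLp_theta k) _ _ _ e0.
- by move=> j; apply: (isLp_bounded_theta k (mF j) (F1 j)).1.
- exact: (isLp_bounded_theta k mf f1).1.
- by move=> j x; exact: le1.
- by move=> x; exact: le1.
- by have [J hJ] := Ff x; exists J => j /hJ->; rewrite subrr normcr0 ltW.
exists (fun x => (F J x)%:C * (theta k x)%:C); split; [exact: isLp_bounded_theta|exact: PF|exact: hJ].
Qed.

(** Dynkin's theorem on the pi-system [lip_sets]. The factor [theta k] keeps all functions in L^p,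
    so that complements and countable disjoint unions are handled by linearity and dominated
    convergence. *)
Lemma P_indic A k : measurable A -> P (fun x => (\1_A x)%:C * (theta k x)%:C).
Proof.
have i01 (B : set E) x : 0 <= (\1_B x : R) <= 1 by rewrite indicE ler0n lern1 leq_b1.
rewrite measurable_lip_sets; apply: (dynkin_induction (P := fun A => P (fun x => (\1_A x)%:C * (theta k x)%:C))).
- exact: measurable_lip_sets.
- exact: lip_sets_setI.
- rewrite indicT; exact: (Plip k lipc1).
- move=> B [mB [h [lh hB]]]; apply: (Plim_dct (F := h)) => //.
  + by move=> j; have [] := lh j.
  + by move=> j; have [] := lh j.
  + by move=> j; exact: Plip.
- move=> B mB PB.
  have := Plin (-1) (isLp_bounded_theta k (measurable_indic mB) (i01 B)) (isLp_theta k) PB.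
  have -> : (fun x => (\1_(~` B) x)%:C * (theta k x)%:C) =
      fun x => -1 * ((\1_B x)%:C * (theta k x)%:C) + (theta k x)%:C.
    by apply/funext => x; rewrite !indicE in_setC; case: (x \in B) => /=; ring.
  apply; have := Plip k lipc1; by under eq_fun do rewrite mul1r.
move=> F mF tF PF.
have mU N : measurable (\bigcup_(i < N) F i) by apply: bigcup_measurable.
apply: (Plim_dct (F := fun N => \1_(\bigcup_(i < N) F i))) => //.
- by apply: measurable_indic; exact: bigcup_measurable.
- move=> x; have [[m _ Fm]|nF] := pselect ((\bigcup_k F k) x).
    exists m.+1 => j mj; rewrite !indicE !mem_set//; first by exists m.
    by exists m.
  exists 0%N => j _; rewrite !indicE !memNset// => -[m _ Fm]; apply: nF; by exists m.
elim=> [|N IH].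
  have := Plin (-1) (isLp_theta k) (isLp_theta k).
  have -> : (fun x => (\1_(\bigcup_(i < 0) F i) x)%:C * (theta k x)%:C) =
      fun x => -1 * (theta k x)%:C + (theta k x)%:C.
    apply/funext => x; rewrite indicE memNset ?mul0r; last by case.
    by ring.
  have h := Plip k lipc1; rewrite (_ : (fun x => _) = fun x => (theta k x)%:C) in h; first exact.
  by apply/funext => x; rewrite mul1r.
have := Plin 1 (isLp_bounded_theta k (measurable_indic (mU N)) (i01 _)) (isLp_bounded_theta k (measurable_indic (mF N)) (i01 _)) IH (PF N).
congr P; apply/funext => x; rewrite mul1r -mulrDl; congr (_ * _).
rewrite -rmorphD/= !indicE -natrD; congr (_%:R)%:C.
have [FN|nFN] := pselect (F N x).
  rewrite (mem_set FN) (@mem_set _ (\bigcup_(i < N.+1) F i)); last by exists N => /=.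
  rewrite memNset// => -[m /= mN Fm].
  by have mE := tF m N I I (ex_intro _ x (conj Fm FN)); rewrite mE ltnn in mN.
rewrite (memNset nFN) addn0; congr nat_of_bool.
apply/idP/idP => /set_mem [m /= mN Fm]; apply/mem_set; exists m => //=; first exact: ltnW.
rewrite ltn_neqAle -ltnS mN andbT; apply/eqP => mE; by rewrite mE in Fm.
Qed.

(** The simple approximations and the cutoffs advance together, along the diagonal; [C] times [v]
    dominates all the products. *)
Lemma P_real (v : E -> R) : measurable_fun setT v -> (forall x, 0 <= v x) ->
  isLp p (fun x => (v x)%:C) -> P (fun x => (v x)%:C).
Proof.
move=> mv v0 Lv; have [C C1 hC] := theta_bound.
have C0 : 0 <= C by exact: le_trans C1.
have mEv : measurable_fun setT (EFin \o v) by exact/measurable_EFinP.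
pose g j := nnsfun_approx measurableT mEv j.
have cg x : g j x @[j --> \oo] --> v x.
  have := @cvg_nnsfun_approx _ _ R _ measurableT _ mEv (fun y _ => v0 y) x I.
  by move/fine_cvg.
have gv j x : g j x <= v x.
  rewrite -(cvg_lim (@Rhausdorff R) (cg x)).
  apply: (@nondecreasing_cvgn_le _ (fun j => g j x)); last by apply/cvg_ex; exists (v x).
  by move=> a b ab; apply/lefP: x; exact: nd_nnsfun_approx.
have g0 j x : 0 <= g j x by exact: fun_ge0.
have Pg j k : P (fun x => (g j x)%:C * (theta k x)%:C).
  have Psum (r : seq R) : isLp p (fun x => (\sum_(y <- r) y * \1_(g j @^-1` [set y]) x)%:C * (theta k x)%:C) /\
      P (fun x => (\sum_(y <- r) y * \1_(g j @^-1` [set y]) x)%:C * (theta k x)%:C).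
    elim: r => [|y r [IL IP]].
      under eq_fun do rewrite big_nil mul0r; split; first by apply: isLp0; exact: lt_le_trans p1.
      have L := isLp_theta k; have Pt := P_indic k measurableT.
      have := Plin (-1) (isLp_bounded_theta k (measurable_indic measurableT) _) (isLp_bounded_theta k (measurable_indic measurableT) _) Pt Pt.
      have b01 (x : E) : 0 <= (\1_[set: E] x : R) <= 1 by rewrite indicE ler0n lern1 leq_b1.
      by move=> /(_ b01 b01); under eq_fun do rewrite mulN1r addNr.
    have mA : measurable (g j @^-1` [set y]) by exact: measurable_sfunP.
    have b01 (x : E) : 0 <= (\1_(g j @^-1` [set y]) x : R) <= 1 by rewrite indicE ler0n lern1 leq_b1.
    have L1 := isLp_bounded_theta k (measurable_indic mA) b01.
    have -> : (fun x => (\sum_(y <- y :: r) y * \1_(g j @^-1` [set y]) x)%:C * (theta k x)%:C) =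
        fun x => y%:C * ((\1_(g j @^-1` [set y]) x)%:C * (theta k x)%:C) +
          (\sum_(y <- r) y * \1_(g j @^-1` [set y]) x)%:C * (theta k x)%:C.
      by apply/funext => x; rewrite big_cons rmorphD rmorphM/= mulrDl mulrA.
    split; first exact: (isLpD p1 (isLpZ _ p1 L1) IL).
    exact: (Plin y%:C L1 IL (P_indic k mA) IP).
  have := (Psum (finmap.enum_fset (fset_set (range (g j))))).2.
  congr P; apply/funext => x; congr (_%:C * _).
  by rewrite [RHS](fimfunE (g j)) fsbig_finite//; exact: fimfunP.
have Lg j k : isLp p (fun x => (g j x)%:C * (theta k x)%:C).
  have mg : cmeas (fun x => (g j x)%:C * (theta k x)%:C).
    by apply: cmeasM; [apply: cmeas_real; exact: measurable_funP|apply: schw_cmeas; exact: schw_theta].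
  have [mC nC] := isLpZ C%:C p1 Lv; split; first exact: mg.
  apply: le_lt_trans nC; apply: (le_Np (le_trans ler01 p1) mg mC) => x.
  rewrite !normcM !normc_real mulrC; have /andP[h1 h2] := hC k x.
  by rewrite !ger0_norm ?v0 ?g0// ler_pM.
apply: Plim => // e e0.
have [||x d d0|J hJ] := Lp_dct (F := fun j x => (g j x)%:C * (theta j x)%:C) (f := fun x => (v x)%:C)
  p1 (fun j => (Lg j j).1) (cmeas_real mv) (isLpZ C%:C p1 Lv) _ _ _ e0.
- move=> j x; rewrite !normcM !normc_real mulrC; have /andP[h1 h2] := hC j x.
  by rewrite !ger0_norm ?v0 ?g0// ler_pM.
- by move=> x; rewrite normcM !normc_real !ger0_norm ?v0// ler_peMl.
- have [K1 h1] := theta_eq1 x.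
  have /cvgrPdist_le/(_ d d0)[K2 _ h2] := cg x.
  exists (maxn K1 K2) => j; rewrite geq_max => /andP[/h1 -> /h2 hd].
  by rewrite mulr1 -raddfB normc_real.
exists (fun x => (g J x)%:C * (theta J x)%:C); split; [exact: Lg|exact: Pg|exact: hJ].
Qed.

(** A property stable under linear combinations and L^p limits holds on L^p once it holds for
    Lipschitz functions times a cutoff: indicators first, then nonnegative real functions, then the
    positive and negative parts of both components. Its use is [mollify]. *)
Lemma Lp_ind v : isLp p v -> P v.
Proof.
move=> Lv; have [[mr mi] _] := Lv.
have real (u : E -> R) : measurable_fun setT u -> (forall x, `|u x| <= normc (v x)) -> isLp p (fun x => (u x)%:C) /\ P (fun x => (u x)%:C).
  move=> mu uv.
  have L (w : E -> R) : measurable_fun setT w -> (forall x, `|w x| <= normc (v x)) -> isLp p (fun x => (w x)%:C).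
    move=> mw wv; have [mv nv] := Lv; split; first exact: cmeas_real.
    apply: le_lt_trans nv; apply: (le_Np (le_trans ler01 p1) (cmeas_real mw) mv) => x.
    by rewrite normc_real.
  split; first exact: L.
  have mp : measurable_fun setT (fun x => Num.max 0 (u x)) by apply: measurable_maxr => //; exact: measurable_cst.
  have mn : measurable_fun setT (fun x => Num.max 0 (- u x)) by apply: measurable_maxr; [exact: measurable_cst|exact: measurableT_comp].
  have bp x : `|Num.max 0 (u x)| <= normc (v x).
    apply: le_trans (uv x); rewrite /Num.max; case: (ltP 0 (u x)) => // _; by rewrite normr0.
  have bn x : `|Num.max 0 (- u x)| <= normc (v x).
    apply: le_trans (uv x); rewrite /Num.max; case: ltP => // _; by rewrite ?normrN ?normr0.
  have Pp : P (fun x => (Num.max 0 (u x))%:C).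
    by apply: (P_real mp _ (L _ mp bp)) => x; rewrite le_max lexx.
  have Pn : P (fun x => (Num.max 0 (- u x))%:C).
    by apply: (P_real mn _ (L _ mn bn)) => x; rewrite le_max lexx.
  have := Plin (-1) (L _ mn bn) (L _ mp bp) Pn Pp.
  congr P; apply/funext => x; rewrite mulN1r addrC -rmorphB/=; congr (_%:C).
  by rewrite /Num.max; do 2 case: ltP => ?; lra.
have [Lr Pr] := real _ mr (fun x => normc_geRe (v x)).
have [Li Pi] := real _ mi (fun x => normc_geIm (v x)).
have := Plin 'i%C Li Lr Pi Pr; congr P; apply/funext => x.
by rewrite [RHS]complexE addrC.
Qed.

End induction.

End principle.

End Lp_limits.

(** * Summable series in L^p, with convergence tested on Schwartz functions *)

Section Lp_complete.
Context {R : realType} {n : nat}.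
Local Notation E := 'rV[R]_n.
Implicit Types (f v : E -> R[i]) (p : R).

Lemma ge0_in_itv (x : \bar R) : (0 <= x)%E -> x \in `[0%E, +oo%E].
Proof. by move=> x0; rewrite in_itv/= x0 leey. Qed.

(** The pairing is the value at 0 of a convolution with the reflected function, so [young_pt] bounds
    it for all p >= 1 at once, with no conjugate exponent. *)
Lemma pair_bound p f : 1 <= p -> schw f -> exists2 C : R, 0 <= C &
  forall v, isLp p v -> ((normc (cintegral (fun x => v x * f x)))%:E <= C%:E * Lp p v)%E.
Proof.
move=> p1 sf; have p0 : 0 < p by exact: lt_le_trans p1.
have [B B0 hB] := schw_bound 0 sf.
pose K := 2 `^ p * rnorm (refl f) `^ (p - 1) * B.
have K0 : 0 <= K by rewrite !mulr_ge0 ?powR_ge0.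
exists (K `^ p^-1); first exact: powR_ge0.
move=> v Lv; have [mv nv] := Lv.
have := young_pt 0 p1 (schw_refl sf) Lv.
have -> : conv (refl f) v 0 = cintegral (fun x => v x * f x).
  by congr cintegral; apply/funext => y; rewrite /refl sub0r opprK mulrC.
set z := normc _ => h.
have {}h : ((z `^ p)%:E <= K%:E * Np p v)%E.
  apply: le_trans h _; rewrite /K [in leRHS]EFinM -[leRHS]muleA.
  apply: lee_wpmul2l; first by rewrite lee_fin mulr_ge0 ?powR_ge0.
  rewrite -ge0_integralZl//; last 2 first.
  - exact: measurable_normc_powR.
  - by move=> x _; rewrite lee_fin powR_ge0.
  apply: ge0_le_integral => //.
  - by move=> x _; rewrite lee_fin mulr_ge0 ?normc_ge0 ?powR_ge0.
  - apply/measurable_EFinP; apply: measurable_funM.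
      by apply: cmeas_normc; apply: schw_cmeas; apply: schw_conv_arg; exact: schw_refl.
    by apply/measurable_EFinP; exact: measurable_normc_powR.
  - by apply: emeasurable_funM => //; exact: measurable_normc_powR.
  move=> x _; rewrite -EFinM lee_fin ler_wpM2r ?powR_ge0//.
  by rewrite /refl sub0r opprK; have := hB x; rewrite expr0 mul1r.
have {}h : (((z `^ p)%:E) `^ p^-1 <= (K%:E * Np p v) `^ p^-1)%E.
  apply: gt0_ler_poweR => //; first by rewrite invr_ge0 ltW.
  - by apply: ge0_in_itv; rewrite lee_fin powR_ge0.
  - by apply: ge0_in_itv; apply: mule_ge0; [rewrite lee_fin|exact: Np_ge0].
move: h; rewrite poweR_EFin -powRrM mulfV ?gt_eqF// powRr1 ?normc_ge0//.
by rewrite poweRM ?Np_ge0 ?lee_fin// -LpE poweR_EFin.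
Qed.

Lemma cintegral_ae (f g : E -> R[i]) : cmeas f -> cmeas g -> (\forall x \ae leb n, f x = g x) ->
  cintegral f = cintegral g.
Proof.
move=> [f1 f2] [g1 g2] fg; rewrite !cintegralE; congr (_ +i* _); rewrite /Rintegral; congr fine.
- apply: ae_eq_integral => //; [exact/measurable_EFinP..|].
  by apply: filterS fg => x /= ->.
- apply: ae_eq_integral => //; [exact/measurable_EFinP..|].
  by apply: filterS fg => x /= ->.
Qed.

Lemma bounded_series_cvg (r : nat -> R) (B : R) : (forall N, \sum_(j < N) `|r j| <= B) ->
  cvgn (fun N => \sum_(j < N) r j).
Proof.
move=> hB.
have -> : (fun N => \sum_(j < N) r j) = series r by apply/funext => N; rewrite /series/= big_mkord.
apply: normed_cvg; apply: nondecreasing_is_cvgn.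
  by apply: nondecreasing_series => i _ _; exact: normr_ge0.
exists B => _ [N _ <-]; apply: le_trans (hB N).
by rewrite -[leLHS]/(\sum_(0 <= i < N) `|r i|) big_mkord.
Qed.

(** The Riesz-Fischer argument: partial sums of moduli are bounded in L^p by [A], so their supremum
    is finite almost everywhere and dominates the series. *)
Lemma Lp_series p (g : nat -> E -> R[i]) (a : nat -> R) (A : R) : 1 <= p ->
  (forall j, isLp p (g j)) -> (forall j, (Lp p (g j) <= (a j)%:E)%E) ->
  (forall N, \sum_(j < N) a j <= A) ->
  exists G, [/\ isLp p G, (Lp p G <= A%:E)%E & forall f, schw f -> forall e, 0 < e ->
    exists N0, forall N, (N0 <= N)%N ->
    normc (\sum_(j < N) cintegral (fun x => g j x * f x) - cintegral (fun x => G x * f x)) < e].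
Proof.
move=> p1 Lg ga hA; have p0 : 0 < p by exact: lt_le_trans p1.
have A0 : 0 <= A by have := hA 0%N; rewrite big_ord0.
pose H (N : nat) (x : E) := \sum_(j < N) normc (g j x).
have H0 N x : 0 <= H N x by apply: sumr_ge0 => j _; exact: normc_ge0.
have mH N : measurable_fun setT (H N).
  by apply: measurable_sum => j; apply: cmeas_normc; exact: (Lg j).1.
have Hmono x : {homo H^~ x : k l / (k <= l)%N >-> k <= l}.
  apply: homo_leq => [//|? ? ?|N]; first exact: le_trans.
  by rewrite /H big_ord_recr/= lerDl normc_ge0.
have LH N : (Lp p (fun x => (H N x)%:C) <= A%:E)%E.
  apply: le_trans (_ : (\sum_(j < N) a j)%:E <= _)%E; last by rewrite lee_fin.
  elim: N => [|N IH].
    rewrite big_ord0 /H; under [X in Lp p X]eq_fun do rewrite big_ord0.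
    by apply: Np_Lp_le => //; rewrite /Np integral0_eq ?lee_fin ?powR_ge0// => x _; rewrite normcr0 powR0// gt_eqF.
  rewrite /H; under [X in Lp p X]eq_fun do rewrite big_ord_recr/= rmorphD.
  have mN : cmeas (fun x => (normc (g N x))%:C) by apply: cmeas_real; apply: cmeas_normc; exact: (Lg N).1.
  apply: le_trans (LpD p1 (cmeas_real (mH N)) mN) _; rewrite big_ord_recr/= EFinD; apply: leeD => //.
  apply: le_trans (ga N); apply: (le_Lp p0 mN (Lg N).1) => x.
  by rewrite normc_real ger0_norm ?normc_ge0.
pose T0 (N : nat) (x : E) : \bar R := (H N x `^ p)%:E.
(* The p-th powers of the partial sums increase, and monotone convergence bounds the integral of
   their supremum by A^p. *)
pose T (x : E) := ereal_sup (range (T0^~ x)).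
have T0T N x : (T0 N x <= T x)%E by apply: ereal_sup_ubound; exists N.
have T_ge0 x : (0 <= T x)%E by apply: le_trans (T0T 0%N x); rewrite lee_fin powR_ge0.
have T0mono x : {homo T0^~ x : k l / (k <= l)%N >-> (k <= l)%E}.
  move=> k l kl; rewrite lee_fin ge0_ler_powR ?nnegrE ?H0 ?Hmono//; exact: ltW.
have cT x : T0 N x @[N --> \oo] --> T x by exact: ereal_nondecreasing_cvgn (T0mono x).
have mT0 N : measurable_fun setT (T0 N).
  by apply/measurable_EFinP; apply: (measurableT_comp (measurable_powR p)); exact: mH.
have mT : measurable_fun setT T by apply: (emeasurable_fun_cvg T0) => // x _; exact: cT.
have T0E N : (\int[leb n]_x T0 N x = Np p (fun x => (H N x)%:C))%E.
  by apply: eq_integral => x _; rewrite normc_real ger0_norm.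
have iT : (\int[leb n]_x T x <= (A `^ p)%:E)%E.
  have -> : (\int[leb n]_x T x = limn (fun N => \int[leb n]_x T0 N x))%E.
    rewrite -monotone_convergence//.
    - by apply: eq_integral => x _; apply/esym; apply: cvg_lim => //; exact: cT.
    - by move=> N x _; rewrite lee_fin powR_ge0.
  apply: lime_le.
    apply: ereal_nondecreasing_is_cvgn => k l kl; apply: ge0_le_integral => //.
    - by move=> x _; rewrite lee_fin powR_ge0.
    - by move=> x _; exact: T0mono.
  near=> N; rewrite T0E Np_Lp ?gt_eqF// -poweR_EFin; apply: gt0_ler_poweR => //.
  - exact: ltW.
  - by apply: ge0_in_itv; exact: Lp_ge0.
  - by apply: ge0_in_itv; rewrite lee_fin.
have intT : (leb n).-integrable setT T.
  apply/integrableP; split => //; apply: le_lt_trans (_ : ((A `^ p)%:E < +oo)%E); last exact: ltry.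
  by apply: le_trans iT; rewrite le_eqVlt; apply/orP; left; apply/eqP; apply: eq_integral => x _; rewrite gee0_abs.
have aeT : \forall x \ae leb n, T x \is a fin_num.
  by have := integrable_ae measurableT intT; apply: filterS => x; apply.
pose S := [set x | (T x < +oo)%E].
have mS : measurable S by rewrite -[S]setTI; exact: emeasurable_fun_infty_o.
pose D (x : E) := fine (T x) `^ p^-1.
have D0 x : 0 <= D x by exact: powR_ge0.
have HD x N : S x -> H N x <= D x.
  move=> Sx; rewrite -[leLHS]powRr1// -(mulfV (lt0r_neq0 p0)) powRrM.
  rewrite ge0_ler_powR ?invr_ge0 ?nnegrE ?powR_ge0 ?fine_ge0//; first exact: ltW.
  have fT : T x \is a fin_num by rewrite ge0_fin_numE.
  by rewrite -lee_fin fineK//; exact: T0T.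
have mD : cmeas (fun x => (D x)%:C).
  apply: cmeas_real; apply: (measurableT_comp (measurable_powR _)).
  by apply: measurableT_comp mT; exact: fine_measurable.
have nD : (Np p (fun x => (D x)%:C) <= (A `^ p)%:E)%E.
  apply: le_trans iT; apply: ge0_le_integral => //.
  - by move=> x _; rewrite lee_fin powR_ge0.
  - exact: measurable_normc_powR.
  move=> x _; rewrite normc_real ger0_norm// -powRrM mulVf ?gt_eqF// powRr1 ?fine_ge0//.
  by move: (T x) (T_ge0 x) => [r||]//= _; exact: leey.
have LD : isLp p (fun x => (D x)%:C) by split; [exact: mD|]; apply: le_lt_trans nD _; exact: ltry.
(* Cutting off to the set where the majorant is finite makes the partial sums converge everywhere,
   so that the limit is measurable; the pairings do not change, as the complement is null. *)
pose F (N : nat) (x : E) := (\1_S x)%:C * \sum_(j < N) g j x.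
have mF N : cmeas (F N).
  apply: cmeasM; first by apply: cmeas_real; exact: measurable_indic.
  by apply: cmeas_sum => j; exact: (Lg j).1.
have FD N x : normc (F N x) <= normc (D x)%:C.
  rewrite /F indicE; have [Sx|Sx] := pselect (S x).
    rewrite mem_set// mul1r normc_real ger0_norm//; apply: le_trans (HD x N Sx).
    exact: normc_sum.
  by rewrite memNset// mul0r normcr0 normc_ge0.
have cF (h : R[i] -> R) x : (forall z, `|h z| <= normc z) -> {morph h : u w / u + w} -> h 0 = 0 ->
    cvgn (fun N => h (F N x)).
  move=> hle hD h00; have [Sx|Sx] := pselect (S x).
    have -> : (fun N => h (F N x)) = (fun N => \sum_(j < N) h (g j x)).
      by apply/funext => N; rewrite /F indicE mem_set// mul1r (big_morph h hD h00).
    apply: (bounded_series_cvg (r := fun j => h (g j x)) (B := D x)) => N; apply: le_trans (HD x N Sx).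
    by apply: ler_sum => j _; exact: hle.
  have -> : (fun N => h (F N x)) = fun=> 0 by apply/funext => N; rewrite /F indicE memNset// mul0r.
  exact: is_cvg_cst.
have cRe x := cF (@complex.Re R) x (@normc_geRe R) (@Re_addc R) erefl.
have cIm x := cF (@complex.Im R) x (@normc_geIm R) (@Im_addc R) erefl.
pose G (x : E) := limn (fun N => complex.Re (F N x)) +i* limn (fun N => complex.Im (F N x)).
have mG : cmeas G.
  split.
    apply: (measurable_fun_cvg (h := fun N x => complex.Re (F N x))) => [N|x _]; first exact: (mF N).1.
    exact: cRe.
  apply: (measurable_fun_cvg (h := fun N x => complex.Im (F N x))) => [N|x _]; first exact: (mF N).2.
  exact: cIm.
have FG x e : 0 < e -> exists K, forall N, (K <= N)%N -> normc (G x - F N x) <= e.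
  move=> e0; have e2 : 0 < e / 2 by rewrite divr_gt0.
  have /cvgrPdist_le/(_ _ e2)[K1 _ h1] := cRe x.
  have /cvgrPdist_le/(_ _ e2)[K2 _ h2] := cIm x.
  exists (maxn K1 K2) => N; rewrite geq_max => /andP[/h1 r1 /h2 r2].
  apply: le_trans (normc_leD _) _; rewrite !(Re_addc, Im_addc, Re_oppc, Im_oppc).
  by rewrite [leRHS]splitr; apply: lerD.
have GD x : normc (G x) <= normc (D x)%:C.
  apply/ler_addgt0Pr => e e0; have [K hK] := FG x e e0.
  rewrite -(subrK (F K x) (G x)); apply: le_trans (le_normcD _ _) _.
  by rewrite addrC lerD// hK.
have LG : isLp p G.
  split; first exact: mG.
  apply: le_lt_trans LD.2; exact: (le_Np (ltW p0) mG mD GD).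
exists G; split; first exact: LG.
  apply: (Np_Lp_le p0 A0); apply: le_trans nD; exact: (le_Np (ltW p0) mG mD GD).
move=> f sf e e0; have [C C0 hC] := pair_bound p1 sf.
have e1 : 0 < e / (C + 1) by rewrite divr_gt0// ltr_wpDl.
have [N0 hN] := Lp_dct p1 mF mG LD FD GD FG e1.
exists N0 => N /hN hLp.
have LF N' : isLp p (F N') by split; [exact: mF|]; apply: le_lt_trans LD.2; exact: (le_Np (ltW p0) (mF N') mD (FD N')).
have Lgf j : L1 (fun x => g j x * f x).
  by have := schw_LwM sf (isLp_Lw p1 (Lg j)); congr L1; apply/funext => x; rewrite mulrC.
have mf := schw_cmeas sf.
have LM v : isLp p v -> L1 (fun x => v x * f x).
  by move=> Lv; have := schw_LwM sf (isLp_Lw p1 Lv); congr L1; apply/funext => x; rewrite mulrC.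
have -> : \sum_(j < N) cintegral (fun x => g j x * f x) = cintegral (fun x => F N x * f x).
  transitivity (cintegral (fun x => \sum_(j < N) g j x * f x)).
    by rewrite (@cintegral_sum _ _ _ _ (fun (j : 'I_N) x => g j x * f x) (fun j => Lgf j)).
  apply: cintegral_ae.
  - by apply: cmeas_sum => j; exact: (Lgf j).1.
  - exact: (LM _ (LF N)).1.
  apply: filterS aeT => x fx; rewrite /F indicE mem_set ?mul1r; last by rewrite /S/= -ge0_fin_numE.
  by rewrite mulr_suml.
rewrite normc_distC -(cintegralB (LM _ LG) (LM _ (LF N))).
have -> : (fun x => G x * f x - F N x * f x) = fun x => (G x - F N x) * f x by apply/funext => x; rewrite mulrBl.
rewrite -lte_fin; apply: le_lt_trans (hC _ (isLpB p1 LG (LF N))) _.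
apply: le_lt_trans (_ : (C%:E * (e / (C + 1))%:E < _)%E); first by apply: lee_wpmul2l.
rewrite -EFinM lte_fin mulrCA gtr_pMr// ltr_pdivrMr ?mul1r ?ltrDl//; first exact: ltr_wpDl.
Unshelve. all: by end_near. Qed.

End Lp_complete.

(** * L^1-normalised dilations and approximate identities *)

Section dilation.
Context {R : realType} {n : nat}.
Local Notation E := 'rV[R]_n.
Implicit Types (f k v a b : E -> R[i]) (p t : R).

Definition dil t k : E -> R[i] := fun x => (t ^- n)%:C * k (t^-1 *: x).

Lemma schw_dil t k : 0 < t -> schw k -> schw (dil t k).
Proof. by move=> t0 sk; apply: schwZ; apply: schw_scale => //; rewrite invr_neq0// gt_eqF. Qed.

Lemma L1_scale t f : 0 < t -> L1 f -> L1 (fun x => f (t *: x)).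
Proof.
move=> t0 /(L1_affine 0 (lt0r_neq0 t0)); congr L1; apply/funext => x; by rewrite addr0.
Qed.

Lemma cintegral_scale t f : 0 < t -> L1 f -> cintegral (fun x => f (t *: x)) = (t ^- n)%:C * cintegral f.
Proof.
move=> t0 Lf; have := cintegral_affine 0 (lt0r_neq0 t0) Lf; rewrite gtr0_norm// => <-.
by congr cintegral; apply/funext => x; rewrite addr0.
Qed.

Lemma real_mulV t : 0 < t -> (t ^- n)%:C * (t^-1 ^- n)%:C = 1 :> R[i].
Proof. by move=> t0; rewrite -rmorphM/= exprVn invrK mulVf// expf_neq0// gt_eqF. Qed.

Lemma cintegral_dil t f : 0 < t -> L1 f -> cintegral (dil t f) = cintegral f.
Proof.
move=> t0 Lf; have t0' : 0 < t^-1 by rewrite invr_gt0.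
rewrite cintegralZ; last exact: L1_scale.
by rewrite cintegral_scale// mulrA real_mulV// mul1r.
Qed.

Lemma Np_dil p t f : 0 < p -> 0 < t -> cmeas f ->
  Np p (dil t f) = (((t ^- n) `^ p * t ^+ n)%:E * Np p f)%E.
Proof.
move=> p0 t0 mf; have t0' : 0 < t^-1 by rewrite invr_gt0.
have tn0 : 0 <= t ^- n by rewrite invr_ge0 exprn_ge0// ltW.
have E1 (x : E) : (normc (dil t f x) `^ p)%:E = (((t ^- n) `^ p)%:E * (normc (f (t^-1 *: x + 0)%R) `^ p)%:E)%E.
  by rewrite addr0 normcM normc_real ger0_norm// powRM ?normc_ge0// EFinM.
rewrite /Np; under eq_integral do rewrite E1.
rewrite ge0_integralZl//; last 3 first.
- by apply: measurable_normc_powR; exact: cmeas_affine.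
- by move=> x _; rewrite lee_fin powR_ge0.
- by rewrite lee_fin powR_ge0.
have N0 (x : E) : (0 <= (normc (f x) `^ p)%:E)%E by rewrite lee_fin powR_ge0.
rewrite (ge0_integral_leb_affine 0 (lt0r_neq0 t0') (measurable_normc_powR p mf) N0).
by rewrite muleA -EFinM gtr0_norm// exprVn invrK.
Qed.

(** For p > 1 the exponent is negative in positive dimension. This is the source of both the decay
    in [vanish] and the summability of low frequencies in [Hdot_Cc_fin]. *)
Lemma Lp_dil p t f : 0 < p -> 0 < t -> cmeas f ->
  Lp p (dil t f) = ((t `^ (n%:R * (p^-1 - 1)))%:E * Lp p f)%E.
Proof.
move=> p0 t0 mf; rewrite !LpE Np_dil// poweRM ?Np_ge0 ?lee_fin ?mulr_ge0 ?powR_ge0 ?exprn_ge0 ?(ltW t0)//.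
rewrite poweR_EFin; congr (_%:E * _)%E.
rewrite -powR_mulrn ?(ltW t0)// -powRN -powRrM -powRD; last by apply/implyP => _; rewrite gt_eqF.
by rewrite -powRrM; congr (_ `^ _); field; rewrite gt_eqF.
Qed.

Lemma rnorm_dil t f : 0 < t -> L1 f -> rnorm (dil t f) = rnorm f.
Proof.
move=> t0 Lf; rewrite /rnorm -!Lp1 Lp_dil//; last exact: Lf.1.
by rewrite invr1 subrr mulr0 powRr0 mul1e.
Qed.

Lemma dil_dil s t f : dil s (dil t f) = dil (s * t) f.
Proof.
by apply/funext => x; rewrite /dil mulrA -rmorphM/= scalerA exprMn !invfM [t^-1 * _]mulrC.
Qed.

Lemma dil1 f : dil 1 f = f.
Proof. by apply/funext => x; rewrite /dil expr1n invr1 scale1r mul1r. Qed.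

Lemma conv_dil t a b : 0 < t -> schw a -> Lw b ->
  conv (dil t a) (dil t b) = dil t (conv a b).
Proof.
move=> t0 sa Lb; have t0' : 0 < t^-1 by rewrite invr_gt0.
apply/funext => x; rewrite /conv /dil.
have L := conv_L1 (t^-1 *: x) sa Lb.
have -> : (fun y => (t ^- n)%:C * a (t^-1 *: (x - y)) * ((t ^- n)%:C * b (t^-1 *: y))) =
    fun y => ((t ^- n)%:C * (t ^- n)%:C) * (a (t^-1 *: x - t^-1 *: y) * b (t^-1 *: y)).
  by apply/funext => y; rewrite scalerBr; ring.
rewrite cintegralZ; last exact: (L1_scale t0' L).
by rewrite (cintegral_scale t0' L) -mulrA; congr (_ * _); rewrite mulrA real_mulV// mul1r.
Qed.

Lemma fourier_inv_scale t f : 0 < t -> schw f -> fourier_inv (fun xi => f (t *: xi)) = dil t (fourier_inv f).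
Proof.
move=> t0 sf; apply/funext => x; rewrite /fourier_inv /dil mulrCA; congr (_ * _).
rewrite -cintegral_scale//; last by apply: schw_L1; exact: schw_expiM.
congr cintegral; apply/funext => xi; congr (_ * expi _).
by rewrite dotvZl dotvZr mulrA mulVf ?mul1r// gt_eqF.
Qed.

(** A Lipschitz bound with decay [w] in space and polynomial growth in the shift. The weight is
    [bell] for L^p estimates and an inverse power of [wt] for Schwartz seminorms. *)
Definition lipdecay (w : E -> R) b := exists N (D : R), 0 <= D /\
  forall x y, normc (b (x - y) - b x) <= D * onorm y * wt y ^+ N * w x.

Lemma schw_lipdecayX M b : schw b -> lipdecay (fun x => (wt x ^+ M)^-1) b.
Proof.
move=> sb; have [C C0 hC] := schw_mvt M sb.
exists M, C; split=> // x y.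
rewrite ler_pdivlMr ?wtX_gt0// mulrC.
by have := hC x (- y); rewrite onormN wtN.
Qed.

Lemma schw_lipdecay b : schw b -> lipdecay (@bell R n) b.
Proof.
move=> sb; have [C C0 hC] := schw_mvt (2 * n) sb.
exists (2 * n)%N, C; split=> // x y.
apply: (wt_bell (f := fun x => b (x - y) - b x)).
by have := hC x (- y); rewrite onormN wtN.
Qed.

Lemma lipc_lipdecay (h : E -> R) W : lipc h -> schw W -> lipdecay (@bell R n) (fun x => (h x)%:C * W x).
Proof.
move=> [_ h01 [L L0 hL]] sW; have [N [D [D0 hD]]] := schw_lipdecay sW.
have [B B0 hB] := schw_bound (2 * n) sW.
exists N.+1, (L * (B + D) + D); split; first by rewrite !(addr_ge0, mulr_ge0).
move=> x y.
have -> : (h (x - y))%:C * W (x - y) - (h x)%:C * W x =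
    (h (x - y) - h x)%:C * W (x - y) + (h x)%:C * (W (x - y) - W x).
  by rewrite raddfB/=; ring.
have o0 := onorm_ge0 y; have b0 := bell_ge0 x; have w1 := wt_ge1 y; have w0 := wt_ge0 y.
have wN1 := wtX_ge1 y N; have wN0 := ltW (wtX_gt0 y N).
have hW : normc (W (x - y)) <= (B + D) * (wt y ^+ N.+1 * bell x).
  rewrite -(subrK (W x) (W (x - y))); apply: le_trans (le_normcD _ _) _.
  rewrite mulrDl addrC; apply: lerD.
    apply: le_trans (wt_bell (hB x)) _; rewrite ler_wpM2l//.
    by rewrite ler_peMl// wtX_ge1.
  apply: le_trans (hD x y) _; rewrite -!mulrA ler_wpM2l// exprS -mulrA.
  by apply: ler_pM; rewrite ?mulr_ge0// onorm_le_wt.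
apply: le_trans (le_normcD _ _) _; rewrite !normcM !normc_real.
have -> : (L * (B + D) + D) * onorm y * wt y ^+ N.+1 * bell x =
  (L * onorm y) * ((B + D) * (wt y ^+ N.+1 * bell x)) + D * onorm y * wt y ^+ N.+1 * bell x by ring.
apply: lerD.
  apply: ler_pM => //; first exact: normc_ge0.
  by apply: le_trans (hL _ _) _; rewrite addrAC subrr add0r onormN.
have /andP[hx0 hx1] := h01 x; rewrite (ger0_norm hx0).
apply: le_trans (_ : normc (W (x - y) - W x) <= _); first by rewrite ler_piMl// normc_ge0.
apply: le_trans (hD x y) _; rewrite ler_wpM2r// ler_wpM2l ?mulr_ge0// exprS ler_peMl//.
Qed.

(* After rescaling, [conv (dil t a) b x = \int a(z) b(x - t z) dz]. *)
Lemma dil_approx (w : E -> R) a b : (forall x, 0 <= w x) -> schw a -> Lw b -> lipdecay w b ->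
  exists2 C : R, 0 <= C & forall t, 0 < t <= 1 -> forall x,
  normc (conv (dil t a) b x - cintegral a * b x) <= C * t * w x.
Proof.
move=> w0 sa Lb [N [D [D0 hD]]].
pose B (z : E) := wt z ^+ N.+1 * normc (a z); have LB := schw_weight_L1 N.+1 sa.
exists (2 * (D * rnorm (fun z => (B z)%:C))); first by rewrite !mulr_ge0 ?rnorm_ge0.
move=> t /andP[t0 t1] x.
have Lc := conv_L1 x (schw_dil t0 sa) Lb.
have nt0 : - t != 0 by rewrite oppr_eq0 gt_eqF.
have cE : (t ^- n)%:C * conv (dil t a) b x = (t ^- n)%:C * cintegral (fun z => a z * b (x - t *: z)).
  have := cintegral_affine x nt0 Lc; rewrite normrN gtr0_norm// => <-.
  have La := L1_affine x nt0 Lc.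
  have E1 : (fun z => dil t a (x - (- t *: z + x)) * b (- t *: z + x)) =
      fun z => (t ^- n)%:C * (a z * b (x - t *: z)).
    apply/funext => z; rewrite /dil.
    have -> : x - (- t *: z + x) = t *: z by rewrite opprD addrCA subrr addr0 scaleNr opprK.
    by rewrite scalerA mulVf ?gt_eqF// scale1r scaleNr addrC mulrA.
  rewrite E1 in La *; rewrite cintegralZ//.
  have := L1Z (t ^+ n)%:C La; congr L1; apply/funext => z.
  by rewrite mulrA -rmorphM/= mulfV ?expf_neq0 ?gt_eqF// mul1r.
have tn : ((t ^- n)%:C : R[i]) != 0.
  by rewrite -normc_gt0 normc_real normr_gt0 invr_neq0// expf_neq0// gt_eqF.
rewrite (mulfI tn cE).
have L1a : L1 (fun z => a z * b (x - t *: z)).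
  have := L1_affine x nt0 Lc => /(L1Z (t ^+ n)%:C); congr L1; apply/funext => z.
  rewrite /dil.
  have -> : x - (- t *: z + x) = t *: z by rewrite opprD addrCA subrr addr0 scaleNr opprK.
  rewrite scalerA mulVf ?gt_eqF// scale1r scaleNr addrC !mulrA -rmorphM/= mulfV ?mul1r//.
  by rewrite expf_neq0 ?gt_eqF.
rewrite mulrC -cintegralZ; last exact: schw_L1.
rewrite -cintegralB//; last by apply: L1Z; exact: schw_L1.
have k0 : 0 <= D * t * w x by rewrite !mulr_ge0 ?w0// ltW.
apply: le_trans (normc_cintegral_le k0 _ LB _) _.
- by apply: L1B => //; apply: L1Z; exact: schw_L1.
- move=> z; rewrite (_ : _ - _ = a z * (b (x - t *: z) - b x)); last by ring.
  rewrite normcM; apply: le_trans (ler_wpM2l (normc_ge0 _) (hD x (t *: z))) _.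
  rewrite onormZ gtr0_norm//.
  have wz : wt (t *: z) ^+ N <= wt z ^+ N.
    by rewrite lerXn2r ?nnegrE ?wt_ge0// wt_segment// t1 ltW.
  have -> : D * t * w x * (wt z ^+ N.+1 * normc (a z)) =
    normc (a z) * (D * (t * wt z) * wt z ^+ N * w x) by rewrite exprS; ring.
  rewrite ler_wpM2l ?normc_ge0// ler_wpM2r ?w0//.
  have t0' := ltW t0.
  by apply: ler_pM; rewrite ?mulr_ge0 ?onorm_ge0 ?exprn_ge0 ?wt_ge0// ler_wpM2l// ler_wpM2l// onorm_le_wt.
rewrite le_eqVlt; apply/orP; left; apply/eqP; rewrite /B; ring.
Qed.

Lemma isLp_bell p : 1 <= p -> isLp p (fun x : E => (bell x)%:C).
Proof.
move=> p1; apply: (@decay_isLp _ _ _ _ 1) => // [|x].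
  by apply: cmeas_real; exact: measurable_bell.
by rewrite mul1r normc_real ger0_norm ?bell_ge0.
Qed.

Lemma Lp_bell_le p : 1 <= p -> exists2 K : R, 0 <= K & forall f (C : R), 0 <= C -> cmeas f ->
  (forall x, normc (f x) <= C * bell x) -> (Lp p f <= (C * K)%:E)%E.
Proof.
move=> p1; have Lb := isLp_bell p1; have fb := isLp_fin Lb; have p0 : 0 < p by exact: lt_le_trans p1.
have fin : Lp p (fun x : E => (bell x)%:C) \is a fin_num by rewrite ge0_fin_numE// Lp_ge0.
exists (fine (Lp p (fun x : E => (bell x)%:C))); first by rewrite fine_ge0// Lp_ge0.
move=> f C C0 mf fC; rewrite EFinM fineK//.
have -> : C%:E = (normc C%:C)%:E by rewrite normc_real ger0_norm.
rewrite -(LpZ _ p0 Lb.1); apply: (le_Lp p0 mf (cmeasZ _ Lb.1)) => x.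
by rewrite normcM !normc_real !ger0_norm ?bell_ge0.
Qed.

End dilation.

(** * Mollification in L^p *)

Section mollification.
Context {R : realType} {n : nat}.
Local Notation E := 'rV[R]_n.
Implicit Types (f g k v a b : E -> R[i]) (p t : R).

Lemma conv_linr k f g (c : R[i]) x : schw k -> Lw f -> Lw g ->
  conv k (fun y => c * f y + g y) x = c * conv k f x + conv k g x.
Proof.
move=> sk Lf Lg; rewrite /conv -cintegralZ; last exact: conv_L1.
rewrite -cintegralD; [|by apply: L1Z; exact: conv_L1|exact: conv_L1].
by congr cintegral; apply/funext => y; ring.
Qed.

Lemma conv_linl k l f (c : R[i]) x : schw k -> schw l -> Lw f ->
  conv (fun y => c * k y + l y) f x = c * conv k f x + conv l f x.
Proof.
move=> sk sl Lf; rewrite /conv -cintegralZ; last exact: conv_L1.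
rewrite -cintegralD; [|by apply: L1Z; exact: conv_L1|exact: conv_L1].
by congr cintegral; apply/funext => y; ring.
Qed.

Lemma Lp_le_lin p f g (c : R[i]) (e1 e2 : R) : 1 <= p -> cmeas f -> cmeas g ->
  (Lp p f <= e1%:E)%E -> (Lp p g <= e2%:E)%E ->
  (Lp p (fun x => (c * f x + g x)%R) <= (normc c * e1 + e2)%:E)%E.
Proof.
move=> p1 mf mg h1 h2; have p0 : 0 < p by exact: lt_le_trans p1.
apply: le_trans (LpD p1 (cmeasZ c mf) mg) _; rewrite EFinD; apply: leeD => //.
by rewrite LpZ// EFinM; apply: lee_wpmul2l => //; rewrite lee_fin normc_ge0.
Qed.

Lemma Lp_congr p f g : f = g -> Lp p f = Lp p g. Proof. by move->. Qed.

Lemma young_le p k v (C e : R) : 1 <= p -> schw k -> isLp p v -> 2 * rnorm k <= C ->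
  (Lp p v <= e%:E)%E -> (Lp p (conv k v) <= (C * e)%:E)%E.
Proof.
move=> p1 sk Lv kC ve; apply: le_trans (young p1 sk Lv) _; rewrite [leRHS]EFinM.
apply: lee_pmul => //; [|exact: Lp_ge0].
by rewrite lee_fin mulr_ge0// rnorm_ge0.
Qed.

Section with_cutoff.
Variable phi : E -> R.
Hypothesis hphi : LP_cutoff phi.

(** [Lp_ind] reduces the claim to Lipschitz functions times a cutoff, where [dil_approx] gives a
    rate linear in t. Limits are admissible since convolution with the dilates is bounded uniformly
    in t. *)
Lemma mollify p rho v : 1 <= p -> schw rho -> cintegral rho = 1 -> isLp p v ->
  forall e, 0 < e -> exists2 d : R, 0 < d & forall t, 0 < t <= d ->
    (Lp p (fun x => (conv (dil t rho) v x - v x)%R) <= e%:E)%E.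
Proof.
move=> p1 sr r1 Lv; have p0 : 0 < p by exact: lt_le_trans p1.
pose K := 2 * rnorm rho; have K0 : 0 <= K by rewrite mulr_ge0// rnorm_ge0.
have mc t f : 0 < t -> isLp p f -> cmeas (fun x => conv (dil t rho) f x - f x).
  move=> t0 Lf; apply: cmeasB; last exact: Lf.1.
  by apply: cmeas_conv; [exact: schw_dil|exact: isLp_Lw Lf].
have rK t : 0 < t -> 2 * rnorm (dil t rho) <= K.
  by move=> t0; rewrite rnorm_dil//; exact: schw_L1.
pose P f := forall e, 0 < e -> exists2 d : R, 0 < d & forall t, 0 < t <= d ->
    (Lp p (fun x => (conv (dil t rho) f x - f x)%R) <= e%:E)%E.
apply: (@Lp_ind _ _ phi hphi p P p1 _ _ _ v Lv) => [c f g Lf Lg Pf Pg e e0|f Lf Pf e e0|h k lh e e0].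
- have c0 := normc_ge0 c.
  have e1 : 0 < e / 2 / (normc c + 1) by rewrite !divr_gt0// ltr_wpDl.
  have e2 : 0 < e / 2 by rewrite divr_gt0.
  have [d1 d10 h1] := Pf _ e1; have [d2 d20 h2] := Pg _ e2.
  exists (Num.min d1 d2) => [|t]; first by rewrite lt_min d10.
  rewrite le_min => /and3P[t0 td1 td2].
  rewrite (@Lp_congr _ _ (fun x => c * (conv (dil t rho) f x - f x) + (conv (dil t rho) g x - g x))); last first.
    apply/funext => x; rewrite conv_linr; [ring|exact: schw_dil|exact: isLp_Lw Lf|exact: isLp_Lw Lg].
  have t1 : 0 < t <= d1 by rewrite t0. have t2 : 0 < t <= d2 by rewrite t0.
  apply: le_trans (Lp_le_lin c p1 (mc _ _ t0 Lf) (mc _ _ t0 Lg) (h1 _ t1) (h2 _ t2)) _.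
  rewrite lee_fin [leRHS](splitr e) lerD2r mulrA ler_pdivrMr ?ltr_wpDl//.
  by rewrite mulrC ler_wpM2l ?lerDl// ltW.
(* Replacing [f] by [g] costs K * eta in the convolution and eta in the function itself. *)
- pose eta := e / 2 / (K + 1).
  have eta0 : 0 < eta by rewrite !divr_gt0// ltr_wpDl.
  have [g [Lg Pg fg]] := Pf _ eta0.
  have e2 : 0 < e / 2 by rewrite divr_gt0.
  have [d d0 hd] := Pg _ e2; exists d => // t /[dup] td /andP[t0 _].
  have Lfg := isLpB p1 Lf Lg.
  rewrite (@Lp_congr _ _ (fun x => 1 * (conv (dil t rho) (fun y => f y - g y) x + (-1) * (f x - g x)) +
     (conv (dil t rho) g x - g x))); last first.
    apply/funext => x.
    have := conv_linr 1 x (schw_dil t0 sr) (isLp_Lw p1 Lfg) (isLp_Lw p1 Lg).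
    rewrite (_ : (fun y => 1 * (f y - g y) + g y) = f) => [->|]; first by ring.
    by apply/funext => y; ring.
  have mfg : cmeas (fun x => conv (dil t rho) (fun y => f y - g y) x + (-1) * (f x - g x)).
    apply: cmeasD; last by apply: cmeasZ; exact: Lfg.1.
    by apply: cmeas_conv; [exact: schw_dil|exact: isLp_Lw Lfg].
  apply: le_trans (Lp_le_lin 1 p1 mfg (mc _ _ t0 Lg) (_ : (_ <= (eta * (K + 1))%:E)%E) (hd _ td)) _; last first.
    by rewrite lee_fin normcr1 mul1r /eta divfK ?gt_eqF ?ltr_wpDl// -splitr.
  apply: le_trans (LpD p1 _ (cmeasZ _ Lfg.1)) _.
    by apply: cmeas_conv; [exact: schw_dil|exact: isLp_Lw Lfg].
  rewrite mulrDr mulr1 EFinD mulrC; apply: leeD; first exact: (young_le p1 (schw_dil t0 sr) Lfg (rK _ t0) fg).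
  by rewrite LpZ ?normcN ?normcr1 ?mul1e//; exact: Lfg.1.
have sth := schw_theta hphi k.
have mh : cmeas (fun x => (h x)%:C * (theta phi k x)%:C).
  by apply: cmeasM; [apply: cmeas_real; case: lh|exact: schw_cmeas].
have Lh : isLp p (fun x => (h x)%:C * (theta phi k x)%:C).
  by apply: isLp_bounded_theta => //; case: lh.
have [C C0 hC] := dil_approx (@bell_ge0 R n) sr (isLp_Lw p1 Lh) (lipc_lipdecay lh sth).
have [B B0 hB] := Lp_bell_le (n := n) p1.
exists (Num.min 1 (e / (C * B + 1))).
  by rewrite lt_min ltr01 divr_gt0// ltr_wpDl// mulr_ge0.
move=> t; rewrite le_min => /and3P[t0 t1 te].
apply: le_trans (hB _ (C * t) _ (mc _ _ t0 Lh) _) _.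
- by rewrite mulr_ge0// ltW.
- move=> x; have tt : 0 < t <= 1 by rewrite t0.
  by have := hC _ tt x; rewrite r1 mul1r.
move: te; rewrite ler_pdivlMr ?ltr_wpDl ?mulr_ge0// lee_fin => te.
apply: le_trans te; rewrite mulrAC mulrC ler_wpM2l ?(ltW t0)// lerDl.
exact: ler01.
Qed.

Lemma conv_supp k v x : schw k -> Lw v -> conv k v x != 0 -> exists y, k (x - y) != 0 /\ v y != 0.
Proof.
move=> sk Lv h; apply: contrapT => hn; move/eqP: h; apply.
rewrite /conv (_ : (fun y => _) = fun=> 0) ?cintegral0//; apply/funext => y; apply/eqP.
rewrite mulf_eq0; apply/negPn/negP; rewrite negb_or => /andP[h1 h2]; apply: hn; by exists y.
Qed.

Lemma Cc_conv k v (M : R) : Cc_infty setT k -> Lw v -> (forall y, v y != 0 -> onorm y <= M) ->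
  Cc_infty setT (conv k v).
Proof.
move=> kc Lv vM; have sk := Cc_schw kc; have [B hB] := Cc_bounded kc.
apply: (@Cc_inftyT _ _ _ (B + M)); first exact: conv_smooth.
move=> x /(conv_supp sk Lv)[y [ky vy]].
by rewrite -(subrK y x); apply: le_trans (onormD _ _) _; rewrite lerD ?hB ?vM.
Qed.

Lemma cintegral_cphi_neq0 : cintegral (cphi phi) != 0.
Proof.
have sp := schw_cphi hphi; have Lc := schw_L1 sp.
have := pos_integral (phi_continuous hphi) (phi_ge0 hphi) (x0 := 0).
rewrite (phi0 hphi) => /(_ ltr01) h.
apply/eqP => H0.
have E1 : (\int[leb n]_x (phi x)%:E = (complex.Re (cintegral (cphi phi)))%:E)%E.
  rewrite cintegralE /= fineK//; exact: (integrable_fin_num measurableT (L1_Re Lc)).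
by move: h; rewrite E1 H0 ltxx.
Qed.

End with_cutoff.
End mollification.

(** * Test functions are dense in L^p; large dilations tend to 0 *)

Section density.
Context {R : realType} {n : nat}.
Local Notation E := 'rV[R]_n.
Implicit Types (f g k v a b : E -> R[i]) (p t : R).
Variable phi : E -> R.
Hypothesis hphi : LP_cutoff phi.

Lemma bump (a : E) : exists rho, [/\ Cc_infty setT rho, cintegral rho = 1 &
  forall y, rho y != 0 -> enorm (y - a) < 4 / 3].
Proof.
pose c := cintegral (cphi phi); have sp := schw_cphi hphi.
have c0 : c != 0 := cintegral_cphi_neq0 hphi.
exists (fun y => c^-1 * cphi phi (y - a)).
have supp y : c^-1 * cphi phi (y - a) != 0 -> enorm (y - a) < 4 / 3.
  apply: contraNT; rewrite -leNgt => /(phi_supp hphi); rewrite /cphi => ->.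
  by rewrite mulr0.
split => //.
- apply: (@Cc_inftyT _ _ _ (n%:R * (4 / 3) + onorm a)).
    by apply: schw_smooth; apply: schwZ; exact: schw_shift.
  move=> y /supp ya; rewrite -(subrK a y); apply: le_trans (onormD _ _) _; rewrite lerD2r.
  by apply: le_trans (onorm_le_enorm _) _; rewrite ler_wpM2l// ltW.
- rewrite cintegralZ; last by apply: schw_L1; exact: schw_shift.
  by rewrite (cintegral_shift (- a) (schw_L1 sp)) mulVf.
Qed.

Lemma theta_Cc (k : nat) : Cc_infty setT (fun x => (theta phi k x)%:C).
Proof.
apply: (@Cc_inftyT _ _ _ (n%:R * (k.+1%:R * (4 / 3)))); first exact: schw_smooth (schw_theta hphi k).
move=> x; apply: contraNT; rewrite -ltNge => h; rewrite /theta (phi_supp hphi) ?eqxx//.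
rewrite enormZ gtr0_norm ?invr_gt0// ler_pdivlMl// leNgt.
apply/negP => h2; move: h; apply/negP; rewrite -leNgt.
by apply: le_trans (onorm_le_enorm _) _; rewrite ler_wpM2l// ltW.
Qed.

Lemma Lp_dense p v : 1 <= p -> isLp p v -> forall e, 0 < e ->
  exists2 f, Cc_infty setT f & (Lp p (fun x => (v x - f x)%R) <= e%:E)%E.
Proof.
move=> p1 Lv e e0; have e2 : 0 < e / 2 by rewrite divr_gt0.
have p0 : 0 < p by exact: lt_le_trans p1.
have [k hk] := theta_Lp hphi p1 Lv e2.
have [rho [rc r1 _]] := bump 0; have sr := Cc_schw rc.
pose w x := (theta phi k x)%:C * v x.
have [C C1 hC] := theta_bound hphi; have C0 : 0 <= C by exact: le_trans C1.
have mw : cmeas w by apply: cmeasM; [apply: schw_cmeas; exact: schw_theta|exact: Lv.1].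
have Lw' : isLp p w.
  have [mC nC] := isLpZ C%:C p1 Lv; split; first exact: mw.
  apply: le_lt_trans nC; apply: (le_Np (ltW p0) mw mC) => x.
  rewrite !normcM !normc_real ler_wpM2r ?normc_ge0//.
  by have /andP[h1 h2] := hC k x; rewrite !ger0_norm.
have [d d0 hd] := mollify hphi p1 sr r1 Lw' e2.
have dc : Cc_infty setT (dil d rho).
  have [M hM] := Cc_bounded rc; apply: (@Cc_inftyT _ _ _ (d * M)).
    by apply: schw_smooth; exact: schw_dil.
  move=> x; rewrite /dil => h; have : rho (d^-1 *: x) != 0 by apply: contraNneq h => ->; rewrite mulr0.
  by move/hM; rewrite onormZ gtr0_norm ?invr_gt0// mulrC ler_pdivrMr// mulrC.
exists (conv (dil d rho) w).
  have [M hM] := Cc_bounded (theta_Cc k).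
  apply: (Cc_conv dc (isLp_Lw p1 Lw') (M := M)).
  by move=> y; rewrite /w mulf_eq0 negb_or => /andP[/hM].
rewrite (@Lp_congr _ _ _ _ (fun x => 1 * (v x - (theta phi k x)%:C * v x) + (-1) * (conv (dil d rho) w x - w x))); last first.
  by apply/funext => x; rewrite /w; ring.
have m1 : cmeas (fun x => v x - (theta phi k x)%:C * v x) by apply: cmeasB; [exact: Lv.1|exact: mw].
have m2 : cmeas (fun x => conv (dil d rho) w x - w x).
  by apply: cmeasB => //; apply: cmeas_conv; [exact: schw_dil|exact: isLp_Lw Lw'].
apply: le_trans (Lp_le_lin 1 p1 m1 (cmeasZ _ m2) (hk k (leqnn k)) (_ : (_ <= (e / 2)%:E)%E)) _.
  by rewrite LpZ// normcN normcr1 mul1e; apply: hd; rewrite d0 lexx.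
by rewrite lee_fin normcr1 mul1r -splitr.
Qed.

(** For a test function f, Young's inequality is used with the roles exchanged: f in L^1 and the
    dilate in L^p, whose norm tends to 0 because p > 1. Density and the uniform L^p bound do the
    rest. *)
Lemma vanish p rho v : (0 < n)%N -> 1 < p -> schw rho -> isLp p v -> forall e, 0 < e ->
  exists2 T : R, 0 < T & forall t, T <= t -> (Lp p (conv (dil t rho) v) <= e%:E)%E.
Proof.
move=> n0 p1 sr Lv e e0; have p1' := ltW p1; have p0 : 0 < p by exact: lt_trans p1.
pose K := 2 * rnorm rho; have K0 : 0 <= K by rewrite mulr_ge0// rnorm_ge0.
have eta0 : 0 < e / 2 / (K + 1) by rewrite !divr_gt0// ltr_wpDl.
have [f fc hf] := Lp_dense p1' Lv eta0; have sf := Cc_schw fc.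
have Lf : isLp p f by exact: schw_isLp.
have Lr : isLp p rho by exact: schw_isLp.
have fr : Lp p rho \is a fin_num by rewrite ge0_fin_numE ?Lp_ge0//; exact: isLp_fin.
pose A := 2 * rnorm f * fine (Lp p rho).
have A0 : 0 <= A by rewrite !mulr_ge0 ?rnorm_ge0 ?fine_ge0 ?Lp_ge0.
pose q := 1 - p^-1; have q0 : 0 < q by rewrite subr_gt0 invf_lt1.
(* With t >= 1 and n >= 1 the norm of the dilate decays at least like t^-q, and beyond [T] that
   beats the constant [A]. *)
pose T := Num.max 1 (((A + 1) / (e / 2)) `^ q^-1).
have T1 : 1 <= T by rewrite le_max lexx.
exists T => [|t Tt]; first exact: lt_le_trans T1.
have t1 : 1 <= t by exact: le_trans Tt.
have t0 : 0 < t by exact: lt_le_trans t1.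
have sd := schw_dil t0 sr.
have Lvf := isLpB p1' Lv Lf.
rewrite (@Lp_congr _ _ _ _ (fun x => 1 * conv (dil t rho) (fun y => v y - f y) x + conv (dil t rho) f x)); last first.
  apply/funext => x.
  have := conv_linr 1 x sd (isLp_Lw p1' Lvf) (isLp_Lw p1' Lf).
  rewrite (_ : (fun y => 1 * (v y - f y) + f y) = v) => [->//|].
  by apply/funext => y; ring.
have h1 : (Lp p (conv (dil t rho) (fun y => (v y - f y)%R)) <= (K * (e / 2 / (K + 1)))%:E)%E.
  by apply: (young_le p1' sd Lvf _ hf); rewrite rnorm_dil//; exact: schw_L1.
have h2 : (Lp p (conv (dil t rho) f) <= (e / 2)%:E)%E.
  rewrite (@Lp_congr _ _ _ _ (conv f (dil t rho))); last by apply/funext => x; exact: conv_schwC.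
  apply: le_trans (young p1' sf (schw_isLp p1' sd)) _.
  rewrite Lp_dil//; last exact: Lr.1.
  rewrite -(fineK fr) -!EFinM lee_fin mulrCA -/A.
  have tq : (A + 1) / (e / 2) <= t `^ q.
    apply: le_trans (_ : (((A + 1) / (e / 2)) `^ q^-1) `^ q <= _).
      by rewrite -powRrM mulVf ?gt_eqF// powRr1// divr_ge0// ?addr_ge0// ltW// divr_gt0.
    rewrite ge0_ler_powR ?nnegrE ?powR_ge0 ?(ltW q0) ?(ltW t0)//.
    by apply: le_trans Tt; rewrite le_max lexx orbT.
  have nq : t `^ (n%:R * (p^-1 - 1)) <= (t `^ q)^-1.
    rewrite -powRN ler_powR// /q opprB.
    by rewrite -[leRHS]mul1r ler_wnM2r ?ler1n// subr_le0 invf_le1// ltW.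
  have tq0 : 0 < t `^ q by exact: powR_gt0.
  apply: le_trans (ler_wpM2r A0 nq) _.
  rewrite mulrC ler_pdivrMr//; move: tq; rewrite ler_pdivrMr ?divr_gt0// mulrC => tq.
  by apply: le_trans tq; rewrite lerDl.
apply: le_trans (Lp_le_lin 1 p1' (cmeas_conv sd (isLp_Lw p1' Lvf)) (cmeas_conv sd (isLp_Lw p1' Lf)) h1 h2) _.
rewrite lee_fin normcr1 mul1r [leRHS](splitr e) lerD2r mulrA ler_pdivrMr ?ltr_wpDl//.
by rewrite mulrC ler_wpM2l ?lerDl// divr_ge0// ltW.
Qed.

Lemma rnorm_le a (C : R) : L1 a -> (Lp 1 a <= C%:E)%E -> rnorm a <= C.
Proof. by move=> La; rewrite Lp1 inormE// lee_fin. Qed.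

(** [dil_approx] compares the convolution with the integral of [a] times [b], here 0, so the linear
    rate becomes smallness of the convolution itself. *)
Lemma conv_dil_mean0 a b : schw a -> schw b -> cintegral a = 0 -> exists2 C : R, 0 <= C &
  forall t, 0 < t <= 1 -> rnorm (conv (dil t a) b) <= C * t.
Proof.
move=> sa sb a0; have [C C0 hC] := dil_approx (@bell_ge0 R n) sa (schw_Lw sb) (schw_lipdecay sb).
have [K K0 hK] := Lp_bell_le (n := n) (lexx (1 : R)).
exists (C * K); first exact: mulr_ge0.
move=> t /[dup] ht /andP[t0 t1]; have sd := schw_dil t0 sa.
have mc : cmeas (conv (dil t a) b) by apply: cmeas_conv => //; exact: schw_Lw.
have hb x : normc (conv (dil t a) b x) <= C * t * bell x.
  by have := hC t ht x; rewrite a0 mul0r subr0.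
apply: rnorm_le; first exact: decay_L1 hb.
by rewrite mulrAC; apply: hK => //; rewrite mulr_ge0// ltW.
Qed.

(** Rescaling by 1/t preserves L^1 norms and exchanges the two functions, so this is
    [conv_dil_mean0] with [b] as the one of mean zero. *)
Lemma conv_dil_mean0_large a b : schw a -> schw b -> cintegral b = 0 -> exists2 C : R, 0 <= C &
  forall t, 1 <= t -> rnorm (conv (dil t a) b) <= C * t^-1.
Proof.
move=> sa sb b0; have [C C0 hC] := conv_dil_mean0 sb sa b0.
exists C => // t t1; have t0 : 0 < t by exact: lt_le_trans t1.
have t0' : 0 < t^-1 by rewrite invr_gt0.
have tt : 0 < t^-1 <= 1 by rewrite t0' invf_le1.
apply: le_trans (hC _ tt).
have sd := schw_dil t0' sb.
have bE : b = dil t (dil t^-1 b) by rewrite dil_dil mulfV ?dil1// gt_eqF.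
have p1 : (1 : R) <= 1 by [].
have Lc : L1 (conv a (dil t^-1 b)) := (isLp1 _).1 (isLp_conv p1 sa (schw_isLp p1 sd)).
rewrite [X in conv _ X]bE (conv_dil t0 sa (schw_Lw sd)) (rnorm_dil t0 Lc).
suff -> : conv a (dil t^-1 b) = conv (dil t^-1 b) a by [].
by apply/funext => x; exact: conv_schwC.
Qed.

Lemma Lp1_dil t f : 0 < t -> cmeas f -> Lp 1 (dil t f) = Lp 1 f.
Proof. by move=> t0 mf; rewrite Lp_dil// invr1 subrr mulr0 powRr0 mul1e. Qed.

Lemma Lp1_conv_dil t a b : 0 < t -> schw a -> schw b -> Lp 1 (conv (dil t a) b) = Lp 1 (conv (dil t^-1 b) a).
Proof.
move=> t0 sa sb; have t0' : 0 < t^-1 by rewrite invr_gt0.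
have sd := schw_dil t0' sb.
have bE : b = dil t (dil t^-1 b) by rewrite dil_dil mulfV ?dil1// gt_eqF.
rewrite [X in conv _ X]bE (conv_dil t0 sa (schw_Lw sd)) Lp1_dil//.
  by apply: Lp_congr; apply/funext => x; exact: conv_schwC.
by apply: cmeas_conv => //; exact: schw_Lw.
Qed.

(** At p = 1 dilations preserve the norm and give no decay. For a test function f close to [v],
    rescaling turns the convolution into that of [rho] with a concentrated f, close to the integral
    of f times [rho]; that integral is small as [v] has mean zero. *)
Lemma vanish1 rho v : schw rho -> L1 v -> cintegral v = 0 -> forall e, 0 < e ->
  exists2 T : R, 0 < T & forall t, T <= t -> (Lp 1 (conv (dil t rho) v) <= e%:E)%E.
Proof.
move=> sr Lv v0 e e0; have p1 := lexx (1 : R).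
have Lv1 : isLp 1 v by exact/isLp1.
pose K := 2 * rnorm rho; have K0 : 0 <= K by rewrite mulr_ge0// rnorm_ge0.
(* One K * eta comes from v - f, the other from the integral of f, which is at most 2 * eta in
   modulus, times the norm of [rho]. *)
pose eta := e / 2 / (K + K + 1).
have eta0 : 0 < eta by rewrite !divr_gt0// ltr_wpDl// addr_ge0.
have [f fc hf] := Lp_dense p1 Lv1 eta0; have sf := Cc_schw fc.
have Lf : isLp 1 f by exact: schw_isLp.
have Lvf := isLpB p1 Lv1 Lf.
have If : normc (cintegral f) <= 2 * eta.
  have -> : cintegral f = - cintegral (fun x => v x - f x).
    by rewrite cintegralB// ?v0 ?sub0r ?opprK//; exact/isLp1.
  rewrite normcN -lee_fin; apply: le_trans (normc_cintegral _) _; first exact/isLp1.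
  by rewrite EFinM lee_pmul2l// -Lp1.
have [C C0 hC] := dil_approx (@bell_ge0 R n) sf (schw_Lw sr) (schw_lipdecay sr).
have [B B0 hB] := Lp_bell_le (n := n) p1.
have CB0 : 0 <= C * B by exact: mulr_ge0.
pose T := Num.max 1 ((C * B + 1) / (e / 2)).
have T1 : 1 <= T by rewrite le_max lexx.
exists T => [|t Tt]; first exact: lt_le_trans T1.
have t1 : 1 <= t by exact: le_trans Tt.
have t0 : 0 < t by exact: lt_le_trans t1.
have sd := schw_dil t0 sr.
have t0' : 0 < t^-1 by rewrite invr_gt0.
have tt : 0 < t^-1 <= 1 by rewrite t0' invf_le1.
rewrite (@Lp_congr _ _ _ _ (fun x => 1 * conv (dil t rho) (fun y => v y - f y) x + conv (dil t rho) f x)); last first.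
  apply/funext => x.
  have := conv_linr 1 x sd (isLp_Lw p1 Lvf) (isLp_Lw p1 Lf).
  rewrite (_ : (fun y => 1 * (v y - f y) + f y) = v) => [->//|].
  by apply/funext => y; ring.
have h1 : (Lp 1 (conv (dil t rho) (fun y => (v y - f y)%R)) <= (K * eta)%:E)%E.
  by apply: (young_le p1 sd Lvf _ hf); rewrite rnorm_dil//; exact: schw_L1.
have h2 : (Lp 1 (conv (dil t rho) f) <= (2 * eta * rnorm rho + C * t^-1 * B)%:E)%E.
  rewrite Lp1_conv_dil//.
  have mc : cmeas (fun x => conv (dil t^-1 f) rho x - cintegral f * rho x).
    by apply: cmeasB; [apply: cmeas_conv; [exact: schw_dil|exact: schw_Lw]|apply: cmeasZ; exact: schw_cmeas].
  rewrite (@Lp_congr _ _ _ _ (fun x => cintegral f * rho x + (conv (dil t^-1 f) rho x - cintegral f * rho x))); last first.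
    by apply/funext => x; ring.
  have hB' := hB _ (C * t^-1) (mulr_ge0 C0 (ltW t0')) mc (hC _ tt).
  have hr : (Lp 1 rho <= (rnorm rho)%:E)%E by rewrite Lp1 -inormE//; exact: schw_L1.
  apply: le_trans (Lp_le_lin _ p1 (schw_cmeas sr) mc hr hB') _.
  by rewrite lee_fin lerD2r ler_wpM2r// rnorm_ge0.
apply: le_trans (Lp_le_lin 1 p1 (cmeas_conv sd (isLp_Lw p1 Lvf)) (cmeas_conv sd (isLp_Lw p1 Lf)) h1 h2) _.
rewrite lee_fin normcr1 mul1r.
have -> : K * eta + (2 * eta * rnorm rho + C * t^-1 * B) = (K + K) * eta + C * B * t^-1 by rewrite /K; ring.
rewrite [leRHS](splitr e); apply: lerD.
  rewrite /eta mulrA ler_pdivrMr ?ltr_wpDl ?addr_ge0// mulrC ler_wpM2l ?lerDl//.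
  by rewrite divr_ge0// ltW.
rewrite ler_pdivrMr//.
have : (C * B + 1) / (e / 2) <= t by apply: le_trans Tt; rewrite le_max lexx orbT.
rewrite ler_pdivrMr ?divr_gt0// => h; rewrite [leRHS]mulrC; apply: le_trans h; by rewrite lerDl.
Qed.

End density.

(** * Dyadic blocks of the smoothing operator *)

Section dyadic.
Context {R : realType} {n : nat}.
Local Notation E := 'rV[R]_n.
Implicit Types (f k v a b : E -> R[i]) (p t d : R).
Variable phi : E -> R.
Hypothesis hphi : LP_cutoff phi.
Local Notation c0 := (cF (cphi phi)).

Definition two (j : int) : R := (2 : R) ^ j.

Lemma two_gt0 j : 0 < two j. Proof. exact: exprz_gt0. Qed.
Lemma two_neq0 j : two j != 0. Proof. exact: lt0r_neq0 (two_gt0 j). Qed.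
Lemma twoN j : two (- j) = (two j)^-1. Proof. by rewrite /two -invr_expz. Qed.

(* Equal to 1 on the support of the Littlewood-Paley function of index 0. *)
Definition tpsi : E -> R[i] := fun xi => cphi phi (4^-1 *: xi) - cphi phi (2 *: xi).

Lemma schw_tpsi : schw tpsi.
Proof. by apply: schwB; apply: schw_scale => //; exact: schw_cphi. Qed.

Lemma tpsi_eq1 xi : 2 / 3 <= enorm xi -> enorm xi < 3 -> tpsi xi = 1.
Proof.
move=> h1 h2; rewrite /tpsi /cphi (phi_eq1 hphi).
  by rewrite (phi_supp hphi) ?subr0// enormZ ger0_norm//; lra.
by rewrite enormZ ger0_norm ?invr_ge0//; lra.
Qed.

Definition tker := fourier_inv tpsi.

Lemma schw_tker : schw tker. Proof. exact: schw_fourier_inv schw_tpsi. Qed.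

Lemma fourier0 f : fourier f 0 = cintegral f.
Proof.
rewrite /fourier; congr cintegral; apply/funext => x.
by rewrite (_ : dotv x 0 = 0) ?oppr0 ?expi0 ?mulr1//; apply: big1 => i _; rewrite mxE mulr0.
Qed.

Lemma cintegral_tker : cintegral tker = 0.
Proof.
rewrite -fourier0 (fourier_invK (schw_cphi hphi) (cphi0 hphi))//; last exact: schw_tpsi.
by rewrite /tpsi !scaler0 subrr mulr0.
Qed.

(** The j-th dyadic piece of a symbol homogeneous of degree [d], [B] being the piece of index 0. *)
Definition scl d B (j : int) : E -> R[i] := fun xi => (two j `^ d)%:C * B (two (- j) *: xi).

Lemma schw_scl d B j : schw B -> schw (scl d B j).
Proof. by move=> sB; apply: schwZ; apply: schw_scale => //; exact: two_neq0. Qed.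

Lemma fourier_inv_scl d B j : schw B ->
  fourier_inv (scl d B j) = fun x => (two j `^ d)%:C * dil (two (- j)) (fourier_inv B) x.
Proof.
move=> sB; apply/funext => x; rewrite /scl fourier_invZ; last first.
  by apply: schw_L1; apply: schw_scale => //; exact: two_neq0.
by rewrite (fourier_inv_scale (two_gt0 _) sB).
Qed.

Opaque Mlt cintegral fourier fourier_inv.

Section mean_zero.
Variable zeta : E -> R[i].
Hypothesis sz : schw zeta.
Hypothesis z0 : cintegral zeta = 0.

(** The transpose of S, convolution with [zeta]: powers of S on distributions are iterates of [Zop]
    on test functions. *)
Definition Zop f := Mlt (sym phi zeta) f.

Lemma schw_Zop f : schw f -> schw (Zop f).
Proof. by move=> sf; apply: schw_Mlt => //; exact: schw_sym. Qed.

Lemma schw_iterZ N f : schw f -> schw (iter N Zop f).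
Proof. by move=> sf; elim: N => [|N IH]; [exact: sf|exact: (schw_Zop IH)]. Qed.

Definition tpsij j : E -> R[i] := fun xi => tpsi (two (- j) *: xi).

Lemma schw_tpsij j : schw (tpsij j).
Proof. by apply: schw_scale; [exact: two_neq0|exact: schw_tpsi]. Qed.

(** The symbol of S localised to frequencies of order 2^j; [mu j] is its kernel, small in L^1 at
    both ends of the axis. *)
Definition msym j : E -> R[i] := fun xi => tpsij j xi * sym phi zeta xi.

Lemma schw_msym j : schw (msym j).
Proof. by apply: schwM; [exact: schw_tpsij|exact: schw_sym]. Qed.

Definition mu j := fourier_inv (msym j).

Lemma schw_mu j : schw (mu j). Proof. exact: schw_fourier_inv (schw_msym j). Qed.

Lemma muE j : mu j = fun x => c0^-1 * conv (dil (two (- j)) tker) zeta x.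
Proof.
apply/funext => x; rewrite /mu /msym /sym.
have -> : (fun xi => tpsij j xi * (c0^-1 * fourier zeta xi)) = fun xi => c0^-1 * (tpsij j xi * fourier zeta xi).
  by apply/funext => xi; ring.
rewrite fourier_invZ; last by apply: schw_L1; apply: schwM; [exact: schw_tpsij|exact: schw_fourier].
rewrite (fourier_inv_conv x (schw_tpsij j) (schw_L1 sz)).
by rewrite /tpsij (fourier_inv_scale (two_gt0 _) schw_tpsi).
Qed.

Lemma rnormZ (c : R[i]) f : L1 f -> rnorm (fun x => c * f x) = normc c * rnorm f.
Proof. by move=> Lf; rewrite /rnorm inormZ ?inormE//; case: Lf. Qed.

(* Both bounds come from the same estimate: rescaling exchanges the roles of the two kernels. *)
Lemma mu_bound : exists2 C : R, 0 <= C & forall k : nat,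
  rnorm (mu k%:Z) <= C * 2^-1 ^+ k /\ rnorm (mu (- k%:Z)) <= C * 2^-1 ^+ k.
Proof.
have [C1 C10 h1] := conv_dil_mean0 schw_tker sz cintegral_tker.
have [C2 C20 h2] := conv_dil_mean0_large schw_tker sz z0.
have n0 := normc_ge0 (c0^-1).
exists (normc c0^-1 * (C1 + C2)); first by rewrite mulr_ge0// addr_ge0.
have Lc j : L1 (conv (dil (two (- j)) tker) zeta).
  apply/isLp1; apply: isLp_conv => //; last exact: schw_isLp.
  by apply: schw_dil; [exact: two_gt0|exact: schw_tker].
have e0 (k : nat) : (0 : R) < 2^-1 ^+ k by rewrite exprn_gt0// invr_gt0.
have rE j : rnorm (mu j) = normc c0^-1 * rnorm (conv (dil (two (- j)) tker) zeta).
  by rewrite muE (rnormZ _ (Lc j)).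
move=> k; rewrite (rE k%:Z) (rE (- k%:Z)) -mulrA; split; apply: (ler_wpM2l n0).
  have -> : two (- k%:Z) = 2^-1 ^+ k by rewrite twoN /two exprVn.
  have ek : 0 < (2^-1 ^+ k : R) <= 1.
    by apply/andP; split; [exact: e0|rewrite exprn_ile1 ?invr_ge0// invf_le1// ler1n].
  by apply: le_trans (h1 _ ek) _; apply: ler_wpM2r; [exact: ltW|rewrite lerDl].
have -> : two (- - k%:Z) = 2 ^+ k by rewrite opprK.
have ek : (1 : R) <= 2 ^+ k by rewrite exprn_ege1// ler1n.
apply: le_trans (h2 _ ek) _; rewrite exprVn; apply: ler_wpM2r; last by rewrite lerDr.
by rewrite invr_ge0 exprn_ge0.
Qed.

Lemma isLp_iter_conv p k v N : 1 <= p -> schw k -> isLp p v -> isLp p (iter N (conv k) v).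
Proof. by move=> p1 sk Lv; elim: N => [|N IH]; [exact: Lv|exact: (isLp_conv p1 sk IH)]. Qed.

Lemma iter_conv_bound p k v (C e : R) N : 1 <= p -> schw k -> isLp p v -> 0 <= e ->
  (Lp p v <= e%:E)%E -> 2 * rnorm k <= C -> (Lp p (iter N (conv k) v) <= (C ^+ N * e)%:E)%E.
Proof.
move=> p1 sk Lv e0 ve kC; elim: N => [|N IH]; first by rewrite expr0 mul1r.
by rewrite exprS -mulrA; exact: (young_le p1 sk (isLp_iter_conv N p1 sk Lv) kC IH).
Qed.

Section block.
Variables (B : E -> R[i]) (d : R).
Hypothesis sB : schw B.
Hypothesis BE : forall xi, B xi * tpsi xi = B xi.

Lemma Mlt_tpsi j f : schw f -> Mlt (msym j) (Mlt (scl d B j) f) = Mlt (scl d B j) (Zop f).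
Proof.
move=> sf; have s1 := schw_scl d j sB.
have s2 := schw_msym j; have s3 : schw (sym phi zeta) by exact: schw_sym.
rewrite /Zop (Mlt_comp hphi s2 s1 sf) (Mlt_comp hphi s1 s3 sf).
suff -> : (fun xi => c0 * (msym j xi * scl d B j xi)) = fun xi => c0 * (scl d B j xi * sym phi zeta xi) by [].
apply/funext => xi; congr (_ * _); rewrite /msym /scl /tpsij.
have := BE (two (- j) *: xi); set x := two (- j) *: xi => BEx.
by rewrite -[in RHS]BEx; move: (tpsi x) (B x) (sym phi zeta xi) (two j `^ d)%:C => t b z q; ring.
Qed.

(** Every one of the N factors of S is localised in turn and moved to [v] as a convolution with
    [mu j]. *)
Lemma pair_iter_conv p v f j N : 1 <= p -> isLp p v -> schw f ->
  cintegral (fun x => conv (fourier_inv (scl d B j)) (iter N (conv (mu j)) v) x * f x) =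
  cintegral (fun x => v x * Mlt (scl d B j) (iter N Zop f) x).
Proof.
move=> p1 Lv sf; have s1 := schw_scl d j sB.
have LW M : Lw (iter M (conv (mu j)) v) := isLp_Lw p1 (isLp_iter_conv M p1 (schw_mu j) Lv).
have key M g : schw g -> cintegral (fun x => iter M (conv (mu j)) v x * Mlt (scl d B j) g x) =
    cintegral (fun x => v x * Mlt (scl d B j) (iter M Zop g) x).
  elim: M g => [g sg|M IH g sg]; first exact: erefl.
  transitivity (cintegral (fun x => iter M (conv (mu j)) v x * Mlt (msym j) (Mlt (scl d B j) g) x)).
    exact: (conv_Mlt (schw_msym j) (LW M) (schw_Mlt s1 sg)).
  rewrite (Mlt_tpsi j sg) iterSr.
  exact: (IH _ (schw_Zop sg)).
by rewrite (conv_Mlt s1 (LW N) sf); exact: (key N f sf).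
Qed.

(** The origin of the exponent N + 1: N factors of size 2^-k absorb the growth of the symbol, and
    one is left for summation. *)
Lemma pow_two_le d' (N k : nat) (j : int) : `|d'| <= N%:R -> j = k%:Z \/ j = - k%:Z ->
  (two j `^ d') * 2^-1 ^+ k ^+ N.+1 <= 2^-1 ^+ k.
Proof.
move=> dN hj.
have k0 : (0 : R) < 2 ^+ k by rewrite exprn_gt0.
have h : two j `^ d' <= (2 ^+ k) ^+ N.
  apply: le_trans (_ : (2 ^+ k) `^ `|d'| <= _).
    case: hj => ->.
      by apply: ler_powR; [rewrite exprn_ege1// ler1n|exact: ler_norm].
    rewrite twoN -powR_inv1 ?(ltW k0)// -powRrM mulN1r.
    by apply: ler_powR; [rewrite exprn_ege1// ler1n|rewrite -normrN; exact: ler_norm].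
  by rewrite -(powR_mulrn N (ltW k0)); apply: ler_powR => //; rewrite exprn_ege1// ler1n.
have e0 : (0 : R) <= (2^-1 ^+ k) ^+ N.+1 by rewrite !exprn_ge0// invr_ge0.
apply: le_trans (ler_wpM2r e0 h) _.
by rewrite exprSr mulrA exprVn exprVn mulfV ?mul1r// expf_neq0// gt_eqF.
Qed.

Lemma half_sum (M : nat) : \sum_(k < M) (2^-1 : R) ^+ k <= 2.
Proof.
have : \sum_(k < M) (2^-1 : R) ^+ k = 2 - 2 * 2^-1 ^+ M.
  elim: M => [|M IH]; first by rewrite big_ord0 expr0 mulr1 subrr.
  by rewrite big_ord_recr/= IH exprS; field.
by move=> ->; rewrite gerBl mulr_ge0// exprn_ge0// invr_ge0.
Qed.

(** One end of the frequency axis. Each term is bounded in L^p by Young's inequality, once for the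
    block and once for each factor [mu], so the series is dominated by a geometric one; [sg] runs
    over k or over -(k+1). *)
Lemma dyadic_half (p : R) N (sg : nat -> int) : 1 <= p -> `|d| <= N%:R ->
  (forall k : nat, exists2 m, (k <= m)%N & sg k = m%:Z \/ sg k = - m%:Z) -> exists2 C : R, 0 <= C & forall v, isLp p v ->
  exists G, [/\ isLp p G, (Lp p G <= C%:E * Lp p v)%E & forall f, schw f -> forall e, 0 < e ->
    exists N0, forall M, (N0 <= M)%N ->
    normc (\sum_(k < M) cintegral (fun x => v x * Mlt (scl d B (sg k)) (iter N.+1 Zop f) x) -
      cintegral (fun x => G x * f x)) < e].
Proof.
move=> p1 dN hsg; have [C C0 hC] := mu_bound; have p0 : 0 < p by exact: lt_le_trans p1.
have sI := schw_fourier_inv sB; pose b := 2 * rnorm (fourier_inv B).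
have b0 : 0 <= b by rewrite mulr_ge0// rnorm_ge0.
pose C' := b * (2 * C) ^+ N.+1.
have C'0 : 0 <= C' by rewrite mulr_ge0// exprn_ge0// mulr_ge0.
exists (2 * C') => [|v Lv]; first by rewrite mulr_ge0.
have fv : Lp p v \is a fin_num by rewrite ge0_fin_numE ?Lp_ge0//; exact: isLp_fin.
pose V := fine (Lp p v); have V0 : 0 <= V by rewrite fine_ge0// Lp_ge0.
have vV : (Lp p v <= V%:E)%E by rewrite fineK.
pose g (k : nat) := conv (fourier_inv (scl d B (sg k))) (iter N.+1 (conv (mu (sg k))) v).
have Lit (k : nat) : isLp p (iter N.+1 (conv (mu (sg k))) v) := isLp_iter_conv N.+1 p1 (schw_mu (sg k)) Lv.
have sF (k : nat) : schw (fourier_inv (scl d B (sg k))) := schw_fourier_inv (schw_scl d (sg k) sB).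
have Lg (k : nat) : isLp p (g k) := isLp_conv p1 (sF k) (Lit k).
have rF (k : nat) : 2 * rnorm (fourier_inv (scl d B (sg k))) <= two (sg k) `^ d * b.
  have sD := schw_dil (two_gt0 (- sg k)) sI.
  rewrite (fourier_inv_scl d (sg k) sB) (rnormZ _ (schw_L1 sD)) (rnorm_dil (two_gt0 _) (schw_L1 sI)).
  by rewrite normc_real ger0_norm ?powR_ge0// mulrCA.
have gb (k : nat) : (Lp p (g k) <= (C' * V * 2^-1 ^+ k)%:E)%E.
  have [m km hm] := hsg k.
  have rmu : 2 * rnorm (mu (sg k)) <= 2 * C * 2^-1 ^+ m.
    rewrite -mulrA; apply: ler_wpM2l; first exact: ler0n.
    by case: hm => ->; [exact: (hC m).1|exact: (hC m).2].
  have h1 := iter_conv_bound N.+1 p1 (schw_mu (sg k)) Lv V0 vV rmu.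
  apply: le_trans (young_le p1 (sF k) (Lit k) (rF k) h1) _; rewrite lee_fin exprMn.
  have -> : two (sg k) `^ d * b * ((2 * C) ^+ N.+1 * (2^-1 ^+ m) ^+ N.+1 * V) =
     C' * V * (two (sg k) `^ d * (2^-1 ^+ m) ^+ N.+1) by rewrite /C'; ring.
  apply: ler_wpM2l; first exact: mulr_ge0.
  apply: le_trans (pow_two_le dN hm) _.
  by apply: ler_wiXn2l => //; rewrite ?invr_ge0// invf_le1// ler1n.
have hA M : \sum_(k < M) C' * V * 2^-1 ^+ k <= C' * V * 2.
  by rewrite -mulr_sumr; apply: ler_wpM2l; [exact: mulr_ge0|exact: half_sum].
have [G [LG GA Gf]] := Lp_series p1 Lg gb hA.
exists G; split; first exact: LG.
  by apply: le_trans GA _; rewrite -(fineK fv) -EFinM lee_fin -/V mulrC mulrA.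
move=> f sf e e0; have [N0 hN] := Gf f sf e e0; exists N0 => M /hN.
by under eq_bigr do rewrite (pair_iter_conv _ _ p1 Lv sf).
Qed.

(** The scalar form of [distr_sum], with the two ends independent. *)
Definition bisum (a : int -> R[i]) (l : R[i]) := forall e : R, 0 < e ->
  \forall M & N \near \oo, normc (\sum_(0 <= k < (M + N).+1) a (k%:Z - M%:Z) - l) < e.

Lemma bisumI (a : int -> R[i]) (l1 l2 : R[i]) :
  (forall e, 0 < e -> exists N0, forall M, (N0 <= M)%N -> normc (\sum_(k < M) a k%:Z - l1) < e) ->
  (forall e, 0 < e -> exists N0, forall M, (N0 <= M)%N -> normc (\sum_(k < M) a (- k.+1%:Z) - l2) < e) ->
  bisum a (l1 + l2).
Proof.
move=> h1 h2 e e0; have e2 : 0 < e / 2 by rewrite divr_gt0.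
have [N1 H1] := h1 _ e2; have [N2 H2] := h2 _ e2.
have E1 M N : \sum_(0 <= k < (M + N).+1) a (k%:Z - M%:Z) =
    \sum_(k < N.+1) a k%:Z + \sum_(k < M) a (- k.+1%:Z).
  rewrite (@big_cat_nat _ _ _ M)//=; last by rewrite -addnS leq_addr.
  rewrite addrC; congr (_ + _).
    rewrite -{1}(add0n M) big_addn -addnS addKn big_mkord; apply: eq_bigr => k _.
    by rewrite PoszD addrK.
  rewrite big_nat_rev/= add0n big_mkord.
  apply: eq_bigr => k _; congr a.
  by rewrite -subzn ?ltn_ord// addrAC subrr add0r.
exists ([set k | (N2 <= k)%N], [set k | (N1 <= k)%N]).
  by split; [exists N2|exists N1].
move=> [M N] [/= hM hN]; rewrite E1 opprD addrACA.
apply: le_lt_trans (le_normcD _ _) _; rewrite (splitr e); apply: ltrD.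
  by apply: H1; exact: leqW.
exact: H2.
Qed.

(** The replacement for a multiplier theorem: a symbol of order at most N in absolute value,
    followed by N + 1 factors of S, is bounded on every L^p, p = 1 included. *)
Lemma dyadic_sum (p : R) N : 1 <= p -> `|d| <= N%:R -> exists2 C : R, 0 <= C & forall v, isLp p v ->
  exists G, [/\ isLp p G, (Lp p G <= C%:E * Lp p v)%E & forall f, schw f ->
    bisum (fun j => cintegral (fun x => v x * Mlt (scl d B j) (iter N.+1 Zop f) x))
      (cintegral (fun x => G x * f x))].
Proof.
move=> p1 dN.
have [C1 C10 h1] := @dyadic_half p N (fun k : nat => k%:Z) p1 dN (fun k : nat => ex_intro2 _ _ k (leqnn k) (or_introl erefl)).
have [C2 C20 h2] := @dyadic_half p N (fun k : nat => - k.+1%:Z) p1 dN (fun k : nat => ex_intro2 _ _ k.+1 (leqnSn k) (or_intror erefl)).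
exists (C1 + C2); first exact: addr_ge0.
move=> v Lv; have [G1 [L1' B1 H1]] := h1 v Lv; have [G2 [L2 B2 H2]] := h2 v Lv.
exists (fun x => G1 x + G2 x); split; first exact: (isLpD p1 L1' L2).
  apply: le_trans (LpD p1 L1'.1 L2.1) _; rewrite EFinD ge0_muleDl//; exact: leeD.
move=> f sf.
have LM u : isLp p u -> L1 (fun x => u x * f x).
  by move=> Lu; have := schw_LwM sf (isLp_Lw p1 Lu); congr L1; apply/funext => x; rewrite mulrC.
have -> : cintegral (fun x => (G1 x + G2 x) * f x) = cintegral (fun x => G1 x * f x) + cintegral (fun x => G2 x * f x).
  rewrite -(cintegralD (LM _ L1') (LM _ L2)); congr cintegral; apply/funext => x; exact: mulrDl.
apply: bisumI; [exact: H1|exact: H2].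
Qed.

End block.
End mean_zero.
End dyadic.

(** * Powers of the modulus as smooth symbols, and the Littlewood-Paley blocks *)

Section power_symbols.
Context {R : realType} {n : nat}.
Local Notation E := 'rV[R]_n.
Variable phi : E -> R.
Hypothesis hphi : LP_cutoff phi.

(* [|xi|^2], made positive near the origin. *)
Definition qreg (xi : E) : R := dotv xi xi + phi (2 *: xi).
Definition cqreg (xi : E) : R[i] := (qreg xi)%:C.

Lemma smooth_dotv : smooth (fun xi : E => (dotv xi xi)%:C).
Proof.
rewrite (_ : (fun xi => _) = fun xi : E => \sum_(i < n) (xi ord0 i)%:C * (xi ord0 i)%:C); last first.
  by apply/funext => xi; rewrite /dotv rmorph_sum; apply: eq_bigr => i _; rewrite rmorphM.
elim: (index_enum _) => [|i r IH].
  by rewrite (_ : (fun xi => _) = fun=> 0); [exact: smooth_cst|apply/funext => xi; rewrite big_nil].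
rewrite (_ : (fun xi => _) = fun xi : E => (xi ord0 i)%:C * (xi ord0 i)%:C +
    \sum_(j <- r) (xi ord0 j)%:C * (xi ord0 j)%:C).
  by apply: smoothD => //; apply: smoothM; exact: smooth_coord.
by apply/funext => xi; rewrite big_cons.
Qed.

Lemma smooth_cqreg : smooth cqreg.
Proof.
rewrite (_ : cqreg = fun xi => (dotv xi xi)%:C + cphi phi (2 *: xi)); last first.
  by apply/funext => xi; rewrite /cqreg /qreg rmorphD.
apply: smoothD; first exact: smooth_dotv.
by apply: schw_smooth; apply: schw_scale => //; exact: schw_cphi.
Qed.

Lemma qreg_gt0 xi : 0 < qreg xi.
Proof.
have d0 : 0 <= dotv xi xi by exact: dotv_ge0.
have [x0|x0] := ltP (enorm (2 *: xi)) (3 / 4).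
  by rewrite /qreg (phi_eq1 hphi) ?ltr_wpDl.
have : 0 < enorm xi by move: x0; rewrite enormZ ger0_norm//; lra.
move=> e0; rewrite /qreg ltr_wpDr ?(phi_ge0 hphi)//.
by rewrite -sqr_enorm exprn_gt0.
Qed.

Definition pw (t : R) (xi : E) : R[i] := (qreg xi `^ t)%:C.

Lemma pwS t xi : pw t xi = cqreg xi * pw (t - 1) xi.
Proof.
rewrite /pw /cqreg -rmorphM /=; congr (_%:C).
have q0 := qreg_gt0 xi.
move: (qreg xi) q0 => q q0.
have -> : q * q `^ (t - 1) = q `^ 1 * q `^ (t - 1) by rewrite powRr1// ltW.
rewrite -powRD; last by apply/implyP => _; rewrite gt_eqF.
by congr (_ `^ _); ring.
Qed.

Lemma pw_diff t x : cdiff (pw t) x /\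
  forall i, pderiv i (pw t) x = t%:C * pderiv i cqreg x * pw (t - 1) x.
Proof.
have [dq _] := smooth_cdiff x smooth_cqreg.
have {}dq : differentiable qreg x by exact: dq.
have dp : is_derive (qreg x) (1 : R) (@powR R ^~ t) (t * qreg x `^ (t - 1)).
  exact: is_derive1_powR (qreg_gt0 x).
have dpd : differentiable (@powR R ^~ t) (qreg x).
  by apply/derivable1_diffP; have [] := dp.
have dc : is_diff x ((@powR R ^~ t) \o qreg) ('d (@powR R ^~ t) (qreg x) \o 'd qreg x).
  exact: (@is_diff_comp _ _ _ _ _ _ _ _ _ (differentiableP dq) (differentiableP dpd)).
have [ddc vdc] := dc.
have imE : @complex.Im R \o pw t = cst 0 by apply/funext.
have imq : @complex.Im R \o cqreg = cst 0 by apply/funext.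
split; first by split; [exact: ddc|rewrite imE; exact: differentiable_cst].
move=> i; rewrite /pderiv imE imq !derive_cst.
rewrite -[@complex.Re R \o pw t]/((@powR R ^~ t) \o qreg) -[@complex.Re R \o cqreg]/qreg.
rewrite deriveE// vdc /= diff1E// derive1E derive_val deriveE//.
apply: complex_eq; rewrite !(Re_mulc, Im_mulc) /= !(mul0r, mulr0, subr0, addr0)//.
by rewrite /GRing.scale/=; ring.
Qed.

(** Products of a smooth function and a real power of [qreg] are stable under derivatives: the power
    drops by one and [pwS] restores a common factor. *)
Lemma smooth_pw t : smooth (pw t).
Proof.
apply: (closed_smooth (S := [set f | exists2 chi, smooth chi & exists t, f = fun x => chi x * pw t x])).
- move=> _ [chi sc [s ->]] x; apply: cdiffM; first exact: smooth_cdiff.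
  by have [] := pw_diff s x.
- move=> _ i [chi sc [s ->]].
  exists (fun x => pderiv i chi x * cqreg x + s%:C * (chi x * pderiv i cqreg x)).
    apply: smoothD; first by apply: smoothM; [exact: smooth_pderiv|exact: smooth_cqreg].
    by apply: smoothZ; apply: smoothM => //; apply: smooth_pderiv; exact: smooth_cqreg.
  exists (s - 1); apply/funext => x; have [d1 d2] := pw_diff s x.
  rewrite pderivM//; last exact: smooth_cdiff.
  by rewrite d2 pwS; ring.
exists (fun=> 1); first exact: smooth_cst.
by exists t; apply/funext => x; rewrite mul1r.
Qed.

Definition psi0 (xi : E) : R := phi (2^-1 *: xi) - phi xi.

Lemma psi0_supp xi : psi0 xi != 0 -> 3 / 4 <= enorm xi /\ enorm xi < 8 / 3.
Proof.
move=> h; split.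
  rewrite leNgt; apply/negP => h'; move/eqP: h; apply; rewrite /psi0.
  have h2 : enorm (2^-1 *: xi) < 3 / 4 by rewrite enormZ ger0_norm ?invr_ge0//; have := enorm_ge0 xi; lra.
  by rewrite !(phi_eq1 hphi) ?subrr.
rewrite ltNge; apply/negP => h'; move/eqP: h; apply; rewrite /psi0.
have h2 : 4 / 3 <= enorm (2^-1 *: xi) by rewrite enormZ ger0_norm ?invr_ge0//; lra.
by rewrite !(phi_supp hphi) ?subrr//; lra.
Qed.

Lemma LP_psiE j xi : LP_psi phi j xi = psi0 (two (- j) *: xi).
Proof. by rewrite /LP_psi /LP_phi /psi0 !scalerA [2^-1 * _]mulrC. Qed.

Definition asym (s : R) (xi : E) : R[i] := (enorm xi `^ s * psi0 xi)%:C.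

(** Where [psi0] does not vanish the correction in [qreg] does, so the regularised power is the true
    one. *)
Lemma asymE s xi : asym s xi = (psi0 xi)%:C * pw (s / 2) xi.
Proof.
rewrite /asym /pw -rmorphM mulrC; congr (_%:C).
have [->|/psi0_supp[h1 h2]] := eqVneq (psi0 xi) 0; first by rewrite !mul0r.
have e0 := enorm_ge0 xi.
congr (_ * _); rewrite /qreg (phi_supp hphi) ?addr0; last by rewrite enormZ ger0_norm//; lra.
by rewrite -sqr_enorm -powR_mulrn// -powRrM mulrC divfK.
Qed.

Lemma Cc_asym s : Cc_infty setT (asym s).
Proof.
rewrite (_ : asym s = fun xi => (psi0 xi)%:C * pw (s / 2) xi); last by apply/funext => xi; exact: asymE.
apply: (@Cc_inftyT _ _ _ (n%:R * (8 / 3))).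
  apply: smoothM; last exact: smooth_pw.
  rewrite (_ : (fun xi => _) = fun xi => cphi phi (2^-1 *: xi) - cphi phi xi); last first.
    by apply/funext => xi; rewrite /psi0 raddfB.
  by apply: schw_smooth; apply: schwB; [apply: schw_scale; rewrite ?invr_neq0//; exact: schw_cphi|exact: schw_cphi].
move=> xi; rewrite mulf_eq0 negb_or => /andP[h _].
have [|_ h2] := @psi0_supp xi; first by apply: contraNneq h => ->.
by apply: le_trans (onorm_le_enorm _) _; rewrite ler_wpM2l// ltW.
Qed.

Lemma schw_asym s : schw (asym s). Proof. exact: Cc_schw (Cc_asym s). Qed.

Lemma asym_tpsi s xi : asym s xi * tpsi phi xi = asym s xi.
Proof.
rewrite /asym; have [->|/psi0_supp[h1 h2]] := eqVneq (psi0 xi) 0; first by rewrite mulr0 mul0r.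
by rewrite (tpsi_eq1 hphi) ?mulr1//; lra.
Qed.

(** Homogeneity: the factor 2^(js) left over from rescaling is the one built into [scl]. *)
Lemma LP_blockE s j : (fun xi => (enorm xi `^ s * LP_psi phi j xi)%:C) = scl s (asym s) j.
Proof.
apply/funext => xi; rewrite LP_psiE /scl /asym -rmorphM/= mulrA; congr (_ * _)%:C.
have t0 := two_gt0 j (R := R).
rewrite enormZ gtr0_norm ?two_gt0// -powRM ?mulr_ge0 ?enorm_ge0 ?(ltW (two_gt0 _))//.
by rewrite twoN mulrA mulfV ?mul1r// gt_eqF.
Qed.

End power_symbols.

(** * Tempered distributions: linearity, continuity, approximate identities *)

Section distribution_theory.
Context {R : realType} {n : nat}.
Local Notation E := 'rV[R]_n.
Implicit Types (f g h : E -> R[i]) (u v : (E -> R[i]) -> R[i]).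

Lemma on_schwartzE u f : schw f -> on_schwartz u f = u f.
Proof. by move=> sf; rewrite /on_schwartz /patch mem_set//; exact/schwartzP. Qed.

Lemma on_schwartz_out u f : ~ schw f -> on_schwartz u f = 0.
Proof. by move=> sf; rewrite /on_schwartz /patch memNset// => /schwartzP. Qed.

Lemma distr_ofE g f : schw f -> distr_of g f = cintegral (fun x => g x * f x).
Proof. exact: on_schwartzE. Qed.

Lemma temp_lin u a f g : tempered u -> schw f -> schw g -> u (fun x => a * f x + g x) = a * u f + u g.
Proof. by move=> [_ + _] sf sg; apply; exact/schwartzP. Qed.

Lemma temp_out u f : tempered u -> ~ schw f -> u f = 0.
Proof. by move=> [+ _ _] sf; apply => /schwartzP. Qed.

Lemma temp0 u : tempered u -> u (fun=> 0) = 0.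
Proof.
move=> tu; have s0 := @schw0 R n.
pose z : E -> R[i] := fun=> 0.
transitivity (u (fun x => -1 * z x + z x)).
  by congr u; apply/funext => x; rewrite /z mulr0 addr0.
by rewrite (temp_lin (-1) tu s0 s0) mulN1r addNr.
Qed.

Lemma tempZ u a f : tempered u -> schw f -> u (fun x => a * f x) = a * u f.
Proof.
move=> tu sf; have := temp_lin a tu sf (@schw0 R n); rewrite temp0// addr0 => <-.
by congr u; apply/funext => x; rewrite addr0.
Qed.

Lemma tempD u f g : tempered u -> schw f -> schw g -> u (fun x => f x + g x) = u f + u g.
Proof.
move=> tu sf sg; have := temp_lin 1 tu sf sg; rewrite mul1r => <-.
by congr u; apply/funext => x; rewrite mul1r.
Qed.

Lemma tempB u f g : tempered u -> schw f -> schw g -> u (fun x => f x - g x) = u f - u g.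
Proof.
move=> tu sf sg; have := temp_lin (-1) tu sg sf; rewrite mulN1r addrC => <-.
by congr u; apply/funext => x; rewrite mulN1r addrC.
Qed.

Lemma temp_cont u : tempered u -> exists N (C : R), 0 <= C /\ forall f (B : R), 0 <= B -> schw f ->
  (forall s x, (size s <= N)%N -> wt x ^+ N * normc (pderivs s f x) <= B) -> normc (u f) <= C * B.
Proof.
move=> [_ _ [C [N hC]]]; exists N, `|C|; split=> // f B B0 sf hB.
rewrite -lee_fin; apply: le_trans (hC f _) _; first exact/schwartzP.
have h := schwartz_norm_le hB.
have s0 : (0 <= schwartz_norm N f)%E.
  apply: le_trans (_ : ((1 + enorm (0 : E)) ^+ N * normc (pderivs [::] f 0))%:E <= _)%E.
    by rewrite lee_fin mulr_ge0 ?normc_ge0 ?exprn_ge0// addr_ge0 ?enorm_ge0.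
  by apply: ereal_sup_ubound; exists [::], 0.
apply: le_trans (_ : (`|C|%:E * schwartz_norm N f <= _)%E).
  by apply: lee_wpmul2r => //; rewrite lee_fin ler_norm.
by rewrite EFinM; apply: lee_wpmul2l => //; rewrite lee_fin.
Qed.

Lemma LwM (v : E -> R[i]) f : Lw v -> schw f -> L1 (fun x => v x * f x).
Proof. by move=> Lv sf; have := schw_LwM sf Lv; congr L1; apply/funext => x; rewrite mulrC. Qed.

(** Integrability against [bell] makes the pairing continuous for the seminorm of order 2n. *)
Lemma tempered_distr g : Lw g -> tempered (distr_of g).
Proof.
move=> Lg; split=> [f sf|a f h /schwartzP sf /schwartzP sh|].
- by apply: on_schwartz_out => /schwartzP.
- rewrite !distr_ofE//; last by apply: schwD => //; exact: schwZ.
  rewrite -(cintegralZ a (LwM Lg sf)) -(cintegralD (L1Z a (LwM Lg sf)) (LwM Lg sh)).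
  by congr cintegral; apply/funext => x; ring.
exists (2 * (n.+1%:R ^+ (2 * n) * rnorm (fun y => (bell y)%:C * g y))), (2 * n)%N => f /schwartzP sf.
have fin : schwartz_norm (2 * n) f \is a fin_num.
  have [B _ hB] := schw_bound_all (2 * n) (2 * n) sf.
  rewrite ge0_fin_numE; first by apply: le_lt_trans (schwartz_norm_le hB) _; rewrite ltry.
  apply: le_trans (_ : ((1 + enorm (0 : E)) ^+ (2 * n) * normc (pderivs [::] f 0))%:E <= _)%E.
    by rewrite lee_fin mulr_ge0 ?normc_ge0 ?exprn_ge0// addr_ge0 ?enorm_ge0.
  by apply: ereal_sup_ubound; exists [::], 0.
pose B := n.+1%:R ^+ (2 * n) * fine (schwartz_norm (2 * n) f).
have hB x : normc (f x) <= B * bell x.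
  apply: wt_bell; rewrite -lee_fin /B [leRHS]EFinM fineK//.
  exact: (@schwartz_norm_ge _ _ (2 * n) f [::] x).
have B0 : 0 <= B.
  by rewrite -(pmulr_lge0 _ (bell_gt0 (0 : E))); apply: le_trans (hB 0); exact: normc_ge0.
rewrite distr_ofE// -(fineK fin) -EFinM lee_fin.
have Lb : L1 (fun y => (normc ((bell y)%:C * g y))%:C).
  case: Lg => mg ig; split; first by apply: cmeas_real; exact: cmeas_normc.
  by rewrite inorm_real// => y; exact: normc_ge0.
apply: le_trans (normc_cintegral_le B0 (LwM Lg sf) Lb _) _.
  move=> y; rewrite !normcM normc_real (ger0_norm (bell_ge0 _)) mulrC mulrA.
  by rewrite ler_wpM2r ?normc_ge0.
rewrite (_ : rnorm (fun y => (normc _)%:C) = rnorm (fun y => (bell y)%:C * g y)).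
  by rewrite le_eqVlt; apply/orP; left; apply/eqP; rewrite /B; ring.
by rewrite /rnorm inorm_real// => y; exact: normc_ge0.
Qed.

Lemma conv_pderiv k h i : schw k -> schw h -> pderiv i (conv k h) = conv k (pderiv i h).
Proof.
move=> sk sh; have -> : conv k h = conv h k by apply/funext => x; exact: conv_schwC.
have [_ ->] := conv_diff sh (schw_Lw sk); apply/funext => x; apply: conv_schwC => //.
exact: schw_pderiv.
Qed.

Lemma conv_pderivs k h s : schw k -> schw h -> pderivs s (conv k h) = conv k (pderivs s h).
Proof.
move=> sk sh; elim: s => [//|i s IH]; rewrite -[LHS]/(pderiv i (pderivs s (conv k h))) IH.
by apply: conv_pderiv => //; exact: schw_pderivs.
Qed.

(** [dil_approx] with an inverse power of [wt] as weight, applied to every derivative of [h]; this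
    is convergence in the Schwartz topology, with a rate. *)
Lemma dil_conv_schw a h N : schw a -> schw h -> exists2 C : R, 0 <= C & forall t, 0 < t <= 1 ->
  forall s x, (size s <= N)%N ->
  wt x ^+ N * normc (conv (dil t a) (pderivs s h) x - cintegral a * pderivs s h x) <= C * t.
Proof.
move=> sa; have base g : schw g -> exists2 C : R, 0 <= C & forall t, 0 < t <= 1 -> forall x,
    wt x ^+ N * normc (conv (dil t a) g x - cintegral a * g x) <= C * t.
  move=> sg; have w0 (x : E) : 0 <= (wt x ^+ N)^-1 :> R by rewrite invr_ge0 ltW ?wtX_gt0.
  have [C C0 hC] := dil_approx w0 sa (schw_Lw sg) (schw_lipdecayX N sg).
  exists C => // t ht x; have := hC t ht x.
  by rewrite ler_pdivlMr ?wtX_gt0// mulrC.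
move: {1}N => k; elim: k h => [|k IH] h sh.
  have [C C0 hC] := base h sh; exists C => // t ht s x.
  by rewrite leqn0 => /nilP ->; exact: hC.
have [C1 C10 h1] := base h sh.
have [|i|C C0 hC] := @fin_bound R 'I_n (fun i C => 0 <= C /\ forall t, 0 < t <= 1 -> forall s x, (size s <= k)%N ->
    wt x ^+ N * normc (conv (dil t a) (pderivs s (pderiv i h)) x - cintegral a * pderivs s (pderiv i h) x) <= C * t).
- move=> i C D CD [C0 hC]; split=> [|t ht s x sk]; first exact: le_trans CD.
  apply: le_trans (hC t ht s x sk) _; rewrite ler_wpM2r//; by case/andP: ht => /ltW.
- by have [C C0 hC] := IH _ (schw_pderiv i sh); exists C.
exists (C1 + C); first exact: addr_ge0.
move=> t ht s x; have t0 : 0 <= t by case/andP: ht => /ltW.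
case/lastP: s => [_|s i].
  by apply: le_trans (h1 t ht x) _; rewrite ler_wpM2r// lerDl.
rewrite size_rcons ltnS => sk; rewrite pderivs_rcons.
by have [_ hi] := hC i; apply: le_trans (hi t ht s x sk) _; rewrite ler_wpM2r// lerDr.
Qed.

Lemma temp_dil_conv u a h : tempered u -> schw a -> schw h -> (forall t, 0 < t -> schw (conv (dil t a) h)) ->
  exists2 C : R, 0 <= C & forall t, 0 < t <= 1 ->
  normc (u (conv (dil t a) h) - cintegral a * u h) <= C * t.
Proof.
move=> tu sa sh sc; have [N [K [K0 hK]]] := temp_cont tu.
have [C C0 hC] := dil_conv_schw N sa sh.
exists (K * C); first exact: mulr_ge0.
move=> t /[dup] ht /andP[t0 t1]; rewrite -tempZ// -tempB//; [|exact: sc|exact: schwZ].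
rewrite -mulrA; apply: hK; [by rewrite mulr_ge0// ltW|by apply: schwB; [exact: sc|exact: schwZ]|].
move=> s x sN; have := hC t ht s x sN; congr (_ * normc _ <= _).
have -> : (fun x => conv (dil t a) h x - cintegral a * h x) = fun x => conv (dil t a) h x + (- cintegral a) * h x.
  by apply/funext => z; rewrite mulNr.
rewrite pderivsD; [|by apply: schw_smooth; exact: sc|by apply: schw_smooth; exact: schwZ].
by rewrite pderivsZ ?mulNr ?conv_pderivs//; [exact: schw_dil|exact: schw_smooth].
Qed.

End distribution_theory.

Section norms.
Context {R : realType} {n : nat}.
Local Notation E := 'rV[R]_n.
Implicit Types (f g h : E -> R[i]) (p : R).

Lemma Lnorm_leb p (f : E -> R) : Lnorm (lebesgue_rV n) p%:E (fun x => (f x)%:E) =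
  ((\int[leb n]_x (`|f x| `^ p)%:E) `^ p^-1)%E.
Proof.
transitivity (poweR (\int[lebesgue_rV n]_x (poweR `|(f x)%:E| p))%E p^-1); first by rewrite unlock.
rewrite integral_lebE//; congr (poweR _ _); exact: eq_integral.
Qed.

Lemma Lp_normE p g : Lnorm (lebesgue_rV n) p%:E (fun x => (normc (g x))%:E) = Lp p g.
Proof.
rewrite Lnorm_leb LpE; congr (poweR _ _); apply: eq_integral => x _.
by rewrite ger0_norm ?normc_ge0.
Qed.

Lemma sum_unit (F : unit -> R) : \sum_(i : unit) F i = F tt.
Proof. by rewrite (bigD1 tt)//= big1 ?addr0// => -[]. Qed.

Lemma Lp_norm_le p g : isLp p g -> (Lp_norm p%:E (distr_of g) <= Lp p g)%E.
Proof.
move=> Lg; apply: ereal_inf_lbound; exists (fun=> g).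
  by move=> _; split => //; [exact: Lg.1.1|exact: Lg.1.2|rewrite Lp_normE; exact: isLp_fin].
rewrite -Lp_normE; congr Lnorm; apply/funext => x.
by rewrite sum_unit sqrtr_sqr ger0_norm// normc_ge0.
Qed.

(** The infimum of the empty set is +oo, so a finite norm provides a representing family. *)
Lemma Lp_norms_fun (I : finType) p (U : I -> (E -> R[i]) -> R[i]) : p != 0 -> (Lp_norms p%:E U < +oo)%E ->
  exists g : I -> E -> R[i], forall i, isLp p (g i) /\ U i = distr_of (g i).
Proof.
move=> p0 /ereal_inf_lt[_ [g hg _] _]; exists g => i; have [m1 m2 f UE] := hg i.
by split => //; apply: Lp_isLp => //; rewrite -Lp_normE.
Qed.

Lemma sqrt_sum_le (I : finType) (a : I -> R) : (forall i, 0 <= a i) ->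
  Num.sqrt (\sum_i a i ^+ 2) <= \sum_i a i.
Proof.
move=> a0; have s0 : 0 <= \sum_i a i by exact: sumr_ge0.
rewrite -[leRHS]ger0_norm// -sqrtr_sqr; apply: ler_wsqrtr.
rewrite [leRHS]expr2 mulr_suml; apply: ler_sum => i _; rewrite expr2 ler_wpM2l//.
by rewrite (bigD1 i)//= lerDl sumr_ge0.
Qed.

Lemma Lp1_norms_le (I : finType) (g : I -> E -> R[i]) : (forall i, isLp 1 (g i)) ->
  (Lp_norms 1%:E (fun i => distr_of (g i)) <= \sum_i Lp 1 (g i))%E.
Proof.
move=> Lg; apply: le_trans (_ : (Lnorm (lebesgue_rV n) 1%:E
   (fun x => (Num.sqrt (\sum_(i : I) normc (g i x) ^+ 2))%:E) <= _)%E).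
  apply: ereal_inf_lbound; exists g => // i.
  by split => //; [exact: (Lg i).1.1|exact: (Lg i).1.2|rewrite Lp_normE; exact: isLp_fin].
have mn i : measurable_fun setT (fun x => normc (g i x)) by apply: cmeas_normc; exact: (Lg i).1.
have ms : measurable_fun setT (fun x => \sum_i normc (g i x)) by exact: measurable_sum.
rewrite Lnorm_leb invr1 poweRe1; last by apply: integral_ge0 => x _; rewrite lee_fin powR_ge0.
apply: le_trans (_ : (\int[leb n]_x (\sum_i normc (g i x))%:E <= _)%E).
  apply: ge0_le_integral => //.
  - apply/measurable_EFinP; apply: (measurableT_comp (measurable_powR 1)).
    apply: (measurableT_comp (@normr_measurable R setT)).
    apply: (measurableT_comp (f := @Num.sqrt R)); first exact: (continuous_measurable_fun (@sqrt_continuous R)).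
    by apply: measurable_sum => i; apply: measurable_funX; exact: mn.
  - exact/measurable_EFinP.
  move=> x _; rewrite lee_fin powRr1// ger0_norm ?sqrtr_ge0// sqrt_sum_le// => i.
  exact: normc_ge0.
under eq_integral do rewrite -sumEFin.
rewrite ge0_integral_sum//.
- by apply: lee_sum => i _; rewrite Lp1.
- by move=> i; exact/measurable_EFinP.
- by move=> i x _; rewrite lee_fin normc_ge0.
Qed.

End norms.

(** * Littlewood-Paley reconstruction in S'_h *)

Section reconstruction.
Context {R : realType} {n : nat}.
Local Notation E := 'rV[R]_n.
Implicit Types (f g h : E -> R[i]) (u v : (E -> R[i]) -> R[i]).
Variable phi : E -> R.
Hypothesis hphi : LP_cutoff phi.
Local Notation c0 := (cF (cphi phi)).

(** The defining condition of S'_h with the cutoff itself as test symbol: the low frequency part is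
    a small bounded function, paired with an integrable one. *)
Lemma Sh_low u h e : Sh' u -> schw h -> 0 < e -> exists L : R, forall lam : R, L <= lam -> lam != 0 ->
  normc (u (Mlt (fun xi => cphi phi (lam *: xi)) h)) <= e.
Proof.
move=> [tu hu] sh e0.
have cc : Cc_infty setT (cphi phi).
  have [hc _ _ _] := hphi; have [M hM] := Cc_bounded hc.
  by apply: (Cc_inftyT (schw_smooth (schw_cphi hphi))); exact: hM.
pose H := 2 * rnorm h + 1; have H0 : 0 < H by rewrite ltr_wpDl// mulr_ge0// rnorm_ge0.
have eta0 : 0 < e / H by rewrite divr_gt0.
have /fine_cvgP[[T1 [_ hL1]]] := hu _ cc.
move=> /cvgrPdist_lt/(_ _ eta0)[T2 [_ hL2]].
exists (Num.max T1 T2 + 1) => lam lamL lam0.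
have l1 : T1 < lam by apply: lt_le_trans lamL; rewrite ltr_pwDr// le_max lexx.
have l2 : T2 < lam by apply: lt_le_trans lamL; rewrite ltr_pwDr// le_max lexx orbT.
have f1 := hL1 _ l1; have := hL2 _ l2; rewrite sub0r normrN => f2.
have : (Lp_norm +oo (multiplier (fun xi => cphi phi (lam *: xi)) u) < (e / H)%:E)%E.
  by rewrite -(fineK f1) lte_fin; apply: le_lt_trans f2; exact: ler_norm.
move=> /ereal_inf_lt[_ [g hg <-]]; have [m1 m2 _ UE] := hg tt => gl.
have -> : u (Mlt (fun xi => cphi phi (lam *: xi)) h) = cintegral (fun x => g tt x * h x).
  rewrite -distr_ofE// -UE /multiplier on_schwartzE//.
have mg : cmeas (g tt) by split.
have aeg : \forall x \ae lebesgue_rV n, ((normc (g tt x))%:E <= (e / H)%:E)%E.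
  (* The L^oo norm has a separate default value when the whole space is null; [cube1_gt0] excludes
     that case. *)
  have : (ess_sup (lebesgue_rV n) (abse \o (fun x => (Num.sqrt (\sum_(i : unit) normc (g i x) ^+ 2))%:E)) <= (e / H)%:E)%E.
    apply: ltW; move: gl; rewrite unlock /=; case: ifPn => // h0.
    have : (0 < @lebesgue_rV R n setT)%E.
      rewrite -lebE; apply: lt_le_trans (cube1_gt0 n) _; apply: le_measure; rewrite ?inE//.
      exact: measurable_cube.
    by rewrite (negbTE h0).
  move/ess_supP; apply: filterS => x /=.
  by rewrite sum_unit sqrtr_sqr !ger0_norm ?normc_ge0.
have mh := schw_cmeas sh.
have Ib : (inorm (fun x => (g tt x * h x)%R) <= (e / H * rnorm h)%:E)%E.
  rewrite /inorm -integral_lebE//.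
  apply: le_trans (_ : (\int[lebesgue_rV n]_x ((e / H)%:E * (normc (h x))%:E) <= _)%E).
    apply: ae_ge0_le_integral => //.
    - by move=> x _; rewrite lee_fin normc_ge0.
    - by apply: cmeas_EFin_normc; exact: cmeasM.
    - by move=> x _; rewrite -EFinM lee_fin mulr_ge0 ?normc_ge0// ltW.
    - by apply: emeasurable_funM => //; exact: cmeas_EFin_normc.
    apply: filterS aeg => x hx _; rewrite normcM EFinM; apply: lee_wpmul2r => //.
    by rewrite lee_fin normc_ge0.
  rewrite integral_lebE// ge0_integralZl//.
  - by rewrite [leRHS]EFinM -(inormE (schw_L1 sh)).
  - exact: cmeas_EFin_normc.
  - by move=> x _; rewrite lee_fin normc_ge0.
  - by rewrite lee_fin ltW.
have Lgh : L1 (fun x => g tt x * h x).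
  by split; [exact: cmeasM|apply: le_lt_trans Ib _; exact: ltry].
rewrite -lee_fin; apply: le_trans (normc_cintegral Lgh) _.
apply: le_trans (_ : (2%:E * (e / H * rnorm h)%:E <= _)%E); first exact: lee_wpmul2l.
rewrite -EFinM lee_fin.
have -> : 2 * (e / H * rnorm h) = e * (2 * rnorm h) / H by ring.
by rewrite ler_pdivrMr// ler_wpM2l ?(ltW e0)// /H lerDl.
Qed.

Lemma Mlt0 h : Mlt (fun=> 0) h = fun=> 0.
Proof.
apply/funext => x; rewrite -[LHS]/(fourier (fun xi => 0 * fourier_inv h xi) x).
rewrite (_ : (fun xi => _) = fun xi => 0 * (fun _ : E => 0 : R[i]) xi); last by apply/funext => xi; rewrite !mul0r.
by rewrite fourierZ ?mul0r//; exact: L10.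
Qed.

Lemma temp_Mlt_sum u I (r : seq I) (m : I -> E -> R[i]) h : tempered u -> schw h -> (forall k, schw (m k)) ->
  u (Mlt (fun xi => \sum_(k <- r) m k xi) h) = \sum_(k <- r) u (Mlt (m k) h).
Proof.
move=> tu sh sm; elim: r => [|k r IH].
  rewrite big_nil (_ : (fun xi => _) = fun=> 0) ?Mlt0 ?temp0//; apply/funext => xi; exact: big_nil.
rewrite big_cons -IH (_ : (fun xi => \sum_(l <- k :: r) m l xi) = fun xi => m k xi + \sum_(l <- r) m l xi); last first.
  by apply/funext => xi; exact: big_cons.
have ss : schw (fun xi => \sum_(l <- r) m l xi) by exact: schw_sum.
by rewrite (MltD (sm k) ss sh) (tempD tu (schw_Mlt (sm k) sh) (schw_Mlt ss sh)).
Qed.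

Definition psij (j : int) : E -> R[i] := scl 0 (asym phi 0) j.

Lemma psijE j xi : psij j xi = (psi0 phi (two (- j) *: xi))%:C.
Proof. by rewrite /psij -LP_blockE powRr0 mul1r LP_psiE. Qed.

Lemma schw_psij j : schw (psij j). Proof. by apply: schw_scl; exact: schw_asym. Qed.

(** Each [psij] is a difference of consecutive dilated cutoffs, so the sum telescopes. *)
Lemma psij_sum (M N : nat) xi : \sum_(0 <= k < (M + N).+1) psij (k%:Z - M%:Z) xi =
  cphi phi (two (- N.+1%:Z) *: xi) - cphi phi (two M%:Z *: xi).
Proof.
pose F (k : nat) := cphi phi (two (M%:Z - k%:Z) *: xi).
rewrite (eq_bigr (fun k => F k.+1 - F k)).
  rewrite telescope_sumr// /F subr0; congr (cphi phi (two _ *: _) - _).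
  by rewrite -addnS PoszD opprD addrA subrr add0r.
move=> k _; rewrite psijE /psi0 raddfB/= /F /cphi opprB scalerA; congr ((phi (_ *: _))%:C - _).
rewrite -[k.+1]addn1 PoszD opprD addrA /two [RHS]expfzDr// mulrC; congr (_ * _).
Qed.

Definition bisum_at (a : int -> R[i]) (M N : nat) := \sum_(0 <= k < (M + N).+1) a (k%:Z - M%:Z).

Lemma bisumP (a : int -> R[i]) l : bisum a l <-> forall e : R, 0 < e -> exists K : nat, forall M N,
  (K <= M)%N -> (K <= N)%N -> normc (bisum_at a M N - l) < e.
Proof.
split=> h e /h.
  move=> [[A B] [[K1 _ hA] [K2 _ hB]] AB]; exists (maxn K1 K2) => M N.
  rewrite !geq_max => /andP[h1 _] /andP[_ h2]; apply: (AB (M, N)); split; [exact: hA|exact: hB].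
move=> [K hK]; exists ([set k | (K <= k)%N], [set k | (K <= k)%N]); first by split; exists K.
by move=> [M N] [/= hM hN]; exact: hK.
Qed.

Lemma bisum_unique (a : int -> R[i]) l l' : bisum a l -> bisum a l' -> l = l'.
Proof.
move=> /bisumP h /bisumP h'; apply: (@le_eps_eq _ _ _ 1) => e e0; have e2 : 0 < e / 2 by rewrite divr_gt0.
have [K hK] := h _ e2; have [K' hK'] := h' _ e2; pose M := maxn K K'.
have h1 := hK M M (leq_maxl _ _) (leq_maxl _ _); have h2 := hK' M M (leq_maxr _ _) (leq_maxr _ _).
rewrite mul1r -(subrKA (bisum_at a M M)); apply: le_trans (le_normcD _ _) _.
by rewrite normc_distC (splitr e); apply: lerD; exact: ltW.
Qed.

Lemma bisum_const (a : int -> R[i]) l (K : nat) :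
  (forall M N, (K <= M)%N -> (K <= N)%N -> bisum_at a M N = l) -> bisum a l.
Proof.
move=> h; apply/bisumP => e e0; exists K => M N hM hN.
by rewrite h// subrr normcr0.
Qed.

Lemma bisum_sum (I : Type) (r : seq I) (a : I -> int -> R[i]) (l : I -> R[i]) : (forall i, bisum (a i) (l i)) ->
  bisum (fun j => \sum_(i <- r) a i j) (\sum_(i <- r) l i).
Proof.
move=> h; elim: r => [|i r IH].
  by apply: (@bisum_const _ _ 0%N) => M N _ _; rewrite /bisum_at big1 ?big_nil// => k _; rewrite big_nil.
apply/bisumP => e e0; have e2 : 0 < e / 2 by rewrite divr_gt0.
have /bisumP/(_ _ e2)[K1 h1] := h i; have /bisumP/(_ _ e2)[K2 h2] := IH.
exists (maxn K1 K2) => M N; rewrite !geq_max => /andP[M1 M2] /andP[N1 N2].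
rewrite /bisum_at; under eq_bigr do rewrite big_cons.
rewrite big_split/= big_cons opprD addrACA (splitr e); apply: le_lt_trans (le_normcD _ _) _.
by apply: ltrD; [exact: h1|exact: h2].
Qed.

Lemma Mlt_cphi_small t h : 0 < t -> schw h -> Mlt (fun xi => cphi phi (t *: xi)) h = conv (dil t (refl (fourier_inv (cphi phi)))) h.
Proof.
move=> t0 sh; have sp := schw_cphi hphi.
rewrite (MltE (schw_scale (lt0r_neq0 t0) sp) sh) (fourier_inv_scale t0 sp).
congr (conv _ h); apply/funext => x; by rewrite /refl /dil scalerN.
Qed.

Lemma two_le_pow (e : R) : 0 < e -> exists K : nat, forall N, (K <= N)%N -> two (- N%:Z) <= e.
Proof.
move=> e0; exists (Num.truncn e^-1).+1 => N hN.
rewrite twoN -[leRHS]invrK lef_pV2 ?posrE ?invr_gt0 ?two_gt0//.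
apply: le_trans (ltW (truncnS_gt _)) _; apply: le_trans (_ : N%:R <= _); first by rewrite ler_nat.
by rewrite /two -[_ ^ _]/(2 ^+ N) -natrX ler_nat ltnW// ltn_expl.
Qed.

(** After telescoping, two terms remain. The wide cutoff is an approximate identity, whose kernel
    has integral [c0]; the narrow one tends to 0 by [Sh_low], which is where S'_h is used. *)
Lemma Sh_reconstruct u h : Sh' u -> schw h -> bisum (fun j => u (Mlt (psij j) h)) (c0 * u h).
Proof.
move=> hu sh; have [tu _] := hu; have sp := schw_cphi hphi.
apply/bisumP => e e0; have e2 : 0 < e / 2 by rewrite divr_gt0.
have [L hL] := Sh_low hu sh e2.
pose a := refl (fourier_inv (cphi phi)); have sa : schw a by apply: schw_refl; exact: schw_fourier_inv.
have Ia : cintegral a = c0.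
  rewrite /a /refl cintegral_opp; last by apply: schw_L1; exact: schw_fourier_inv.
  by rewrite -fourier0 (fourier_invK sp (cphi0 hphi))// (cphi0 hphi) mulr1.
have [|C C0 hC] := temp_dil_conv tu sa sh.
  by move=> t t0; rewrite -Mlt_cphi_small//; apply: schw_Mlt => //; apply: schw_scale => //; exact: lt0r_neq0.
have e3 : 0 < e / 2 / (C + 1) by rewrite divr_gt0// ltr_wpDl.
have [K1 h1] := two_le_pow e3.
exists (maxn K1 (Num.truncn L).+1) => M N; rewrite !geq_max => /andP[_ ML] /andP[NK _].
have sm (t : R) : t != 0 -> schw (fun xi => cphi phi (t *: xi)) by move=> t0; exact: schw_scale.
have -> : bisum_at (fun j => u (Mlt (psij j) h)) M N =
    u (Mlt (fun xi => cphi phi (two (- N.+1%:Z) *: xi)) h) - u (Mlt (fun xi => cphi phi (two M%:Z *: xi)) h).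
  rewrite /bisum_at -(temp_Mlt_sum _ tu sh (fun k : nat => schw_psij (k%:Z - M%:Z))).
  rewrite -(tempB tu (schw_Mlt (sm _ (two_neq0 _)) sh) (schw_Mlt (sm _ (two_neq0 _)) sh)); congr u.
  have s1 := sm _ (two_neq0 (- N.+1%:Z)); have s2 := sm _ (two_neq0 M%:Z).
  rewrite (_ : (fun xi => \sum_(_ <- _) _) = fun xi => cphi phi (two (- N.+1%:Z) *: xi) + (-1) * cphi phi (two M%:Z *: xi)); last first.
    by apply/funext => xi; rewrite psij_sum mulN1r.
  rewrite (MltD s1 (schwZ _ s2) sh); apply/funext => x; congr (_ + _).
  by rewrite (MltZ _ s2 sh) mulN1r.
have -> : forall z w b : R[i], z - w - b = (z - b) + (- w) by move=> z w b; ring.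
apply: le_lt_trans (le_normcD _ _) _; rewrite normcN [ltRHS]splitr; apply: ltr_leD.
  rewrite (Mlt_cphi_small (two_gt0 _) sh) -/a -Ia.
  have tN : two (- N.+1%:Z) <= e / 2 / (C + 1) by apply: h1; exact: leqW.
  apply: le_lt_trans (hC _ _) _.
    rewrite two_gt0/= twoN invf_le1 ?two_gt0// /two -[_ ^ _]/(2 ^+ N.+1).
    by rewrite exprn_ege1// ler1n.
  apply: le_lt_trans (ler_wpM2l C0 tN) _.
  rewrite mulrCA gtr_pMr// ltr_pdivrMr ?mul1r ?ltrDl//.
  exact: ltr_wpDl.
apply: hL; last exact: two_neq0.
apply: le_trans (ltW (truncnS_gt _)) _; apply: le_trans (_ : M%:R <= _); first by rewrite ler_nat.
by rewrite /two -[_ ^ _]/(2 ^+ M) -natrX ler_nat ltnW// ltn_expl.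
Qed.

End reconstruction.

(** * The smoothed distribution as an L^p function, and the norm of the error *)

Section representation.
Context {R : realType} {n : nat}.
Local Notation E := 'rV[R]_n.
Implicit Types (f g h : E -> R[i]) (u : (E -> R[i]) -> R[i]).
Variable phi : E -> R.
Hypothesis hphi : LP_cutoff phi.
Local Notation c0 := (cF (cphi phi)).
Local Notation Z := (Zop phi).

Lemma bisum_lin (a b : int -> R[i]) (l l' c : R[i]) : bisum a l -> bisum b l' ->
  bisum (fun j => c * a j + b j) (c * l + l').
Proof.
move=> /bisumP h /bisumP h'; apply/bisumP => e e0.
have n0 := normc_ge0 c.
have e1 : 0 < e / 2 / (normc c + 1) by rewrite !divr_gt0// ltr_wpDl.
have e2 : 0 < e / 2 by rewrite divr_gt0.
have [K hK] := h _ e1; have [K' hK'] := h' _ e2.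
exists (maxn K K') => M N; rewrite !geq_max => /andP[M1 M2] /andP[N1 N2].
rewrite /bisum_at big_split/= -mulr_sumr opprD addrACA -mulrBr (splitr e).
apply: le_lt_trans (le_normcD _ _) _; apply: ler_ltD; last exact: hK'.
rewrite normcM; apply: le_trans (ler_wpM2l n0 (ltW (hK M N M1 N1))) _.
rewrite mulrA ler_pdivrMr ?ltr_wpDl// mulrC ler_wpM2l ?lerDl// ltW//.
Qed.

Lemma eq_bisum (a b : int -> R[i]) l : a =1 b -> bisum a l -> bisum b l.
Proof. by move=> ab; rewrite (funext ab). Qed.

Lemma LP_block_at s u j f : schw f -> LP_block phi s u j f = u (Mlt (scl s (asym phi s) j) f).
Proof. by move=> sf; rewrite /LP_block LP_blockE /multiplier on_schwartzE. Qed.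

Lemma distr_sumP s u v : (forall f, schw f -> bisum (fun j => u (Mlt (scl s (asym phi s) j) f)) (v f)) <->
  distr_sum (LP_block phi s u) v.
Proof.
split=> h f.
  move=> /schwartzP sf.
  have : bisum (fun j => LP_block phi s u j f) (v f) by apply: eq_bisum (h f sf) => j; rewrite LP_block_at.
  exact.
move=> sf; have : bisum (fun j => LP_block phi s u j f) (v f) by apply: h; exact/schwartzP.
by apply: eq_bisum => j; rewrite LP_block_at.
Qed.

Lemma psij_supp j xi : psij phi j xi != 0 -> 3 / 4 * two j <= enorm xi /\ enorm xi < 8 / 3 * two j.
Proof.
move=> h; have [|h1 h2] := @psi0_supp _ _ _ hphi (two (- j) *: xi).
  by apply: contraNneq h => h; rewrite psijE h.
move: h1 h2; rewrite enormZ gtr0_norm ?two_gt0// twoN.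
by rewrite ler_pdivlMl ?two_gt0// ltr_pdivrMl ?two_gt0// mulrC [X in _ < X -> _]mulrC.
Qed.

(** On the annulus of index j the wide cutoff is 1 and the narrow one is 0 as soon as the range of
    summation is long enough. *)
Lemma psij_sum_eq1 j : exists K : nat, forall M N, (K <= M)%N -> (K <= N)%N -> forall xi,
  psij phi j xi * (\sum_(0 <= k < (M + N).+1) psij phi (k%:Z - M%:Z) xi) = psij phi j xi.
Proof.
have t0 := two_gt0 j (R := R).
have q1 : 0 < 1 / (4 * two j) :> R by rewrite divr_gt0// mulr_gt0.
have q2 : 0 < two j / 2 :> R by rewrite divr_gt0.
have [K1 h1] := two_le_pow q1; have [K2 h2] := two_le_pow q2.
exists (maxn K1 K2) => M N; rewrite !geq_max => /andP[_ hM] /andP[hN _] xi.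
have [->|/psij_supp[a1 a2]] := eqVneq (psij phi j xi) 0; first by rewrite mul0r.
have tM := two_gt0 M%:Z (R := R); have tN := two_gt0 (- N.+1%:Z) (R := R).
have b1 := h1 N.+1 (leqW hN); have b2 := h2 M hM.
rewrite psij_sum// /cphi (phi_eq1 hphi) ?(phi_supp hphi) ?subr0 ?mulr1//.
- rewrite enormZ gtr0_norm//; move: b2; rewrite twoN => b2.
  move: (two M%:Z : R) (two j : R) tM t0 a1 b2 => a b a0 b0 a1 b2.
  have h1' : a * a^-1 <= a * (b / 2) by rewrite ler_wpM2l// ltW.
  have h2' : a * (3 / 4 * b) <= a * enorm xi by rewrite ler_wpM2l// ltW.
  by move: h1'; rewrite mulfV ?gt_eqF//; lra.
rewrite enormZ gtr0_norm//.
apply: le_lt_trans (_ : 1 / (4 * two j) * (8 / 3 * two j) < _).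
  by apply: ler_pM => //; [exact: ltW|exact: enorm_ge0|exact: ltW].
rewrite (_ : 1 / (4 * two j) * (8 / 3 * two j) = 2 / 3); first by lra.
by field; rewrite gt_eqF.
Qed.

(** Applying the blocks of order -s to v = (-Delta)^(s/2) u returns the plain blocks of [u]: only
    finitely many indices k meet the annulus of index j, so the defining series of v is eventually
    constant. Composition contributes the factor [c0]. *)
Lemma LP_inverse s u (v : (E -> R[i]) -> R[i]) j h : tempered u -> schw h ->
  (forall f, schw f -> bisum (fun k => u (Mlt (scl s (asym phi s) k) f)) (v f)) ->
  v (Mlt (scl (- s) (asym phi (- s)) j) h) = c0 * u (Mlt (psij phi j) h).
Proof.
move=> tu sh hv.
have sa t k : schw (scl t (asym phi t) k) by apply: schw_scl; exact: schw_asym.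
have sb := sa (- s) j; have sbh := schw_Mlt sb sh.
apply: bisum_unique (hv _ sbh) _.
have [K hK] := psij_sum_eq1 j; apply: (@bisum_const _ _ _ K) => M N hM hN.
have sp := schw_psij hphi.
rewrite /bisum_at (eq_bigr (fun k : nat => u (Mlt (fun xi => c0 * (psij phi j xi * psij phi (k%:Z - M%:Z) xi)) h))); last first.
  move=> k _; rewrite (Mlt_comp hphi (sa _ _) sb sh); congr (u (Mlt _ h)); apply/funext => xi; congr (_ * _).
  rewrite -!LP_blockE !psijE !LP_psiE -!rmorphM/=; congr (_%:C).
  have [z0|/(psi0_supp hphi)[e1 _]] := eqVneq (psi0 phi (two (- j) *: xi)) 0; first by rewrite z0 !(mulr0, mul0r).
  have e0 : enorm xi != 0.
    by apply: contraTneq e1 => e0; rewrite enormZ e0 mulr0 -ltNge.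
  rewrite mulrACA -powRD ?subrr ?powRr0 ?mul1r; first by rewrite mulrC.
  by apply/implyP.
rewrite -(temp_Mlt_sum _ tu sh (m := fun (k : nat) xi => c0 * (psij phi j xi * psij phi (k%:Z - M%:Z) xi))); last first.
  by move=> k; apply: schwZ; apply: schwM.
rewrite -(tempZ _ tu (schw_Mlt (sp j) sh)) -(MltZ _ (sp j) sh); congr (u (Mlt _ h)).
by apply/funext => xi; rewrite -mulr_sumr -mulr_sumr hK.
Qed.

Section zeta.
Variable zeta : E -> R[i].
Hypothesis sz : schw zeta.

Lemma Mlt_iterZ m f K : schw m -> schw f -> Mlt m (iter K (Z zeta) f) = iter K (Z zeta) (Mlt m f).
Proof.
move=> sm sf; elim: K => [//|K IH]; rewrite !iterS -IH /Zop.
exact: (MltC hphi sm (schw_sym phi sz) (schw_iterZ phi sz K sf)).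
Qed.

Lemma pair_iterZ p v f K : 1 <= p -> isLp p v -> schw f ->
  cintegral (fun x => iter K (conv zeta) v x * f x) = cintegral (fun x => v x * iter K (Z zeta) f x).
Proof.
move=> p1 Lv; elim: K f => [//|K IH] f sf; rewrite iterS iterSr.
have Lw' := isLp_Lw p1 (isLp_iter_conv K p1 sz Lv).
have := conv_Mlt (schw_sym phi sz) Lw' sf; rewrite (fourier_inv_sym hphi sz) => ->.
exact: (IH _ (schw_Zop phi sz sf)).
Qed.

Definition err (M : nat) u (r : E -> R[i]) : (E -> R[i]) -> R[i] := on_schwartz (fun h =>
  u h - u (iter (M + M) (Z zeta) h) + cintegral (fun x => r x * iter M (Z zeta) h x)).

Hypothesis z0 : cintegral zeta = 0.

(** The blocks of [u] are known through L^p functions [v i]; evaluated after N + 1 factors of S they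
    sum in L^p by [dyadic_sum], and to [u] by [Sh_reconstruct]. The family serves derivatives, a
    single function the case of Hdot. *)
Lemma rep_exists (I : finType) (v : I -> E -> R[i]) (B : I -> E -> R[i]) (c1 : R[i]) p d N u :
  1 <= p -> Sh' u -> (forall i, isLp p (v i)) -> (forall i, schw (B i)) ->
  (forall i xi, B i xi * tpsi phi xi = B i xi) -> c1 != 0 -> `|d| <= N%:R ->
  (forall j h, schw h -> \sum_i cintegral (fun x => v i x * Mlt (scl d (B i) j) h x) = c1 * u (Mlt (psij phi j) h)) ->
  exists w, isLp p w /\ forall f, schw f -> cintegral (fun x => w x * f x) = u (iter N.+1 (Z zeta) f).
Proof.
move=> p1 hu Lv sB BE c10 dN hv; have p0 : 0 < p by exact: lt_le_trans p1.
have /choice[G hG] : forall i, exists G, isLp p G /\ forall f, schw f ->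
    bisum (fun j => cintegral (fun x => v i x * Mlt (scl d (B i) j) (iter N.+1 (Z zeta) f) x)) (cintegral (fun x => G x * f x)).
  move=> i; have [C C0 hC] := dyadic_sum hphi sz z0 (sB i) (BE i) p1 dN.
  by have [G [LG _ h]] := hC _ (Lv i); exists G.
(* One constant comes from the hypothesis on blocks, the other from the reconstruction formula. *)
have cc0 := cF_neq0 hphi; pose c := c1 * c0; have cn0 : c != 0 by rewrite mulf_neq0.
have LS (r : seq I) : isLp p (fun x => \sum_(i <- r) G i x).
  elim: r => [|i r IH].
    by rewrite (_ : (fun x => _) = fun=> 0); [exact: isLp0|apply/funext => x; rewrite big_nil].
  rewrite (_ : (fun x => _) = fun x => G i x + \sum_(i <- r) G i x); last by apply/funext => x; rewrite big_cons.
  exact: (isLpD p1 (hG i).1 IH).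
have LG := LS (index_enum I).
exists (fun x => c^-1 * \sum_i G i x); split; first exact: isLpZ.
move=> f sf; have sZ := schw_iterZ phi sz N.+1 sf.
have L i : L1 (fun x => G i x * f x) := LwM (isLp_Lw p1 (hG i).1) sf.
have -> : cintegral (fun x => (c^-1 * \sum_i G i x) * f x) = c^-1 * \sum_i cintegral (fun x => G i x * f x).
  rewrite -(@cintegral_sum _ _ _ _ (fun i x => G i x * f x) L) -cintegralZ; last exact: L1_sum.
  by congr cintegral; apply/funext => x; rewrite -mulr_suml mulrA.
apply: (mulfI cn0); rewrite mulrA mulfV// mul1r.
apply: bisum_unique (bisum_sum (index_enum I) (fun i => (hG i).2 f sf)) _.
have h0 : bisum (fun=> 0 : R[i]) 0 by apply: (@bisum_const _ _ _ 0%N) => M K _ _; rewrite /bisum_at big1.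
have := bisum_lin c1 (Sh_reconstruct hphi hu sZ) h0; rewrite addr0 mulrA -/c.
by apply: eq_bisum => j; rewrite addr0 hv.
Qed.

Section Hdot.
Variables (s p : R) (u : (E -> R[i]) -> R[i]) (v0 : E -> R[i]).
Hypothesis p1 : 1 <= p.
Hypothesis hu : Sh' u.
Hypothesis Lv0 : isLp p v0.
Hypothesis hv0 : forall f, schw f ->
  bisum (fun j => u (Mlt (scl s (asym phi s) j) f)) (cintegral (fun x => v0 x * f x)).

Lemma Hdot_rep N : `|s| <= N%:R ->
  exists w, isLp p w /\ forall f, schw f -> cintegral (fun x => w x * f x) = u (iter N.+1 (Z zeta) f).
Proof.
move=> sN; have [tu _] := hu.
apply: (@rep_exists unit (fun=> v0) (fun=> asym phi (- s)) c0 p (- s) N u) => //.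
- by move=> _; exact: schw_asym.
- by move=> _ xi; exact: asym_tpsi.
- exact: cF_neq0.
- by rewrite normrN.
move=> j h sh; transitivity (cintegral (fun x => v0 x * Mlt (scl (- s) (asym phi (- s)) j) h x)).
  by move: (cintegral _) => F; rewrite (bigD1 tt)//= big1 ?addr0// => -[].
exact: (LP_inverse (v := fun f => cintegral (fun x => v0 x * f x)) j tu sh hv0).
Qed.

(** S commutes with the blocks, so the first part of the error has (-Delta)^(s/2) equal to v0 -
    S^(2N+2) v0; the second is bounded by [dyadic_sum] with the symbol of order s. *)
Lemma Hdot_err N : `|s| <= N%:R -> exists2 C : R, 0 <= C & forall r, isLp p r ->
  (Hdot_norm phi s p (err N.+1 u r) <=
   Lp p (fun x => (v0 x - iter (N.+1 + N.+1) (conv zeta) v0 x)%R) + C%:E * Lp p r)%E.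
Proof.
move=> sN; have [tu _] := hu; pose M := N.+1; have p0 : 0 < p by exact: lt_le_trans p1.
have [C C0 hC] := dyadic_sum hphi sz z0 (schw_asym hphi s) (asym_tpsi hphi s) p1 sN.
exists C => // r Lr; have [G [LG GC hG]] := hC r Lr.
have LS := isLp_iter_conv (M + M) p1 sz Lv0.
have LB := isLpB p1 Lv0 LS.
pose g x := (v0 x - iter (M + M) (conv zeta) v0 x) + G x.
have Lg : isLp p g := isLpD p1 LB LG.
apply: le_trans (_ : Lp p g <= _)%E; last first.
  by apply: le_trans (LpD p1 LB.1 LG.1) _; exact: leeD.
apply: le_trans (Lp_norm_le Lg); apply: ereal_inf_lbound.
exists (distr_of g) => //; split; first exact: tempered_distr (isLp_Lw p1 Lg).
apply/distr_sumP => f sf; rewrite distr_ofE//.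
have sa j : schw (scl s (asym phi s) j) by apply: schw_scl; exact: schw_asym.
have -> : cintegral (fun x => g x * f x) =
   (-1) * cintegral (fun x => v0 x * iter (M + M) (Z zeta) f x) + (1 * cintegral (fun x => v0 x * f x) + cintegral (fun x => G x * f x)).
  rewrite -(pair_iterZ _ p1 Lv0 sf) mulN1r mul1r addrA [- _ + _]addrC.
  have H q : isLp p q -> L1 (fun x => q x * f x) by move=> Lq; exact: LwM (isLp_Lw p1 Lq) sf.
  rewrite -(cintegralB (H _ Lv0) (H _ LS)) -cintegralD; [|by apply: L1B; exact: H|exact: H].
  by congr cintegral; apply/funext => x; rewrite /g; ring.
have := bisum_lin (-1) (hv0 (schw_iterZ phi sz (M + M) sf)) (bisum_lin 1 (hv0 sf) (hG f sf)).
apply: eq_bisum => j; rewrite /err on_schwartzE; last exact: schw_Mlt.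
by rewrite !(Mlt_iterZ _ (sa j) sf) mulN1r mul1r addrA [- _ + _]addrC.
Qed.

End Hdot.
End zeta.
End representation.

(** * Supports of distributions *)

Section supports.
Context {R : realType} {n : nat}.
Local Notation E := 'rV[R]_n.
Implicit Types (f g h : E -> R[i]) (u : (E -> R[i]) -> R[i]).

Lemma lip_closed (F : E -> R) (K c : R) : (forall x y, F x - F y <= K * onorm (x - y)) -> closed [set y | F y <= c].
Proof.
move=> hF y cy /=; apply/ler_addgt0Pr => e e0.
have k0 : 0 < `|K| * n%:R + 1 by rewrite ltr_wpDl// mulr_ge0.
pose d := e / (`|K| * n%:R + 1); have d0 : 0 < d by rewrite divr_gt0.
have [z [/= Fz [_ bz]]] := cy (ball y d) (nbhsx_ballx _ _ d0).
have oz : onorm (y - z) <= n%:R * d.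
  rewrite /onorm -sum_ord_cst; apply: ler_sum => i _; rewrite !mxE.
  by have := bz ord0 i; rewrite /ball/= => /ltW.
rewrite -(subrK (F z) (F y)) addrC; apply: lerD => //.
apply: le_trans (hF y z) _; apply: le_trans (_ : `|K| * (n%:R * d) <= _).
  apply: le_trans (ler_wpM2r (onorm_ge0 _) (ler_norm K)) _; exact: ler_wpM2l.
by rewrite mulrA /d mulrA ler_pdivrMr// mulrC ler_wpM2l ?lerDl// ltW.
Qed.

Lemma onorm_lip (a x y : E) : onorm (x - a) - onorm (y - a) <= 1 * onorm (x - y).
Proof.
rewrite mul1r lerBlDr; have := onormD (x - y) (y - a).
by rewrite addrA subrK.
Qed.

Lemma onorm_lipN (a x y : E) : - onorm (x - a) - - onorm (y - a) <= 1 * onorm (x - y).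
Proof. by rewrite opprK addrC -(onormN (x - y)) opprB; exact: onorm_lip. Qed.

Variable phi : E -> R.
Hypothesis hphi : LP_cutoff phi.

Lemma not_dsupp u x : ~ dsupp u x -> exists2 r : R, 0 < r & forall f, smooth f ->
  (forall y, f y != 0 -> onorm (y - x) <= n%:R * (4 / 3 * r)) -> u f = 0.
Proof.
move=> hx; have [V oV hV] : exists2 V, open_nbhs x V & forall f, Cc_infty V f -> u f = 0.
  apply: contrapT => H; apply: hx => V oV; apply: contrapT => H2; apply: H; exists V => // f fc.
  by apply/eqP; apply/negPn/negP => uf; apply: H2; exists f.
have /nbhs_ballP[e /= e0 he] := open_nbhs_nbhs oV.
(* The Euclidean radius 4/3 * r is that of a rescaled cutoff; in the l^1 norm it becomes at most n *
   4/3 * r, which is less than [e] for this r. *)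
exists (e / (2 * n.+1%:R)); first by rewrite divr_gt0// mulr_gt0.
set r := e / _ => f sf hf; apply: hV.
have r0 : 0 <= n%:R * (4 / 3 * r) by rewrite mulr_ge0// mulr_ge0// divr_ge0 ?mulr_ge0// ltW.
apply: (@Cc_inftyI _ _ _ _ [set y | onorm (y - x) <= n%:R * (4 / 3 * r)] (n%:R * (4 / 3 * r) + onorm x)) => //.
- exact: lip_closed (onorm_lip x).
- move=> y /= hy; apply: he; split=> // i j; rewrite ord1 /ball/=.
  have -> : x 0 j - y 0 j = - (y - x) ord0 j by rewrite !mxE opprB.
  rewrite normrN; apply: le_lt_trans (coord_le_onorm _ _) _; apply: le_lt_trans hy _.
  rewrite /r; have -> : n%:R * (4 / 3 * (e / (2 * n.+1%:R))) = e * (2 / 3 * (n%:R / n.+1%:R)).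
    have N0 : n.+1%:R != 0 :> R by rewrite pnatr_eq0.
    by move: (n.+1%:R : R) N0 => N N0; field.
  rewrite gtr_pMr//; have : n%:R / n.+1%:R <= 1 :> R by rewrite ler_pdivrMr// mul1r ler_nat.
  by move: (n%:R / n.+1%:R : R) => q q1; lra.
- move=> y /hf hy; rewrite -(subrK x y); apply: le_trans (onormD _ _) _; by rewrite lerD2r.
Qed.

(** In place of a partition of unity, functions are peeled off along a finite cover: g splits into g
    * b, killed by the local hypothesis at y, and g - g * b, which vanishes on the cell of y, where
    the rescaled cutoff b is 1. The radii 3/4 and 4/3 are those of the cutoff. *)
Lemma dsupp_vanish u f : tempered u -> Cc_infty setT f -> (forall x, supp f x -> ~ dsupp u x) -> u f = 0.
Proof.
move=> tu fc hs; have [_ [cf _]] := fc.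
have /choice[r hr] : forall x, exists r : R, supp f x -> 0 < r /\ forall g, smooth g ->
    (forall y, g y != 0 -> onorm (y - x) <= n%:R * (4 / 3 * r)) -> u g = 0.
  move=> x; have [sx|] := pselect (supp f x); last by exists 0.
  by have [r r0 hr] := not_dsupp (hs x sx); exists r.
pose D x := [set y : E | onorm (y - x) < 3 / 4 * r x].
have oD x : open (D x).
  rewrite (_ : D x = ~` [set y | - onorm (y - x) <= - (3 / 4 * r x)]).
    by apply: closed_openC; exact: lip_closed (onorm_lipN x).
  by apply/seteqP; split=> y; rewrite /D /= lerN2 => h; [apply/negP; rewrite -ltNge|rewrite ltNge; apply/negP].
move: cf; rewrite compact_cover => /(_ E (supp f) D (fun x _ => oD x))[|F Fs cov].
  move=> x sx; exists x => //; rewrite /D/= subrr onorm0 mulr_gt0//.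
  by have [] := hr x sx.
have {}cov x : f x != 0 -> exists2 y, y \in (finmap.enum_fset F) & D y x.
  by move=> fx; have [|y yF Dy] := cov x; [exact: subset_closure|exists y].
have {}Fs y : y \in (finmap.enum_fset F) -> supp f y by move=> yF; have := Fs y yF; rewrite inE.
have {}hr y : y \in (finmap.enum_fset F) -> 0 < r y /\ forall g, smooth g ->
    (forall z, g z != 0 -> onorm (z - y) <= n%:R * (4 / 3 * r y)) -> u g = 0 by move=> /Fs; exact: hr.
move: {hs Fs} (finmap.enum_fset F) hr cov => s.
elim: s f fc => [|y s IH] g gc hr cov.
  rewrite (_ : g = fun=> 0) ?temp0//; apply/funext => x; apply/eqP/negPn/negP => gx.
  by have [] := cov x gx.
have [r0 ry] := hr y (mem_head _ _).
pose b x := cphi phi ((r y)^-1 *: (x - y)).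
have sb : smooth b.
  apply: schw_smooth; have := schw_shift (- y) (schw_scale (_ : (r y)^-1 != 0) (schw_cphi hphi)).
  by apply; rewrite invr_neq0// gt_eqF.
have [sg _] := gc; have [M hM] := Cc_bounded gc.
have sgb : smooth (fun x => g x * b x) by exact: smoothM.
have gbc : Cc_infty setT (fun x => g x * b x).
  by apply: (Cc_inftyT sgb (M := M)) => x; rewrite mulf_eq0 negb_or => /andP[/hM].
have ggc : Cc_infty setT (fun x => (-1) * (g x * b x) + g x) by exact: Cc_inftyD.
have -> : u g = u (fun x => g x * b x) + u (fun x => (-1) * (g x * b x) + g x).
  rewrite -(tempD tu (Cc_schw gbc) (Cc_schw ggc)); congr u; apply/funext => x; ring.
rewrite [X in X + _]ry// ?add0r; last first.
  move=> x; rewrite mulf_eq0 negb_or => /andP[_ bx].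
  apply: le_trans (onorm_le_enorm _) _; rewrite ler_wpM2l// leNgt; apply/negP => h.
  move/eqP: bx; apply; rewrite /b /cphi (phi_supp hphi)// enormZ gtr0_norm ?invr_gt0//.
  by rewrite ler_pdivlMl// mulrC ltW.
apply: IH => [//|x xs|x hx]; first by apply: hr; rewrite inE xs orbT.
have gx : g x != 0 by apply: contraNneq hx => ->; rewrite mul0r mulr0 addr0.
have [z] := cov x gx; rewrite inE => /predU1P[->|zs] Dz; last by exists z.
exfalso; move/eqP: hx; apply; rewrite /b /cphi (phi_eq1 hphi); first by rewrite mulr1 mulN1r addNr.
rewrite enormZ gtr0_norm ?invr_gt0// ltr_pdivrMl// mulrC.
exact: le_lt_trans (enorm_le_onorm _) Dz.
Qed.

End supports.

(** * Cones, and the support of the truncated approximant *)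

Section truncation.
Context {R : realType} {m : nat}.
Local Notation n := m.+1.
Local Notation E := 'rV[R]_n.
Implicit Types (f g h : E -> R[i]) (u : (E -> R[i]) -> R[i]).
Variable phi : E -> R.
Hypothesis hphi : LP_cutoff phi.
Local Notation Z := (Zop phi).

Definition head (x : E) : 'rV[R]_m := \row_i x ord0 (lift ord_max i).

Lemma headB x y : head (x - y) = head x - head y.
Proof. by apply/rowP => i; rewrite !mxE. Qed.

Lemma onorm_head x : onorm x = onorm (head x) + `|x ord0 ord_max|.
Proof.
rewrite /onorm big_ord_recr/=; congr (_ + _); apply: eq_bigr => i _; rewrite mxE.
by congr (`|x _ _|); apply: val_inj; exact: (esym (lift_max i)).
Qed.

Variables (Omega : set E) (gam : 'rV[R]_m -> R) (L : R).
Hypothesis L0 : 0 <= L.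
Hypothesis gamL : forall x y, `|gam x - gam y| <= L * onorm (x - y).
Hypothesis OE : Omega = [set x | gam (head x) < x ord0 ord_max].

(** The signed height of the graph above a point is Lipschitz, which makes its sublevel sets closed:
    they describe the closure of the domain and the sets at positive depth inside it. *)
Lemma gap_lip x y : (gam (head x) - x ord0 ord_max) - (gam (head y) - y ord0 ord_max) <= (L + 1) * onorm (x - y).
Proof.
have -> : (gam (head x) - x ord0 ord_max) - (gam (head y) - y ord0 ord_max) =
  (gam (head x) - gam (head y)) - (x - y) ord0 ord_max by rewrite !mxE; ring.
rewrite onorm_head; apply: le_trans (lerD (ler_norm _) (ler_norm _)) _.
rewrite normrN; apply: le_trans (lerD (gamL _ _) (lexx _)) _; rewrite headB.
move: (normr_ge0 ((x - y) ord0 ord_max)) (onorm_ge0 (head x - head y)).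
move: (`|(x - y) ord0 ord_max|) (onorm (head x - head y)) => a b a0 b0.
have La := mulr_ge0 L0 a0; rewrite mulrDl mul1r mulrDr; lra.
Qed.

Lemma closureO x : closure Omega x -> gam (head x) <= x ord0 ord_max.
Proof.
have cl : closed [set x : E | gam (head x) - x ord0 ord_max <= 0] := lip_closed gap_lip.
have sub : Omega `<=` [set x : E | gam (head x) - x ord0 ord_max <= 0].
  by move=> y; rewrite OE /= subr_le0 => /ltW.
by move/(closure_subset sub)/cl; rewrite /= subr_le0.
Qed.

(** The upward cone of slope L, raised by d: a translate of a point on or above the graph by such a
    vector lies at least d above the graph. *)
Definition cone (d : R) (y : E) := L * onorm (head y) + d <= y ord0 ord_max.

Lemma coneD d y z : cone 0 y -> cone d z -> cone d (y + z).
Proof.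
rewrite /cone !mxE => h1 h2; have -> : head (y + z) = head y + head z by apply/rowP => i; rewrite !mxE.
apply: le_trans (_ : L * (onorm (head y) + onorm (head z)) + d <= _).
  by rewrite lerD2r ler_wpM2l// onormD.
by rewrite mulrDr; lra.
Qed.

Variable zeta : E -> R[i].
Hypothesis zc : Cc_infty setT zeta.
Variable d : R.
Hypothesis d0 : 0 < d.
Hypothesis zcone : forall y, zeta y != 0 -> cone d y.

Let sz : schw zeta := Cc_schw zc.

Lemma zcone0 y : zeta y != 0 -> cone 0 y.
Proof. by move/zcone; rewrite /cone => h; apply: le_trans h; rewrite lerD2l ltW. Qed.

Lemma ZopE f : schw f -> Z zeta f = conv (refl zeta) f.
Proof. by move=> sf; rewrite /Zop (MltE (schw_sym phi sz) sf) (fourier_inv_sym hphi sz). Qed.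

Lemma refl_Cc f : Cc_infty setT f -> Cc_infty setT (refl f).
Proof.
move=> fc; have [M hM] := Cc_bounded fc.
apply: (Cc_inftyT (schw_smooth (schw_refl (Cc_schw fc))) (M := M)) => y /hM.
by rewrite onormN.
Qed.

(** The transpose convolves with the reflected kernel and pushes supports down, away from x; the
    cones add by [coneD]. *)
Lemma Zop_supp x f : Cc_infty setT f -> (forall y, f y != 0 -> cone d (x - y)) ->
  Cc_infty setT (Z zeta f) /\ forall y, Z zeta f y != 0 -> cone d (x - y).
Proof.
move=> fc hf; have sf := Cc_schw fc; rewrite (ZopE sf); split.
  by have [M hM] := Cc_bounded fc; apply: (Cc_conv (refl_Cc zc) (schw_Lw sf) hM).
move=> y /(conv_supp (schw_refl sz) (schw_Lw sf))[z [h1 h2]].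
have -> : x - y = (z - y) + (x - z) by rewrite [RHS]addrC addrA subrK.
by apply: coneD; [apply: zcone0; move: h1; rewrite /refl opprB|exact: hf].
Qed.

Lemma iterZ_supp x f K : Cc_infty setT f -> (forall y, f y != 0 -> cone d (x - y)) ->
  Cc_infty setT (iter K (Z zeta) f) /\ forall y, iter K (Z zeta) f y != 0 -> cone d (x - y).
Proof.
move=> fc hf; elim: K => [|K [IH1 IH2]]; first by split.
exact: (Zop_supp IH1 IH2).
Qed.

(** A point y of the support with y in the closed domain would put x at height d or more above the
    graph, by the Lipschitz bound; so the support of [f] misses that of [u]. *)
Lemma cone_vanish u x f : tempered u -> dsupp u `<=` closure Omega -> Cc_infty setT f ->
  (forall y, f y != 0 -> cone d (x - y)) -> - d < gam (head x) - x ord0 ord_max -> u f = 0.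
Proof.
move=> tu hu fc hf hx; apply: (dsupp_vanish hphi tu fc) => y sy /hu /closureO hy.
have cl : closed [set y : E | L * onorm (head (x - y)) + y ord0 ord_max <= x ord0 ord_max - d].
  apply: (@lip_closed _ _ _ (L + 1)) => a b.
  rewrite !headB opprD addrACA onorm_head mulrDl mul1r headB.
  have h1 : L * onorm (head x - head a) - L * onorm (head x - head b) <= L * onorm (head a - head b).
    rewrite -mulrBr ler_wpM2l// lerBlDr -(onormN (head a - _)) opprB.
    rewrite [X in onorm X <= _](_ : _ = (head b - head a) + (head x - head b)); first exact: onormD.
    by rewrite [RHS]addrC addrA subrK.
  have h2 : a ord0 ord_max - b ord0 ord_max <= `|(a - b) ord0 ord_max|.
    by rewrite !mxE; exact: ler_norm.
  move: (normr_ge0 ((a - b) ord0 ord_max)) (onorm_ge0 (head a - head b)) h1 h2.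
  move: (`|(a - b) ord0 ord_max|) => A A0 o0 h1 h2.
  have LA := mulr_ge0 L0 A0; rewrite mulrDr; lra.
have : L * onorm (head (x - y)) + y ord0 ord_max <= x ord0 ord_max - d.
  apply: cl; apply: closure_subset sy => z /= /hf; rewrite /cone !mxE; lra.
rewrite headB => h; have := le_trans (ler_norm _) (gamL (head x) (head y)).
by move: hx hy h; lra.
Qed.

(** [w] is known only through its pairings, so the support of the approximant is found on the test
    side. The second claim is S^(N+1) w = S^(2N+2) u, which makes the difference an [err] term. *)
Lemma trunc_Cc p u w N k : 1 <= p -> tempered u -> dsupp u `<=` closure Omega -> isLp p w ->
  (forall f, schw f -> cintegral (fun x => w x * f x) = u (iter N.+1 (Z zeta) f)) ->
  Cc_infty Omega (iter N.+1 (conv zeta) (fun x => (theta phi k x)%:C * w x)) /\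
  forall h, schw h -> u h - cintegral (fun x => iter N.+1 (conv zeta) (fun x => (theta phi k x)%:C * w x) x * h x) =
    err phi zeta N.+1 u (fun x => w x - (theta phi k x)%:C * w x) h.
Proof.
move=> p1 tu hu Lw' hw; pose tw x := (theta phi k x)%:C * w x.
have p0 : 0 < p by exact: lt_le_trans p1.
have sth := schw_theta hphi k.
have Ltw : isLp p tw.
  have [C C1 hC] := theta_bound hphi; have C0 : 0 <= C by exact: le_trans C1.
  have mtw : cmeas tw by apply: cmeasM; [exact: schw_cmeas|exact: Lw'.1].
  have [mC nC] := isLpZ C%:C p1 Lw'; split; first exact: mtw.
  apply: le_lt_trans nC; apply: (le_Np (ltW p0) mtw mC) => x.
  rewrite !normcM !normc_real ler_wpM2r ?normc_ge0//.
  by have /andP[h1 h2] := hC k x; rewrite !ger0_norm.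
have [M0 hM0] := Cc_bounded (theta_Cc hphi k).
have bnd K : exists M : R, forall y, iter K (conv zeta) tw y != 0 -> onorm y <= M.
  have [B hB] := Cc_bounded zc; elim: K => [|K [M hM]].
    by exists M0 => y /=; rewrite /tw mulf_eq0 negb_or => /andP[/hM0].
  exists (B + M) => y; have LK := isLp_Lw p1 (isLp_iter_conv K p1 sz Ltw).
  move=> /(conv_supp sz LK)[z [h1 h2]]; rewrite -(subrK z y); apply: le_trans (onormD _ _) _.
  by apply: lerD; [exact: hB|exact: hM].
split.
  have [M hM] := bnd N.+1.
  have LK := isLp_Lw p1 (isLp_iter_conv N p1 sz Ltw).
  apply: (@Cc_inftyI _ _ _ _ [set x | gam (head x) - x ord0 ord_max <= - d] M).
  - exact: conv_smooth.
  - exact: lip_closed gap_lip.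
  - by move=> x /= hx; rewrite OE /= -subr_lt0; apply: le_lt_trans hx _; rewrite oppr_lt0.
  - move=> x; apply: contraNT; rewrite -ltNge => hx; apply/eqP.
    (* The outermost convolution at x is a pairing with this function. The other N become [Z] acting
       on it, multiplication by [theta] does not enlarge supports, and the pairing with w is u after
       N + 1 more factors [Z]: a test function in the downward cone of x, on which u vanishes if x
       is less than d above the graph. *)
    pose kx y := zeta (x - y).
    have kc : Cc_infty setT kx.
      have [B hB] := Cc_bounded zc; apply: (Cc_inftyT (schw_smooth (schw_conv_arg x sz)) (M := B + onorm x)) => y /hB hy.
      have -> : y = - (x - y) + x by rewrite opprB subrK.
      by apply: le_trans (onormD _ _) _; rewrite lerD2r onormN.
    have [c1 s1] := iterZ_supp N kc (fun y (h : kx y != 0) => zcone h).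
    transitivity (cintegral (fun y => iter N (conv zeta) tw y * kx y)).
      by rewrite iterS /conv; congr cintegral; apply/funext => y; rewrite mulrC.
    rewrite (pair_iterZ hphi sz N p1 Ltw (Cc_schw kc)).
    pose F y := (theta phi k y)%:C * iter N (Z zeta) kx y.
    have Fc : Cc_infty setT F.
      have [B hB] := Cc_bounded c1; apply: (Cc_inftyT (schw_smooth (schwM sth (Cc_schw c1))) (M := B)).
      by move=> y; rewrite mulf_eq0 negb_or => /andP[_ /hB].
    have Fs y : F y != 0 -> cone d (x - y) by rewrite mulf_eq0 negb_or => /andP[_ /s1].
    transitivity (cintegral (fun y => w y * F y)).
      by congr cintegral; apply/funext => y; rewrite /tw /F; ring.
    rewrite (hw F (Cc_schw Fc)).
    have [c2 s2] := iterZ_supp N.+1 Fc Fs.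
    exact: (cone_vanish tu hu c2 s2 hx).
  - exact: hM.
move=> h sh; rewrite /err on_schwartzE//.
have sZ := schw_iterZ phi sz N.+1 sh.
have -> := pair_iterZ hphi sz N.+1 p1 Ltw sh.
rewrite iterD -(hw _ sZ).
have -> : cintegral (fun x => (w x - (theta phi k x)%:C * w x) * iter N.+1 (Z zeta) h x) =
    cintegral (fun x => w x * iter N.+1 (Z zeta) h x) - cintegral (fun x => tw x * iter N.+1 (Z zeta) h x).
  rewrite -(cintegralB (LwM (isLp_Lw p1 Lw') sZ) (LwM (isLp_Lw p1 Ltw) sZ)).
  by congr cintegral; apply/funext => x; rewrite mulrBl.
by rewrite addrA subrK.
Qed.

End truncation.

(** * Test functions belong to S'_h and to the homogeneous spaces *)

Section test_functions_in_spaces.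
Context {R : realType} {n : nat}.
Local Notation E := 'rV[R]_n.
Implicit Types (f g h : E -> R[i]) (u : (E -> R[i]) -> R[i]).
Variable phi : E -> R.
Hypothesis hphi : LP_cutoff phi.
Local Notation c0 := (cF (cphi phi)).

Lemma Lp_norms_ge0 (I : finType) p (U : I -> (E -> R[i]) -> R[i]) : (0 <= Lp_norms p U)%E.
Proof. by apply: le_ereal_inf_tmp => _ [g _ <-]; exact: Lnorm_ge0. Qed.

Lemma Lp_norm_bounded g (B : R) : 0 <= B -> cmeas g -> (forall x, normc (g x) <= B) ->
  (Lp_norm +oo (distr_of g) <= B%:E)%E.
Proof.
move=> B0 mg gB; have ub : (ess_sup (lebesgue_rV n) (abse \o (fun x => (normc (g x))%:E)) <= B%:E)%E.
  by apply/ess_supP; apply: aeW => x /=; rewrite ger0_norm ?normc_ge0// lee_fin.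
have nB : (Lnorm (lebesgue_rV n) +oo (fun x => (normc (g x))%:E) <= B%:E)%E.
  by rewrite unlock /=; case: ifPn => _; [exact: ub|rewrite lee_fin].
apply: le_trans nB; apply: ereal_inf_lbound; exists (fun=> g).
  move=> _; split => //; [exact: mg.1|exact: mg.2|].
  rewrite unlock /=; case: ifPn => _; last exact: ltry.
  exact: le_lt_trans ub (ltry _).
congr Lnorm; apply/funext => x.
by rewrite (bigD1 tt)//= big1 ?addr0 => [|[]//]; rewrite sqrtr_sqr ger0_norm// normc_ge0.
Qed.

Lemma multiplier_distr m f : schw m -> schw f -> multiplier m (distr_of f) = distr_of (conv (fourier_inv m) f).
Proof.
move=> sm sf; apply/funext => h; have [sh|sh] := pselect (schw h); last by rewrite /multiplier /distr_of !on_schwartz_out.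
rewrite /multiplier on_schwartzE// !distr_ofE//; last exact: (schw_Mlt sm sh).
by rewrite (conv_Mlt sm (schw_Lw sf) sh).
Qed.

Hypothesis n0 : (0 < n)%N.

(** The sup norm of the dilated kernel is O(t^-n), at most O(t^-1) because n >= 1; this gives the
    limit in the definition of S'_h. *)
Lemma dil_inf (k : E -> R[i]) f : schw k -> schw f -> exists2 C : R, 0 <= C & forall t x, 1 <= t ->
  normc (conv (dil t k) f x) <= C * t^-1.
Proof.
move=> sk sf; have [B B0 hB] := schw_bound 0 sk.
have Lf1 : L1 (fun y => (normc (f y))%:C).
  have [mf nf] := schw_L1 sf; split; first by apply: cmeas_real; exact: cmeas_normc.
  by rewrite inorm_real// => y; exact: normc_ge0.
exists (2 * (B * rnorm (fun y => (normc (f y))%:C))); first by rewrite !mulr_ge0 ?rnorm_ge0.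
move=> t x t1; have t0 : 0 < t by exact: lt_le_trans t1.
have tn : t ^- n <= t^-1.
  by rewrite lef_pV2 ?posrE ?exprn_gt0//; case: n n0 => // n' _; rewrite exprS ler_peMr ?exprn_ege1// ltW.
have k0 : 0 <= t^-1 * B by rewrite mulr_ge0// invr_ge0 ltW.
apply: le_trans (normc_cintegral_le k0 (conv_L1 x (schw_dil t0 sk) (schw_Lw sf)) Lf1 _) _.
  move=> y; rewrite normcM ler_wpM2r ?normc_ge0// /dil normcM normc_real ger0_norm; last first.
    by rewrite invr_ge0 exprn_ge0// ltW.
  apply: ler_pM => //; [by rewrite invr_ge0 exprn_ge0// ltW|exact: normc_ge0|].
  by have := hB (t^-1 *: (x - y)); rewrite expr0 mul1r.
by rewrite le_eqVlt; apply/orP; left; apply/eqP; ring.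
Qed.

Lemma Sh_distr f : Cc_infty setT f -> Sh' (distr_of f).
Proof.
move=> fc; have sf := Cc_schw fc; split; first exact: tempered_distr (schw_Lw sf).
move=> Theta Tc; have sT := Cc_schw Tc; have sFT := schw_fourier_inv sT.
have [C C0 hC] := dil_inf sFT sf.
have bnd lam : 1 <= lam -> (Lp_norm +oo (multiplier (fun xi => Theta (lam *: xi)) (distr_of f)) <= (C * lam^-1)%:E)%E.
  move=> l1; have l0 : 0 < lam by exact: lt_le_trans l1.
  have sl := schw_scale (lt0r_neq0 l0) sT.
  rewrite multiplier_distr// (fourier_inv_scale l0 sT); apply: Lp_norm_bounded.
  - by rewrite mulr_ge0// invr_ge0 ltW.
  - by apply: cmeas_conv; [exact: schw_dil|exact: schw_Lw].
  - by move=> x; exact: hC.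
have fin lam : 1 <= lam -> Lp_norm +oo (multiplier (fun xi => Theta (lam *: xi)) (distr_of f)) \is a fin_num.
  by move=> l1; rewrite ge0_fin_numE ?Lp_norms_ge0//; exact: le_lt_trans (bnd _ l1) (ltry _).
apply/fine_cvgP; split.
  by exists 1; split => // lam /ltW; exact: fin.
apply/cvgrPdist_le => /= e e0.
exists (Num.max 1 (C / e)); split; first exact: num_real.
move=> lam; rewrite gt_max => /andP[/ltW l1 le]; have l0 : 0 < lam by exact: lt_le_trans l1.
rewrite sub0r normrN ger0_norm ?fine_ge0 ?Lp_norms_ge0//.
rewrite -lee_fin fineK ?fin//; apply: le_trans (bnd _ l1) _.
by rewrite lee_fin ler_pdivrMr// mulrC -ler_pdivrMr// ltW.
Qed.

Lemma dsupp_distr f (K : set E) : schw f -> closed K -> (forall x, f x != 0 -> K x) -> dsupp (distr_of f) `<=` K.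
Proof.
move=> sf cK fK x hx; apply: contrapT => nK.
have oV : open_nbhs x (~` K) by split => //; exact: closed_openC.
have [g gc] := hx _ oV; move/eqP; apply; rewrite distr_ofE; last exact: Cc_schw gc.
rewrite (_ : (fun x => _) = fun=> 0) ?cintegral0//; apply/funext => y; apply/eqP.
rewrite mulf_eq0; apply/negPn/negP; rewrite negb_or => /andP[/fK Ky gy].
by have [_ [_ +]] := gc => /(_ y); apply => //; apply: subset_closure.
Qed.

Lemma Cc_sub (U V : set E) f : U `<=` V -> Cc_infty U f -> Cc_infty V f.
Proof. by move=> UV [h1 [h2 h3]]; split=> //; split=> // x /h3 /UV. Qed.

(* The Laplacian supplies the decay of the high frequency blocks of a test function. *)
Definition lapl f : E -> R[i] := fun x => \sum_(i < n) - pderivs [:: i; i] f x.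

Lemma schw_lapl f : schw f -> schw (lapl f).
Proof. by move=> sf; apply: schw_sum => i; apply: schwN; exact: schw_pderivs. Qed.

Definition msq (xi : E) : R[i] := (dotv xi xi)%:C.

Lemma fourier_lapl f xi : schw f -> fourier (lapl f) xi = msq xi * fourier f xi.
Proof.
move=> sf; have s2 i := schw_pderivs [:: i; i] sf.
have E1 i : fourier (fun x => - pderivs [:: i; i] f x) xi = (xi ord0 i * xi ord0 i)%:C * fourier f xi.
  rewrite (_ : (fun x => _) = fun x => -1 * pderiv i (pderiv i f) x); last by apply/funext => x; rewrite mulN1r.
  rewrite fourierZ; last exact: schw_L1 (s2 i).
  rewrite !fourier_pderiv//; last exact: schw_pderiv.
  rewrite rmorphM/=; have ii : 'i%C * 'i%C = -1 :> R[i] by rewrite -expr2 sqr_i.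
  transitivity (- ('i%C * 'i%C) * ((xi ord0 i)%:C * (xi ord0 i)%:C) * fourier f xi); first by ring.
  by rewrite ii opprK mul1r.
rewrite /fourier /lapl.
transitivity (\sum_(i < n) fourier (fun x => - pderivs [:: i; i] f x) xi).
  rewrite -(@cintegral_sum _ _ _ _ (fun i x => - pderivs [:: i; i] f x * expi (- dotv x xi))).
    by congr cintegral; apply/funext => x; rewrite mulr_suml.
  by move=> i; apply: L1_fourier; apply: L1N; exact: schw_L1 (s2 i).
under eq_bigr do rewrite E1.
by rewrite -mulr_suml -rmorph_sum.
Qed.

Lemma fourier_iter_lapl f K xi : schw f -> fourier (iter K lapl f) xi = msq xi ^+ K * fourier f xi.
Proof.
move=> sf; elim: K => [|K IH]; first by rewrite expr0 mul1r.
have sK : schw (iter K lapl f) by elim: K {IH} => [//|K IH]; exact: schw_lapl.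
by rewrite iterS fourier_lapl// IH exprS mulrA.
Qed.

Lemma schw_iter_lapl f K : schw f -> schw (iter K lapl f).
Proof. by move=> sf; elim: K => [//|K IH]; exact: schw_lapl. Qed.

Lemma asym_lapl s K xi : asym phi s xi = asym phi (s - (2 * K)%:R) xi * msq xi ^+ K.
Proof.
rewrite /asym /msq -rmorphXn -rmorphM/=; congr (_%:C).
have [->|/(psi0_supp hphi)[h _]] := eqVneq (psi0 phi xi) 0; first by rewrite !(mulr0, mul0r).
have e0 : 0 < enorm xi by apply: lt_le_trans h; rewrite divr_gt0.
rewrite mulrAC; congr (_ * _); rewrite -sqr_enorm -exprM -powR_mulrn ?(ltW e0)// -powRD ?subrK//.
by apply/implyP => _; rewrite gt_eqF.
Qed.

(** K Laplacians are moved onto [f], which lowers the order of the block from s to s - 2K; the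
    powers of 2^j match by homogeneity. *)
Lemma pair_high s f j K h : schw f -> schw h ->
  cintegral (fun x => f x * Mlt (scl s (asym phi s) j) h x) =
  cintegral (fun x => conv (fourier_inv (scl (s - (2 * K)%:R) (asym phi (s - (2 * K)%:R)) j)) (iter K lapl f) x * h x).
Proof.
move=> sf sh; set t := s - _; have sK := schw_iter_lapl K sf.
have sa r : schw (scl r (asym phi r) j) by apply: schw_scl; exact: schw_asym.
rewrite -(conv_Mlt (sa s) (schw_Lw sf) sh); congr cintegral; apply/funext => x; congr (_ * _).
rewrite -(fourier_inv_conv x (sa s) (schw_L1 sf)) -(fourier_inv_conv x (sa t) (schw_L1 sK)).
congr (fourier_inv _ x); apply/funext => xi; rewrite fourier_iter_lapl// mulrA; congr (_ * _).
have t0 := two_gt0 j (R := R).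
rewrite /scl (asym_lapl s K) -/t -!mulrA mulrCA [in RHS]mulrCA; congr (_ * _).
have -> : msq (two (- j) *: xi) = (two (- j) ^+ 2)%:C * msq xi.
  by rewrite /msq dotvZl dotvZr mulrA -expr2 rmorphM.
rewrite exprMn mulrA; congr (_ * _); rewrite -rmorphXn -rmorphM/=; congr (_%:C).
rewrite -exprM -powR_mulrn ?(ltW (two_gt0 _))// twoN -powR_inv1 ?(ltW t0)// -powRrM -powRD.
  by congr (_ `^ _); rewrite /t mulN1r.
by apply/implyP => _; rewrite gt_eqF.
Qed.

End test_functions_in_spaces.

Section Hdot_finite.
Context {R : realType} {n : nat}.
Local Notation E := 'rV[R]_n.
Implicit Types (f g h : E -> R[i]).
Variable phi : E -> R.
Hypothesis hphi : LP_cutoff phi.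

Lemma geom_sum (q : R) N : 0 <= q < 1 -> \sum_(k < N) q ^+ k <= (1 - q)^-1.
Proof.
move=> /andP[q0 q1]; have h : 0 < 1 - q by rewrite subr_gt0.
have -> : \sum_(k < N) q ^+ k = (1 - q ^+ N) / (1 - q).
  elim: N => [|N IH]; first by rewrite big_ord0 expr0 subrr mul0r.
  by rewrite big_ord_recr/= IH exprS; field; rewrite gt_eqF.
by rewrite -[leRHS]mul1r ler_wpM2r ?invr_ge0 ?(ltW h)// gerBl exprn_ge0.
Qed.

Lemma geom_series p (g : nat -> E -> R[i]) (A q : R) : 1 <= p -> 0 <= A -> 0 <= q < 1 ->
  (forall k, isLp p (g k)) -> (forall k, (Lp p (g k) <= (A * q ^+ k)%:E)%E) ->
  exists2 G, isLp p G & forall f, schw f -> forall e, 0 < e -> exists N0, forall N, (N0 <= N)%N ->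
    normc (\sum_(j < N) cintegral (fun x => g j x * f x) - cintegral (fun x => G x * f x)) < e.
Proof.
move=> p1 A0 hq Lg gA.
have hA N : \sum_(k < N) A * q ^+ k <= A * (1 - q)^-1.
  by rewrite -mulr_sumr ler_wpM2l// geom_sum.
by have [G [LG _ hG]] := Lp_series p1 Lg gA hA; exists G.
Qed.

Lemma Lp_fineE p (v : E -> R[i]) : isLp p v -> (Lp p v <= (fine (Lp p v))%:E)%E.
Proof. by move=> Lv; rewrite fineK// ge0_fin_numE ?Lp_ge0// isLp_fin. Qed.

(** High frequencies: enough Laplacians make the order at most -1, and the blocks are O(2^-k) in
    L^p. Low frequencies: f is taken in L^1 and the kernel in L^p, whose norm scales like 2^(-k (s +
    n (1 - 1/p))); the lower bound on s is the convergence of that geometric series. *)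
Lemma Hdot_Cc_fin s p f : 1 < p -> - (n%:R * (1 - p^-1)) < s -> schw f ->
  (Hdot_norm phi s p (distr_of f) < +oo)%E.
Proof.
move=> p1 hs sf; have p1' := ltW p1; have p0 : 0 < p by exact: lt_trans p1.
have sa r j : schw (scl r (asym phi r) j) by apply: schw_scl; exact: schw_asym.
have sFa r := schw_fourier_inv (schw_asym hphi r).
have sF r j := schw_fourier_inv (sa r j).
(* K exceeds |s + 1|, so that s - 2K <= -1. *)
pose K := (Num.truncn `|s + 1|).+1; pose t := s - (2 * K)%:R.
have t1 : t <= -1.
  have := truncnS_gt `|s + 1|; rewrite -/K => hK; have := ler_norm (s + 1).
  have : (K%:R : R) <= (2 * K)%:R by rewrite ler_nat leq_pmull.
  by rewrite /t; lra.
have sK := schw_iter_lapl K sf.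
pose g1 (k : nat) := conv (fourier_inv (scl t (asym phi t) k%:Z)) (iter K lapl f).
have Lg1 k : isLp p (g1 k) := isLp_conv p1' (sF t k%:Z) (schw_isLp p1' sK).
pose b1 := 2 * rnorm (fourier_inv (asym phi t)); pose V1 := fine (Lp p (iter K lapl f)).
have b10 : 0 <= b1 by rewrite mulr_ge0// rnorm_ge0.
have V10 : 0 <= V1 by rewrite fine_ge0// Lp_ge0.
have gb1 k : (Lp p (g1 k) <= (b1 * V1 * 2^-1 ^+ k)%:E)%E.
  have sD := schw_dil (two_gt0 (- k%:Z)) (sFa t).
  have rF : 2 * rnorm (fourier_inv (scl t (asym phi t) k%:Z)) <= 2^-1 ^+ k * b1.
    rewrite (fourier_inv_scl t k%:Z (schw_asym hphi t)) (rnormZ _ (schw_L1 sD)) (rnorm_dil (two_gt0 _) (schw_L1 (sFa t))).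
    rewrite normc_real ger0_norm ?powR_ge0// mulrCA; apply: ler_wpM2r => //.
    rewrite exprVn -powR_inv1 ?exprn_ge0//; apply: ler_powR => //.
    by rewrite /two -[_ ^ _]/(2 ^+ k) exprn_ege1// ler1n.
  apply: le_trans (young_le p1' (sF t k%:Z) (schw_isLp p1' sK) rF (Lp_fineE (schw_isLp p1' sK))) _.
  by rewrite lee_fin -/V1 le_eqVlt; apply/orP; left; apply/eqP; ring.
have hq1 : 0 <= (2^-1 : R) < 1 by rewrite invr_ge0 ler0n invf_lt1// ltr1n.
have [G1 LG1 hG1] := geom_series p1' (mulr_ge0 b10 V10) hq1 Lg1 gb1.
(* The decay rate of the low frequency blocks; [q] is the resulting geometric ratio. *)
pose sig := s + n%:R * (1 - p^-1); have sig0 : 0 < sig by rewrite /sig; lra.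
pose q := (2^-1 : R) `^ sig.
have hq : 0 <= q < 1.
  rewrite powR_ge0/= /q.
  apply: (@lt_le_trans _ _ (1 `^ sig)); last by rewrite powR1.
  by apply: gt0_ltr_powR; rewrite ?nnegrE ?invr_ge0 ?ler0n ?ler01//; case/andP: hq1.
pose b := fourier_inv (asym phi s); have Lb := schw_isLp p1' (sFa s).
pose A := 2 * rnorm f * fine (Lp p b) * q.
have B0 : 0 <= 2 * rnorm f * fine (Lp p b) by rewrite !mulr_ge0 ?rnorm_ge0 ?fine_ge0 ?Lp_ge0.
have A0 : 0 <= A by rewrite mulr_ge0//; case/andP: hq.
pose g2 (k : nat) := conv (fourier_inv (scl s (asym phi s) (- k.+1%:Z))) f.
have Lg2 k : isLp p (g2 k) := isLp_conv p1' (sF s (- k.+1%:Z)) (schw_isLp p1' sf).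
have tau k : (two (- k.+1%:Z)) `^ s * (two k.+1%:Z `^ (n%:R * (p^-1 - 1))) = q * q ^+ k :> R.
  have t0 := two_gt0 k.+1%:Z (R := R).
  rewrite twoN -powR_inv1 ?(ltW t0)// -powRrM -powRD; last by apply/implyP => _; rewrite gt_eqF.
  rewrite (_ : -1 * s + n%:R * (p^-1 - 1) = -1 * sig); last by rewrite /sig; ring.
  rewrite powRrM powR_inv1 ?(ltW t0)// -exprS /q /two -[_ ^ _]/(2 ^+ k.+1) -exprVn.
  have h0 : 0 <= (2^-1 : R) by rewrite invr_ge0.
  by rewrite -(powR_mulrn _ h0) -(powR_mulrn _ (powR_ge0 _ _)) -!powRrM mulrC.
have gb2 k : (Lp p (g2 k) <= (A * q ^+ k)%:E)%E.
  rewrite (@Lp_congr _ _ _ _ (conv f (fourier_inv (scl s (asym phi s) (- k.+1%:Z))))); last first.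
    by apply/funext => x; apply: conv_schwC => //; exact: sF.
  apply: le_trans (young p1' sf (schw_isLp p1' (sF s (- k.+1%:Z)))) _.
  have sD := schw_dil (two_gt0 (- - k.+1%:Z)) (sFa s).
  rewrite (fourier_inv_scl s (- k.+1%:Z) (schw_asym hphi s)) LpZ//; last exact: schw_cmeas.
  rewrite Lp_dil//; [|exact: two_gt0|exact: Lb.1].
  rewrite normc_real ger0_norm ?powR_ge0// opprK [X in (_ * X)%E]muleA -[X in (_ * (X * _))%E]EFinM tau.
  rewrite -(fineK (_ : Lp p b \is a fin_num)); last by rewrite ge0_fin_numE ?Lp_ge0// isLp_fin.
  by rewrite -!EFinM lee_fin le_eqVlt; apply/orP; left; apply/eqP; rewrite /A; ring.
have [G2 LG2 hG2] := geom_series p1' A0 hq Lg2 gb2.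
have LG := isLpD p1' LG1 LG2.
apply: (@le_lt_trans _ _ (Lp p (fun x => G1 x + G2 x)%R)); last exact: isLp_fin.
apply: le_trans (Lp_norm_le LG); apply: ereal_inf_lbound.
exists (distr_of (fun x => G1 x + G2 x)) => //; split; first exact: tempered_distr (isLp_Lw p1' LG).
apply/distr_sumP => h sh; rewrite distr_ofE//.
rewrite (_ : cintegral _ = cintegral (fun x => G1 x * h x) + cintegral (fun x => G2 x * h x)); last first.
  rewrite -(cintegralD (LwM (isLp_Lw p1' LG1) sh) (LwM (isLp_Lw p1' LG2) sh)).
  by congr cintegral; apply/funext => x; rewrite mulrDl.
have E1 (k : nat) : cintegral (fun x => g1 k x * h x) = distr_of f (Mlt (scl s (asym phi s) k%:Z) h).
  by rewrite distr_ofE; [rewrite (pair_high hphi s k%:Z K sf sh)|exact: schw_Mlt].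
have E2 (k : nat) : cintegral (fun x => g2 k x * h x) = distr_of f (Mlt (scl s (asym phi s) (- k.+1%:Z)) h).
  by rewrite distr_ofE; [rewrite /g2 (conv_Mlt (sa _ _) (schw_Lw sf) sh)|exact: schw_Mlt].
apply: bisumI => e e0.
  have [N0 hN] := hG1 h sh e e0; exists N0 => N /hN.
  by under eq_bigr do rewrite E1.
have [N0 hN] := hG2 h sh e e0; exists N0 => N /hN.
by under eq_bigr do rewrite E2.
Qed.

End Hdot_finite.

(** * Derivatives and the spaces Wdot *)

Section derivatives.
Context {R : realType} {n : nat}.
Local Notation E := 'rV[R]_n.
Implicit Types (f g h : E -> R[i]) (u : (E -> R[i]) -> R[i]) (s : seq 'I_n).
Variable phi : E -> R.
Hypothesis hphi : LP_cutoff phi.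
Local Notation c0 := (cF (cphi phi)).
Local Notation Z := (Zop phi).

Definition psymb s (xi : E) : R[i] := \prod_(i <- s) ((- 'i%C) * (xi ord0 i)%:C).

Lemma schw_psymbM s g : schw g -> schw (fun xi => psymb s xi * g xi).
Proof.
move=> sg; elim: s => [|i s IH].
  by rewrite (_ : (fun xi : E => _) = g)//; apply/funext => xi; rewrite /psymb big_nil mul1r.
rewrite (_ : (fun xi : E => _) = fun xi : E => (- 'i%C) * ((xi ord0 i)%:C * (psymb s xi * g xi))); last first.
  by apply/funext => xi; rewrite /psymb big_cons !mulrA.
by apply: schwZ; exact: schw_coordM.
Qed.

Lemma pderivs_fourier s g : schw g -> pderivs s (fourier g) = fourier (fun xi => psymb s xi * g xi).
Proof.
move=> sg; elim: s => [|i s IH].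
  by congr fourier; apply/funext => xi; rewrite /psymb big_nil mul1r.
rewrite -[LHS]/(pderiv i (pderivs s (fourier g))) IH.
have [_ ->] := fourier_diff (schw_psymbM s sg).
by congr fourier; apply/funext => xi; rewrite /psymb big_cons !mulrA.
Qed.

Lemma pderivs_Mlt s m h : schw m -> schw h -> pderivs s (Mlt m h) = Mlt (fun xi => psymb s xi * m xi) h.
Proof.
move=> sm sh; rewrite -[LHS]/(pderivs s (fourier (fun xi => m xi * fourier_inv h xi))).
rewrite pderivs_fourier; last by apply: schwM => //; exact: schw_fourier_inv.
rewrite -[RHS]/(fourier (fun xi => psymb s xi * m xi * fourier_inv h xi)).
by congr fourier; apply/funext => xi; rewrite mulrA.
Qed.

Lemma schw_inv f : schw f -> f = fourier (fun xi => c0^-1 * fourier_inv f xi).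
Proof.
move=> sf; have sp := schw_cphi hphi; apply/funext => x.
rewrite fourierZ; last by apply: schw_L1; exact: schw_fourier_inv.
by rewrite (fourier_invK sp (cphi0 hphi))// mulrA mulVf ?mul1r// cF_neq0.
Qed.

Lemma fourier_inv_pderivs s f xi : schw f -> fourier_inv (pderivs s f) xi = psymb s xi * fourier_inv f xi.
Proof.
move=> sf; have sp := schw_cphi hphi; have si := schwZ c0^-1 (schw_fourier_inv sf).
rewrite {1}(schw_inv sf) (pderivs_fourier s si) (fourierK sp (cphi0 hphi)); last exact: schw_psymbM.
by rewrite mulrCA; congr (_ * _); rewrite mulrA mulfV ?mul1r// cF_neq0.
Qed.

Lemma Mlt_pderivs s m h : schw m -> schw h -> Mlt m (pderivs s h) = Mlt (fun xi => psymb s xi * m xi) h.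
Proof.
move=> sm sh; rewrite -[LHS]/(fourier (fun xi => m xi * fourier_inv (pderivs s h) xi)).
rewrite -[RHS]/(fourier (fun xi => psymb s xi * m xi * fourier_inv h xi)).
by congr fourier; apply/funext => xi; rewrite fourier_inv_pderivs//; ring.
Qed.

(** On the Fourier side derivatives are products of symbols, which commute. *)
Lemma pderivs_comm s t f : schw f -> pderivs s (pderivs t f) = pderivs t (pderivs s f).
Proof.
move=> sf; have si := schwZ c0^-1 (schw_fourier_inv sf).
rewrite (schw_inv sf) !(pderivs_fourier _ si) !pderivs_fourier; try exact: schw_psymbM.
by congr fourier; apply/funext => xi; rewrite mulrCA.
Qed.

Lemma pderivs_iterZ zeta s h K : schw zeta -> schw h -> pderivs s (iter K (Z zeta) h) = iter K (Z zeta) (pderivs s h).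
Proof.
move=> sz sh; elim: K => [//|K IH]; rewrite !iterS -IH /Zop.
have sK := schw_iterZ phi sz K sh; have sy := schw_sym phi sz.
by rewrite (pderivs_Mlt s sy sK) (Mlt_pderivs s sy sK).
Qed.

(** The outermost derivative is moved first and ends up innermost; hence the reversal. *)
Lemma byparts_seq s f g : schw f -> schw g ->
  cintegral (fun x => f x * pderivs s g x) = (-1) ^+ size s * cintegral (fun x => pderivs (rev s) f x * g x).
Proof.
move=> sf sg; elim: s f sf => [|i s IH] f sf; first by rewrite mul1r.
rewrite exprS rev_cons pderivs_rcons -mulrA -IH; last exact: schw_pderiv.
by rewrite cintegral_byparts ?mulN1r ?opprK//; exact: schw_pderivs.
Qed.

Lemma dpderivs_at s u f : schw f -> dpderivs s u f = (-1) ^+ size s * u (pderivs s f).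
Proof. by move=> sf; rewrite /dpderivs on_schwartzE. Qed.

Lemma dpderivs_distr s f : schw f -> dpderivs s (distr_of f) = distr_of (pderivs (rev s) f).
Proof.
move=> sf; apply/funext => h; have [sh|sh] := pselect (schw h); last by rewrite /dpderivs /distr_of !on_schwartz_out.
rewrite dpderivs_at// !distr_ofE//; last exact: schw_pderivs.
by rewrite byparts_seq// mulrA -expr2 sqrr_sign mul1r.
Qed.

Lemma lee_sum_lty (I : finType) (a : I -> \bar R) : (forall i, (0 <= a i)%E) -> (forall i, (a i < +oo)%E) ->
  (\sum_i a i < +oo)%E.
Proof. by move=> a0 ay; apply: lte_sum_pinfty => i _. Qed.

Lemma Wdot_Cc_fin k f : schw f -> (Wdot_norm k (distr_of f) < +oo)%E.
Proof.
move=> sf; rewrite /Wdot_norm.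
have -> : (fun t : k.-tuple 'I_n => dpderivs t (distr_of f)) = fun t => distr_of (pderivs (rev t) f).
  by apply/funext => t; exact: dpderivs_distr.
have L (t : k.-tuple 'I_n) : isLp 1 (pderivs (rev t) f) by apply: schw_isLp => //; exact: schw_pderivs.
apply: le_lt_trans (Lp1_norms_le L) _; apply: lee_sum_lty => t; [exact: Lp_ge0|exact: isLp_fin].
Qed.

Lemma sum_tuple_prod (a : 'I_n -> R[i]) k : \sum_(t : k.-tuple 'I_n) \prod_(i <- t) a i = (\sum_i a i) ^+ k.
Proof.
transitivity (\prod_(j < k) \sum_i a i); last by rewrite prodr_const card_ord.
rewrite bigA_distr_bigA/= (reindex (@tuple_of_finfun 'I_n k))/=; last first.
  by exists (@finfun_of_tuple 'I_n k) => f _; [exact: tuple_of_finfunK|exact: finfun_of_tupleK].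
by apply: eq_bigr => f _; rewrite big_map big_enum.
Qed.

(** With [sum_tuple_prod], the signed squares of all symbols of order k add up to |eta|^(2k): the
    multinomial identity behind the inversion of the k-th gradient. *)
Lemma psymbsq s (eta : E) : \prod_(i <- s) (eta ord0 i * eta ord0 i)%:C = (-1) ^+ size s * (psymb s eta * psymb s eta).
Proof.
elim: s => [|i s IH]; first by rewrite /psymb !big_nil !mulr1.
rewrite /psymb !big_cons IH /= exprS -/(psymb s eta) rmorphM/=.
move: (eta ord0 i)%:C (psymb s eta) ((-1) ^+ size s) => a b c.
transitivity (- ('i%C * 'i%C) * (a * a) * (c * (b * b)) : R[i]); last by ring.
have := @sqr_i R; rewrite expr2 => ->.
by rewrite opprK mul1r.
Qed.

Section Wdot.
Variables (k : nat) (u : (E -> R[i]) -> R[i]) (v : k.-tuple 'I_n -> E -> R[i]).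
Hypothesis hu : Sh' u.
Hypothesis Lv : forall t, isLp 1 (v t).
Hypothesis hv : forall t : k.-tuple 'I_n, dpderivs t u = distr_of (v t).

Let tu : tempered u. Proof. by case: hu. Qed.

Lemma v_at (t : k.-tuple 'I_n) f : schw f -> cintegral (fun x => v t x * f x) = (-1) ^+ k * u (pderivs t f).
Proof. by move=> sf; rewrite -distr_ofE// -hv dpderivs_at// size_tuple. Qed.

Variable zeta : E -> R[i].
Hypothesis sz : schw zeta.

(** The left inverse of the k-th gradient on an annulus: a derivative of order k times |xi|^(-2k),
    hence of total order -k. *)
Definition wsym (t : k.-tuple 'I_n) (xi : E) : R[i] := psymb t xi * asym phi (- (2 * k)%:R) xi.

Lemma W_rep N : cintegral zeta = 0 -> (k <= N)%N ->
  exists w, isLp 1 w /\ forall f, schw f -> cintegral (fun x => w x * f x) = u (iter N.+1 (Z zeta) f).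
Proof.
move=> z0 kN.
have sB (t : k.-tuple 'I_n) : schw (wsym t) by apply: schw_psymbM; exact: schw_asym.
apply: (@rep_exists _ _ phi hphi zeta sz z0 (k.-tuple 'I_n) v wsym 1 1 (- k%:R) N u) => //.
- by move=> t xi; rewrite /wsym -mulrA asym_tpsi.
- by rewrite normrN ger0_norm ?ler_nat.
move=> j h sh; rewrite mul1r.
have sS (t : k.-tuple 'I_n) := schw_scl (- k%:R) j (sB t).
have sm (t : k.-tuple 'I_n) : schw (fun xi => (-1) ^+ k * (psymb t xi * scl (- k%:R) (wsym t) j xi)).
  by apply: schwZ; exact: schw_psymbM.
transitivity (\sum_t u (Mlt (fun xi => (-1) ^+ k * (psymb (t : k.-tuple 'I_n) xi * scl (- k%:R) (wsym t) j xi)) h)).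
  apply: eq_bigr => t _; rewrite v_at; last exact: schw_Mlt.
  rewrite (pderivs_Mlt t (sS t) sh) (MltZ _ (schw_psymbM t (sS t)) sh) tempZ//.
  by apply: schw_Mlt => //; exact: schw_psymbM.
rewrite -(temp_Mlt_sum _ tu sh sm); congr (u (Mlt _ h)); apply/funext => xi.
have t0 := two_gt0 j (R := R); set eta := two (- j) *: xi.
have pE (t : k.-tuple 'I_n) : psymb t xi = (two j ^+ k)%:C * psymb t eta.
  rewrite /psymb (eq_bigr (fun i => (two j)%:C * ((- 'i%C) * (eta ord0 i)%:C))).
    by rewrite big_split/= big_const_seq count_predT size_tuple iter_mulr mulr1 rmorphXn.
  move=> i _; rewrite mulrCA -rmorphM/= /eta mxE twoN mulrA mulfV ?mul1r// gt_eqF//.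
transitivity (\sum_(t : k.-tuple 'I_n) (\prod_(i <- t) (eta ord0 i * eta ord0 i)%:C) * asym phi (- (2 * k)%:R) eta).
  apply: eq_bigr => t _; rewrite pE /scl /wsym -/eta.
  rewrite psymbsq size_tuple; set a := psymb t eta; set b := asym _ _ _.
  have -> : (two j `^ (- k%:R))%:C = ((two j ^+ k)%:C)^-1 :> R[i].
    by rewrite powRN powR_mulrn ?(ltW t0)// fmorphV.
  have : (two j ^+ k)%:C != 0 :> R[i] by rewrite fmorph_eq0 gt_eqF// exprn_gt0.
  by move: (two j ^+ k)%:C a b ((-1) ^+ k) => c a b sg c0'; field.
rewrite -mulr_suml sum_tuple_prod.
rewrite (_ : \sum_i (eta ord0 i * eta ord0 i)%:C = msq eta); last by rewrite /msq /dotv rmorph_sum.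
by rewrite /psij /scl powRr0 (_ : 1%:C = 1)// mul1r (asym_lapl hphi 0 k) sub0r mulrC.
Qed.

(** The symbol of S with one derivative of order k put on its kernel. *)
Definition ksym (t : seq 'I_n) (xi : E) : R[i] := psymb t xi * sym phi zeta xi.

(** All derivatives of S^(N+1) r fall on the kernel of a single factor of S, so they are L^1 with a
    bound by the norm of r; the other N factors are merely bounded. Unlike for [Hdot_err], no dyadic
    sum is involved, so [zeta] may have integral 1. *)
Lemma W_err N : exists2 C : R, 0 <= C & forall r, isLp 1 r ->
  (Wdot_norm k (err phi zeta N.+1 u r) <=
   \sum_t Lp 1 (fun x => (v t x - iter (N.+1 + N.+1) (conv zeta) (v t) x)%R) + C%:E * Lp 1 r)%E.
Proof.
have sK t : schw (ksym t) by apply: schw_psymbM; exact: schw_sym.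
pose kt t := fourier_inv (ksym t); have skt t : schw (kt t) := schw_fourier_inv (sK t).
pose C0 := 2 * rnorm zeta; have C00 : 0 <= C0 by rewrite mulr_ge0// rnorm_ge0.
pose M := N.+1; have l1 : (1 : R) <= 1 by [].
pose C := \sum_(t : k.-tuple 'I_n) C0 ^+ N * (2 * rnorm (kt t)).
have Ct0 (t : k.-tuple 'I_n) : 0 <= C0 ^+ N * (2 * rnorm (kt t)) by rewrite !mulr_ge0 ?exprn_ge0 ?rnorm_ge0.
exists C => [|r Lr]; first by apply: sumr_ge0.
pose q t := conv (kt t) r; have Lq t : isLp 1 (q t) := isLp_conv l1 (skt t) Lr.
have LS t := isLp_iter_conv (M + M) l1 sz (Lv t).
have LB t := isLpB l1 (Lv t) (LS t).
have LQ t := isLpZ ((-1) ^+ k) l1 (isLp_iter_conv N l1 sz (Lq t)).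
pose g (t : k.-tuple 'I_n) x := (v t x - iter (M + M) (conv zeta) (v t) x) + (-1) ^+ k * iter N (conv zeta) (q t) x.
have Lg t : isLp 1 (g t) := isLpD l1 (LB t) (LQ t).
have -> : Wdot_norm k (err phi zeta N.+1 u r) = Lp_norms 1%:E (fun t : k.-tuple 'I_n => distr_of (g t)).
  congr Lp_norms; apply/funext => t; apply/funext => h.
  have [sh|sh] := pselect (schw h); last by rewrite /dpderivs /distr_of !on_schwartz_out.
  rewrite dpderivs_at// size_tuple distr_ofE// /err on_schwartzE; last exact: schw_pderivs.
  rewrite -!(pderivs_iterZ t _ sz sh) iterS.
  have sN := schw_iterZ phi sz N sh.
  rewrite [Zop _ _ _]/(Mlt (sym phi zeta) (iter N (Z zeta) h)).
  have -> : pderivs t (Z zeta (iter N (Z zeta) h)) = Mlt (ksym t) (iter N (Z zeta) h).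
    by rewrite /Zop (pderivs_Mlt t (schw_sym phi sz) sN).
  rewrite -(conv_Mlt (sK t) (isLp_Lw l1 Lr) sN) -(pair_iterZ hphi sz N l1 (Lq t) sh).
  rewrite mulrDr mulrBr -(v_at t sh) -(v_at t (schw_iterZ phi sz (M + M) sh)) -(pair_iterZ hphi sz (M + M) l1 (Lv t) sh).
  have H p' : isLp 1 p' -> L1 (fun x => p' x * h x) by move=> Lp'; exact: LwM (isLp_Lw l1 Lp') sh.
  have HQ := H _ (LQ t).
  rewrite -(cintegralB (H _ (Lv t)) (H _ (LS t))) -cintegralZ; last exact: H (isLp_iter_conv N l1 sz (Lq t)).
  rewrite -cintegralD.
  - by congr cintegral; apply/funext => x; rewrite /g; ring.
  - by apply: L1B; exact: H.
  - by rewrite (_ : (fun x : E => _) = fun x => (-1) ^+ k * iter N (conv zeta) (q t) x * h x)//; apply/funext => x; rewrite mulrA.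
apply: le_trans (Lp1_norms_le Lg) _.
have -> : C%:E = (\sum_(t : k.-tuple 'I_n) (C0 ^+ N * (2 * rnorm (kt t)))%:E)%E by rewrite /C sumEFin.
rewrite ge0_sume_distrl; last by move=> t _; rewrite lee_fin.
rewrite -big_split/=; apply: lee_sum => t _.
apply: le_trans (LpD l1 (LB t).1 (LQ t).1) _; apply: leeD => //.
have p0 : (0 : R) < 1 by [].
rewrite (LpZ _ p0 (isLp_iter_conv N l1 sz (Lq t)).1).
have -> : normc ((-1) ^+ k : R[i]) = 1 by rewrite normcX normcN normc1 expr1n.
rewrite mul1e.
have Fr := Lp_fineE Lr; have F0 : 0 <= fine (Lp 1 r) by rewrite fine_ge0// Lp_ge0.
have e0 : 0 <= 2 * rnorm (kt t) * fine (Lp 1 r) by rewrite !mulr_ge0 ?rnorm_ge0.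
apply: le_trans (iter_conv_bound N l1 sz (Lq t) e0 (young_le l1 (skt t) Lr (lexx _) Fr) (lexx _)) _.
rewrite -/C0 mulrA EFinM fineK// ge0_fin_numE ?Lp_ge0//; exact: isLp_fin.
Qed.

(** With no derivative, u is itself an L^1 function, and w = S^(N+1) u needs no reconstruction. *)
Lemma W_rep0 (t : k.-tuple 'I_n) N f : k = 0 -> schw f ->
  cintegral (fun x => iter N.+1 (conv zeta) (v t) x * f x) = u (iter N.+1 (Z zeta) f).
Proof.
move=> k0 sf; rewrite (pair_iterZ hphi sz N.+1 _ (Lv t) sf)// v_at; last exact: schw_iterZ.
have -> : tval t = [::] by apply: size0nil; rewrite size_tuple.
by rewrite k0 mul1r.
Qed.

End Wdot.
End derivatives.

(** * Derivatives of positive order in L^1 have integral zero *)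

Section mean_zero.
Context {R : realType} {n : nat}.
Local Notation E := 'rV[R]_n.
Implicit Types (f g h : E -> R[i]) (u : (E -> R[i]) -> R[i]).
Variable phi : E -> R.
Hypothesis hphi : LP_cutoff phi.
Local Notation c0 := (cF (cphi phi)).

(** Dominated convergence, with the sup of P as constant: stretching the test function isolates the
    integral of [v]. *)
Lemma scale_limit (v : E -> R[i]) P (a : E) : isLp 1 v -> schw P -> forall e : R, 0 < e ->
  exists K, forall j, (K <= j)%N ->
    normc (cintegral v * P a - cintegral (fun x => v x * P (j.+1%:R^-1 *: x + a))) <= e.
Proof.
move=> Lv sP e e0; have l1 : (1 : R) <= 1 by [].
have b0 (j : nat) : (j.+1%:R^-1 : R) != 0 by rewrite invr_neq0.
have [C C0 hC] := schw_bound 0 sP; have [C1 C10 hC1] := schw_mvt 0 sP.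
have PC x : normc (P x) <= C by have := hC x; rewrite expr0 mul1r.
have Lv1 : L1 v by exact/isLp1.
pose F (j : nat) x := v x * P (j.+1%:R^-1 *: x + a); pose f x := v x * P a.
have mF j : cmeas (F j) by apply: cmeasM; [exact: Lv.1|apply: schw_cmeas; exact: schw_affine].
have mf : cmeas f by apply: cmeasM; [exact: Lv.1|exact: cmeas_cst].
have LG : isLp 1 (fun x => C%:C * v x) := isLpZ C%:C l1 Lv.
have nG x : normc (C%:C * v x) = C * normc (v x) by rewrite normcM normc_real ger0_norm.
have FG j x : normc (F j x) <= normc (C%:C * v x) by rewrite nG normcM mulrC ler_wpM2r ?normc_ge0.
have fG x : normc (f x) <= normc (C%:C * v x) by rewrite nG normcM mulrC ler_wpM2r ?normc_ge0.
have pw x (d : R) : 0 < d -> exists K, forall j, (K <= j)%N -> normc (f x - F j x) <= d.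
  move=> d0; pose B := normc (v x) * (C1 * onorm x).
  have B0 : 0 <= B by rewrite !mulr_ge0 ?normc_ge0 ?onorm_ge0.
  exists (Num.truncn (B / d)).+1 => j jK.
  have hj : B / d < j.+1%:R by apply: lt_le_trans (truncnS_gt _) _; rewrite ler_nat; exact: leqW.
  have hh := hC1 a (j.+1%:R^-1 *: x); rewrite !expr0 mulr1 mul1r onormZ ger0_norm ?invr_ge0 ?ler0n// in hh.
  rewrite (_ : f x - F j x = - (v x * (P (a + j.+1%:R^-1 *: x) - P a))); last first.
    by rewrite /f /F [_ + a]addrC; ring.
  rewrite normcN normcM; apply: le_trans (ler_wpM2l (normc_ge0 _) hh) _.
  rewrite (_ : _ * _ = B / j.+1%:R); last by rewrite /B; move: (normc _) (onorm x) (j.+1%:R^-1) => p q r; ring.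
  by rewrite ler_pdivrMr ?ltr0n// mulrC -ler_pdivrMr// ltW.
have e20 : 0 < e / 2 by rewrite divr_gt0.
have [K hK] := Lp_dct l1 mF mf LG FG fG pw e20; exists K => j /hK hj.
have LF : isLp 1 (F j).
  apply: Lp_isLp; [by rewrite oner_eq0|exact: mF|].
  by apply: le_lt_trans (isLp_fin LG); apply: le_Lp => //; exact: LG.1.
have Lf : isLp 1 f.
  apply: Lp_isLp; [by rewrite oner_eq0|exact: mf|].
  by apply: le_lt_trans (isLp_fin LG); apply: le_Lp => //; exact: LG.1.
have Iv : cintegral v * P a = cintegral f.
  by rewrite mulrC -cintegralZ//; congr cintegral; apply/funext => x; rewrite mulrC.
have LD : L1 (fun x => f x - F j x) := (isLp1 _).1 (isLpB l1 Lf LF).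
have hn : (inorm (fun x => f x - F j x)%R <= (e / 2)%:E)%E by rewrite -Lp1.
rewrite Iv -/(F j) -(cintegralB ((isLp1 _).1 Lf) ((isLp1 _).1 LF)) -lee_fin.
apply: le_trans (normc_cintegral LD) _.
have -> : e%:E = (2%:E * (e / 2)%:E)%E by rewrite -EFinM; congr (_%:E); field.
by apply: lee_wpmul2l.
Qed.

Lemma onorm_delta (i : 'I_n) : onorm (delta_mx ord0 i : E) = 1.
Proof.
rewrite /onorm (bigD1 i)//= big1 ?addr0; first by rewrite mxE !eqxx/= normr1.
by move=> l li; rewrite mxE eqxx (negbTE li)/= normr0.
Qed.

(* Since [d^t' v_t = d^t v_t'], dilating a test function [F] gives
   [\int v_t * d^t' F = \int v_t' * d^t F]; on the Fourier side the ratio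
   of the two symbols is not constant when n >= 2. *)
Lemma W_mean0 k u (v : k.+1.-tuple 'I_n -> E -> R[i]) (t : k.+1.-tuple 'I_n) : (1 < n)%N ->
  (forall t, isLp 1 (v t)) -> (forall t : k.+1.-tuple 'I_n, dpderivs t u = distr_of (v t)) ->
  cintegral (v t) = 0.
Proof.
move=> n1 Lv hv; have l1 : (1 : R) <= 1 by [].
have [l lt1] : exists l : 'I_n, l != thead t.
  case: (eqVneq (Ordinal (ltnW n1)) (thead t)) => [h|]; last by exists (Ordinal (ltnW n1)).
  by exists (Ordinal n1); rewrite -h.
pose t' : k.+1.-tuple 'I_n := [tuple of nseq k.+1 l].
have sp := schw_cphi hphi; have sF := schw_fourier sp; set F := fourier (cphi phi) in sF.
pose P := pderivs t' F; pose Q := pderivs t F.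
have sP : schw P by exact: schw_pderivs.
have sQ : schw Q by exact: schw_pderivs.
have ident (a : E) (j : nat) : cintegral (fun x => v t x * P (j.+1%:R^-1 *: x + a)) =
    cintegral (fun x => v t' x * Q (j.+1%:R^-1 *: x + a)).
  set b : R := j.+1%:R^-1; have b0 : b != 0 by rewrite invr_neq0.
  have sf := schw_affine a b0 sF; set f := (fun x => F (b *: x + a)) in sf.
  have H := v_at hv t (schw_pderivs t' sf); have H' := v_at hv t' (schw_pderivs t sf).
  rewrite (pderivs_comm hphi t t' sf) -H' in H.
  have ZZ (w g : E -> R[i]) (c : R[i]) : isLp 1 w -> schw g -> cintegral (fun x => w x * (c * g x)) = c * cintegral (fun x => w x * g x).
    move=> Lw sg; rewrite -cintegralZ; last by apply: LwM => //; exact: isLp_Lw Lw.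
    by congr cintegral; apply/funext => x; ring.
  have E1 : pderivs t' f = fun x => (b ^+ k.+1)%:C * P (b *: x + a).
    by rewrite /f (pderivs_affine b a t' (schw_smooth sF)) size_tuple.
  have E2 : pderivs t f = fun x => (b ^+ k.+1)%:C * Q (b *: x + a).
    by rewrite /f (pderivs_affine b a t (schw_smooth sF)) size_tuple.
  rewrite E1 E2 in H.
  rewrite (ZZ _ _ _ (Lv t) (schw_affine a b0 sP)) (ZZ _ _ _ (Lv t') (schw_affine a b0 sQ)) in H.
  have c0' : (b ^+ k.+1)%:C != 0 :> R[i] by rewrite fmorph_eq0 expf_neq0.
  exact: (mulfI c0' H).
have key (a : E) : cintegral (v t) * P a = cintegral (v t') * Q a.
  apply/eqP; rewrite -subr_eq0; apply/eqP; apply: eq0_normc; apply/eqP.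
  rewrite eq_le normc_ge0 andbT; apply/ler_addgt0Pr => e e0; rewrite add0r.
  have e20 : 0 < e / 2 by rewrite divr_gt0.
  have [K1 h1] := scale_limit a (Lv t) sP e20; have [K2 h2] := scale_limit a (Lv t') sQ e20.
  have := h1 _ (leq_maxl K1 K2); have := h2 _ (leq_maxr K1 K2); rewrite ident.
  pose I := cintegral (fun x => v t' x * Q ((maxn K1 K2).+1%:R^-1 *: x + a)); rewrite -/I; move: (_ * P a) (_ * Q a) => x y hy hx.
  rewrite (_ : x - y = (x - I) - (y - I)); last by ring.
  by apply: le_trans (le_normcD _ _) _; rewrite normcN; lra.
(* A frequency on an axis other than that of the first derivative in t: the symbol of t vanishes
   there, that of t' does not, and half a unit vector lies where the cutoff is 1. *)
pose xi : E := 2^-1 *: delta_mx ord0 l.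
have ex : cphi phi xi = 1.
  have [_ _ _ h] := hphi; rewrite /cphi h//; apply: le_lt_trans (enorm_le_onorm _) _.
  by rewrite onormZ onorm_delta mulr1 ger0_norm ?invr_ge0//; lra.
have s1 := schw_psymbM t' sp; have s2 := schw_psymbM t sp.
have EF : fourier (fun x => cintegral (v t) * (psymb t' x * cphi phi x)) = fourier (fun x => cintegral (v t') * (psymb t x * cphi phi x)).
  apply/funext => a; rewrite !fourierZ; [|exact: schw_L1|exact: schw_L1].
  by have := key a; rewrite /P /Q /F !(pderivs_fourier _ sp).
have := congr1 (fun G => fourier_inv G xi) EF.
rewrite (fourierK sp (cphi0 hphi) _ (schwZ _ s1)) (fourierK sp (cphi0 hphi) _ (schwZ _ s2)).
rewrite ex !mulr1 => /mulfI; rewrite (cF_neq0 hphi) => /(_ isT).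
have pt : psymb t xi = 0.
  have xE : xi ord0 (thead t) = 0 by rewrite /xi !mxE eqxx/= eq_sym (negbTE lt1) mulr0.
  apply/eqP; rewrite /psymb prodf_seq_eq0; apply/hasP; exists (thead t); first exact: mem_tnth.
  by rewrite /= xE mulf_eq0 fmorph_eq0 eqxx orbT.
have pt' : psymb t' xi != 0.
  have xE : xi ord0 l = 2^-1 by rewrite /xi !mxE !eqxx/= mulr1.
  rewrite /psymb prodf_seq_neq0; apply/allP => i /nseqP[-> _] /=.
  rewrite xE mulf_eq0 negb_or oppr_eq0 fmorph_eq0 invr_eq0 pnatr_eq0 andbT.
  by apply/eqP => /(congr1 (@complex.Im R))/eqP; rewrite /= oner_eq0.
by rewrite pt mulr0 => /eqP; rewrite mulf_eq0 (negbTE pt') orbF => /eqP.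
Qed.

End mean_zero.

(** * Choice of the kernel *)

Section kernels.
Context {R : realType} {m : nat}.
Local Notation E := 'rV[R]_m.+1.
Implicit Types (f g h : E -> R[i]).
Variable phi : E -> R.
Hypothesis hphi : LP_cutoff phi.

Lemma iter_convB p K (k : E -> R[i]) f g : 1 <= p -> schw k -> isLp p f -> isLp p g ->
  iter K (conv k) (fun x => f x - g x) = fun x => iter K (conv k) f x - iter K (conv k) g x.
Proof.
move=> p1 sk Lf Lg; elim: K => [//|K IH]; rewrite !iterS IH; apply/funext => x.
have If := isLp_Lw p1 (isLp_iter_conv K p1 sk Lf); have Ig := isLp_Lw p1 (isLp_iter_conv K p1 sk Lg).
rewrite (_ : (fun x => _) = fun x => (-1) * iter K (conv k) g x + iter K (conv k) f x); last first.
  by apply/funext => y; rewrite mulN1r addrC.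
by rewrite (conv_linr (-1) x sk Ig If) mulN1r addrC.
Qed.

(** v - S^K v is the sum of S^i (v - S v) for i < K, each factor of S costing at most [A]. *)
Lemma iter_approx p (zeta v : E -> R[i]) (e A : R) K : 1 <= p -> schw zeta -> isLp p v -> 0 <= e ->
  2 * rnorm zeta <= A -> (Lp p (fun x => (v x - conv zeta v x)%R) <= e%:E)%E ->
  (Lp p (fun x => (v x - iter K (conv zeta) v x)%R) <= (e * \sum_(i < K) A ^+ i)%:E)%E.
Proof.
move=> p1 sz Lv e0 zA ve; have p0 : 0 < p by exact: lt_le_trans p1.
elim: K => [|K IH].
  rewrite big_ord0 mulr0 (_ : (fun x => _) = fun x => 0 * v x); last by apply/funext => x; rewrite subrr mul0r.
  by rewrite (LpZ _ p0 Lv.1) normc0 mul0e.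
have Lz := isLp_conv p1 sz Lv; have Ld := isLpB p1 Lv Lz.
have LK := isLp_iter_conv K p1 sz Lv; have LdK := isLp_iter_conv K p1 sz Ld.
rewrite (_ : (fun x => _) = fun x => (v x - iter K (conv zeta) v x) + iter K (conv zeta) (fun x => v x - conv zeta v x) x); last first.
  apply/funext => x; rewrite iterSr (iter_convB K p1 sz Lv Lz); move: (iter _ _ _ _) (iter _ _ _ _) => y z; ring.
apply: le_trans (LpD p1 (isLpB p1 Lv LK).1 LdK.1) _.
rewrite big_ord_recr/= mulrDr EFinD; apply: leeD => //.
by rewrite [in leRHS]mulrC; apply: iter_conv_bound.
Qed.

Lemma fin_pos (I : finType) (P : I -> R -> Prop) :
  (forall i, exists2 d, 0 < d & forall t, 0 < t <= d -> P i t) ->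
  exists2 d, 0 < d & forall i t, 0 < t <= d -> P i t.
Proof.
move=> h; suff [d d0 hd] : exists2 d, 0 < d & forall i, i \in enum I -> forall t, 0 < t <= d -> P i t.
  by exists d => // i; apply: hd; rewrite mem_enum.
elim: (enum I) => [|i s [d d0 hd]]; first by exists 1.
have [d' d'0 hd'] := h i; exists (Num.min d d'); first by rewrite lt_min d0.
move=> l; rewrite inE => /orP[/eqP ->|ls] t /andP[t0]; rewrite le_min => /andP[td td'].
  by apply: hd'; rewrite t0.
by apply: hd => //; rewrite t0.
Qed.

Lemma cone_bump (L : R) : 0 <= L -> exists rho : E -> R[i], [/\ Cc_infty setT rho, cintegral rho = 1 &
  forall y, rho y != 0 -> cone L 1 y].
Proof.
(* The bump occupies a Euclidean ball of radius 4/3; raised by [A], its lowest point is still 1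
   above the slope of the cone over the ball. *)
move=> L0; pose A : R := 4 / 3 + L * (m.+1%:R * (4 / 3)) + 1.
pose a : E := A *: delta_mx ord0 ord_max.
have [rho [rc r1 rs]] := bump hphi a; exists rho; split => //.
move=> y /rs hy; rewrite /cone.
have ha : head a = 0.
  by apply/rowP => i; rewrite !mxE eqxx /= eq_sym (negbTE (neq_lift _ _)) mulr0.
have hyE : head y = head (y - a).
  by apply/rowP => i; have /rowP/(_ i) := ha; rewrite !mxE => ->; rewrite subr0.
have ho : onorm (y - a) <= m.+1%:R * (4 / 3).
  by apply: le_trans (onorm_le_enorm _) _; rewrite ler_wpM2l// ltW.
have := onorm_head (y - a); rewrite -hyE => hh.
have h1 : onorm (head y) <= m.+1%:R * (4 / 3) by apply: le_trans ho; rewrite hh lerDl.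
have h2 := ler_wpM2l L0 h1.
have h3 : `|(y - a) ord0 ord_max| < 4 / 3 by apply: le_lt_trans (coord_le_enorm _ _) hy.
move: h3; rewrite !mxE !eqxx/= mulr1 ltr_norml => /andP[h3 _].
by move: h2 h3; rewrite /A; lra.
Qed.

Lemma dil_Cc (t : R) (rho : E -> R[i]) : 0 < t -> Cc_infty setT rho -> Cc_infty setT (dil t rho).
Proof.
move=> t0 rc; have [M hM] := Cc_bounded rc.
apply: (Cc_inftyT (schw_smooth (schw_dil t0 (Cc_schw rc))) (M := t * M)) => x.
rewrite /dil mulf_eq0 negb_or => /andP[_ /hM]; rewrite onormZ ger0_norm ?invr_ge0 ?(ltW t0)//.
by rewrite ler_pdivrMl.
Qed.

Lemma dil_cone (L t : R) (rho : E -> R[i]) : 0 < t -> (forall y, rho y != 0 -> cone L 1 y) ->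
  forall y, dil t rho y != 0 -> cone L t y.
Proof.
move=> t0 h y; rewrite /dil mulf_eq0 negb_or => /andP[_ /h]; rewrite /cone.
have -> : head (t^-1 *: y) = t^-1 *: head y by apply/rowP => i; rewrite !mxE.
have -> : (t^-1 *: y) ord0 ord_max = t^-1 * y ord0 ord_max by rewrite mxE.
rewrite onormZ ger0_norm ?invr_ge0 ?(ltW t0)// mulrCA => hh.
have := ler_wpM2l (ltW t0) hh; rewrite mulrDr mulr1 !mulrA mulfV ?gt_eqF// !mul1r.
by [].
Qed.

Definition kern_ok (L : R) (zeta : E -> R[i]) := Cc_infty setT zeta /\ exists2 d, 0 < d & forall y, zeta y != 0 -> cone L d y.

Lemma kern_mollify (L : R) (I : finType) (p : I -> R) (v : I -> E -> R[i]) K (e : R) : 0 <= L -> 0 < e ->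
  (forall i, 1 <= p i) -> (forall i, isLp (p i) (v i)) ->
  exists2 zeta, kern_ok L zeta & forall i, (Lp (p i) (fun x => (v i x - iter K (conv zeta) (v i) x)%R) <= e%:E)%E.
Proof.
move=> L0 e0 p1 Lv; have [rho [cr r1 rc]] := cone_bump L0; have sr := Cc_schw cr.
pose A := 2 * rnorm rho; have A0 : 0 <= A by rewrite mulr_ge0// rnorm_ge0.
pose S := \sum_(i < K) A ^+ i + 1; have S0 : 0 < S by rewrite ltr_wpDl// sumr_ge0// => i _; rewrite exprn_ge0.
have eS : 0 < e / S by rewrite divr_gt0.
have [d d0 hd] := fin_pos (fun i => mollify hphi (p1 i) sr r1 (Lv i) eS).
have sD := schw_dil d0 sr; exists (dil d rho).
  by split; [exact: dil_Cc|exists d => //; exact: dil_cone].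
move=> i; have p0 : 0 < p i by exact: lt_le_trans (p1 i).
have rD : 2 * rnorm (dil d rho) <= A by rewrite (rnorm_dil d0 (schw_L1 sr)).
have Lz := isLp_conv (p1 i) sD (Lv i).
have hz : (Lp (p i) (fun x => (v i x - conv (dil d rho) (v i) x)%R) <= (e / S)%:E)%E.
  rewrite (_ : (fun x => _) = fun x => - (conv (dil d rho) (v i) x - v i x)); last by apply/funext => x; rewrite opprB.
  by rewrite (LpN p0 (isLpB (p1 i) Lz (Lv i)).1); apply: hd; rewrite d0 lexx.
apply: le_trans (iter_approx K (p1 i) sD (Lv i) (ltW eS) rD hz) _.
by rewrite lee_fin mulrAC ler_pdivrMr// ler_wpM2l ?(ltW e0)// lerDl.
Qed.

(** The difference of a narrow and a wide dilate of one bump: the narrow one reproduces each [v i],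
    the wide one annihilates it in the limit, by [vanish] for p > 1 and [vanish1] for p = 1. Each
    accounts for half of the error. *)
Lemma kern_mean0 (L : R) (I : finType) (p : I -> R) (v : I -> E -> R[i]) K (e : R) : 0 <= L -> 0 < e ->
  (forall i, 1 <= p i) -> (forall i, isLp (p i) (v i)) ->
  (forall i, 1 < p i \/ p i = 1 /\ cintegral (v i) = 0) ->
  exists zeta, [/\ kern_ok L zeta, cintegral zeta = 0 &
    forall i, (Lp (p i) (fun x => (v i x - iter K (conv zeta) (v i) x)%R) <= e%:E)%E].
Proof.
move=> L0 e0 p1 Lv hv; have [rho [cr r1 rc]] := cone_bump L0; have sr := Cc_schw cr.
pose A := 2 * (rnorm rho + rnorm rho); have A0 : 0 <= A by rewrite mulr_ge0// addr_ge0// rnorm_ge0.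
pose S := \sum_(i < K) A ^+ i + 1; have S0 : 0 < S by rewrite ltr_wpDl// sumr_ge0// => i _; rewrite exprn_ge0.
have eS : 0 < e / S / 2 by rewrite !divr_gt0.
have [d d0 hd] := fin_pos (fun i => mollify hphi (p1 i) sr r1 (Lv i) eS).
have van i : exists2 T, 0 < T & forall t, T <= t -> (Lp (p i) (conv (dil t rho) (v i)) <= (e / S / 2)%:E)%E.
  case: (hv i) => [pi1|[pi1 vi0]]; first exact: (vanish hphi (ltn0Sn m) pi1 sr (Lv i) eS).
  by have := Lv i; rewrite pi1 => Li; exact: (vanish1 hphi sr ((isLp1 _).1 Li) vi0 eS).
(* Written for the inverse scale, largeness becomes smallness and [fin_pos] can choose one scale for
   all i. *)
have van' i : exists2 d, 0 < d & forall t, 0 < t <= d -> (Lp (p i) (conv (dil t^-1 rho) (v i)) <= (e / S / 2)%:E)%E.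
  have [T T0 hT] := van i; exists T^-1; first by rewrite invr_gt0.
  by move=> t /andP[t0 tT]; apply: hT; rewrite -(invrK T) lef_pV2// posrE ?invr_gt0.
have [b b0 hb] := fin_pos van'.
(* Besides being wide enough, the wide scale c^-1 is kept at least d, so that its cone lies in the
   one of the narrow kernel. *)
pose c := Num.min b d^-1; have c0 : 0 < c by rewrite lt_min b0 invr_gt0.
have dT : d <= c^-1 by rewrite -(invrK d) lef_pV2 ?posrE ?invr_gt0// /c ge_min lexx orbT.
have T0 : 0 < c^-1 by rewrite invr_gt0.
have sD := schw_dil d0 sr; have sT := schw_dil T0 sr.
pose zeta x := (-1) * dil c^-1 rho x + dil d rho x.
have sz : schw zeta by apply: schwD => //; exact: schwZ.
have iz : cintegral zeta = 0.
  rewrite /zeta cintegralD; [|by apply: L1Z; exact: schw_L1|exact: schw_L1].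
  rewrite cintegralZ; last exact: schw_L1.
  by rewrite !cintegral_dil ?r1 ?mulN1r ?addNr//; exact: schw_L1.
exists zeta; split => //.
  split; first by apply: Cc_inftyD; exact: dil_Cc.
  exists d => // y; rewrite /zeta => hy.
  have [h|h] := eqVneq (dil d rho y) 0; last exact: dil_cone d0 rc _ h.
  move: hy; rewrite h addr0 mulN1r oppr_eq0 => /(dil_cone T0 rc); rewrite /cone.
  by apply: le_trans; rewrite lerD2l.
move=> i; have p0 : 0 < p i by exact: lt_le_trans (p1 i).
have l1 : (1 : R) <= 1 by [].
have rD : 2 * rnorm zeta <= A.
  rewrite ler_wpM2l// -lee_fin EFinD -!inormE; [|exact: schw_L1|exact: schw_L1].
  rewrite -!Lp1; apply: le_trans (LpD l1 _ _) _; [by apply: cmeasZ; exact: schw_cmeas|exact: schw_cmeas|].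
  rewrite LpZ//; last exact: schw_cmeas.
  rewrite normcN normc1 mul1e !Lp1 !inormE; try exact: schw_L1.
  by rewrite !rnorm_dil//; exact: schw_L1.
have LzD := isLp_conv (p1 i) sD (Lv i); have LzT := isLp_conv (p1 i) sT (Lv i).
have hz : (Lp (p i) (fun x => (v i x - conv zeta (v i) x)%R) <= (e / S)%:E)%E.
  rewrite (_ : (fun x => _) = fun x => - (conv (dil d rho) (v i) x - v i x) + conv (dil c^-1 rho) (v i) x); last first.
    by apply/funext => x; rewrite /zeta (conv_linl (-1) x sT sD (isLp_Lw (p1 i) (Lv i))); ring.
  have LB := isLpB (p1 i) LzD (Lv i).
  apply: le_trans (LpD (p1 i) (isLpN (p1 i) LB).1 LzT.1) _.
  rewrite (LpN p0 LB.1) (_ : e / S = e / S / 2 + e / S / 2); last by field; rewrite gt_eqF.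
  rewrite EFinD; apply: leeD; first by apply: hd; rewrite d0 lexx.
  by apply: hb; rewrite c0 /c ge_min lexx.
have eS' : 0 <= e / S by rewrite ltW// divr_gt0.
apply: le_trans (iter_approx K (p1 i) sz (Lv i) eS' rD hz) _.
by rewrite lee_fin mulrAC ler_pdivrMr// ler_wpM2l ?(ltW e0)// lerDl.
Qed.

End kernels.

(** * Assembly of the density statements *)

Section density.
Context {R : realType} {m : nat}.
Local Notation n := m.+1.
Local Notation E := 'rV[R]_n.
Implicit Types (f g h : E -> R[i]) (u : (E -> R[i]) -> R[i]).
Variable phi : E -> R.
Hypothesis hphi : LP_cutoff phi.
Local Notation Z := (Zop phi).
Variables (Omega : set E) (gam : 'rV[R]_m -> R) (L : R).
Hypothesis L0 : 0 <= L.
Hypothesis gamL : forall x y, `|gam x - gam y| <= L * onorm (x - y).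
Hypothesis OE : Omega = [set x | gam (head x) < x ord0 ord_max].

Definition represents zeta N u (w : E -> R[i]) :=
  forall f, schw f -> cintegral (fun x => w x * f x) = u (iter N.+1 (Z zeta) f).

Definition err_small (nrm : ((E -> R[i]) -> R[i]) -> \bar R) p zeta N u (e : R) :=
  exists2 C : R, 0 <= C & forall r, isLp p r ->
    (nrm (err phi zeta N.+1 u r) <= e%:E + C%:E * Lp p r)%E.

Lemma theta_err p (w : E -> R[i]) (C e : R) : 1 <= p -> isLp p w -> 0 <= C -> 0 < e ->
  exists K, forall k, (K <= k)%N -> isLp p (fun x => w x - (theta phi k x)%:C * w x) /\
    (C%:E * Lp p (fun x => (w x - (theta phi k x)%:C * w x)%R) <= e%:E)%E.
Proof.
move=> p1 Lw' C0 e0; have C1 : 0 < C + 1 by rewrite ltr_wpDl.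
have [K hK] := theta_Lp hphi p1 Lw' (divr_gt0 e0 C1); exists K => k /hK hk.
have mt : cmeas (fun x => w x - (theta phi k x)%:C * w x).
  apply: cmeasB; first exact: Lw'.1.
  by apply: cmeasM; [exact: schw_cmeas (schw_theta hphi k)|exact: Lw'.1].
split; first by apply: Lp_isLp => //; [rewrite gt_eqF// (lt_le_trans _ p1)|exact: le_lt_trans hk (ltry _)].
apply: le_trans (lee_wpmul2l _ hk) _; first by rewrite lee_fin.
rewrite -EFinM lee_fin mulrA ler_pdivrMr// mulrC ler_wpM2l ?(ltW e0)//.
by rewrite lerDl.
Qed.

(** One approximant serves both norms: pairing S^(N+1) (theta_k w0) or S^(N+1) (theta_k w1) with h
    gives the same value of [u], so the error relative to either is an [err] term for its own w. The
    total is at most 2 (e/4 + e/8) < e. *)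
Lemma pair_density nrm0 nrm1 p0 p1 u zeta N w0 w1 (e : R) : kern_ok L zeta -> 1 <= p0 -> 1 <= p1 ->
  tempered u -> dsupp u `<=` closure Omega -> isLp p0 w0 -> isLp p1 w1 ->
  represents zeta N u w0 -> represents zeta N u w1 -> 0 < e ->
  err_small nrm0 p0 zeta N u (e / 4) -> err_small nrm1 p1 zeta N u (e / 4) ->
  exists2 g, Cc_infty_distr Omega g & (nrm0 (u \- g)%R + nrm1 (u \- g)%R < e%:E)%E.
Proof.
move=> [zc [d d0 zcone]] p01 p11 tu su Lw0 Lw1 rw0 rw1 e0 [C0 C00 hC0] [C1 C10 hC1].
have e8 : 0 < e / 8 by rewrite divr_gt0.
have [K0 hK0] := theta_err p01 Lw0 C00 e8; have [K1 hK1] := theta_err p11 Lw1 C10 e8.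
(* A common truncation level, needed for the approximants to coincide. *)
pose k := maxn K0 K1; have [Lr0 hr0] := hK0 k (leq_maxl _ _); have [Lr1 hr1] := hK1 k (leq_maxr _ _).
have sz := Cc_schw zc; have sth := schw_theta hphi k.
have [gc E0] := trunc_Cc hphi L0 gamL OE zc d0 zcone k p01 tu su Lw0 rw0.
have [_ E1] := trunc_Cc hphi L0 gamL OE zc d0 zcone k p11 tu su Lw1 rw1.
have trL p (w : E -> R[i]) : 1 <= p -> isLp p w -> isLp p (fun x => w x - (theta phi k x)%:C * w x) -> isLp p (fun x => (theta phi k x)%:C * w x).
  move=> q1 Lw' Lr; have := isLpB q1 Lw' Lr; congr isLp; apply/funext => x.
  by rewrite opprB addrCA subrr addr0.
have pr p (w : E -> R[i]) h : 1 <= p -> isLp p w -> isLp p (fun x => w x - (theta phi k x)%:C * w x) -> represents zeta N u w -> schw h ->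
    cintegral (fun x => iter N.+1 (conv zeta) (fun x => (theta phi k x)%:C * w x) x * h x) =
    u (iter N.+1 (Z zeta) (fun x => (theta phi k x)%:C * iter N.+1 (Z zeta) h x)).
  move=> q1 Lw' Lr rw sh; rewrite (pair_iterZ hphi sz N.+1 q1 (trL p w q1 Lw' Lr) sh).
  rewrite -rw; last by apply: schwM => //; exact: schw_iterZ.
  by congr cintegral; apply/funext => x; rewrite mulrCA mulrA.
set g := iter N.+1 (conv zeta) _ in gc E0.
have EQ r : (forall h, schw h -> u h - cintegral (fun x => g x * h x) = err phi zeta N.+1 u r h) ->
    u \- distr_of g = err phi zeta N.+1 u r.
  move=> H; apply/funext => h; rewrite [LHS]/(u h - distr_of g h).
  have [sh|sh] := pselect (schw h); first by rewrite -(H h sh) -distr_ofE.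
  by rewrite /distr_of /err !on_schwartz_out// temp_out//; exact: (subrr (0 : R[i])).
have F0 := EQ _ E0.
have F1 : u \- distr_of g = err phi zeta N.+1 u (fun x => w1 x - (theta phi k x)%:C * w1 x).
  apply: EQ => h sh; rewrite -(E1 h sh) (pr p1 w1 h p11 Lw1 Lr1 rw1 sh) /g.
  by rewrite (pr p0 w0 h p01 Lw0 Lr0 rw0 sh).
exists (distr_of g); first by exists g.
have b0 := le_trans (hC0 _ Lr0) (leeD2l _ hr0); have b1 := le_trans (hC1 _ Lr1) (leeD2l _ hr1).
rewrite -F0 in b0; rewrite -F1 in b1.
apply: le_lt_trans (leeD b0 b1) _; rewrite -!EFinD lte_fin; lra.
Qed.

(** Finiteness of the norm yields both the limit of the defining series and a function representing
    it. *)
Lemma Hdot_extract s p u : 1 < p -> (Hdot_norm phi s p u < +oo)%E ->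
  exists v0, isLp p v0 /\ forall f, schw f ->
    bisum (fun j => u (Mlt (scl s (asym phi s) j) f)) (cintegral (fun x => v0 x * f x)).
Proof.
move=> p1 /ereal_inf_lt[_ [v [tv sv] <-] fv].
have p0 : p != 0 by rewrite gt_eqF// (lt_trans _ p1).
have [g hg] := Lp_norms_fun p0 fv; have [Lg vE] := hg tt; exists (g tt); split => // f sf.
by have /distr_sumP H := sv; have := H f sf; rewrite vE distr_ofE.
Qed.

Lemma Hdot_density s0 s1 p0 p1 u (e : R) : 1 < p0 -> 1 < p1 -> Sh' u -> dsupp u `<=` closure Omega ->
  (Hdot_norm phi s0 p0 u < +oo)%E -> (Hdot_norm phi s1 p1 u < +oo)%E -> 0 < e ->
  exists2 g, Cc_infty_distr Omega g & (Hdot_norm phi s0 p0 (u \- g)%R + Hdot_norm phi s1 p1 (u \- g)%R < e%:E)%E.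
Proof.
move=> p01 p11 hu su f0 f1 e0; have [tu _] := hu; have p01' := ltW p01; have p11' := ltW p11.
have [v0 [Lv0 hv0]] := Hdot_extract p01 f0; have [v1 [Lv1 hv1]] := Hdot_extract p11 f1.
pose N := maxn (Num.truncn `|s0|).+1 (Num.truncn `|s1|).+1.
have N0 : `|s0| <= N%:R by apply: le_trans (ltW (truncnS_gt _)) _; rewrite ler_nat leq_maxl.
have N1 : `|s1| <= N%:R by apply: le_trans (ltW (truncnS_gt _)) _; rewrite ler_nat leq_maxr.
pose p (b : bool) := if b then p1 else p0; pose v (b : bool) := if b then v1 else v0.
have e4 : 0 < e / 4 by rewrite divr_gt0.
have hp b : 1 <= p b by case: b.
have hv b : isLp (p b) (v b) by case: b.
have hc b : 1 < p b \/ p b = 1 /\ cintegral (v b) = 0 by left; case: b.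
have [zeta [zk z0 hz]] := kern_mean0 hphi (N.+1 + N.+1) L0 e4 hp hv hc.
have sz := Cc_schw zk.1.
have [w0 [Lw0 rw0]] := Hdot_rep hphi sz z0 p01' hu Lv0 hv0 N0.
have [w1 [Lw1 rw1]] := Hdot_rep hphi sz z0 p11' hu Lv1 hv1 N1.
apply: (pair_density zk p01' p11' tu su Lw0 Lw1 rw0 rw1 e0).
  have [C C0 hC] := Hdot_err hphi sz z0 p01' hu Lv0 hv0 N0; exists C => // r Lr.
  by apply: le_trans (hC r Lr) _; apply: leeD => //; exact: (hz false).
have [C C0 hC] := Hdot_err hphi sz z0 p11' hu Lv1 hv1 N1; exists C => // r Lr.
by apply: le_trans (hC r Lr) _; apply: leeD => //; exact: (hz true).
Qed.

Lemma sum_const_le (I : finType) (F : I -> \bar R) (eta c : R) : (forall i, (F i <= eta%:E)%E) ->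
  0 <= eta -> #|I|%:R <= c -> (\sum_i F i <= (eta * c)%:E)%E.
Proof.
move=> hF eta0 hc; apply: le_trans (lee_sum _ (fun i _ => hF i)) _.
by rewrite sumEFin lee_fin sumr_const -mulr_natr ler_wpM2l.
Qed.

Lemma W_mean0_pos k u (v : k.-tuple 'I_n -> E -> R[i]) (t : k.-tuple 'I_n) : (1 < n)%N -> k != 0%N ->
  (forall t, isLp 1 (v t)) -> (forall t : k.-tuple 'I_n, dpderivs t u = distr_of (v t)) ->
  cintegral (v t) = 0.
Proof. by case: k v t => // k v t n1 _; exact: (W_mean0 hphi). Qed.

(** A finite family collects the derivatives of both orders, and one kernel must work for all. If an
    order is 0, u is integrable but its integral need not vanish, so a kernel of integral 1 is taken
    and [w] is a mollification of u. Otherwise all derivatives have mean zero and a mean-zero kernel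
    recovers [w]. *)
Lemma Wdot_density k0 k1 u (e : R) : (1 < n)%N -> Sh' u -> dsupp u `<=` closure Omega ->
  (Wdot_norm k0 u < +oo)%E -> (Wdot_norm k1 u < +oo)%E -> 0 < e ->
  exists2 g, Cc_infty_distr Omega g & (Wdot_norm k0 (u \- g)%R + Wdot_norm k1 (u \- g)%R < e%:E)%E.
Proof.
move=> n1 hu su f0 f1 e0; have [tu _] := hu; have l1 : (1 : R) <= 1 by [].
have one0 : (1 : R) != 0 by rewrite oner_eq0.
have [v0 hv0'] := Lp_norms_fun one0 f0; have [v1 hv1'] := Lp_norms_fun one0 f1.
have Lv0 t := (hv0' t).1; have hv0 t := (hv0' t).2.
have Lv1 t := (hv1' t).1; have hv1 t := (hv1' t).2.
pose N := maxn k0 k1.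
pose I := (k0.-tuple 'I_n + k1.-tuple 'I_n)%type.
pose v (i : I) := match i with inl t => v0 t | inr t => v1 t end.
(* The norm of the error is a sum over tuples, so the tolerance is divided by their number; the
   added 1 keeps [c] positive. *)
pose c : R := #|{: k0.-tuple 'I_n}|%:R + #|{: k1.-tuple 'I_n}|%:R + 1.
have c0 : 0 < c by rewrite ltr_wpDl// addr_ge0.
pose eta := e / 4 / c; have eta0 : 0 < eta by rewrite !divr_gt0.
have etac : eta * c = e / 4 by rewrite /eta divfK// gt_eqF.
have hp (i : I) : (1 : R) <= 1 by [].
have Lv (i : I) : isLp 1 (v i) by case: i.
have fin zeta : kern_ok L zeta -> (exists w, isLp 1 w /\ represents zeta N u w) ->
    (forall i : I, (Lp 1 (fun x => (v i x - iter (N.+1 + N.+1) (conv zeta) (v i) x)%R) <= eta%:E)%E) ->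
    exists2 g, Cc_infty_distr Omega g & (Wdot_norm k0 (u \- g)%R + Wdot_norm k1 (u \- g)%R < e%:E)%E.
  move=> zk [w [Lw' rw]] hz; have sz := Cc_schw zk.1.
  apply: (pair_density zk l1 l1 tu su Lw' Lw' rw rw e0).
    have [C C0 hC] := W_err hphi Lv0 hv0 sz N; exists C => // r Lr.
    apply: le_trans (hC r Lr) _; apply: leeD => //; rewrite -etac.
    apply: sum_const_le => [t||]; [exact: (hz (inl t))|exact: ltW|].
    by rewrite /c -addrA lerDl addr_ge0.
  have [C C0 hC] := W_err hphi Lv1 hv1 sz N; exists C => // r Lr.
  apply: le_trans (hC r Lr) _; apply: leeD => //; rewrite -etac.
  apply: sum_const_le => [t||]; [exact: (hz (inr t))|exact: ltW|].
  by rewrite /c addrAC lerDr addr_ge0.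
have [k00|k00] := eqVneq k0 0.
  have [zeta zk hz] := kern_mollify hphi (N.+1 + N.+1) L0 eta0 hp Lv.
  apply: (fin zeta zk) hz; have sz := Cc_schw zk.1.
  pose t : k0.-tuple 'I_n := [tuple of nseq k0 ord0].
  exists (iter N.+1 (conv zeta) (v0 t)); split; first exact: isLp_iter_conv.
  by move=> f sf; exact: (W_rep0 hphi Lv0 hv0 sz t N k00 sf).
have [k10|k10] := eqVneq k1 0.
  have [zeta zk hz] := kern_mollify hphi (N.+1 + N.+1) L0 eta0 hp Lv.
  apply: (fin zeta zk) hz; have sz := Cc_schw zk.1.
  pose t : k1.-tuple 'I_n := [tuple of nseq k1 ord0].
  exists (iter N.+1 (conv zeta) (v1 t)); split; first exact: isLp_iter_conv.
  by move=> f sf; exact: (W_rep0 hphi Lv1 hv1 sz t N k10 sf).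
have hm0 (i : I) : (1 : R) < 1 \/ (1 : R) = 1 /\ cintegral (v i) = 0.
  right; split => //; case: i => t; first exact: (W_mean0_pos t n1 k00 Lv0 hv0).
  exact: (W_mean0_pos t n1 k10 Lv1 hv1).
have [zeta [zk z0 hz]] := kern_mean0 hphi (N.+1 + N.+1) L0 eta0 hp Lv hm0.
apply: (fin zeta zk) hz; have sz := Cc_schw zk.1.
exact: (W_rep hphi hu Lv0 hv0 sz z0 (leq_maxl k0 k1)).
Qed.

Lemma Cc_distr_space0 nrm f : Cc_infty Omega f -> (nrm (distr_of f) < +oo)%E -> space0 nrm Omega (distr_of f).
Proof.
move=> fc fn; have fT := Cc_sub (@subsetT _ Omega) fc; split => //.
  exact: (Sh_distr (ltn0Sn m) fT).
apply: (dsupp_distr (Cc_schw fc) (@closed_closure _ _)) => x fx; apply: subset_closure.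
by have [_ [_ fO]] := fc; apply: fO; exact: subset_closure.
Qed.

Lemma Cc_distr_sub : Cc_infty_distr Omega 0 /\
  forall (a : R[i]) u v, Cc_infty_distr Omega u -> Cc_infty_distr Omega v -> Cc_infty_distr Omega (fun f => a * u f + v f).
Proof.
split.
  exists (fun=> 0).
    by apply: (@Cc_inftyI _ _ _ _ set0 0) => //; [exact: smooth_cst|exact: closed0|move=> x; rewrite eqxx|move=> x; rewrite eqxx].
  apply/funext => h; have [sh|sh] := pselect (schw h); last by rewrite /distr_of on_schwartz_out.
  rewrite distr_ofE// (_ : (fun x => _) = fun=> 0) ?cintegral0//.
  by apply/funext => x; rewrite mul0r.
move=> a _ _ [f fc <-] [g gc <-]; exists (fun x => a * f x + g x); first exact: Cc_inftyD.
apply/funext => h; have [sh|sh] := pselect (schw h); last by rewrite /distr_of !on_schwartz_out// mulr0 addr0.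
have Lf := LwM (schw_Lw (Cc_schw fc)) sh; have Lg := LwM (schw_Lw (Cc_schw gc)) sh.
rewrite !distr_ofE// -cintegralZ// -cintegralD//; last exact: L1Z.
by congr cintegral; apply/funext => x; rewrite mulrDl mulrA.
Qed.

End density.

Lemma fine_hoelder_conjugate {R : realType} (p : R) : 1 < p -> fine (hoelder_conjugate p%:E) = p / (p - 1).
Proof.
move=> p1; have p0 : p != 0 by rewrite gt_eqF// (lt_trans _ p1).
by rewrite /hoelder_conjugate/= eqe (negbTE p0) -EFinB inver subr_eq0 (gt_eqF p1).
Qed.

Theorem proposition3p12 (R : realType) (m : nat) (hm : (2 <= m.+1)%N)
    (phi : 'rV[R]_m.+1 -> R) (hphi : LP_cutoff phi)
    (Omega : set 'rV[R]_m.+1) (hOmega : special_lipschitz Omega)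
    (s0 s1 p0 p1 : R) (hp0 : 1 < p0) (hp1 : 1 < p1) :
  [/\ -1 + 1 / p0 < s0 -> -1 + 1 / p1 < s1 ->
      dense_subspace (Cc_infty_distr Omega)
        (space0 (Hdot_norm phi s0 p0) Omega `&`
         space0 (Hdot_norm phi s1 p1) Omega)
        (fun u => Hdot_norm phi s0 p0 u + Hdot_norm phi s1 p1 u)%E,
      - (m.+1%:R / fine (hoelder_conjugate p0%:E)) < s0 -> s0 < 0 ->
      dense_subspace (Cc_infty_distr Omega)
        (space0 (Hdot_norm phi s0 p0) Omega)
        (Hdot_norm phi s0 p0) &
      forall k0 k1 : nat,
      dense_subspace (Cc_infty_distr Omega)
        (space0 (Wdot_norm k0) Omega `&` space0 (Wdot_norm k1) Omega)
        (fun u => Wdot_norm k0 u + Wdot_norm k1 u)%E].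
Proof.
have [gam0 [L1' gamL1] OE'] := hOmega.
pose L := `|L1'|; have L0 : 0 <= L := normr_ge0 L1'.
have gamL (x y : 'rV[R]_m) : `|gam0 x - gam0 y| <= L * onorm (x - y).
  apply: le_trans (gamL1 x y) _; apply: le_trans (ler_wpM2r (sqrtr_ge0 _) (ler_norm L1')) _.
  by rewrite ler_wpM2l// enorm_le_onorm.
have OE : Omega = [set x | gam0 (head x) < x ord0 ord_max] by [].
have [D0 DD] := @Cc_distr_sub R m Omega.
have n1 : (1 : R) <= m.+1%:R by rewrite ler1n.
(* Since n >= 1, the bound -1 + 1/p is at least -n (1 - 1/p), the threshold for test functions to
   have finite norm. *)
have fin_i (s p : R) : 1 < p -> -1 + 1 / p < s -> - (m.+1%:R * (1 - p^-1)) < s.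
  move=> q1; apply: le_lt_trans.
  have q0 : 0 < p by exact: lt_trans q1.
  have h : 0 <= 1 - p^-1 by rewrite subr_ge0 invf_le1// ltW.
  by have := ler_peMl h n1; rewrite div1r; lra.
have Hin (s p : R) f : 1 < p -> - (m.+1%:R * (1 - p^-1)) < s -> Cc_infty Omega f ->
    space0 (Hdot_norm phi s p) Omega (distr_of f).
  move=> q1 hs fc; apply: (Cc_distr_space0 fc).
  exact: (Hdot_Cc_fin hphi q1 hs (Cc_schw fc)).
have Win k f : Cc_infty Omega f -> space0 (Wdot_norm k) Omega (distr_of f).
  by move=> fc; apply: (Cc_distr_space0 fc); exact: (Wdot_Cc_fin k (Cc_schw fc)).
split.
- move=> h0 h1; split=> //.
    by move=> _ [f fc <-]; split; apply: Hin => //; exact: fin_i.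
  move=> u [[hu f0 su] [_ f1 _]] e e0.
  exact: (Hdot_density hphi L0 gamL OE hp0 hp1 hu su f0 f1 e0).
- move=> h0 _; split=> //.
    move=> _ [f fc <-]; apply: Hin => //; move: h0; rewrite fine_hoelder_conjugate//.
    have p00 : 0 < p0 by exact: lt_trans hp0.
    have q0 : 0 < p0 - 1 by rewrite subr_gt0.
    by rewrite (_ : m.+1%:R / (p0 / (p0 - 1)) = m.+1%:R * (1 - p0^-1))//; field; rewrite !gt_eqF.
  move=> u [hu f0 su] e e0.
  (* A single space is treated as an intersection with itself; one of the two equal norms is then
     dropped. *)
  have [g Dg hg] := Hdot_density hphi L0 gamL OE hp0 hp0 hu su f0 f0 e0.
  by exists g => //; apply: le_lt_trans hg; rewrite leeDl//; apply: le_ereal_inf_tmp => _ [w _ <-]; exact: Lp_norms_ge0.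
move=> k0 k1; split=> //.
  by move=> _ [f fc <-]; split; exact: Win.
move=> u [[hu f0 su] [_ f1 _]] e e0.
exact: (Wdot_density hphi L0 gamL OE hm hu su f0 f1 e0).
Qed.
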